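(* Let $L$ be an extremal even unimodular lattice of rank 48, let $X$ be its set of vectors of squared norm $6$, and let $\iota:\sqrt3E_8\hookrightarrow L$ be an isometric embedding, extended linearly to $\mathbb{R}^8$. For $1\le k\le8$ let $$U_k=\iota\bigl(\sqrt3\operatorname{span}_{\mathbb{R}}\{e_1,\ldots,e_k\}\bigr).$$ For $m=8-k$, the number of vectors of $X$ perpendicular to $U_k$ is $$|X\cap U_k^\perp|=1092000+18360m+464944\binom m2+11880\binom m3+146880\binom m4+2520\binom m5+31680\binom m6 .$$ The same holds for every Weyl conjugate of this nested family, i.e. with $e_1,\dots,e_k$ replaced by $we_1,\dots,we_k$ for any $w\in W(E_8)$. In particular, some Weyl conjugate of the family has as its rank-five member the space $\operatorname{span}_{\mathbb{R}}\{\iota(\sqrt3\alpha_1),\dots,\iota(\sqrt3\alpha_5)\}$ spanned by the $D_5$ subsystem with simple roots $\alpha_1,\dots,\alpha_5$.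
   Context: An even unimodular lattice of rank 48 is extremal if its minimum squared norm is $6$. The $E_8$ lattice is taken in the model $$E_8=\{u/2:u\in\mathbb{Z}^8,\ u_i\text{ all of the same parity},\ \textstyle\sum_iu_i\equiv0\pmod4\}\subset\mathbb{R}^8,$$ with standard basis vectors $e_1,\dots,e_8$ of $\mathbb{R}^8$, and simple roots $$\alpha_1=\tfrac12(1,-1,-1,-1,-1,-1,-1,1),\quad\alpha_2=e_1+e_2,\quad\alpha_{i+2}=-e_i+e_{i+1}\ (1\le i\le6).$$ $W(E_8)$ is the Weyl group, acting on $\mathbb{R}^8$; $\sqrt3E_8$ is $E_8$ scaled by $\sqrt3$. *)

(* Defs.v *)
From HB Require Import structures.
From mathcomp Require Import all_boot all_order all_algebra.
From mathcomp Require Import boolp classical_sets functions cardinality reals.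
From mathcomp Require Import ring.

Set Implicit Arguments.
Unset Strict Implicit.
Unset Printing Implicit Defensive.

Import Order.TTheory GRing.Theory Num.Theory.
Local Open Scope ring_scope.
Local Open Scope classical_set_scope.

Section Lattices.
Variables (R : realType) (n : nat).
Implicit Types (u v : 'rV[R]_n) (L : set 'rV[R]_n).

Definition dot u v : R := (u *m v^T) 0 0.

Definition is_lattice L : Prop :=
  exists2 B : 'M[R]_n, B \in unitmx
    & L = [set map_mx intr z *m B | z in [set: 'rV[int]_n]].

Definition dual_lattice L : set 'rV[R]_n :=
  [set v | forall u, L u -> exists c : int, dot v u = c%:~R].

Definition unimodular L : Prop := is_lattice L /\ L = dual_lattice L.

Definition even_lattice L : Prop :=
  forall v, L v -> exists c : int, dot v v = (2 * c)%:~R.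

Definition minimum_norm L (r : R) : Prop :=
  (exists v, [/\ L v, v != 0 & dot v v = r]) /\
  (forall v, L v -> v != 0 -> r <= dot v v).

Definition shell L (r : R) : set 'rV[R]_n := [set v | L v /\ dot v v = r].

Definition perp (U : set 'rV[R]_n) : set 'rV[R]_n :=
  [set v | forall u, U u -> dot v u = 0].

Definition reflection (a v : 'rV[R]_n) : 'rV[R]_n :=
  v - (2 * dot v a / dot a a) *: a.

End Lattices.

Definition extremal48 (R : realType) (L : set 'rV[R]_48) : Prop :=
  [/\ unimodular L, even_lattice L & minimum_norm L 6].

Section E8.
Variable R : realType.
Implicit Types (v a : 'rV[R]_8).

Definition E8 : set 'rV[R]_8 :=
  [set v | exists u : 'rV[int]_8,
    [/\ v = 2^-1 *: map_mx intr u,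
        forall i j, (u 0%R i = u 0%R j %[mod 2])%Z
      & (4 %| \sum_i u 0%R i)%Z]].

(* 1-based: [e_ 1], ..., [e_ 8] are the standard basis vectors. *)
Definition e_ (i : nat) : 'rV[R]_8 := \row_(j < 8) (j.+1 == i)%:R.

(* 1-based, in Bourbaki's numbering; only 1 <= i <= 8 is meaningful. *)
Definition alpha (i : nat) : 'rV[R]_8 :=
  match i with
  | 1%N => 2^-1 *: (e_ 1 - e_ 2 - e_ 3 - e_ 4 - e_ 5 - e_ 6 - e_ 7 + e_ 8)
  | 2%N => e_ 1 + e_ 2
  | j.+2 => - e_ j + e_ j.+1
  | _ => 0
  end.

Definition E8_root : set 'rV[R]_8 := shell E8 2.

(* The reflections are involutions, so the group they generate is already
   the monoid they generate. *)
Inductive weyl_E8 : ('rV[R]_8 -> 'rV[R]_8) -> Prop :=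
| weyl_id : weyl_E8 id
| weyl_reflection a w :
    E8_root a -> weyl_E8 w -> weyl_E8 (reflection a \o w).

Definition sqrt3E8 : set 'rV[R]_8 := [set Num.sqrt 3 *: v | v in E8].

(* [f] is the R-linear extension of the lattice embedding, which is its
   restriction to [sqrt3E8]. *)
Definition isometric_embedding (f : {linear 'rV[R]_8 -> 'rV[R]_48})
    (L : set 'rV[R]_48) : Prop :=
  (forall v, sqrt3E8 v -> L (f v)) /\
  (forall u v, sqrt3E8 u -> sqrt3E8 v -> dot (f u) (f v) = dot u v).

Definition Uspace (f : {linear 'rV[R]_8 -> 'rV[R]_48})
    (w : 'rV[R]_8 -> 'rV[R]_8) (k : nat) : set 'rV[R]_48 :=
  [set f (Num.sqrt 3 *: v)
    | v in [set` <<[seq w (e_ i) | i <- iota 1 k]>>%VS]].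

Definition D5_space (f : {linear 'rV[R]_8 -> 'rV[R]_48}) : set 'rV[R]_48 :=
  [set` <<[seq f (Num.sqrt 3 *: alpha i) | i <- iota 1 5]>>%VS].

(* Edges of the D5 diagram on the nodes 1, ..., 5: the chain 1 - 3 - 4 with
   both 2 and 5 attached to 4. *)
Definition D5_edge (i j : nat) : bool :=
  (i, j) \in [:: (1, 3); (3, 1); (3, 4); (4, 3);
                 (2, 4); (4, 2); (4, 5); (5, 4)]%N.

Lemma alpha_D5 (i j : nat) : (1 <= i <= 5)%N -> (1 <= j <= 5)%N ->
  dot (alpha i) (alpha j) =
    if i == j then 2 else if D5_edge i j then -1 else 0.
Proof.
case: i => [|[|[|[|[|[|i]]]]]] //; case: j => [|[|[|[|[|[|j]]]]]] // _ _.
all: rewrite /dot /alpha mxE !big_ord_recl big_ord0 /= !mxE /=.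
all: rewrite /bump /=.
all: by field.
Qed.

End E8.

Definition perp_count (m : nat) : nat :=
  (1092000 + 18360 * m + 464944 * 'C(m, 2) + 11880 * 'C(m, 3)
  + 146880 * 'C(m, 4) + 2520 * 'C(m, 5) + 31680 * 'C(m, 6))%N.

(* Main.v *)
(** For a vector v of L, the theta series of L restricted along v, together with its Taylor coefficients in
the direction of v, is inverted by t -> 1/t by Poisson summation over L. Dividing by the 24th power of the
discriminant and multiplying by suitable polynomials in the Eisenstein series leaves series whose constant
term vanishes; since L has no vectors of norm 2 and 4, these relations determine the moments
sum_{x in X} (x.v)^(2j), 0 <= j <= 5, so X behaves as a spherical 11-design.

A vector x of X is then projected to the copy of sqrt 3 E8. The projection is sqrt 3 times a root (once for each root) or
a vector p / sqrt 3 with p in the 3-fold Voronoi cell of E8, so that p is one of 26401 vectors of norm at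
most 8, and the number N(p) of x over p depends only on p mod 3 E8. Polynomials in |p|^2 and in the (p.c)^2
for a few fixed vectors c, of total degree at most 10, are chosen such that their sums over all classes
mod 3 but one vanish; their average over X, known from the moments, gives N(p) = 1092000, 116235, 9180 and
495 for |p|^2 = 0, 2, 4 and 6, and the sum of N over the vectors of type (2,1,1,1,1) with given support
is 2520. Adding these over the p perpendicular to e_1, ..., e_k gives the formula. *)

From Stdlib Require ZArith Arith Factorial List Bool Permutation Sorted Reals Lra Lia Psatz.
From Coquelicot Require Coquelicot.

(** Modular forms occur only through their values on the imaginary axis: power series in a real
    nome, with the single relation t -> 1/t. That a form of weight 2 has zero constant term is
    proved without contour integrals. A primitive of the form is invariant under t -> 1/t, hence
    even in w = (t-1)/(t+1), hence real at the corner of the fundamental domain; there the nome is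
    real, but the linear term c t of the primitive is not. Dividing by [eta]^72, the cube of the
    discriminant, leaves weight 2 exactly when 4a + 6b + 2j = 14. For j = 6 this would ask for a
    monomial in E4 and E6 of weight 2, whence the bound j <= 5.

    Poisson summation over L is derived from dimension one: L contains an orthogonal family of full
    rank and is a finite union of cosets of its span.

    The real field of the theorem is arbitrary, while the analysis lives in one fixed model of the
    reals. The two meet in rational pairings of integer coordinates, and the moments cross over as
    identities between integers. *)

Module Analysis.
Import ZArith Arith Factorial List Reals Lra Lia Psatz.
Import Coquelicot.
Local Open Scope R_scope.

(** * Series *)

(** Restated at type [R]: the general lemmas produce the operations of an abstract monoid, which
    [ring] and [lra] do not recognise. *)
Lemma sum_n_0 (a : nat -> R) : sum_n a 0 = a 0%nat :> R.
Proof. exact (@sum_O R_AbelianMonoid a). Qed.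

Lemma sum_n_S (a : nat -> R) (n : nat) : sum_n a (S n) = sum_n a n + a (S n) :> R.
Proof. exact (@sum_Sn R_AbelianMonoid a n). Qed.

Lemma sum_n_scal (c : R) (a : nat -> R) (n : nat) :
  sum_n (fun k => c * a k) n = c * sum_n a n :> R.
Proof. exact (@sum_n_mult_l R_Ring c a n). Qed.

Lemma sum_n_add (a b : nat -> R) (n : nat) :
  sum_n (fun k => a k + b k) n = sum_n a n + sum_n b n :> R.
Proof. exact (@sum_n_plus R_AbelianMonoid a b n). Qed.

Lemma sum_n_eq (a b : nat -> R) (n : nat) :
  (forall k, (k <= n)%nat -> a k = b k) -> sum_n a n = sum_n b n :> R.
Proof. exact (@sum_n_ext_loc R_AbelianMonoid a b n). Qed.

Lemma sum_n_nonneg (a : nat -> R) : (forall n, 0 <= a n) -> forall n, 0 <= sum_n a n.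
Proof.
intros H n; induction n as [|n IH].
- rewrite sum_O; apply H.
- rewrite sum_Sn; unfold plus; simpl; specialize (H (S n)); lra.
Qed.

Lemma sum_n_incr (a : nat -> R) : (forall n, 0 <= a n) ->
  forall n, sum_n a n <= sum_n a (S n).
Proof. intros H n; rewrite sum_Sn; unfold plus; simpl; specialize (H (S n)); lra. Qed.

Lemma sum_n_le_series (a : nat -> R) (s : R) : (forall n, 0 <= a n) ->
  is_series a s -> forall n, sum_n a n <= s.
Proof.
intros H Hs n.
apply (is_lim_seq_incr_compare (sum_n a) s); [exact Hs|].
apply sum_n_incr; exact H.
Qed.

Lemma ex_series_bounded (a : nat -> R) (M : R) : (forall n, 0 <= a n) ->
  (forall n, sum_n a n <= M) -> ex_series a.
Proof.
intros H HM.
destruct (ex_finite_lim_seq_incr (sum_n a) M) as [l Hl]; auto.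
- apply sum_n_incr; exact H.
- exists l; exact Hl.
Qed.

Lemma is_series_le_bound (a : nat -> R) (s M : R) :
  is_series a s -> (forall n, sum_n a n <= M) -> s <= M.
Proof.
intros Hs HM.
apply (is_lim_seq_le (sum_n a) (fun _ => M) s M HM Hs (is_lim_seq_const M)).
Qed.

Lemma term_le_sum_n (a : nat -> R) : (forall n, 0 <= a n) ->
  forall n, a n <= sum_n a n.
Proof.
intros H [|n]; [rewrite sum_O; lra|].
rewrite sum_Sn; unfold plus; simpl.
assert (h := sum_n_nonneg a H n); lra.
Qed.

Lemma is_series_sum_n (a : nat -> nat -> R) (s : nat -> R) (J : nat) :
  (forall j, is_series (a j) (s j)) ->
  is_series (fun n => sum_n (fun j => a j n) J) (sum_n s J).
Proof.
intros H; induction J as [|J IH].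
- rewrite sum_O; apply is_series_ext with (a 0%nat); [|apply H].
  intros n; now rewrite sum_O.
- rewrite sum_Sn.
  apply is_series_ext with (fun n => plus (sum_n (fun j => a j n) J) (a (S J) n)).
  + intros n; now rewrite sum_Sn.
  + exact (is_series_plus _ _ _ _ IH (H (S J))).
Qed.

Lemma sum_n_le (a b : nat -> R) (N : nat) :
  (forall n, (n <= N)%nat -> a n <= b n) -> sum_n a N <= sum_n b N.
Proof. induction N as [|N IH]; intros H.
- rewrite !sum_O; apply H; lia.
- rewrite !sum_Sn; unfold plus; simpl; apply Rplus_le_compat.
  + apply IH; intros; apply H; lia.
  + apply H; lia.
Qed.

(** Finite sums of columns are bounded by the total of the rows, which yields only T <= S0. The
    equality comes from a second application, to the transposed array. *)
Lemma fubini_nonneg (a : nat -> nat -> R) (r : nat -> R) (S0 : R) :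
  (forall n j, 0 <= a n j) -> (forall n, is_series (a n) (r n)) -> is_series r S0 ->
  (forall j, ex_series (fun n => a n j)) /\
  exists T, T <= S0 /\ is_series (fun j => Series (fun n => a n j)) T.
Proof.
intros Ha Hr HS.
assert (Hr0 : forall n, 0 <= r n).
{ intros n; apply Rle_trans with (sum_n (a n) 0).
  - apply sum_n_nonneg, Ha.
  - apply sum_n_le_series; auto. }
assert (Hc : forall j, ex_series (fun n => a n j)).
{ intros j; apply (@ex_series_le R_AbsRing R_CompleteNormedModule) with r.
  - intros n; change (norm (a n j)) with (Rabs (a n j)); rewrite Rabs_pos_eq; [|apply Ha].
    apply Rle_trans with (sum_n (a n) j); [apply term_le_sum_n, Ha|].
    apply sum_n_le_series; auto.
  - now exists S0. }
split; [exact Hc|].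
assert (Hb : forall J, sum_n (fun j => Series (fun n => a n j)) J <= S0).
{ intros J.
  assert (H1 : is_series (fun n => sum_n (fun j => a n j) J)
      (sum_n (fun j => Series (fun n => a n j)) J)).
  { apply (is_series_sum_n (fun j n => a n j)).
    intros j; apply Series_correct, Hc. }
  apply (is_series_le_bound _ _ _ H1); intros N.
  apply Rle_trans with (sum_n r N); [|apply sum_n_le_series; auto].
  apply sum_n_le; intros n _; apply sum_n_le_series; auto. }
assert (H0 : forall j, 0 <= Series (fun n => a n j)).
{ intros j; apply Rle_trans with (sum_n (fun n => a n j) 0).
  - apply sum_n_nonneg; intros; apply Ha.
  - apply sum_n_le_series; [intros; apply Ha|]; apply Series_correct, Hc. }
destruct (ex_series_bounded _ S0 H0 Hb) as [T HT].
exists T; split; auto.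
now apply (is_series_le_bound _ _ _ HT).
Qed.

Lemma fubini_nonneg_eq (a : nat -> nat -> R) (r : nat -> R) (S0 : R) :
  (forall n j, 0 <= a n j) -> (forall n, is_series (a n) (r n)) -> is_series r S0 ->
  is_series (fun j => Series (fun n => a n j)) S0.
Proof.
intros Ha Hr HS.
destruct (fubini_nonneg a r S0 Ha Hr HS) as [Hc [T [HTS HT]]].
destruct (fubini_nonneg (fun j n => a n j) (fun j => Series (fun n => a n j)) T)
  as [_ [S1 [HST HS1]]]; auto.
{ intros j; apply Series_correct, Hc. }
assert (S1 = S0).
{ rewrite <- (is_series_unique _ _ HS1), <- (is_series_unique _ _ HS).
  apply Series_ext; intros n; apply is_series_unique, Hr. }
replace S0 with T by lra; exact HT.
Qed.

(** Reduction to nonnegative arrays by a = |a| - (|a| - a). *)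
Lemma fubini (a : nat -> nat -> R) :
  (forall n, ex_series (fun j => Rabs (a n j))) ->
  ex_series (fun n => Series (fun j => Rabs (a n j))) ->
  (forall j, ex_series (fun n => Rabs (a n j))) /\
  is_series (fun j => Series (fun n => a n j)) (Series (fun n => Series (a n))).
Proof.
intros H1 H2.
set (b := fun n j => Rabs (a n j) - a n j).
assert (Ha : forall n, ex_series (a n)) by (intros n; apply ex_series_Rabs, H1).
assert (hb0 : forall n j, 0 <= b n j).
{ intros n j; unfold b; assert (h := Rle_abs (a n j)); lra. }
assert (hbs : forall n, is_series (b n) (Series (fun j => Rabs (a n j)) - Series (a n))).
{ intros n.
  apply (is_series_minus (fun j => Rabs (a n j)) (a n)); apply Series_correct; auto. }
assert (hra : ex_series (fun n => Series (a n))).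
{ apply (@ex_series_le R_AbsRing R_CompleteNormedModule) with (2 := H2).
  intros n; apply Series_Rabs, H1. }
assert (hbS : is_series (fun n => Series (fun j => Rabs (a n j)) - Series (a n))
   (Series (fun n => Series (fun j => Rabs (a n j))) - Series (fun n => Series (a n)))).
{ apply (is_series_minus (fun n => Series (fun j => Rabs (a n j))) (fun n => Series (a n)));
  now apply Series_correct. }
assert (FA := fubini_nonneg_eq (fun n j => Rabs (a n j)) _ _
   (fun n j => Rabs_pos _) (fun n => Series_correct _ (H1 n)) (Series_correct _ H2)).
destruct (fubini_nonneg (fun n j => Rabs (a n j)) _ _
   (fun n j => Rabs_pos _) (fun n => Series_correct _ (H1 n)) (Series_correct _ H2)) as [Hc _].
assert (FB := fubini_nonneg_eq b _ _ hb0 hbs hbS).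
split; [exact Hc|].
apply is_series_ext with (fun j => minus (Series (fun n => Rabs (a n j))) (Series (fun n => b n j))).
- intros j; unfold minus, plus, opp; simpl.
  unfold b; rewrite Series_minus; [|auto|apply ex_series_Rabs; auto]. ring.
- replace (Series (fun n => Series (a n))) with
   (minus (Series (fun n => Series (fun j => Rabs (a n j))))
     (Series (fun n => Series (fun j => Rabs (a n j))) - Series (fun n => Series (a n))))
   by (unfold minus, plus, opp; simpl; ring).
  exact (is_series_minus _ _ _ _ FA FB).
Qed.

Lemma sum_n_minus_le (a g : nat -> R) (s : R) (K N : nat) :
  (forall k, Rabs (a k) <= g k) -> is_series g s -> (K <= N)%nat ->
  Rabs (sum_n a N - sum_n a K) <= s - sum_n g K.
Proof.
intros Hag Hg HKN.
assert (Hg0 : forall k, 0 <= g k).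
{ intros k; apply Rle_trans with (2 := Hag k), Rabs_pos. }
apply Rle_trans with (sum_n g N - sum_n g K).
- induction HKN as [|N HKN IH].
  + unfold Rminus; rewrite !Rplus_opp_r, Rabs_R0; lra.
  + rewrite !sum_Sn; unfold plus; simpl.
    replace (sum_n a N + a (S N) - sum_n a K) with ((sum_n a N - sum_n a K) + a (S N)) by ring.
    apply Rle_trans with (1 := Rabs_triang _ _).
    specialize (Hag (S N)); lra.
- assert (h := sum_n_le_series g s Hg0 Hg N); lra.
Qed.

(** Dominated convergence for finite sums whose length grows with l. Both sides of Polya's identity
    pass to the limit through it. *)
Lemma tannery (F : nat -> nat -> R) (G g : nat -> R) (N : nat -> nat) :
  eventually (fun l => forall k, Rabs (F l k) <= g k) -> ex_series g ->
  (forall k, is_lim_seq (fun l => F l k) (G k)) ->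
  (forall K, eventually (fun l => (K <= N l)%nat)) ->
  ex_series G /\ is_lim_seq (fun l => sum_n (F l) (N l)) (Series G).
Proof.
intros HF [s Hg] HG HN.
assert (HGg : forall k, Rabs (G k) <= g k).
{ intros k.
  apply (is_lim_seq_le_loc (fun l => Rabs (F l k)) (fun _ => g k) (Rabs (G k)) (g k)).
  - destruct HF as [L HL]; exists L; intros l Hl; now apply HL.
  - apply (is_lim_seq_abs _ (G k)), HG.
  - apply is_lim_seq_const. }
assert (HexG : ex_series G).
{ apply (@ex_series_le R_AbsRing R_CompleteNormedModule) with g; [exact HGg| now exists s]. }
split; [exact HexG|].
assert (HsG : is_lim_seq (sum_n G) (Series G)) by exact (Series_correct _ HexG).
assert (Hsg : is_lim_seq (sum_n g) s) by exact Hg.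
apply is_lim_seq_spec; intros eps.
assert (He : 0 < eps / 4) by (destruct eps; simpl; lra).
apply is_lim_seq_spec in HsG; apply is_lim_seq_spec in Hsg.
destruct (HsG (mkposreal _ He)) as [K1 HK1].
destruct (Hsg (mkposreal _ He)) as [K2 HK2].
set (K := max K1 K2).
assert (Hfin : is_lim_seq (fun l => sum_n (F l) K) (sum_n G K)).
{ clearbody K; induction K as [|K IH].
  - rewrite sum_O; apply is_lim_seq_ext with (fun l => F l 0%nat); [|apply HG].
    intros l; now rewrite sum_O.
  - rewrite sum_Sn.
    apply is_lim_seq_ext with (fun l => sum_n (F l) K + F l (S K)).
    + intros l; now rewrite sum_Sn.
    + now apply is_lim_seq_plus'. }
apply is_lim_seq_spec in Hfin.
destruct (Hfin (mkposreal _ He)) as [L1 HL1].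
destruct (HN K) as [L2 HL2].
destruct HF as [L3 HF].
exists (max (max L1 L2) L3); intros l Hl.
assert (h1 := HL1 l ltac:(lia)); assert (h2 := HL2 l ltac:(lia)).
assert (h3 := HK1 K ltac:(lia)); assert (h4 := HK2 K ltac:(lia)).
assert (h5 := sum_n_minus_le (F l) g s K (N l) (HF l ltac:(lia)) Hg h2).
simpl in h1, h3, h4.
replace (sum_n (F l) (N l) - Series G) with
  ((sum_n (F l) (N l) - sum_n (F l) K) + ((sum_n (F l) K - sum_n G K) + (sum_n G K - Series G))) by ring.
apply Rle_lt_trans with (1 := Rabs_triang _ _).
assert (h6 := Rabs_triang (sum_n (F l) K - sum_n G K) (sum_n G K - Series G)).
apply Rabs_def2 in h4; destruct eps as [eps Heps]; simpl in *; lra.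
Qed.

(** * Polya's identity *)

(** Folds a sum over all integers into a series over the naturals by pairing n with -n, so that 0 is
    counted once; [ew] is the corresponding weight of an even term. *)
Definition sym (f : R -> R) (n : nat) : R :=
  match n with O => f 0 | S _ => f (INR n) + f (- INR n) end.

Definition ew (n : nat) : R := match n with O => 1 | S _ => 2 end.

(** Set to 0 for k > n, where [Binomial.C] is nonzero because of truncated subtraction; Pascal's
    rule then holds without a side condition. *)
Definition binom (n k : nat) : R := if Nat.leb k n then Binomial.C n k else 0.

Lemma binom_S (n k : nat) : binom (S n) (S k) = binom n k + binom n (S k).
Proof.
unfold binom.
destruct (Nat.leb_spec k n); destruct (Nat.leb_spec (S k) n);
  destruct (Nat.leb_spec (S k) (S n)); try lia.
- rewrite <- pascal; [ring|lia].
- replace k with n by lia.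
  unfold Binomial.C; rewrite !Nat.sub_diag; simpl (fact 0).
  assert (h := INR_fact_neq_0 n); assert (h' := INR_fact_neq_0 (S n)).
  change (INR 1) with 1; field; auto.
- ring.
Qed.

Lemma binom_0 (n : nat) : binom n 0 = 1.
Proof.
unfold binom; simpl; unfold Binomial.C; rewrite Nat.sub_0_r; simpl (fact 0); change (INR 1) with 1.
field; apply INR_fact_neq_0.
Qed.

Lemma binom_sym (n k : nat) : (k <= n)%nat -> binom n (n - k) = binom n k.
Proof.
intros H; unfold binom.
destruct (Nat.leb_spec k n); destruct (Nat.leb_spec (n - k) n); try lia.
now rewrite <- pascal_step1.
Qed.

Lemma sum_n_shift1 (a : nat -> R) (n : nat) :
  sum_n a (S n) = a 0%nat + sum_n (fun k => a (S k)) n :> R.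
Proof.
induction n as [|n IH].
- now rewrite sum_n_S, !sum_n_0.
- rewrite sum_n_S, IH, (sum_n_S _ n); ring.
Qed.

Lemma two_cos_pow (y : R) (M : nat) :
  (2 * cos y) ^ M = sum_n (fun j => binom M j * cos ((INR M - 2 * INR j) * y)) M :> R.
Proof.
induction M as [|M IH].
- rewrite sum_n_0, binom_0; simpl; replace ((0 - 2 * 0) * y) with 0 by ring.
  rewrite cos_0; ring.
- change ((2 * cos y) ^ S M) with (2 * cos y * (2 * cos y) ^ M); rewrite IH.
  set (a := fun j => binom M j * cos ((INR M + 1 - 2 * INR j) * y)).
  set (b := fun j => binom M j * cos ((INR M - 1 - 2 * INR j) * y)).
  assert (H1 : 2 * cos y * sum_n (fun j => binom M j * cos ((INR M - 2 * INR j) * y)) M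
     = sum_n a M + sum_n b M).
  { rewrite <- sum_n_scal, <- sum_n_add; apply sum_n_eq; intros j _.
    unfold a, b.
    replace ((INR M + 1 - 2 * INR j) * y) with ((INR M - 2 * INR j) * y + y) by ring.
    replace ((INR M - 1 - 2 * INR j) * y) with ((INR M - 2 * INR j) * y - y) by ring.
    rewrite cos_plus, cos_minus; ring. }
  rewrite H1.
  rewrite sum_n_shift1.
  assert (Hb : sum_n (fun k => binom (S M) (S k) * cos ((INR (S M) - 2 * INR (S k)) * y)) M
    = sum_n b M + sum_n (fun k => a (S k)) M :> R).
  { rewrite <- sum_n_add; apply sum_n_eq; intros j _.
    unfold a, b; rewrite binom_S, !S_INR.
    replace ((INR M + 1 - 2 * (INR j + 1)) * y) with ((INR M - 1 - 2 * INR j) * y) by ring.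
    ring. }
  rewrite Hb.
  assert (Ha : sum_n a M = a 0%nat + sum_n (fun k => a (S k)) M :> R).
  { rewrite <- sum_n_shift1, sum_n_S.
    replace (a (S M)) with 0; [now rewrite Rplus_0_r|].
    unfold a, binom; destruct (Nat.leb_spec (S M) M); [lia|ring]. }
  rewrite Ha at 1.
  unfold a at 1; rewrite !binom_0, S_INR; ring.
Qed.

Lemma sum_n_fold (X : nat -> R) (m : nat) :
  sum_n X (2 * m) =
  sum_n (fun r => match r with O => X m | S _ => X (m - r)%nat + X (m + r)%nat end) m :> R.
Proof.
set (Y := fun r => match r with O => X m | S _ => X (m - r)%nat + X (m + r)%nat end).
assert (H : forall k, (k <= m)%nat -> sum_n_m X (m - k) (m + k) = sum_n Y k :> R).
{ induction k as [|k IH]; intros Hk.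
  - rewrite Nat.sub_0_r, Nat.add_0_r, sum_n_n; symmetry; apply (sum_n_0 Y).
  - rewrite sum_n_S, <- IH by lia.
    replace (m + S k)%nat with (S (m + k)) by lia.
    rewrite sum_n_Sm by lia.
    rewrite sum_Sn_m by lia.
    replace (S (m - S k)) with (m - k)%nat by lia.
    unfold Y; replace (m + S k)%nat with (S (m + k)) by lia.
    change (X (m - S k)%nat + sum_n_m X (m - k) (m + k) + X (S (m + k)) =
      sum_n_m X (m - k) (m + k) + (X (m - S k)%nat + X (S (m + k))) :> R); ring. }
rewrite <- H by lia; unfold sum_n; f_equal; lia.
Qed.

(* [cm m r] is the coefficient of [z^r] in [(z^(1/2) + z^(-1/2))^(2m)]. *)
Definition cm (m r : nat) : R := binom (2 * m) (m + r).

Lemma cos_pow_even (y : R) (m : nat) :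
  cos y ^ (2 * m) = / 4 ^ m * sum_n (fun r => ew r * cm m r * cos (2 * INR r * y)) m :> R.
Proof.
assert (H := two_cos_pow y (2 * m)).
rewrite Rpow_mult_distr, (pow_mult 2) in H.
replace (2 ^ 2) with 4 in H by ring.
assert (H4 : 4 ^ m <> 0) by (apply pow_nonzero; lra).
apply (Rmult_eq_reg_l (4 ^ m)); [|exact H4].
rewrite H, <- Rmult_assoc, Rinv_r, Rmult_1_l by exact H4.
rewrite sum_n_fold; apply sum_n_eq; intros [|r] Hr.
- unfold cm, ew; rewrite Nat.add_0_r, mult_INR; change (INR 2) with 2; change (INR 0) with 0.
  replace ((2 * INR m - 2 * INR m) * y) with 0 by ring.
  replace (2 * 0 * y) with 0 by ring; rewrite cos_0; ring.
- unfold cm, ew.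
  replace (binom (2 * m) (m - S r)) with (binom (2 * m) (m + S r)).
  2:{ rewrite <- (binom_sym (2 * m) (m - S r)) by lia; f_equal; lia. }
  rewrite minus_INR, plus_INR, mult_INR by lia; change (INR 2) with 2.
  replace ((2 * INR m - 2 * (INR m - INR (S r))) * y) with (2 * INR (S r) * y) by ring.
  replace ((2 * INR m - 2 * (INR m + INR (S r))) * y) with (- (2 * INR (S r) * y)) by ring.
  rewrite cos_neg; ring.
Qed.

(** The closed form of Dirichlet's kernel, multiplied by sin (b/2) so that no division by a possibly
    vanishing sine occurs. *)
Lemma dirichlet_sum (b : R) (h : nat) :
  sin (b / 2) * sum_n (fun n => ew n * cos (b * INR n)) h = sin (b * (INR h + / 2)) :> R.
Proof.
induction h as [|h IH].
- rewrite sum_n_0; simpl; rewrite Rmult_0_r, cos_0; rewrite !Rmult_1_r.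
  f_equal; field.
- rewrite sum_n_S; change (ew (S h)) with 2.
  rewrite Rmult_plus_distr_l, IH, S_INR.
  replace (b * (INR h + / 2)) with (b * (INR h + 1) - b / 2) by field.
  replace (b * (INR h + 1 + / 2)) with (b * (INR h + 1) + b / 2) by field.
  rewrite sin_plus, sin_minus; ring.
Qed.

Lemma sin_PI_nat (r : nat) : sin (INR r * PI) = 0.
Proof. apply sin_eq_0_1; exists (Z.of_nat r); now rewrite <- INR_IZR_INZ. Qed.

Lemma cos_2PI_nat (r : nat) (x : R) : cos (2 * PI * INR r + x) = cos x.
Proof.
replace (2 * PI * INR r + x) with (x + 2 * INR r * PI) by ring; apply cos_period.
Qed.

(** Orthogonality of roots of unity. As l = 2h+1 is odd, -h, ..., h is a complete residue system. If
    l does not divide r, the kernel identity reads sin (r PI / l) * sum = sin (r PI) = 0, and the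
    first factor is nonzero. *)
Lemma sym_cos_sum (h r : nat) (u : R) : let l := S (2 * h) in
  sum_n (sym (fun x => cos (2 * INR r * (PI * (x + u) / INR l)))) h =
  if Nat.eqb (r mod l) 0 then INR l * cos (2 * PI * INR (r / l) * u) else 0 :> R.
Proof.
intros l.
assert (Hl : 0 < INR l) by (apply lt_0_INR; lia).
set (b := 2 * INR r * PI / INR l).
assert (H1 : sum_n (sym (fun x => cos (2 * INR r * (PI * (x + u) / INR l)))) h =
   cos (b * u) * sum_n (fun n => ew n * cos (b * INR n)) h :> R).
{ rewrite <- sum_n_scal; apply sum_n_eq; intros [|n] _; unfold sym, ew.
  - change (INR 0) with 0; rewrite Rmult_0_r, cos_0, Rplus_0_l, !Rmult_1_r; f_equal; unfold b; field; lra.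
  - replace (2 * INR r * (PI * (INR (S n) + u) / INR l)) with (b * u + b * INR (S n)) by (unfold b; field; lra).
    replace (2 * INR r * (PI * (- INR (S n) + u) / INR l)) with (b * u - b * INR (S n)) by (unfold b; field; lra).
    rewrite cos_plus, cos_minus; ring. }
rewrite H1; clear H1.
assert (Hdm := Nat.div_mod_eq r l).
destruct (Nat.eqb_spec (r mod l) 0) as [H0|H0].
- assert (Hb : b = 2 * PI * INR (r / l)).
  { unfold b; rewrite Hdm, H0, Nat.add_0_r, Nat.mul_comm, mult_INR at 1.
    replace (r / l * l / l)%nat with (r / l)%nat.
    - field; lra.
    - now rewrite Nat.div_mul by lia. }
  rewrite Hb.
  assert (H2 : sum_n (fun n => ew n * cos (2 * PI * INR (r / l) * INR n)) h = INR l :> R).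
  { assert (H3 : forall n, cos (2 * PI * INR (r / l) * INR n) = 1).
    { intros n; replace (2 * PI * INR (r / l) * INR n) with (2 * PI * INR (r / l * n) + 0)
        by (rewrite mult_INR; ring). now rewrite cos_2PI_nat, cos_0. }
    set (q := (r / l)%nat) in *; clearbody q; unfold l; clear -H3; induction h as [|h IH].
    - rewrite sum_n_0, H3; simpl; ring.
    - rewrite sum_n_S, IH, H3; change (ew (S h)) with 2.
      rewrite !S_INR, !mult_INR, !S_INR; simpl; ring. }
  rewrite H2; apply Rmult_comm.
- assert (H2 := dirichlet_sum b h).
  replace (b * (INR h + / 2)) with (INR r * PI) in H2.
  2:{ unfold b, l; rewrite S_INR, mult_INR; change (INR 2) with 2.
      assert (0 <= INR h) by apply pos_INR. field; lra. }
  rewrite sin_PI_nat in H2.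
  apply Rmult_integral in H2; destruct H2 as [H2|H2]; [|rewrite H2; apply Rmult_0_r].
  exfalso; apply sin_eq_0_0 in H2; destruct H2 as [k Hk].
  assert (Hk' : INR r = IZR k * INR l).
  { unfold b in Hk; apply (Rmult_eq_reg_r (PI / INR l)).
    - replace (IZR k * INR l * (PI / INR l)) with (IZR k * PI) by (field; lra).
      rewrite <- Hk; field; lra.
    - apply Rgt_not_eq; apply Rdiv_lt_0_compat; [apply PI_RGT_0| lra]. }
  rewrite !INR_IZR_INZ, <- mult_IZR in Hk'; apply eq_IZR in Hk'.
  apply H0.
  assert (Hz : (Z.of_nat r mod Z.of_nat l = 0)%Z).
  { rewrite Hk'; apply Z.mod_mul; lia. }
  rewrite <- Nat2Z.inj_mod in Hz; lia.
Qed.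

Lemma sum_n_multiples (g : nat -> R) (l M : nat) : (0 < l)%nat ->
  (forall r, (M < r)%nat -> g r = 0) ->
  sum_n (fun r => if Nat.eqb (r mod l) 0 then g r else 0) M =
  sum_n (fun v => g (l * v)%nat) M :> R.
Proof.
intros Hl Hg.
set (a := fun r => if Nat.eqb (r mod l) 0 then g r else 0).
assert (Hblock : forall K, sum_n a (l * K) = sum_n (fun v => g (l * v)%nat) K :> R).
{ induction K as [|K IH].
  - rewrite Nat.mul_0_r, !sum_n_0, Nat.mul_0_r; unfold a.
    now rewrite Nat.Div0.mod_0_l.
  - rewrite sum_n_S, <- IH.
    assert (Hin : forall i, (i < l)%nat -> sum_n a (l * K + i) = sum_n a (l * K) :> R).
    { induction i as [|i IHi]; intros Hi.
      - now rewrite Nat.add_0_r.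
      - replace (l * K + S i)%nat with (S (l * K + i)) by lia.
        rewrite sum_n_S, IHi by lia.
        unfold a at 2; replace (S (l * K + i)) with (S i + K * l)%nat by lia.
        rewrite Nat.Div0.mod_add, Nat.mod_small by lia.
        simpl; ring. }
    replace (l * S K)%nat with (S (l * K + (l - 1))) by lia.
    rewrite sum_n_S, Hin by lia; f_equal.
    unfold a; replace (S (l * K + (l - 1))) with (0 + S K * l)%nat by lia.
    rewrite Nat.Div0.mod_add, Nat.Div0.mod_0_l; reflexivity. }
rewrite <- Hblock.
assert (Hext : forall i, sum_n a (M + i) = sum_n a M :> R).
{ induction i as [|i IH]; [now rewrite Nat.add_0_r|].
  rewrite Nat.add_succ_r, sum_n_S, IH; unfold a at 2.
  rewrite Hg by lia; destruct (Nat.eqb _ 0); ring. }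
replace (l * M)%nat with (M + (l * M - M))%nat by nia.
now rewrite Hext.
Qed.

(** Expanding the even power into cosines and summing over l equally spaced points keeps only the
    frequencies divisible by l. When m / l^2 tends to t / PI, the left side becomes a Gaussian sum
    and the right side its Poisson dual. *)
Lemma polya_identity (h m : nat) (u : R) : let l := S (2 * h) in
  sum_n (sym (fun x => cos (PI * (x + u) / INR l) ^ (2 * m))) h =
  INR l * / 4 ^ m * sum_n (fun v => ew v * cm m (l * v) * cos (2 * PI * INR v * u)) m :> R.
Proof.
intros l.
assert (Hl : 0 < INR l) by (apply lt_0_INR; lia).
transitivity (sum_n (fun n => sum_n (fun r => / 4 ^ m * (ew r * cm m r) *
    sym (fun x => cos (2 * INR r * (PI * (x + u) / INR l))) n) m) h).
{ apply sum_n_eq; intros [|n] _; unfold sym.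
  - rewrite cos_pow_even, <- sum_n_scal.
    apply sum_n_eq; intros r _; ring.
  - rewrite !cos_pow_even, <- Rmult_plus_distr_l, <- sum_n_add, <- sum_n_scal.
    apply sum_n_eq; intros r _; ring. }
rewrite sum_n_switch.
transitivity (/ 4 ^ m * sum_n (fun r => if Nat.eqb (r mod l) 0 then
    ew r * cm m r * (INR l * cos (2 * PI * INR (r / l) * u)) else 0) m).
{ rewrite <- sum_n_scal; apply sum_n_eq; intros r _.
  rewrite sum_n_scal; unfold l; rewrite sym_cos_sum; fold l.
  destruct (Nat.eqb _ 0); ring. }
rewrite (sum_n_multiples (fun r => ew r * cm m r * (INR l * cos (2 * PI * INR (r / l) * u)))).
- rewrite (Rmult_comm (INR l)), Rmult_assoc; f_equal.
  rewrite <- sum_n_scal; apply sum_n_eq; intros v _.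
  rewrite (Nat.mul_comm l v), Nat.div_mul by lia.
  replace (ew (v * l)) with (ew v).
  + ring.
  + destruct v; simpl; [reflexivity|]; unfold l; reflexivity.
- lia.
- intros r Hr; unfold cm, binom; destruct (Nat.leb_spec (m + r) (2 * m)); [lia|ring].
Qed.

(** * Binomial and cosine bounds *)

Lemma exp_pow (x : R) (n : nat) : exp x ^ n = exp (INR n * x).
Proof.
induction n as [|n IH].
- simpl; rewrite Rmult_0_l, exp_0; reflexivity.
- change (exp x ^ S n) with (exp x * exp x ^ n); rewrite IH, <- exp_plus, S_INR; f_equal; ring.
Qed.

Lemma exp_le (x y : R) : x <= y -> exp x <= exp y.
Proof. intros [H|H]; [left; now apply exp_increasing| right; now rewrite H]. Qed.

Lemma one_minus_le_exp (s : R) : 1 - s <= exp (- s).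
Proof. assert (h := exp_ineq1_le (- s)); lra. Qed.

Lemma exp_le_one_minus (s : R) : 0 <= s < 1 -> exp (- (s / (1 - s))) <= 1 - s.
Proof.
intros [H0 H1]; rewrite exp_Ropp.
assert (h := exp_ineq1_le (s / (1 - s))).
replace (1 + s / (1 - s)) with (/ (1 - s)) in h by (field; lra).
rewrite <- (Rinv_inv (1 - s)) at 2.
apply Rinv_le_contravar; [apply Rinv_0_lt_compat; lra| exact h].
Qed.

Lemma ex_series_exp (c K : R) : 0 < c -> ex_series (fun n => K * exp (- (c * INR n))).
Proof.
intros Hc; apply (ex_series_scal_l K (fun n => exp (- (c * INR n)))).
apply ex_series_ext with (fun n => exp (- c) ^ n).
- intros n; rewrite exp_pow; f_equal; ring.
- exists (/ (1 - exp (- c))); apply is_series_geom.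
  rewrite Rabs_pos_eq by (left; apply exp_pos).
  rewrite <- exp_0; apply exp_increasing; lra.
Qed.

Lemma cm_step (m r : nat) : (r < m)%nat ->
  cm m (S r) * (INR m + INR r + 1) = cm m r * (INR m - INR r).
Proof.
intros H; unfold cm, binom.
destruct (Nat.leb_spec (m + S r) (2 * m)); destruct (Nat.leb_spec (m + r) (2 * m)); try lia.
rewrite Nat.add_succ_r, pascal_step3 by lia.
replace (2 * m - (m + r))%nat with (m - r)%nat by lia.
rewrite minus_INR, S_INR, plus_INR by lia.
assert (h := pos_INR m); assert (h' := pos_INR r); field; lra.
Qed.

Lemma cm_zero (m r : nat) : (m < r)%nat -> cm m r = 0.
Proof. intros H; unfold cm, binom; destruct (Nat.leb_spec (m + r) (2 * m)); [lia|reflexivity]. Qed.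

Lemma cm_pos0 (m : nat) : 0 < cm m 0.
Proof.
unfold cm, binom; destruct (Nat.leb_spec (m + 0) (2 * m)); [|lia].
unfold Binomial.C; apply Rdiv_lt_0_compat; [apply INR_fact_lt_0|].
apply Rmult_lt_0_compat; apply INR_fact_lt_0.
Qed.

Lemma cm_ge0 (m r : nat) : 0 <= cm m r.
Proof.
unfold cm, binom; destruct (Nat.leb_spec (m + r) (2 * m)); [|lra].
unfold Binomial.C; left; apply Rdiv_lt_0_compat; [apply INR_fact_lt_0|].
apply Rmult_lt_0_compat; apply INR_fact_lt_0.
Qed.

(** Consecutive coefficients have ratio 1 - (2r+1)/(m+r+1), and the odd numbers 1, 3, ..., 2r-1 add
    up to r^2; so 1 - s <= exp (-s) gives a Gaussian bound. *)
Lemma cm_upper (m R r : nat) : (r <= R)%nat -> (R <= m)%nat ->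
  cm m r <= cm m 0 * exp (- (INR r ^ 2 / (INR m + INR R))).
Proof.
intros HrR HRm; induction r as [|r IH].
- change (INR 0) with 0; replace (- (0 ^ 2 / (INR m + INR R))) with 0 by (unfold Rdiv; ring).
  rewrite exp_0; lra.
- assert (Hs := cm_step m r ltac:(lia)).
  assert (HR : INR r + 1 <= INR R) by (rewrite <- S_INR; apply le_INR; lia).
  assert (HM : INR R <= INR m) by (apply le_INR; lia).
  assert (h := pos_INR r).
  assert (IH' := IH ltac:(lia)); clear IH.
  assert (Hd : 0 < INR m + INR r + 1) by lra.
  assert (Hr : cm m (S r) = cm m r * (1 - (2 * INR r + 1) / (INR m + INR r + 1))).
  { apply (Rmult_eq_reg_r (INR m + INR r + 1)); [|lra].
    rewrite Hs; field; lra. }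
  rewrite Hr.
  apply Rle_trans with (cm m r * exp (- ((2 * INR r + 1) / (INR m + INR R)))).
  + apply Rmult_le_compat_l; [apply cm_ge0|].
    apply Rle_trans with (1 := one_minus_le_exp _).
    apply exp_le, Ropp_le_contravar.
    apply Rmult_le_compat_l; [lra|]; apply Rinv_le_contravar; lra.
  + apply Rle_trans with (cm m 0 * exp (- (INR r ^ 2 / (INR m + INR R))) *
      exp (- ((2 * INR r + 1) / (INR m + INR R)))).
    * apply Rmult_le_compat_r; [left; apply exp_pos| exact IH'].
    * rewrite Rmult_assoc, <- exp_plus; right; do 2 f_equal.
      rewrite S_INR; field; lra.
Qed.

(** The same product, now with 1 - s >= exp (-s/(1-s)), where s/(1-s) = (2r+1)/(m-r). *)
Lemma cm_lower (m R r : nat) : (r <= R)%nat -> (R < m)%nat ->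
  cm m 0 * exp (- (INR r ^ 2 / (INR m - INR R))) <= cm m r.
Proof.
intros HrR HRm; induction r as [|r IH].
- change (INR 0) with 0; replace (- (0 ^ 2 / (INR m - INR R))) with 0 by (unfold Rdiv; ring).
  rewrite exp_0; lra.
- assert (Hs := cm_step m r ltac:(lia)).
  assert (HR : INR r + 1 <= INR R) by (rewrite <- S_INR; apply le_INR; lia).
  assert (HM : INR R + 1 <= INR m) by (rewrite <- S_INR; apply le_INR; lia).
  assert (h := pos_INR r).
  assert (IH' := IH ltac:(lia)); clear IH.
  assert (Hd : 0 < INR m + INR r + 1) by lra.
  assert (Hr : cm m (S r) = cm m r * (1 - (2 * INR r + 1) / (INR m + INR r + 1))).
  { apply (Rmult_eq_reg_r (INR m + INR r + 1)); [|lra].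
    rewrite Hs; field; lra. }
  rewrite Hr.
  apply Rle_trans with (cm m r * exp (- ((2 * INR r + 1) / (INR m - INR R)))).
  + apply Rle_trans with (cm m 0 * exp (- (INR r ^ 2 / (INR m - INR R))) *
      exp (- ((2 * INR r + 1) / (INR m - INR R)))).
    * rewrite Rmult_assoc, <- exp_plus; right; do 2 f_equal.
      rewrite S_INR; field; lra.
    * apply Rmult_le_compat_r; [left; apply exp_pos| exact IH'].
  + apply Rmult_le_compat_l; [apply cm_ge0|].
    set (s := (2 * INR r + 1) / (INR m + INR r + 1)).
    assert (Hs01 : 0 <= s < 1).
    { unfold s; split; [apply Rdiv_le_0_compat; lra|].
      apply Rmult_lt_reg_r with (INR m + INR r + 1); [lra|].
      unfold Rdiv; rewrite Rmult_assoc, Rinv_l by lra; lra. }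
    apply Rle_trans with (2 := exp_le_one_minus s Hs01).
    apply exp_le, Ropp_le_contravar.
    replace (s / (1 - s)) with ((2 * INR r + 1) / (INR m - INR r)).
    * apply Rmult_le_compat_l; [lra|]; apply Rinv_le_contravar; lra.
    * unfold s; field; lra.
Qed.

(** The slope 1/4 is crude, but any positive slope on an interval containing [0, PI/2] yields a
    Gaussian domination of even powers of the cosine. *)
Lemma sin_ge_quarter (y : R) : 0 <= y <= 2 -> y / 4 <= sin y.
Proof.
intros [H0 H2].
assert (HPI : 2 <= PI) by (assert (h := PI2_3_2); lra).
destruct (SIN y H0 ltac:(lra)) as [H _].
apply Rle_trans with (2 := H).
assert (E : sin_lb y = y * (1 - y ^ 2 / 6 + (y ^ 2) ^ 2 / 120 - (y ^ 2) ^ 3 / 5040)).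
{ unfold sin_lb, sin_approx, sin_term; cbn -[pow]; simpl; field. }
rewrite E.
assert (Hb : 0 <= y ^ 2 <= 4) by nra.
set (b := y ^ 2) in *; clearbody b.
assert (0 <= b ^ 2) by apply pow2_ge_0.
assert (b ^ 3 <= 64).
{ replace 64 with (4 ^ 3) by ring; apply pow_incr; lra. }
apply Rle_trans with (y * / 4); [unfold Rdiv; lra|].
apply Rmult_le_compat_l; lra.
Qed.

Lemma cos_even_pow_le (y : R) (m : nat) : Rabs y <= PI / 2 ->
  cos y ^ (2 * m) <= exp (- (INR m * (y ^ 2 / 16))).
Proof.
intros Hy.
assert (Hs : y ^ 2 / 16 <= sin y ^ 2).
{ assert (HP := PI_4).
  destruct (Rle_dec 0 y) as [H0|H0].
  - rewrite Rabs_pos_eq in Hy by lra.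
    assert (h := sin_ge_quarter y ltac:(lra)); nra.
  - rewrite Rabs_left in Hy by lra.
    assert (h := sin_ge_quarter (- y) ltac:(lra)); rewrite sin_neg in h; nra. }
rewrite pow_mult.
replace (- (INR m * (y ^ 2 / 16))) with (INR m * (- (y ^ 2 / 16))) by ring.
rewrite <- exp_pow; apply pow_incr; split; [apply pow2_ge_0|].
assert (h := sin2_cos2 y); unfold Rsqr in h.
assert (h' := one_minus_le_exp (y ^ 2 / 16)); simpl in *; lra.
Qed.

(** With s = sin y, the bounds exp (-s^2/(1-s^2)) <= 1 - s^2 <= exp (-s^2) squeeze the power, once m
    s^2 is known to have the same limit as m y^2. *)
Lemma lim_cos_pow (y : nat -> R) (m : nat -> nat) (a : R) :
  is_lim_seq y 0 -> is_lim_seq (fun h => INR (m h) * y h ^ 2) a ->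
  is_lim_seq (fun h => cos (y h) ^ (2 * m h)) (exp (- a)).
Proof.
intros Hy Ha.
assert (Hsin : is_lim_seq (fun h => sin (y h)) 0).
{ rewrite <- sin_0; apply (is_lim_seq_continuous sin y 0); [|exact Hy].
  apply continuity_sin. }
(* m sin^2 y -> a, through y (1 - y^2/6) <= sin y <= y *)
assert (Hms : is_lim_seq (fun h => INR (m h) * sin (y h) ^ 2) a).
{ assert (Hk : forall eps, 0 < eps -> exists d, 0 < d /\ forall x, Rabs x < d ->
     (1 - eps) * x ^ 2 <= sin x ^ 2 <= x ^ 2 * (1 + eps)).
  { intros eps Heps.
    assert (h := is_lim_sinc_0); apply is_lim_spec in h.
    assert (He : 0 < Rmin (eps / 3) 1) by (apply Rmin_case; lra).
    destruct (h (mkposreal _ He)) as [d Hd]; simpl in Hd.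
    exists d; split; [apply cond_pos|]; intros x Hx.
    destruct (Req_dec x 0) as [->|Hx0]; [rewrite sin_0; simpl; lra|].
    assert (Hq := Hd x).
    assert (Hball : ball 0 d x).
    { change (Rabs (x - 0) < d); now rewrite Rminus_0_r. }
    specialize (Hq Hball Hx0); apply Rabs_def2 in Hq.
    assert (H1 := Rmin_l (eps / 3) 1); assert (H2 := Rmin_r (eps / 3) 1).
    set (q := sin x / x) in *.
    replace (sin x) with (q * x) by (unfold q; field; exact Hx0).
    assert (Hx2 : 0 <= x ^ 2) by apply pow2_ge_0.
    assert (1 - eps <= q ^ 2 <= 1 + eps) by nra.
    rewrite Rpow_mult_distr; nra. }
  apply is_lim_seq_spec; intros eps.
  apply is_lim_seq_spec in Ha; apply is_lim_seq_spec in Hy.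
  set (A := Rabs a + 1).
  assert (HA : 0 < A) by (unfold A; assert (h := Rabs_pos a); lra).
  assert (He : 0 < eps / (2 * A)) by (apply Rdiv_lt_0_compat; [apply cond_pos| lra]).
  destruct (Hk _ He) as [d [Hd Hk']].
  assert (He2 : 0 < Rmin (eps / 2) 1) by (destruct eps; simpl; apply Rmin_case; lra).
  destruct (Ha (mkposreal _ He2)) as [N1 H1]; destruct (Hy (mkposreal _ Hd)) as [N2 H2].
  exists (max N1 N2); intros h Hh.
  specialize (H1 h ltac:(lia)); specialize (H2 h ltac:(lia)); cbn [pos] in H1, H2.
  rewrite Rminus_0_r in H2; specialize (Hk' _ H2).
  assert (Hm := pos_INR (m h)).
  set (X := INR (m h) * y h ^ 2) in *; set (Y := INR (m h) * sin (y h) ^ 2).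
  assert (HX : 0 <= X) by (apply Rmult_le_pos; [exact Hm| apply pow2_ge_0]).
  assert (HXA : X <= A).
  { apply Rabs_def2 in H1; assert (h1 := Rmin_r (eps / 2) 1); assert (h2 := Rle_abs a).
    unfold A; lra. }
  assert (HY : X * (1 - eps / (2 * A)) <= Y <= X * (1 + eps / (2 * A))).
  { unfold X, Y; split; rewrite Rmult_assoc; apply Rmult_le_compat_l; lra. }
  assert (HXe : X * (eps / (2 * A)) <= eps / 2).
  { apply Rle_trans with (A * (eps / (2 * A))); [apply Rmult_le_compat_r; lra|].
    right; field; lra. }
  assert (h1 := Rmin_l (eps / 2) 1).
  apply Rabs_def2 in H1; apply Rabs_def1; lra. }
assert (Hs2 : is_lim_seq (fun h => sin (y h) ^ 2) 0).
{ replace (Finite 0) with (Finite (0 * (0 * 1))) by (f_equal; ring).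
  apply is_lim_seq_mult'; [exact Hsin|]; apply is_lim_seq_mult'; [exact Hsin|apply is_lim_seq_const]. }
apply (is_lim_seq_le_le_loc (fun h => exp (- (INR (m h) * sin (y h) ^ 2 / (1 - sin (y h) ^ 2))))
   _ (fun h => exp (- (INR (m h) * sin (y h) ^ 2)))).
- apply is_lim_seq_spec in Hs2.
  destruct (Hs2 (mkposreal _ Rlt_0_1)) as [N HN].
  exists N; intros h Hh; specialize (HN h Hh); simpl in HN.
  rewrite Rminus_0_r in HN.
  assert (H0 : 0 <= sin (y h) ^ 2) by apply pow2_ge_0.
  rewrite Rabs_pos_eq in HN by (simpl in H0; lra).
  rewrite pow_mult.
  assert (Hc : cos (y h) ^ 2 = 1 - sin (y h) ^ 2).
  { assert (h0 := sin2_cos2 (y h)); unfold Rsqr in h0; simpl; lra. }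
  rewrite Hc; split.
  + replace (- (INR (m h) * sin (y h) ^ 2 / (1 - sin (y h) ^ 2)))
      with (INR (m h) * (- (sin (y h) ^ 2 / (1 - sin (y h) ^ 2)))) by (unfold Rdiv; ring).
    rewrite <- exp_pow; apply pow_incr; split; [left; apply exp_pos|].
    apply exp_le_one_minus; simpl in *; lra.
  + replace (- (INR (m h) * sin (y h) ^ 2)) with (INR (m h) * (- (sin (y h) ^ 2))) by ring.
    rewrite <- exp_pow; apply pow_incr; split; [simpl in *; lra|]; apply one_minus_le_exp.
- apply (is_lim_seq_continuous exp).
  { apply derivable_continuous_pt, derivable_pt_exp. }
  replace (Finite (- a)) with (Finite (- (a / (1 - 0)))) by (f_equal; field).
  apply (is_lim_seq_opp _ (a / (1 - 0))).
  apply is_lim_seq_div'; [exact Hms| |lra].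
  apply is_lim_seq_minus'; [apply is_lim_seq_const| exact Hs2].
- apply (is_lim_seq_continuous exp).
  { apply derivable_continuous_pt, derivable_pt_exp. }
  now apply (is_lim_seq_opp _ a).
Qed.

(** * The limit in the identity of Polya *)

Definition gauss (t u x : R) : R := exp (- (PI * t * (x + u) ^ 2)).

Definition dual_term (t u : R) (v : nat) : R :=
  ew v * exp (- (PI * INR v ^ 2 / t)) * cos (2 * PI * INR v * u).

Definition odd_nat (h : nat) : nat := S (2 * h).

Lemma lim_odd_nat : is_lim_seq (fun h => INR (odd_nat h)) p_infty.
Proof.
apply is_lim_seq_le_p_loc with (fun h => INR h).
- exists 0%nat; intros h _; apply le_INR; unfold odd_nat; lia.
- apply is_lim_seq_INR.
Qed.

Lemma odd_nat_pos (h : nat) : 0 < INR (odd_nat h).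
Proof. apply lt_0_INR; unfold odd_nat; lia. Qed.

Lemma lim_inv_odd (c : R) : is_lim_seq (fun h => c / INR (odd_nat h)) 0.
Proof.
replace (Finite 0) with (Rbar_mult c 0) by (simpl; now rewrite Rmult_0_r).
unfold Rdiv; apply (is_lim_seq_scal_l (fun h => / INR (odd_nat h)) c 0).
replace (Finite 0) with (Rbar_inv p_infty) by reflexivity.
apply is_lim_seq_inv; [apply lim_odd_nat| discriminate].
Qed.

Lemma ew_bound (v : nat) : 1 <= ew v <= 2.
Proof. destruct v; simpl; lra. Qed.

Section Limits.
Variables (t : R) (m : nat -> nat).
Hypothesis Ht : 0 < t.
Hypothesis Hm : is_lim_seq (fun h => INR (m h) / INR (odd_nat h) ^ 2) (t / PI).

Lemma tPI_pos : 0 < t / PI.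
Proof. apply Rdiv_lt_0_compat; [exact Ht| apply PI_RGT_0]. Qed.

Lemma m_bounds : eventually (fun h =>
  t / PI / 2 * INR (odd_nat h) ^ 2 <= INR (m h) <= 2 * (t / PI) * INR (odd_nat h) ^ 2).
Proof.
assert (Hp := tPI_pos).
apply is_lim_seq_spec in Hm.
assert (He : 0 < t / PI / 2) by lra.
destruct (Hm (mkposreal _ He)) as [N HN]; exists N; intros h Hh.
specialize (HN h Hh); cbn [pos] in HN; apply Rabs_def2 in HN.
assert (Hl := odd_nat_pos h).
assert (Hl2 : 0 < INR (odd_nat h) ^ 2) by (apply pow_lt; lra).
set (q := INR (m h) / INR (odd_nat h) ^ 2) in *.
replace (INR (m h)) with (q * INR (odd_nat h) ^ 2) by (unfold q; field; lra).
split; apply Rmult_le_compat_r; lra.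
Qed.

Lemma m_infty (K : nat) : eventually (fun h => (K <= m h)%nat).
Proof.
destruct m_bounds as [N HN].
assert (Hp := tPI_pos).
assert (Hinf : is_lim_seq (fun h => t / PI / 2 * INR (odd_nat h)) p_infty).
{ replace p_infty with (Rbar_mult (t / PI / 2) p_infty).
  - apply is_lim_seq_scal_l, lim_odd_nat.
  - simpl; destruct (Rle_dec 0 (t / PI / 2)) as [H|H]; [|lra].
    destruct (Rle_lt_or_eq_dec 0 (t / PI / 2) H); [reflexivity|lra]. }
apply is_lim_seq_spec in Hinf.
destruct (Hinf (INR K)) as [N2 HN2].
exists (max N N2); intros h Hh.
specialize (HN h ltac:(lia)); specialize (HN2 h ltac:(lia)).
apply INR_le.
assert (H1 : 1 <= INR (odd_nat h)).
{ change 1 with (INR 1); apply le_INR; unfold odd_nat; lia. }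
assert (t / PI / 2 * INR (odd_nat h) <= t / PI / 2 * INR (odd_nat h) ^ 2) by nra.
lra.
Qed.

(** The restriction |u| <= 1/2 keeps PI (x+u)/l inside [-PI/2, PI/2], where the cosine power is
    dominated; periodicity removes it in [poisson]. *)
Lemma polya_lim (u : R) : Rabs u <= / 2 ->
  ex_series (sym (gauss t u)) /\
  is_lim_seq (fun h => sum_n (sym (fun x =>
    cos (PI * (x + u) / INR (odd_nat h)) ^ (2 * m h))) h) (Series (sym (gauss t u))).
Proof.
intros Hu.
assert (HPI := PI_RGT_0).
assert (Hp := tPI_pos).
set (F := fun h n => sym (fun x => cos (PI * (x + u) / INR (odd_nat h)) ^ (2 * m h)) n).
(* Cut off at n <= h: [tannery] wants one bound for all n, and beyond h the argument may leave the
   interval where the cosine is dominated. *)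
set (F' := fun h n => if Nat.leb n h then F h n else 0).
set (c := t / PI / 2 * PI ^ 2 / 64).
assert (Hc : 0 < c).
{ unfold c; assert (0 < PI ^ 2) by (apply pow_lt; lra).
  apply Rdiv_lt_0_compat; [apply Rmult_lt_0_compat|]; lra. }
assert (Hterm : forall x, is_lim_seq
   (fun h => cos (PI * (x + u) / INR (odd_nat h)) ^ (2 * m h)) (gauss t u x)).
{ intros x; unfold gauss; apply lim_cos_pow.
  - apply lim_inv_odd.
  - apply is_lim_seq_ext with (fun h => PI ^ 2 * (x + u) ^ 2 * (INR (m h) / INR (odd_nat h) ^ 2)).
    + intros h; assert (Hl := odd_nat_pos h); field; lra.
    + replace (Finite (PI * t * (x + u) ^ 2)) with
        (Rbar_mult (PI ^ 2 * (x + u) ^ 2) (t / PI)) by (simpl; f_equal; field; lra).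
      now apply is_lim_seq_scal_l. }
destruct (tannery F' (sym (gauss t u)) (fun n => 2 * exp (- (c * INR n))) (fun h => h))
  as [H1 H2].
- destruct m_bounds as [N HN]; exists N; intros h Hh n.
  specialize (HN h Hh).
  unfold F'; destruct (Nat.leb_spec n h) as [Hn|Hn].
  2:{ rewrite Rabs_R0; left; apply Rmult_lt_0_compat; [lra|apply exp_pos]. }
  assert (Hl := odd_nat_pos h).
  assert (Hn' : INR n <= INR h) by now apply le_INR.
  assert (Hn0 := pos_INR n).
  assert (Ho : INR (odd_nat h) = 2 * INR h + 1).
  { unfold odd_nat; rewrite S_INR, mult_INR; change (INR 2) with 2; ring. }
  assert (HB : forall x, Rabs x = INR n ->
     0 <= cos (PI * (x + u) / INR (odd_nat h)) ^ (2 * m h) <= exp (- (c * INR n))).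
  { intros x Hx.
    assert (Hxu : Rabs (x + u) <= INR n + / 2).
    { apply Rle_trans with (1 := Rabs_triang _ _); lra. }
    assert (Hxl : INR n / 4 <= (x + u) ^ 2).
    { assert (h0 := Rabs_triang_inv2 x (- u)); rewrite Rabs_Ropp in h0.
      unfold Rminus in h0; rewrite Ropp_involutive in h0.
      rewrite <- (pow2_abs (x + u)); rewrite Hx in h0.
      assert (h1 := Rle_abs (INR n + - Rabs u)).
      destruct n as [|n]; [simpl; simpl in *; assert (h2 := pow2_ge_0 (Rabs (x + u))); simpl in h2; lra|].
      rewrite S_INR in *; assert (hn := pos_INR n).
      assert (INR n + / 2 <= Rabs (x + u)) by lra; nra. }
    split; [rewrite pow_mult; apply pow_le, pow2_ge_0|].
    apply Rle_trans with (1 := cos_even_pow_le (PI * (x + u) / INR (odd_nat h)) (m h)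
      ltac:(unfold Rdiv; rewrite !Rabs_mult, Rabs_inv, (Rabs_pos_eq PI), (Rabs_pos_eq (INR _)) by lra;
        apply Rmult_le_reg_r with (INR (odd_nat h)); [lra|];
        rewrite Rmult_assoc, Rinv_l by lra; nra)).
    apply exp_le, Ropp_le_contravar.
    replace (INR (m h) * ((PI * (x + u) / INR (odd_nat h)) ^ 2 / 16))
      with (INR (m h) * (PI ^ 2 * (x + u) ^ 2 / 16 / INR (odd_nat h) ^ 2)) by (field; lra).
    assert (Hl2 : 0 < INR (odd_nat h) ^ 2) by (apply pow_lt; lra).
    assert (HP2 : 0 < PI ^ 2) by (apply pow_lt; lra).
    apply Rle_trans with (t / PI / 2 * INR (odd_nat h) ^ 2 *
      (PI ^ 2 * (x + u) ^ 2 / 16 / INR (odd_nat h) ^ 2)).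
    - replace (t / PI / 2 * INR (odd_nat h) ^ 2 * (PI ^ 2 * (x + u) ^ 2 / 16 / INR (odd_nat h) ^ 2))
        with (t / PI / 2 * PI ^ 2 / 16 * (x + u) ^ 2) by (field; lra).
      apply Rle_trans with (t / PI / 2 * PI ^ 2 / 16 * (INR n / 4)).
      + right; unfold c; field; lra.
      + apply Rmult_le_compat_l; [|exact Hxl].
        unfold c in Hc; lra.
    - apply Rmult_le_compat_r; [|lra].
      apply Rdiv_le_0_compat; [|exact Hl2].
      apply Rmult_le_pos; [|lra]; apply Rmult_le_pos; [lra| apply pow2_ge_0]. }
  unfold F, sym; destruct n as [|n].
  + destruct (HB 0 ltac:(rewrite Rabs_R0; reflexivity)) as [Ha Hb].
    rewrite Rabs_pos_eq by exact Ha; assert (h1 := exp_pos (- (c * INR 0))); lra.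
  + destruct (HB (INR (S n)) ltac:(rewrite Rabs_pos_eq; auto)) as [Ha Hb].
    destruct (HB (- INR (S n)) ltac:(rewrite Rabs_Ropp, Rabs_pos_eq; auto)) as [Ha' Hb'].
    rewrite Rabs_pos_eq; lra.
- now apply ex_series_exp.
- intros n; apply is_lim_seq_ext_loc with (fun h => F h n).
  + exists n; intros h Hh; unfold F'; destruct (Nat.leb_spec n h); [reflexivity|lia].
  + unfold F, sym; destruct n as [|n]; [apply Hterm|].
    apply is_lim_seq_plus'; apply Hterm.
- intros K; exists K; auto.
- split; [exact H1|].
  apply is_lim_seq_ext with (2 := H2); intros h.
  apply sum_n_eq; intros n Hn; unfold F'.
  destruct (Nat.leb_spec n h); [reflexivity|lia].
Qed.

(** Division by the central coefficient gives each term a finite limit, exp (-PI v^2 / t), by the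
    two Gaussian bounds. The central coefficient itself is collected in [polya_const]. *)
Lemma binom_lim (u : R) :
  ex_series (dual_term t u) /\
  is_lim_seq (fun h => sum_n (fun v => ew v * (cm (m h) (odd_nat h * v) / cm (m h) 0)
     * cos (2 * PI * INR v * u)) (m h)) (Series (dual_term t u)).
Proof.
assert (HPI := PI_RGT_0).
assert (Hp := tPI_pos).
set (lam := t / PI) in *.
set (c := / (4 * lam)).
assert (Hc : 0 < c) by (apply Rinv_0_lt_compat; lra).
assert (Hcos : forall x, -1 <= cos x <= 1) by apply COS_bound.
apply tannery with (g := fun n => 2 * exp (- (c * INR n))).
- destruct m_bounds as [N HN].
  destruct (m_infty 1) as [N2 HN2].
  exists (max N N2); intros h Hh v.
  specialize (HN h ltac:(lia)); specialize (HN2 h ltac:(lia)); fold lam in HN.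
  assert (Hc0 := cm_pos0 (m h)).
  assert (Hge := cm_ge0 (m h) (odd_nat h * v)).
  assert (HR : 0 <= cm (m h) (odd_nat h * v) / cm (m h) 0 <= exp (- (c * INR v))).
  { split; [apply Rdiv_le_0_compat; auto|].
    destruct (le_lt_dec (odd_nat h * v) (m h)) as [Hv|Hv].
    2:{ rewrite cm_zero by exact Hv; unfold Rdiv; rewrite Rmult_0_l; left; apply exp_pos. }
    assert (HU := cm_upper (m h) (m h) (odd_nat h * v) Hv (le_n _)).
    apply Rmult_le_reg_r with (cm (m h) 0); [exact Hc0|].
    unfold Rdiv; rewrite Rmult_assoc, Rinv_l, Rmult_1_r, Rmult_comm by lra.
    apply Rle_trans with (1 := HU).
    apply Rmult_le_compat_l; [lra|].
    apply exp_le, Ropp_le_contravar.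
    assert (Hm1 : 1 <= INR (m h)) by (change 1 with (INR 1); now apply le_INR).
    apply Rmult_le_reg_r with (INR (m h) + INR (m h)); [lra|].
    replace (INR (odd_nat h * v) ^ 2 / (INR (m h) + INR (m h)) * (INR (m h) + INR (m h)))
      with (INR (odd_nat h * v) ^ 2) by (field; lra).
    rewrite mult_INR.
    assert (Hl := odd_nat_pos h).
    assert (Hv0 := pos_INR v).
    assert (Hvv : INR v <= INR v ^ 2).
    { destruct v as [|v]; [simpl; lra|]; rewrite S_INR; assert (hv := pos_INR v); nra. }
    apply Rle_trans with (INR (odd_nat h) ^ 2 * INR v).
    - replace (c * INR v * (INR (m h) + INR (m h))) with (2 * c * INR (m h) * INR v) by ring.
      apply Rmult_le_compat_r; [lra|].
      apply Rle_trans with (2 * c * (2 * lam * INR (odd_nat h) ^ 2)).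
      + apply Rmult_le_compat_l; lra.
      + right; unfold c; field; lra.
    - rewrite Rpow_mult_distr; apply Rmult_le_compat_l; [apply pow2_ge_0| lra]. }
  rewrite Rabs_mult, Rabs_mult.
  assert (he := ew_bound v).
  rewrite (Rabs_pos_eq (ew v)), (Rabs_pos_eq (cm _ _ / _)) by lra.
  assert (Hca : Rabs (cos (2 * PI * INR v * u)) <= 1) by (apply Rabs_le; apply Hcos).
  assert (Hca0 := Rabs_pos (cos (2 * PI * INR v * u))).
  apply Rle_trans with (2 * exp (- (c * INR v)) * 1); [|lra].
  apply Rmult_le_compat; try lra.
  + apply Rmult_le_pos; lra.
  + apply Rmult_le_compat; lra.
- now apply ex_series_exp.
- intros v; unfold dual_term.
  apply is_lim_seq_mult'; [|apply is_lim_seq_const].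
  apply is_lim_seq_mult'; [apply is_lim_seq_const|].
  assert (Hdiv : is_lim_seq (fun h => INR (odd_nat h * v) / INR (odd_nat h) ^ 2) 0).
  { apply is_lim_seq_ext with (2 := lim_inv_odd (INR v)); intros h.
    assert (Hl := odd_nat_pos h); rewrite mult_INR; field; lra. }
  assert (Hlim : forall s, is_lim_seq (fun h => INR (odd_nat h * v) ^ 2 /
     (INR (m h) + s * INR (odd_nat h * v))) (PI * INR v ^ 2 / t)).
  { intros s.
    apply is_lim_seq_ext with (fun h => INR v ^ 2 / (INR (m h) / INR (odd_nat h) ^ 2
       + s * (INR (odd_nat h * v) / INR (odd_nat h) ^ 2))).
    - intros h; assert (Hl := odd_nat_pos h).
      assert (Hl2 : INR (odd_nat h) ^ 2 <> 0) by (apply pow_nonzero; lra).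
      rewrite mult_INR.
      replace (INR (m h) / INR (odd_nat h) ^ 2 + s * (INR (odd_nat h) * INR v / INR (odd_nat h) ^ 2))
        with ((INR (m h) + s * (INR (odd_nat h) * INR v)) / INR (odd_nat h) ^ 2) by (field; lra).
      unfold Rdiv; rewrite Rinv_mult, Rinv_inv; ring.
    - replace (PI * INR v ^ 2 / t) with (INR v ^ 2 / (lam + s * 0)) by (unfold lam; field; lra).
      apply is_lim_seq_div'; [apply is_lim_seq_const| |lra].
      apply is_lim_seq_plus'; [exact Hm|].
      apply is_lim_seq_mult'; [apply is_lim_seq_const| exact Hdiv]. }
  assert (Hlt : eventually (fun h => (odd_nat h * v < m h)%nat)).
  { apply is_lim_seq_spec in Hdiv; apply is_lim_seq_spec in Hm.
    assert (He : 0 < lam / 2) by lra.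
    destruct (Hdiv (mkposreal _ He)) as [N1 H1]; destruct (Hm (mkposreal _ He)) as [N2 H2].
    exists (max N1 N2); intros h Hh.
    specialize (H1 h ltac:(lia)); specialize (H2 h ltac:(lia)).
    cbn [pos] in H1, H2; apply Rabs_def2 in H1; apply Rabs_def2 in H2.
    apply INR_lt.
    assert (Hl : 0 < / INR (odd_nat h) ^ 2).
    { apply Rinv_0_lt_compat, pow_lt, odd_nat_pos. }
    apply Rmult_lt_reg_r with (1 := Hl); unfold Rdiv in *; fold lam in H2; lra. }
  apply (is_lim_seq_le_le_loc
    (fun h => exp (- (INR (odd_nat h * v) ^ 2 / (INR (m h) + (-1) * INR (odd_nat h * v))))) _
    (fun h => exp (- (INR (odd_nat h * v) ^ 2 / (INR (m h) + 1 * INR (odd_nat h * v)))))).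
  + destruct Hlt as [N HN]; exists N; intros h Hh; specialize (HN h Hh).
    assert (Hc0 := cm_pos0 (m h)).
    assert (HU := cm_upper (m h) (odd_nat h * v) (odd_nat h * v) (le_n _) ltac:(lia)).
    assert (HL := cm_lower (m h) (odd_nat h * v) (odd_nat h * v) (le_n _) HN).
    replace (INR (m h) + -1 * INR (odd_nat h * v)) with (INR (m h) - INR (odd_nat h * v)) by ring.
    rewrite Rmult_1_l.
    split; apply Rmult_le_reg_l with (1 := Hc0).
    * apply Rle_trans with (1 := HL); right; field; lra.
    * apply Rle_trans with (2 := HU); right; field; lra.
  + apply (is_lim_seq_continuous exp).
    { apply derivable_continuous_pt, derivable_pt_exp. }
    apply (is_lim_seq_opp _ (PI * INR v ^ 2 / t)), Hlim.
  + apply (is_lim_seq_continuous exp).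
    { apply derivable_continuous_pt, derivable_pt_exp. }
    apply (is_lim_seq_opp _ (PI * INR v ^ 2 / t)), Hlim.
- apply m_infty.
Qed.

End Limits.

(** * One-dimensional Poisson summation *)

Lemma exists_rate (a : R) : 0 < a -> exists m : nat -> nat,
  is_lim_seq (fun h => INR (m h) / INR (odd_nat h) ^ 2) a.
Proof.
intros Ha.
assert (Hp : forall h, 0 <= a * INR (odd_nat h) ^ 2).
{ intros h; apply Rmult_le_pos; [lra| apply pow2_ge_0]. }
exists (fun h => proj1_sig (nfloor_ex _ (Hp h))).
apply (is_lim_seq_le_le (fun h => a - (1 / INR (odd_nat h))) _ (fun _ => a)).
- intros h; destruct (nfloor_ex _ (Hp h)) as [n [Hn1 Hn2]]; cbn [proj1_sig].
  assert (Hl := odd_nat_pos h).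
  assert (H1 : 1 <= INR (odd_nat h)).
  { change 1 with (INR 1); apply le_INR; unfold odd_nat; lia. }
  assert (Hl2 : 0 < INR (odd_nat h) ^ 2) by (apply pow_lt; lra).
  split; apply Rmult_le_reg_r with (1 := Hl2).
  + replace (INR n / INR (odd_nat h) ^ 2 * INR (odd_nat h) ^ 2) with (INR n) by (field; lra).
    replace ((a - 1 / INR (odd_nat h)) * INR (odd_nat h) ^ 2)
      with (a * INR (odd_nat h) ^ 2 - INR (odd_nat h)) by (field; lra).
    lra.
  + replace (INR n / INR (odd_nat h) ^ 2 * INR (odd_nat h) ^ 2) with (INR n) by (field; lra).
    exact Hn1.
- replace (Finite a) with (Finite (a - 0)) by (f_equal; ring).
  apply is_lim_seq_minus'; [apply is_lim_seq_const| apply lim_inv_odd].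
- apply is_lim_seq_const.
Qed.

Definition gauss_sum (t u : R) : R := Series (sym (gauss t u)).
Definition dual_sum (t u : R) : R := Series (dual_term t u).

(* The Wallis constant is not computed: [wallis] converges by monotonicity and
   its limit is read off from the self-dual case [t = 1]. *)
Definition wallis (m : nat) : R := INR m / 16 ^ m * cm m 0 ^ 2.

Lemma cm_S0 (m : nat) : cm (S m) 0 * (INR m + 1) = cm m 0 * (2 * (2 * INR m + 1)).
Proof.
unfold cm, binom.
destruct (Nat.leb_spec (S m + 0) (2 * S m)); destruct (Nat.leb_spec (m + 0) (2 * m)); try lia.
rewrite !Nat.add_0_r; unfold Binomial.C.
replace (2 * S m - S m)%nat with (S m) by lia.
replace (2 * m - m)%nat with m by lia.
replace (2 * S m)%nat with (S (S (2 * m))) by lia.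
rewrite !fact_simpl, !mult_INR, !S_INR, mult_INR; change (INR 2) with 2.
assert (h := INR_fact_neq_0 m); assert (h' := pos_INR m); field; repeat split; first [exact h|lra].
Qed.

Lemma wallis_incr (m : nat) : wallis m <= wallis (S m).
Proof.
unfold wallis.
assert (Hm := pos_INR m).
assert (E : cm (S m) 0 = cm m 0 * (2 * (2 * INR m + 1)) / (INR m + 1)).
{ apply (Rmult_eq_reg_r (INR m + 1)); [|lra]; rewrite cm_S0; field; lra. }
rewrite E, S_INR.
change (16 ^ S m) with (16 * 16 ^ m).
assert (H16 : 0 < 16 ^ m) by (apply pow_lt; lra).
replace ((INR m + 1) / (16 * 16 ^ m) * (cm m 0 * (2 * (2 * INR m + 1)) / (INR m + 1)) ^ 2)
  with ((INR m + / (4 * (INR m + 1))) / 16 ^ m * cm m 0 ^ 2) by (field; lra).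
apply Rmult_le_compat_r; [apply pow2_ge_0|].
apply Rmult_le_compat_r; [left; now apply Rinv_0_lt_compat|].
assert (0 < / (4 * (INR m + 1))) by (apply Rinv_0_lt_compat; lra); lra.
Qed.

Lemma wallis_mono (m n : nat) : (m <= n)%nat -> wallis m <= wallis n.
Proof.
induction 1 as [|n _ IH]; [lra|]; apply Rle_trans with (1 := IH), wallis_incr.
Qed.

Lemma dual_sum_ge1 (t : R) : 0 < t -> ex_series (dual_term t 0) -> 1 <= dual_sum t 0.
Proof.
intros Ht Hex.
apply Rle_trans with (sum_n (dual_term t 0) 0).
- rewrite sum_n_0; unfold dual_term, ew; change (INR 0) with 0.
  replace (- (PI * 0 ^ 2 / t)) with 0 by (field; lra).
  replace (2 * PI * 0 * 0) with 0 by ring; rewrite exp_0, cos_0; lra.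
- apply sum_n_le_series; [|now apply Series_correct].
  intros v; unfold dual_term; rewrite Rmult_0_r, cos_0, Rmult_1_r.
  assert (h := ew_bound v); apply Rmult_le_pos; [lra| left; apply exp_pos].
Qed.

Definition polya_const (h m : nat) : R := INR (odd_nat h) * / 4 ^ m * cm m 0.

Lemma polya_const_sqr (h m : nat) : (0 < m)%nat ->
  polya_const h m ^ 2 = wallis m / (INR m / INR (odd_nat h) ^ 2).
Proof.
intros Hm; unfold polya_const, wallis.
assert (Hm' : 0 < INR m) by now apply lt_0_INR.
assert (Hl := odd_nat_pos h).
replace (16 ^ m) with (4 ^ m * 4 ^ m) by (rewrite <- Rpow_mult_distr; f_equal; ring).
assert (H4 : 0 < 4 ^ m) by (apply pow_lt; lra).
field; lra.
Qed.

(** The prefactor has a limit because at u = 0 both sums converge and the dual one is at least 1;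
    that same limit then serves for every u. *)
Lemma polya_const_lim (t : R) (m : nat -> nat) : 0 < t ->
  is_lim_seq (fun h => INR (m h) / INR (odd_nat h) ^ 2) (t / PI) ->
  is_lim_seq (fun h => polya_const h (m h)) (gauss_sum t 0 / dual_sum t 0) /\
  (forall u, Rabs u <= / 2 ->
    gauss_sum t u = gauss_sum t 0 / dual_sum t 0 * dual_sum t u).
Proof.
intros Ht Hm.
destruct (binom_lim t m Ht Hm 0) as [Hex0 HB0].
assert (H1 := dual_sum_ge1 t Ht Hex0).
assert (HLR : forall h u, sum_n (sym (fun x =>
     cos (PI * (x + u) / INR (odd_nat h)) ^ (2 * m h))) h =
   polya_const h (m h) * sum_n (fun v => ew v * (cm (m h) (odd_nat h * v) / cm (m h) 0)
     * cos (2 * PI * INR v * u)) (m h) :> R).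
{ intros h u; unfold odd_nat at 1; rewrite polya_identity; fold (odd_nat h).
  unfold polya_const; rewrite <- !sum_n_scal; apply sum_n_eq; intros v _.
  assert (h0 := cm_pos0 (m h)).
  assert (H4 : 0 < 4 ^ m h) by (apply pow_lt; lra).
  field; lra. }
assert (HK : is_lim_seq (fun h => polya_const h (m h)) (gauss_sum t 0 / dual_sum t 0)).
{ destruct (polya_lim t m Ht Hm 0) as [_ HP0].
  { rewrite Rabs_R0; lra. }
  apply is_lim_seq_ext_loc with (fun h => sum_n (sym (fun x =>
     cos (PI * (x + 0) / INR (odd_nat h)) ^ (2 * m h))) h /
     sum_n (fun v => ew v * (cm (m h) (odd_nat h * v) / cm (m h) 0)
     * cos (2 * PI * INR v * 0)) (m h)).
  - apply is_lim_seq_spec in HB0.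
    destruct (HB0 (mkposreal _ Rlt_0_1)) as [N HN].
    exists N; intros h Hh; specialize (HN h Hh); cbn [pos] in HN.
    rewrite HLR; apply Rabs_def2 in HN.
    field; unfold dual_sum in H1; lra.
  - apply is_lim_seq_div'; auto; unfold dual_sum in *; lra. }
split; [exact HK|].
intros u Hu.
destruct (polya_lim t m Ht Hm u Hu) as [_ HPu].
destruct (binom_lim t m Ht Hm u) as [_ HBu].
assert (HL2 := is_lim_seq_mult' _ _ _ _ HK HBu).
assert (HL3 : is_lim_seq (fun h => sum_n (sym (fun x =>
     cos (PI * (x + u) / INR (odd_nat h)) ^ (2 * m h))) h)
     (gauss_sum t 0 / dual_sum t 0 * dual_sum t u)).
{ apply is_lim_seq_ext with (2 := HL2); intros h; now rewrite HLR. }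
apply is_lim_seq_unique in HPu; apply is_lim_seq_unique in HL3.
unfold gauss_sum at 1; rewrite HL3 in HPu; injection HPu; auto.
Qed.

Lemma gauss_sum_ex (t u : R) : 0 < t -> Rabs u <= / 2 -> ex_series (sym (gauss t u)).
Proof.
intros Ht Hu; destruct (exists_rate (t / PI)) as [m Hm].
{ apply Rdiv_lt_0_compat; [exact Ht| apply PI_RGT_0]. }
now destruct (polya_lim t m Ht Hm u Hu).
Qed.

Lemma dual_sum_ex (t u : R) : 0 < t -> ex_series (dual_term t u).
Proof.
intros Ht; destruct (exists_rate (t / PI)) as [m Hm].
{ apply Rdiv_lt_0_compat; [exact Ht| apply PI_RGT_0]. }
now destruct (binom_lim t m Ht Hm u).
Qed.

Lemma wallis_lim : is_lim_seq wallis (/ PI).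
Proof.
assert (HPI := PI_RGT_0).
destruct (exists_rate (1 / PI)) as [m Hm].
{ apply Rdiv_lt_0_compat; lra. }
destruct (polya_const_lim 1 m Rlt_0_1 Hm) as [HK _].
assert (Hself : gauss_sum 1 0 = dual_sum 1 0).
{ apply Series_ext; intros [|n]; unfold sym, gauss, dual_term, ew.
  - change (INR 0) with 0; rewrite Rmult_0_r, cos_0.
    replace (PI * 1 * (0 + 0) ^ 2) with (PI * 0 ^ 2 / 1) by field; ring.
  - rewrite Rmult_0_r, cos_0.
    replace (PI * 1 * (INR (S n) + 0) ^ 2) with (PI * INR (S n) ^ 2 / 1) by field.
    replace (PI * 1 * (- INR (S n) + 0) ^ 2) with (PI * INR (S n) ^ 2 / 1) by field.
    ring. }
assert (H1 := dual_sum_ge1 1 Rlt_0_1 (dual_sum_ex 1 0 Rlt_0_1)).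
rewrite Hself in HK; replace (dual_sum 1 0 / dual_sum 1 0) with 1 in HK by (field; lra).
assert (Hw : is_lim_seq (fun h => wallis (m h)) (1 * 1 * (1 / PI))).
{ apply is_lim_seq_ext_loc with (fun h => polya_const h (m h) * polya_const h (m h) *
     (INR (m h) / INR (odd_nat h) ^ 2)).
  - destruct (m_infty 1 m Rlt_0_1 Hm 1) as [N HN].
    exists N; intros h Hh; specialize (HN h Hh).
    assert (E := polya_const_sqr h (m h) HN).
    assert (Hl := odd_nat_pos h).
    assert (Hm' : 0 < INR (m h)) by (apply lt_0_INR; lia).
    assert (0 < INR (m h) / INR (odd_nat h) ^ 2).
    { apply Rdiv_lt_0_compat; [exact Hm'| apply pow_lt; lra]. }
    replace (polya_const h (m h) * polya_const h (m h)) with (polya_const h (m h) ^ 2) by ring.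
    rewrite E; field; lra.
  - apply is_lim_seq_mult'; [now apply is_lim_seq_mult'| exact Hm]. }
replace (1 * 1 * (1 / PI)) with (/ PI) in Hw by (field; lra).
assert (Hbd : forall n, wallis n <= / PI + 1).
{ intros n.
  apply is_lim_seq_spec in Hw; destruct (Hw (mkposreal _ Rlt_0_1)) as [N1 H1'].
  destruct (m_infty 1 m Rlt_0_1 Hm n) as [N2 H2].
  specialize (H1' (max N1 N2) ltac:(lia)); specialize (H2 (max N1 N2) ltac:(lia)).
  cbn [pos] in H1'; apply Rabs_def2 in H1'.
  assert (h := wallis_mono _ _ H2); lra. }
destruct (ex_finite_lim_seq_incr wallis _ wallis_incr Hbd) as [W HW].
assert (Hsub : is_lim_seq (fun h => wallis (m h)) W).
{ apply is_lim_seq_spec in HW; apply is_lim_seq_spec; intros eps.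
  destruct (HW eps) as [N HN].
  destruct (m_infty 1 m Rlt_0_1 Hm N) as [N2 HN2]; exists N2; intros h Hh; auto. }
apply is_lim_seq_unique in Hsub; apply is_lim_seq_unique in Hw.
rewrite Hsub in Hw; injection Hw; intros <-; exact HW.
Qed.

Lemma theta_const (t : R) : 0 < t -> gauss_sum t 0 / dual_sum t 0 = / sqrt t.
Proof.
intros Ht.
assert (HPI := PI_RGT_0).
destruct (exists_rate (t / PI)) as [m Hm].
{ apply Rdiv_lt_0_compat; lra. }
destruct (polya_const_lim t m Ht Hm) as [HK _].
set (k := gauss_sum t 0 / dual_sum t 0) in *.
assert (Hk0 : 0 <= k).
{ apply (is_lim_seq_le (fun _ => 0) (fun h => polya_const h (m h)) 0 k); auto.
  - intros h; unfold polya_const; apply Rmult_le_pos; [|left; apply cm_pos0].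
    apply Rmult_le_pos; [apply pos_INR| left; apply Rinv_0_lt_compat, pow_lt; lra].
  - apply is_lim_seq_const. }
assert (Hk2 : k * k = / t).
{ assert (HL1 := is_lim_seq_mult' _ _ _ _ HK HK).
  assert (Hw : is_lim_seq (fun h => wallis (m h)) (/ PI)).
  { assert (HW := wallis_lim).
    apply is_lim_seq_spec in HW; apply is_lim_seq_spec; intros eps.
    destruct (HW eps) as [N HN].
    destruct (m_infty t m Ht Hm N) as [N2 HN2]; exists N2; intros h Hh; auto. }
  assert (Htp : t / PI <> 0).
  { apply Rgt_not_eq, Rdiv_lt_0_compat; lra. }
  assert (HL2 := is_lim_seq_div' _ _ _ _ Hw Hm Htp).
  assert (HL3 : is_lim_seq (fun h => polya_const h (m h) * polya_const h (m h)) (/ PI / (t / PI))).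
  { apply is_lim_seq_ext_loc with (2 := HL2).
    destruct (m_infty t m Ht Hm 1) as [N HN].
    exists N; intros h Hh; specialize (HN h Hh).
    rewrite <- polya_const_sqr by exact HN; ring. }
  apply is_lim_seq_unique in HL1; apply is_lim_seq_unique in HL3.
  rewrite HL1 in HL3; injection HL3; intros ->; field; lra. }
assert (Hs : 0 < sqrt t) by now apply sqrt_lt_R0.
assert (Hss : sqrt t * sqrt t = t) by (apply sqrt_sqrt; lra).
assert (Hi : 0 < / sqrt t) by now apply Rinv_0_lt_compat.
apply Rsqr_inj; [exact Hk0| lra|]; unfold Rsqr.
rewrite Hk2, <- Rinv_mult, Hss; reflexivity.
Qed.

Lemma sym_shift (f : R -> R) (N : nat) :
  sum_n (sym (fun x => f (x + 1))) N = sum_n (sym f) N - f (- INR N) + f (INR N + 1) :> R.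
Proof.
induction N as [|N IH].
- rewrite !sum_n_0; unfold sym; change (INR 0) with 0.
  replace (-0) with 0 by ring; ring.
- rewrite !sum_n_S, IH; unfold sym; rewrite !S_INR.
  replace (- (INR N + 1) + 1) with (- INR N) by ring; ring.
Qed.

Lemma gauss_lim0 (t u : R) (x : nat -> R) : 0 < t ->
  (forall n, INR n <= Rabs (x n)) -> is_lim_seq (fun n => gauss t u (x n)) 0.
Proof.
intros Ht Hx; unfold gauss.
assert (HPI := PI_RGT_0).
apply (is_lim_seq_le_le_loc (fun _ => 0) _ (fun n => exp (- (PI * t * (INR n - Rabs u))))).
- destruct (nfloor_ex (Rabs u + 1) ltac:(assert (h := Rabs_pos u); lra)) as [K HK].
  exists (S K); intros n Hn; split; [left; apply exp_pos|].
  apply exp_le, Ropp_le_contravar.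
  apply Rmult_le_compat_l; [nra|].
  assert (h0 := Rabs_triang_inv2 (x n) (- u)); rewrite Rabs_Ropp in h0.
  unfold Rminus in h0; rewrite Ropp_involutive in h0.
  assert (h1 := Rle_abs (Rabs (x n) + - Rabs u)).
  rewrite <- (pow2_abs (x n + u)).
  specialize (Hx n).
  assert (hn : INR (S K) <= INR n) by now apply le_INR.
  rewrite S_INR in hn; nra.
- apply is_lim_seq_const.
- apply is_lim_seq_ext with (fun n => exp (PI * t * Rabs u) * exp (- (PI * t)) ^ n).
  + intros n; rewrite exp_pow, <- exp_plus; f_equal; ring.
  + replace (Finite 0) with (Rbar_mult (exp (PI * t * Rabs u)) 0) by (simpl; now rewrite Rmult_0_r).
    apply is_lim_seq_scal_l, is_lim_seq_geom.
    rewrite Rabs_pos_eq by (left; apply exp_pos).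
    rewrite <- exp_0; apply exp_increasing; nra.
Qed.

(** Both sides have period 1 in u: on the left, a unit shift changes a partial sum by two boundary
    terms that tend to 0. Induction on the number of shifts reaches every u from |u| <= 1/2. *)
Lemma poisson (t u : R) : 0 < t ->
  is_series (sym (gauss t u)) (/ sqrt t * dual_sum t u).
Proof.
intros Ht.
assert (Hcos : forall v, dual_sum t (v + 1) = dual_sum t v).
{ intros v; apply Series_ext; intros n; unfold dual_term; f_equal.
  replace (2 * PI * INR n * (v + 1)) with (2 * PI * INR n + 2 * PI * INR n * v) by ring.
  apply cos_2PI_nat. }
assert (Hg : forall v, sym (gauss t (v + 1)) = sym (fun x => gauss t v (x + 1)) ).
{ intros v; apply FunctionalExtensionality.functional_extensionality; intros [|n];
    unfold sym, gauss; repeat (f_equal; try ring). }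
assert (Hlim : forall v, is_lim_seq (fun N => gauss t v (- INR N)) 0 /\
   is_lim_seq (fun N => gauss t v (INR N + 1)) 0).
{ intros v; split; apply gauss_lim0; auto; intros n; assert (h := pos_INR n).
  - rewrite Rabs_Ropp, Rabs_pos_eq; lra.
  - rewrite Rabs_pos_eq; lra. }
assert (Hup : forall v s, is_series (sym (gauss t v)) s <-> is_series (sym (gauss t (v + 1))) s).
{ intros v s; rewrite Hg; destruct (Hlim v) as [L1 L2]; split; intros Hs.
  - assert (Hs' : is_lim_seq (sum_n (sym (gauss t v))) s) by exact Hs.
    change (is_lim_seq (sum_n (sym (fun x => gauss t v (x + 1)))) s).
    apply is_lim_seq_ext with (fun N => sum_n (sym (gauss t v)) N - gauss t v (- INR N) + gauss t v (INR N + 1)).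
    + intros N; now rewrite sym_shift.
    + replace s with (s - 0 + 0) by ring.
      apply is_lim_seq_plus'; [apply is_lim_seq_minus'|]; assumption.
  - assert (Hs' : is_lim_seq (sum_n (sym (fun x => gauss t v (x + 1)))) s) by exact Hs.
    change (is_lim_seq (sum_n (sym (gauss t v))) s).
    apply is_lim_seq_ext with (fun N => sum_n (sym (fun x => gauss t v (x + 1))) N + gauss t v (- INR N) - gauss t v (INR N + 1)).
    + intros N; rewrite sym_shift; change (sum_n (sym (gauss t v)) N) with (sum_n (sym (gauss t v)) N : R).
      generalize (sum_n (sym (gauss t v)) N : R); intros; ring.
    + replace s with (s + 0 - 0) by ring.
      apply is_lim_seq_minus'; [apply is_lim_seq_plus'|]; assumption. }
assert (Hn : forall n v, Rabs v <= / 2 + INR n -> is_series (sym (gauss t v)) (/ sqrt t * dual_sum t v)).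
{ induction n as [|n IH]; intros v Hv.
  - rewrite Rplus_0_r in Hv.
    destruct (exists_rate (t / PI)) as [m Hm].
    { apply Rdiv_lt_0_compat; [exact Ht| apply PI_RGT_0]. }
    destruct (polya_const_lim t m Ht Hm) as [_ HK].
    rewrite <- theta_const, <- (HK v Hv) by exact Ht.
    apply Series_correct, gauss_sum_ex; auto.
  - rewrite S_INR in Hv; assert (hn := pos_INR n).
    destruct (Rle_dec (Rabs v) (/ 2 + INR n)) as [H0|H0]; [now apply IH|].
    destruct (Rle_dec 0 v) as [Hv0|Hv0].
    + rewrite Rabs_pos_eq in Hv, H0 by exact Hv0.
      replace v with (v - 1 + 1) by ring; rewrite Hcos; apply (proj1 (Hup (v - 1) _)), IH.
      apply Rabs_le; lra.
    + rewrite Rabs_left in Hv, H0 by lra.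
      apply (proj2 (Hup v _)); rewrite <- Hcos; apply IH; apply Rabs_le; lra. }
destruct (nfloor_ex (Rabs u) (Rabs_pos u)) as [n Hnn].
apply (Hn (S n)); rewrite S_INR; lra.
Qed.

(** * The eta function *)

Definition chi12 (v : nat) : R :=
  match (v mod 12)%nat with 1%nat | 11%nat => 1 | 5%nat | 7%nat => -1 | _ => 0 end.

Definition eta_term (t : R) (v : nat) : R := exp (- (PI * t * INR v ^ 2 / 12)).

(** Dedekind's eta function at i t, defined by the theta series over the character [chi12] (Euler's
    pentagonal expansion) and not by the infinite product, so that its inversion law is a case of
    Poisson summation. *)
Definition eta (t : R) : R := Series (fun v => chi12 v * eta_term t v).

Lemma chi12_add (N k : nat) : chi12 (N * 12 + k) = chi12 k.
Proof. unfold chi12; rewrite Nat.add_comm, Nat.Div0.mod_add; reflexivity. Qed.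

Lemma chi12_bound (v : nat) : Rabs (chi12 v) <= 1.
Proof.
unfold chi12; destruct (v mod 12)%nat as [|[|[|[|[|[|[|[|[|[|[|[|n]]]]]]]]]]]];
  apply Rabs_le; lra.
Qed.

Lemma INR_le_sqr (v : nat) : INR v <= INR v ^ 2.
Proof.
destruct v as [|v]; [simpl; lra|]; rewrite S_INR; assert (hv := pos_INR v); nra.
Qed.

Lemma eta_term_bound (t : R) (v : nat) : 0 < t ->
  0 <= eta_term t v <= exp (- (PI * t / 12 * INR v)).
Proof.
intros Ht; unfold eta_term; split; [left; apply exp_pos|].
apply exp_le, Ropp_le_contravar.
replace (PI * t * INR v ^ 2 / 12) with (PI * t / 12 * INR v ^ 2) by field.
apply Rmult_le_compat_l; [|apply INR_le_sqr].
assert (HPI := PI_RGT_0); assert (0 < PI * t) by nra; lra.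
Qed.

Lemma eta_abs_ex (t : R) : 0 < t -> ex_series (fun v => Rabs (chi12 v * eta_term t v)).
Proof.
intros Ht; assert (HPI := PI_RGT_0).
apply (@ex_series_le R_AbsRing R_CompleteNormedModule) with (fun v => 1 * exp (- (PI * t / 12 * INR v))).
- intros v; change (norm (Rabs (chi12 v * eta_term t v))) with (Rabs (Rabs (chi12 v * eta_term t v))).
  rewrite Rabs_Rabsolu, Rabs_mult.
  destruct (eta_term_bound t v Ht) as [H0 H1].
  apply Rmult_le_compat; try apply Rabs_pos; [apply chi12_bound|].
  now rewrite Rabs_pos_eq.
- apply ex_series_exp; assert (0 < PI * t) by nra; lra.
Qed.

Lemma eta_ex (t : R) : 0 < t -> is_series (fun v => chi12 v * eta_term t v) (eta t).
Proof. intros Ht; apply Series_correct, ex_series_Rabs, eta_abs_ex, Ht. Qed.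

(** For |x| <= N the progressions 12x+1 and 12x+7 reach, in absolute value, every number prime to 6
    up to 12N+7 except 12N+5, which belongs to x = -(N+1); hence the correction. *)
Lemma eta_gauss_partial (t : R) (N : nat) :
  sum_n (sym (gauss (12 * t) (/ 12))) N - sum_n (sym (gauss (12 * t) (7 / 12))) N
  = sum_n (fun v => chi12 v * eta_term t v) (N * 12 + 7) + eta_term t (N * 12 + 5) :> R.
Proof.
assert (HE : forall (s : R) x v, Rabs (12 * x + s) = INR v -> gauss (12 * t) (s / 12) x = eta_term t v).
{ intros s x v H; unfold gauss, eta_term; rewrite <- H, pow2_abs; do 2 f_equal; field. }
assert (HE1 : forall x v, Rabs (12 * x + 1) = INR v -> gauss (12 * t) (/ 12) x = eta_term t v).
{ intros x v H; rewrite <- (HE 1 x v H); f_equal; field. }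
induction N as [|N IH].
- change (0 * 12 + 7)%nat with 7%nat; change (0 * 12 + 5)%nat with 5%nat.
  rewrite !sum_n_S, !sum_n_0; unfold sym.
  rewrite (HE1 0 1%nat), (HE 7 0 7%nat).
  + unfold chi12; simpl; ring.
  + replace (12 * 0 + 7) with 7 by ring; rewrite Rabs_pos_eq by lra; simpl; ring.
  + replace (12 * 0 + 1) with 1 by ring; rewrite Rabs_pos_eq by lra; simpl; ring.
- rewrite !(sum_n_S (sym _)).
  assert (hN := pos_INR N).
  unfold sym at 2 4.
  rewrite (HE1 (INR (S N)) (N * 12 + 13)%nat), (HE1 (- INR (S N)) (N * 12 + 11)%nat),
    (HE 7 (INR (S N)) (N * 12 + 19)%nat), (HE 7 (- INR (S N)) (N * 12 + 5)%nat).
  + replace (S N * 12 + 7)%nat with (N * 12 + 19)%nat by lia.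
    replace (S N * 12 + 5)%nat with (N * 12 + 17)%nat by lia.
    set (a := fun v => chi12 v * eta_term t v) in *.
    assert (HS : forall k, sum_n a (N * 12 + S k) = sum_n a (N * 12 + k) + a (N * 12 + S k)%nat :> R).
    { intros k; rewrite Nat.add_succ_r; apply sum_n_S. }
    rewrite (HS 18%nat), (HS 17%nat), (HS 16%nat), (HS 15%nat), (HS 14%nat), (HS 13%nat), (HS 12%nat), (HS 11%nat), (HS 10%nat), (HS 9%nat), (HS 8%nat), (HS 7%nat).
    unfold a at 2 3 4 5 6 7 8 9 10 11 12 13; rewrite !chi12_add.
    unfold chi12; cbn [Nat.modulo Nat.divmod fst snd Nat.sub].
    revert IH.
    generalize (sum_n (sym (gauss (12 * t) (/ 12))) N : R), (sum_n (sym (gauss (12 * t) (7 / 12))) N : R),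
      (sum_n a (N * 12 + 7) : R); intros x y z IH.
    simpl; lra.
  + rewrite S_INR, Rabs_left by lra; rewrite plus_INR, mult_INR; simpl; ring.
  + rewrite S_INR, Rabs_pos_eq by lra; rewrite plus_INR, mult_INR; simpl; ring.
  + rewrite S_INR, Rabs_left by lra; rewrite plus_INR, mult_INR; simpl; ring.
  + rewrite S_INR, Rabs_pos_eq by lra; rewrite plus_INR, mult_INR; simpl; ring.
Qed.

Lemma is_lim_seq_sub (u : nat -> R) (l : R) (f : nat -> nat) :
  (forall n, (n <= f n)%nat) -> is_lim_seq u l -> is_lim_seq (fun n => u (f n)) l.
Proof.
intros Hf Hu; apply is_lim_seq_spec in Hu; apply is_lim_seq_spec; intros eps.
destruct (Hu eps) as [N HN]; exists N; intros n Hn; apply HN; specialize (Hf n); lia.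
Qed.

Lemma eta_gauss (t : R) : 0 < t ->
  eta t = gauss_sum (12 * t) (/ 12) - gauss_sum (12 * t) (7 / 12).
Proof.
intros Ht.
assert (H12 : 0 < 12 * t) by lra.
assert (Hs : forall u, is_lim_seq (sum_n (sym (gauss (12 * t) u))) (gauss_sum (12 * t) u)).
{ intros u; apply Series_correct; exists (/ sqrt (12 * t) * dual_sum (12 * t) u); now apply poisson. }
assert (L1 := is_lim_seq_minus' _ _ _ _ (Hs (/ 12)) (Hs (7 / 12))).
assert (He : is_lim_seq (sum_n (fun v => chi12 v * eta_term t v)) (eta t)) by exact (eta_ex t Ht).
assert (Hz : is_lim_seq (eta_term t) 0).
{ assert (HPI := PI_RGT_0).
  apply (is_lim_seq_le_le (fun _ => 0) _ (fun v => exp (- (PI * t / 12 * INR v)))).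
  - intros v; now apply eta_term_bound.
  - apply is_lim_seq_const.
  - apply is_lim_seq_ext with (fun v => exp (- (PI * t / 12)) ^ v).
    + intros v; rewrite exp_pow; f_equal; ring.
    + apply is_lim_seq_geom; rewrite Rabs_pos_eq by (left; apply exp_pos).
      rewrite <- exp_0; apply exp_increasing; assert (0 < PI * t) by nra; lra. }
assert (L2 : is_lim_seq (fun N => sum_n (sym (gauss (12 * t) (/ 12))) N - sum_n (sym (gauss (12 * t) (7 / 12))) N) (eta t + 0)).
{ apply is_lim_seq_ext with (fun N => sum_n (fun v => chi12 v * eta_term t v) (N * 12 + 7) + eta_term t (N * 12 + 5)).
  - intros N; now rewrite eta_gauss_partial.
  - apply is_lim_seq_plus'.
    + apply (is_lim_seq_sub (sum_n (fun v => chi12 v * eta_term t v)) (eta t) (fun N => N * 12 + 7)%nat); [intros; lia| exact He].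
    + apply (is_lim_seq_sub (eta_term t) 0 (fun N => N * 12 + 5)%nat); [intros; lia| exact Hz]. }
apply is_lim_seq_unique in L1; apply is_lim_seq_unique in L2.
rewrite L1 in L2; injection L2; intros; lra.
Qed.

(** [chi12] is its own Fourier transform up to its Gauss sum sqrt 12 = 2 sqrt 3. *)
Lemma eta_dual_coef (v : nat) :
  ew v * (cos (2 * PI * INR v * / 12) - cos (2 * PI * INR v * (7 / 12))) = 2 * sqrt 3 * chi12 v.
Proof.
assert (Hodd : cos (2 * PI * INR v * (7 / 12)) = cos (2 * PI * INR v * / 12 + INR v * PI)).
{ f_equal; field. }
rewrite Hodd, cos_plus, sin_PI_nat, Rmult_0_r, Rminus_0_r.
rewrite (Nat.div_mod_eq v 12) at 2 3 4.
set (q := (v / 12)%nat); set (r := (v mod 12)%nat).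
rewrite plus_INR, mult_INR.
replace (2 * PI * (INR 12 * INR q + INR r) * / 12) with (2 * PI * INR q + INR r * (PI / 6))
  by (simpl; field).
rewrite cos_2PI_nat.
assert (Hc : cos ((INR 12 * INR q + INR r) * PI) = cos (INR r * PI)).
{ replace ((INR 12 * INR q + INR r) * PI) with (2 * PI * INR (6 * q) + INR r * PI)
    by (rewrite mult_INR; simpl; ring). apply cos_2PI_nat. }
rewrite Hc.
assert (Hr : (r < 12)%nat) by (apply Nat.mod_upper_bound; lia).
assert (Hv : chi12 v = chi12 r).
{ unfold chi12, r; now rewrite Nat.Div0.mod_mod. }
rewrite Hv.
assert (Hew : r <> 0%nat -> ew v = 2).
{ unfold r; destruct v; [now intros []|reflexivity]. }
assert (HcS : forall n, cos (INR (S n) * PI) = - cos (INR n * PI)).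
{ intros n; rewrite S_INR, Rmult_plus_distr_r, Rmult_1_l; apply neg_cos. }
assert (H0 : cos (INR 0 * PI) = 1) by (simpl; rewrite Rmult_0_l; apply cos_0).
clearbody r q; clear Hv Hc Hodd.
destruct r as [|[|[|[|[|[|[|[|[|[|[|[|r]]]]]]]]]]]]; try lia; rewrite ?HcS, H0; unfold chi12;
  cbn [Nat.modulo Nat.divmod fst snd Nat.sub]; try ring; rewrite Hew by discriminate.
- replace (INR 1 * (PI / 6)) with (PI / 6) by (simpl; ring). rewrite cos_PI6; field.
- replace (INR 3 * (PI / 6)) with (PI / 2) by (simpl; field). rewrite cos_PI2; ring.
- replace (INR 5 * (PI / 6)) with (PI - PI / 6) by (simpl; field).
  rewrite cos_minus, cos_PI, sin_PI, cos_PI6; field.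
- replace (INR 7 * (PI / 6)) with (PI / 6 + PI) by (simpl; field). rewrite neg_cos, cos_PI6; field.
- replace (INR 9 * (PI / 6)) with (PI / 2 + PI) by (simpl; field). rewrite neg_cos, cos_PI2; ring.
- replace (INR 11 * (PI / 6)) with (- (PI / 6) + 2 * INR 1 * PI) by (simpl; field).
  rewrite cos_period, cos_neg, cos_PI6; field.
Qed.

Lemma eta_inv (t : R) : 0 < t -> eta t = / sqrt t * eta (/ t).
Proof.
intros Ht.
assert (H12 : 0 < 12 * t) by lra.
rewrite eta_gauss by exact Ht.
unfold gauss_sum; rewrite !(is_series_unique _ _ (poisson (12 * t) _ H12)).
rewrite <- Rmult_minus_distr_l.
unfold dual_sum; rewrite <- Series_minus by now apply dual_sum_ex.
assert (Hti : 0 < / t) by now apply Rinv_0_lt_compat.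
rewrite (Series_ext _ (fun v => 2 * sqrt 3 * (chi12 v * eta_term (/ t) v))).
- rewrite Series_scal_l; fold (eta (/ t)).
  rewrite <- Rmult_assoc; f_equal.
  replace (12 * t) with (2 * 2 * 3 * t) by ring.
  rewrite !sqrt_mult by lra.
  rewrite <- (sqrt_mult 2 2), sqrt_square by lra.
  assert (0 < sqrt t) by now apply sqrt_lt_R0.
  assert (0 < sqrt 3) by (apply sqrt_lt_R0; lra).
  field; lra.
- intros v; unfold dual_term.
  transitivity (exp (- (PI * INR v ^ 2 / (12 * t))) *
    (ew v * (cos (2 * PI * INR v * / 12) - cos (2 * PI * INR v * (7 / 12))))); [ring|].
  rewrite eta_dual_coef; unfold eta_term.
  replace (PI * / t * INR v ^ 2 / 12) with (PI * INR v ^ 2 / (12 * t)) by (field; lra).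
  ring.
Qed.

(** * Series in the nome *)

Lemma is_series_single (k : nat) (c : R) :
  is_series (fun n => if Nat.eqb n k then c else 0) c.
Proof.
change (is_lim_seq (sum_n (fun n => if Nat.eqb n k then c else 0)) c).
apply is_lim_seq_ext_loc with (fun _ => c); [|apply is_lim_seq_const].
exists k; intros n Hn.
assert (H : forall m, sum_n (fun n => if Nat.eqb n k then c else 0) m = if Nat.leb k m then c else 0 :> R).
{ induction m as [|m IH].
  - rewrite sum_n_0; destruct k; reflexivity.
  - rewrite sum_n_S, IH.
    destruct (Nat.leb_spec k m); destruct (Nat.leb_spec k (S m)); destruct (Nat.eqb_spec (S m) k);
      try lia; first [apply Rplus_0_r|apply Rplus_0_l]. }
rewrite H; destruct (Nat.leb_spec k n); [reflexivity|lia].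
Qed.

Lemma is_series_zero : is_series (fun _ : nat => 0) 0.
Proof.
apply is_series_ext with (2 := is_series_single 0 0); intros n; now destruct (Nat.eqb n 0).
Qed.

(** The coefficients of Euler's product of the 1 - q^n: the exponents are (v^2 - 1)/24 for v prime
    to 6. *)
Definition phi (n : nat) : R :=
  let v := Nat.sqrt (24 * n + 1) in
  if Nat.eqb (v * v) (24 * n + 1) then chi12 v else 0.

Definition qexp (t : R) : R := exp (- (2 * PI * t)).

Lemma qexp_pow (t : R) (n : nat) : qexp t ^ n = exp (- (2 * PI * t * INR n)).
Proof. unfold qexp; rewrite exp_pow; f_equal; ring. Qed.

Lemma qexp_pos (t : R) : 0 < qexp t.
Proof. apply exp_pos. Qed.

Lemma chi12_sqr (v : nat) : chi12 v <> 0 -> exists n, (v * v = 24 * n + 1)%nat.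
Proof.
intros H.
assert (Hv := Nat.div_mod_eq v 12); unfold chi12 in H.
set (q := (v / 12)%nat) in *; set (r := (v mod 12)%nat) in *; clearbody q r.
destruct r as [|[|[|[|[|[|[|[|[|[|[|[|n]]]]]]]]]]]]; try (exfalso; apply H; reflexivity); subst v.
- exists (6 * q * q + q)%nat; lia.
- exists (6 * q * q + 5 * q + 1)%nat; lia.
- exists (6 * q * q + 7 * q + 2)%nat; lia.
- exists (6 * q * q + 11 * q + 5)%nat; lia.
Qed.

(** Each v contributes to a single exponent, so the array over v and n has one nonzero entry per
    contributing row, and Fubini regroups the series by exponents. *)
Lemma eta_q (t : R) : 0 < t -> is_pseries phi (qexp t) (exp (PI * t / 12) * eta t).
Proof.
intros Ht.
set (a := fun v n => if Nat.eqb (v * v) (24 * n + 1) then chi12 v * (exp (PI * t / 12) * eta_term t v) else 0).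
assert (Hrow : forall (b : nat -> R) v, (chi12 v = 0 -> b v = 0) ->
   is_series (fun n => if Nat.eqb (v * v) (24 * n + 1) then b v else 0) (b v)).
{ intros b v Hb; destruct (Req_dec (chi12 v) 0) as [H0|H0].
  - rewrite Hb by exact H0; apply is_series_ext with (2 := is_series_zero).
    intros n; now destruct (Nat.eqb (v * v) (24 * n + 1)).
  - destruct (chi12_sqr v H0) as [k Hk].
    apply is_series_ext with (2 := is_series_single k (b v)); intros n.
    destruct (Nat.eqb_spec n k); destruct (Nat.eqb_spec (v * v) (24 * n + 1)); try reflexivity; lia. }
assert (Ha : forall v, is_series (a v) (chi12 v * (exp (PI * t / 12) * eta_term t v))).
{ intros v; apply (Hrow (fun v => chi12 v * (exp (PI * t / 12) * eta_term t v))).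
  intros ->; ring. }
assert (Haa : forall v, is_series (fun n => Rabs (a v n)) (Rabs (chi12 v * (exp (PI * t / 12) * eta_term t v)))).
{ intros v; apply is_series_ext with (fun n => if Nat.eqb (v * v) (24 * n + 1)
     then Rabs (chi12 v * (exp (PI * t / 12) * eta_term t v)) else 0).
  - intros n; unfold a; destruct (Nat.eqb (v * v) _); [reflexivity| now rewrite Rabs_R0].
  - apply (Hrow (fun v => Rabs (chi12 v * (exp (PI * t / 12) * eta_term t v)))).
    intros ->; rewrite Rmult_0_l; apply Rabs_R0. }
destruct (fubini a) as [_ HF].
- intros v; eexists; apply Haa.
- apply ex_series_ext with (fun v => Rabs (exp (PI * t / 12)) * Rabs (chi12 v * eta_term t v)).
  + intros v; rewrite (is_series_unique _ _ (Haa v)), <- Rabs_mult; f_equal; ring.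
  + exact (ex_series_scal_l (Rabs (exp (PI * t / 12))) _ (eta_abs_ex t Ht)).
- replace (exp (PI * t / 12) * eta t) with (Series (fun v => Series (a v))).
  2:{ unfold eta; rewrite <- Series_scal_l; apply Series_ext; intros v.
      rewrite (is_series_unique _ _ (Ha v)); ring. }
  apply is_series_ext with (2 := HF); intros n.
  rewrite pow_n_pow.
  change (scal (qexp t ^ n) (phi n)) with (qexp t ^ n * phi n).
  apply is_series_unique.
  assert (HE : forall v, (v * v = 24 * n + 1)%nat ->
     exp (PI * t / 12) * eta_term t v = qexp t ^ n).
  { intros v Hv; rewrite qexp_pow; unfold eta_term; rewrite <- exp_plus; f_equal.
    replace (INR v ^ 2) with (INR (v * v)) by (rewrite mult_INR; ring).
    rewrite Hv, plus_INR, mult_INR; simpl; field. }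
  unfold phi; set (v0 := Nat.sqrt (24 * n + 1)).
  assert (Hs : forall v, (v * v = 24 * n + 1)%nat -> v = v0).
  { intros v Hv; unfold v0; rewrite <- Hv; symmetry; apply Nat.sqrt_square. }
  destruct (Nat.eqb_spec (v0 * v0) (24 * n + 1)) as [H0|H0].
  + apply is_series_ext with (2 := is_series_single v0 (qexp t ^ n * chi12 v0)); intros v.
    unfold a; destruct (Nat.eqb_spec v v0) as [Hv|Hne];
      destruct (Nat.eqb_spec (v * v) (24 * n + 1)) as [H1|H1]; try reflexivity.
    * rewrite HE by exact H1; rewrite Hv; apply Rmult_comm.
    * exfalso; apply H1; now rewrite Hv.
    * exfalso; apply Hne, Hs, H1.
  + rewrite Rmult_0_r.
    apply is_series_ext with (2 := is_series_zero); intros v; unfold a.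
    destruct (Nat.eqb_spec (v * v) (24 * n + 1)) as [H1|H1]; [|reflexivity].
    exfalso; apply H0; now rewrite <- (Hs v H1).
Qed.

(** * Power series of radius at least 1/4 *)

(** The radius 1/4 comes from the bound 4^n on the coefficients of 1/[phi]. It is enough for the
    nomes with t > 1/2 and for the majorant exp (-2 PI rho) met at the corner. *)
Definition conv4 (a : nat -> R) : Prop := Rbar_le (/ 4) (CV_radius a).

Lemma conv4_ex (a : nat -> R) : (forall x, 0 < x < / 4 -> ex_pseries a x) -> conv4 a.
Proof.
intros H; unfold conv4.
destruct (Rbar_le_dec (/ 4) (CV_radius a)) as [Hle|Hnle]; [exact Hle|exfalso].
apply Rbar_not_le_lt in Hnle.
assert (H0 := CV_radius_ge_0 a).
destruct (CV_radius a) as [r| |] eqn:E; try contradiction; simpl in *.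
set (x := (r + / 4) / 2).
apply (CV_disk_outside a x).
- rewrite E; simpl; rewrite Rabs_pos_eq; unfold x; lra.
- assert (Hx := H x ltac:(unfold x; lra)).
  apply ex_series_lim_0 in Hx.
  apply is_lim_seq_ext with (2 := Hx); intros n.
  rewrite pow_n_pow; apply Rmult_comm.
Qed.

Lemma conv4_lt (a : nat -> R) (x : R) : conv4 a -> Rabs x < / 4 -> Rbar_lt (Rabs x) (CV_radius a).
Proof. intros Ha Hx; exact (Rbar_lt_le_trans (Rabs x) (/ 4) (CV_radius a) Hx Ha). Qed.

Lemma conv4_lt_pos (a : nat -> R) (x : R) : conv4 a -> 0 < x < / 4 -> Rbar_lt (Rabs x) (CV_radius a).
Proof. intros Ha Hx; apply conv4_lt; auto; rewrite Rabs_pos_eq; lra. Qed.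

Lemma conv4_plus (a b : nat -> R) : conv4 a -> conv4 b -> conv4 (PS_plus a b).
Proof.
intros Ha Hb; apply conv4_ex; intros x Hx.
apply (@ex_pseries_plus R_AbsRing R_NormedModule); apply CV_radius_inside; now apply conv4_lt_pos.
Qed.

Lemma conv4_scal (c : R) (a : nat -> R) : conv4 a -> conv4 (PS_scal c a).
Proof.
intros Ha; apply conv4_ex; intros x Hx.
apply (@ex_pseries_scal R_AbsRing R_NormedModule); [apply Rmult_comm|].
apply CV_radius_inside; now apply conv4_lt_pos.
Qed.

Lemma conv4_mult (a b : nat -> R) : conv4 a -> conv4 b -> conv4 (PS_mult a b).
Proof.
intros Ha Hb; apply conv4_ex; intros x Hx.
apply ex_pseries_mult; now apply conv4_lt_pos.
Qed.

Definition xD (a : nat -> R) (n : nat) : R := INR n * a n.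

Lemma PSeries_xD (a : nat -> R) (x : R) : PSeries (xD a) x = x * PSeries (PS_derive a) x.
Proof.
rewrite <- PSeries_incr_1; apply PSeries_ext; intros [|n]; unfold xD, PS_incr_1, PS_derive.
- apply Rmult_0_l.
- reflexivity.
Qed.

Lemma conv4_xD (a : nat -> R) : conv4 a -> conv4 (xD a).
Proof.
intros Ha; apply conv4_ex; intros x Hx.
apply (ex_pseries_ext (PS_incr_1 (PS_derive a))).
- intros [|n]; unfold xD, PS_incr_1, PS_derive; [symmetry; apply Rmult_0_l| reflexivity].
- apply ex_pseries_incr_1, CV_radius_inside; rewrite CV_radius_derive; now apply conv4_lt_pos.
Qed.

Lemma conv4_bound (a : nat -> R) : (forall n, Rabs (a n) <= 4 ^ n) -> conv4 a.
Proof.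
intros H; apply conv4_ex; intros x Hx.
apply ex_series_Rabs.
apply (@ex_series_le R_AbsRing R_CompleteNormedModule) with (fun n => (4 * x) ^ n).
- intros n.
  change (Rabs (Rabs (pow_n x n * a n)) <= (4 * x) ^ n).
  rewrite Rabs_Rabsolu, Rabs_mult, pow_n_pow, Rpow_mult_distr, Rmult_comm.
  rewrite (Rabs_pos_eq (x ^ n)) by (apply pow_le; lra).
  apply Rmult_le_compat_r; [apply pow_le; lra| apply H].
- exists (/ (1 - 4 * x)); apply is_series_geom; rewrite Rabs_pos_eq; lra.
Qed.

Definition hat (a : nat -> R) (t : R) : R := PSeries a (qexp t).

(* At [t > 1/2] the nome is [< exp(-PI) < 1/4]. *)
Lemma qexp_small (t : R) : / 2 < t -> 0 < qexp t < / 4.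
Proof.
intros Ht; split; [apply qexp_pos|].
assert (HPI : 3 < PI) by (assert (h := PI2_3_2); lra).
unfold qexp; rewrite exp_Ropp.
apply Rinv_lt_contravar.
- apply Rmult_lt_0_compat; [lra| apply exp_pos].
- assert (h := exp_ineq1 (2 * PI * t) ltac:(nra)); nra.
Qed.

Lemma hat_plus (a b : nat -> R) (t : R) : conv4 a -> conv4 b -> / 2 < t ->
  hat (PS_plus a b) t = hat a t + hat b t.
Proof.
intros Ha Hb Ht; apply PSeries_plus; apply CV_radius_inside; apply conv4_lt_pos; auto;
  now apply qexp_small.
Qed.

Lemma hat_scal (c : R) (a : nat -> R) (t : R) : hat (PS_scal c a) t = c * hat a t.
Proof. apply PSeries_scal. Qed.

Lemma hat_mult (a b : nat -> R) (t : R) : conv4 a -> conv4 b -> / 2 < t ->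
  hat (PS_mult a b) t = hat a t * hat b t.
Proof.
intros Ha Hb Ht; apply PSeries_mult; apply conv4_lt_pos; auto; now apply qexp_small.
Qed.

Lemma is_derive_hat (a : nat -> R) (t : R) : conv4 a -> / 2 < t ->
  is_derive (hat a) t (- (2 * PI) * hat (xD a) t).
Proof.
intros Ha Ht.
unfold hat; rewrite PSeries_xD.
replace (- (2 * PI) * (qexp t * PSeries (PS_derive a) (qexp t)))
  with (scal (- (2 * PI) * qexp t) (PSeries (PS_derive a) (qexp t)))
  by (unfold scal; simpl; unfold mult; simpl; ring).
apply (is_derive_comp (PSeries a) qexp).
- apply is_derive_PSeries, conv4_lt_pos; auto; now apply qexp_small.
- unfold qexp; auto_derive; [auto|ring].
Qed.

(** * Eisenstein series *)

(** All coefficients so far, newest first: the recurrence for an inverse series refers to every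
    earlier coefficient. *)
Fixpoint psi_list (n : nat) : list R :=
  match n with
  | O => cons 1 nil
  | S n => cons (- sum_n (fun k => phi (S k) * nth k (psi_list n) 0) n) (psi_list n)
  end.

(* The coefficients of [1 / phi]. *)
Definition psi (n : nat) : R := hd 0 (psi_list n).

Definition PS_one (n : nat) : R := match n with O => 1 | S _ => 0 end.

Lemma nth_psi_list (n k : nat) : (k <= n)%nat -> nth k (psi_list n) 0 = psi (n - k).
Proof.
revert k; induction n as [|n IH]; intros [|k] Hk; try lia; try reflexivity.
simpl; now rewrite IH by lia.
Qed.

Lemma psi_S (n : nat) : psi (S n) = - sum_n (fun k => phi (S k) * psi (n - k)) n.
Proof.
unfold psi at 1; simpl; f_equal; apply sum_n_eq; intros k Hk; now rewrite nth_psi_list.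
Qed.

Lemma phi_0 : phi 0 = 1.
Proof. reflexivity. Qed.

Lemma phi_bound (n : nat) : Rabs (phi n) <= 1.
Proof.
unfold phi; destruct (Nat.eqb _ _); [apply chi12_bound| rewrite Rabs_R0; lra].
Qed.

Lemma sum_n_f_R0 (a : nat -> R) (n : nat) : sum_n a n = sum_f_R0 a n :> R.
Proof.
induction n as [|n IH]; [rewrite sum_n_0; reflexivity|]; rewrite sum_n_S, IH; reflexivity.
Qed.

Lemma PS_mult_phi_psi (n : nat) : PS_mult phi psi n = PS_one n.
Proof.
unfold PS_mult; rewrite <- sum_n_f_R0; destruct n as [|n].
- rewrite sum_n_0, phi_0; unfold psi; simpl; ring.
- rewrite sum_n_shift1, phi_0, Nat.sub_0_r, psi_S.
  replace (sum_n (fun k => phi (S k) * psi (S n - S k)) n : R)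
    with (sum_n (fun k => phi (S k) * psi (n - k)) n : R) by reflexivity.
  simpl; ring.
Qed.

(** With |phi| <= 1 the recurrence bounds the next coefficient by 1 + 4 + ... + 4^n, which is less
    than 4^(n+1)/3. *)
Lemma psi_bound (n : nat) : Rabs (psi n) <= 4 ^ n.
Proof.
induction n as [n IH] using lt_wf_ind.
destruct n as [|n]; [unfold psi; simpl; rewrite Rabs_R1; lra|].
rewrite psi_S, Rabs_Ropp.
assert (H : forall m, (m <= n)%nat ->
   Rabs (sum_n (fun k => phi (S k) * psi (n - k)) m) <= (4 ^ (S n) - 4 ^ (n - m)) / 3).
{ induction m as [|m IHm]; intros Hm.
  - rewrite sum_n_0, Nat.sub_0_r, Rabs_mult.
    apply Rle_trans with (1 * 4 ^ n); [|simpl; assert (0 < 4 ^ n) by (apply pow_lt; lra); lra].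
    apply Rmult_le_compat; try apply Rabs_pos; [apply phi_bound| apply IH; lia].
  - rewrite sum_n_S; apply Rle_trans with (1 := Rabs_triang _ _).
    assert (H1 := IHm ltac:(lia)).
    assert (H2 : Rabs (phi (S (S m)) * psi (n - S m)) <= 1 * 4 ^ (n - S m)).
    { rewrite Rabs_mult; apply Rmult_le_compat; try apply Rabs_pos; [apply phi_bound| apply IH; lia]. }
    replace (n - m)%nat with (S (n - S m)) in H1 by lia.
    change (4 ^ S (n - S m)) with (4 * 4 ^ (n - S m)) in H1; lra. }
apply Rle_trans with (1 := H n (le_n _)).
assert (0 < 4 ^ (n - n)) by (apply pow_lt; lra).
assert (0 < 4 ^ S n) by (apply pow_lt; lra); lra.
Qed.

Lemma conv4_phi : conv4 phi.
Proof.
apply conv4_bound; intros n; apply Rle_trans with (1 := phi_bound n), pow_R1_Rle; lra.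
Qed.

Lemma conv4_psi : conv4 psi.
Proof. apply conv4_bound, psi_bound. Qed.

Lemma conv4_one : conv4 PS_one.
Proof.
apply conv4_bound; intros [|n]; simpl; [rewrite Rabs_R1; lra|].
rewrite Rabs_R0; assert (0 < 4 ^ n) by (apply pow_lt; lra); lra.
Qed.

Lemma hat_one (t : R) : hat PS_one t = 1.
Proof.
unfold hat, PSeries; apply is_series_unique.
apply is_series_ext with (2 := is_series_single 0 1); intros [|n]; unfold PS_one; simpl; ring.
Qed.

Lemma hat_phi_psi (t : R) : / 2 < t -> hat phi t * hat psi t = 1.
Proof.
intros Ht; rewrite <- hat_mult by (auto using conv4_phi, conv4_psi).
rewrite <- (hat_one t); apply PSeries_ext, PS_mult_phi_psi.
Qed.

(** E2 is 24 times the logarithmic derivative of [eta] in the nome. E4 and E6 are read off from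
    Ramanujan's differential equations, so that their inversion laws follow from that of [eta] by
    differentiation. *)
Definition E2s : nat -> R := PS_plus PS_one (PS_scal 24 (PS_mult (xD phi) psi)).
Definition E4s : nat -> R := PS_plus (PS_mult E2s E2s) (PS_scal (-12) (xD E2s)).
Definition E6s : nat -> R := PS_plus (PS_mult E2s E4s) (PS_scal (-3) (xD E4s)).

Lemma conv4_E2 : conv4 E2s.
Proof.
apply conv4_plus; [apply conv4_one|]; apply conv4_scal, conv4_mult;
  [apply conv4_xD, conv4_phi| apply conv4_psi].
Qed.

Lemma conv4_E4 : conv4 E4s.
Proof.
apply conv4_plus; [apply conv4_mult; apply conv4_E2|]; apply conv4_scal, conv4_xD, conv4_E2.
Qed.

Lemma conv4_E6 : conv4 E6s.
Proof.
apply conv4_plus; [apply conv4_mult; [apply conv4_E2| apply conv4_E4]|].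
apply conv4_scal, conv4_xD, conv4_E4.
Qed.

Lemma eta_hat (t : R) : 0 < t -> eta t = exp (- (PI * t / 12)) * hat phi t.
Proof.
intros Ht; unfold hat; rewrite (is_pseries_unique _ _ _ (eta_q t Ht)).
rewrite <- Rmult_assoc, <- exp_plus.
replace (- (PI * t / 12) + PI * t / 12) with 0 by ring; rewrite exp_0; ring.
Qed.

Lemma hat_E2 (t : R) : / 2 < t -> hat E2s t = 1 + 24 * hat (xD phi) t * hat psi t.
Proof.
intros Ht; unfold E2s.
assert (H1 := conv4_one); assert (H2 := conv4_xD _ conv4_phi); assert (H3 := conv4_psi).
assert (H4 := conv4_mult _ _ H2 H3); assert (H5 := conv4_scal 24 _ H4).
rewrite hat_plus, hat_one, hat_scal, hat_mult by auto; ring.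
Qed.

Lemma hat_E4 (t : R) : / 2 < t -> hat E4s t = hat E2s t * hat E2s t - 12 * hat (xD E2s) t.
Proof.
intros Ht; unfold E4s.
assert (H1 := conv4_E2); assert (H2 := conv4_xD _ conv4_E2).
assert (H4 := conv4_mult _ _ H1 H1); assert (H5 := conv4_scal (-12) _ H2).
rewrite hat_plus, hat_scal, hat_mult by auto; ring.
Qed.

Lemma hat_E6 (t : R) : / 2 < t -> hat E6s t = hat E2s t * hat E4s t - 3 * hat (xD E4s) t.
Proof.
intros Ht; unfold E6s.
assert (H1 := conv4_E2); assert (H2 := conv4_E4); assert (H3 := conv4_xD _ conv4_E4).
assert (H4 := conv4_mult _ _ H1 H2); assert (H5 := conv4_scal (-3) _ H3).
rewrite hat_plus, hat_scal, hat_mult by auto; ring.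
Qed.

Lemma is_derive_eta (t : R) : / 2 < t ->
  is_derive eta t (- (PI / 12) * hat E2s t * eta t).
Proof.
intros Ht.
assert (Hp := hat_phi_psi t Ht).
apply is_derive_ext_loc with (fun t => exp (- (PI * t / 12)) * hat phi t).
- exists (mkposreal (t - / 2) ltac:(lra)); intros y Hy.
  assert (Hy' : Rabs (y - t) < t - / 2) by exact Hy.
  apply Rabs_def2 in Hy'; symmetry; apply eta_hat; lra.
- rewrite eta_hat by lra.
  assert (Hd := is_derive_hat phi t conv4_phi Ht).
  assert (He : is_derive (fun t => exp (- (PI * t / 12))) t (- (PI / 12) * exp (- (PI * t / 12)))).
  { auto_derive; [auto|]. unfold Rdiv; ring. }
  assert (Hm := is_derive_mult _ _ _ _ _ He Hd Rmult_comm).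
  replace (- (PI / 12) * hat E2s t * (exp (- (PI * t / 12)) * hat phi t)) with
    (plus (mult (- (PI / 12) * exp (- (PI * t / 12))) (hat phi t))
      (mult (exp (- (PI * t / 12))) (- (2 * PI) * hat (xD phi) t))); [exact Hm|].
  change ((- (PI / 12) * exp (- (PI * t / 12))) * (hat phi t) +
      (exp (- (PI * t / 12))) * (- (2 * PI) * hat (xD phi) t) =
    - (PI / 12) * hat E2s t * (exp (- (PI * t / 12)) * hat phi t)).
  rewrite hat_E2 by exact Ht.
  replace (- (PI / 12) * (1 + 24 * hat (xD phi) t * hat psi t) * (exp (- (PI * t / 12)) * hat phi t))
   with (- (PI / 12) * exp (- (PI * t / 12)) * (hat phi t + 24 * hat (xD phi) t * (hat phi t * hat psi t))) by ring.
  rewrite Hp; field.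
Qed.

(** An interval stable under t -> 1/t on which both nomes are below 1/4, so that all series may be
    evaluated and differentiated at t and at 1/t. *)
Definition near1 (t : R) : Prop := / 2 < t < 2.

Lemma near1_inv (t : R) : near1 t -> near1 (/ t).
Proof.
intros [H1 H2]; split.
- apply Rinv_lt_contravar; lra.
- rewrite <- (Rinv_inv 2); apply Rinv_lt_contravar; [|lra].
  apply Rmult_lt_0_compat; lra.
Qed.

Lemma near1_locally (t : R) (P : R -> Prop) : near1 t -> (forall y, near1 y -> P y) -> locally t P.
Proof.
intros [H1 H2] HP.
assert (Hd : 0 < Rmin (t - / 2) (2 - t)) by (apply Rmin_case; lra).
exists (mkposreal _ Hd); intros y Hy; apply HP.
assert (Hy' : Rabs (y - t) < Rmin (t - / 2) (2 - t)) by exact Hy.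
assert (h1 := Rmin_l (t - / 2) (2 - t)); assert (h2 := Rmin_r (t - / 2) (2 - t)).
apply Rabs_def2 in Hy'; split; lra.
Qed.

Lemma is_derive_inv_comp (f : R -> R) (t l : R) : t <> 0 ->
  is_derive f (/ t) l -> is_derive (fun t => f (/ t)) t (- l / t ^ 2).
Proof.
intros Ht Hf.
replace (- l / t ^ 2) with (scal (- / t ^ 2) l) by (unfold scal; simpl; unfold mult; simpl; field; exact Ht).
apply (is_derive_comp f Rinv); [exact Hf|].
auto_derive; [exact Ht| field; exact Ht].
Qed.

(** The logarithmic derivative of [eta_inv]; the factor 1/sqrt t is the source of the anomalous term
    6 t / PI. *)
Lemma E2_inv (t : R) : near1 t -> hat E2s (/ t) = - t ^ 2 * hat E2s t + 6 * t / PI.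
Proof.
intros Ht; assert (Hi := near1_inv t Ht).
assert (H1 : / 2 < t) by apply Ht; assert (H2 : / 2 < / t) by apply Hi.
assert (HPI := PI_RGT_0).
assert (Hs : 0 < sqrt t) by (apply sqrt_lt_R0; lra).
assert (Hss : sqrt t * sqrt t = t) by (apply sqrt_sqrt; lra).
assert (D1 := is_derive_eta t H1).
assert (D2 := is_derive_inv_comp eta t _ ltac:(lra) (is_derive_eta (/ t) H2)).
assert (D3 : is_derive (fun t => / sqrt t) t (- / (2 * t * sqrt t))).
{ auto_derive; [split; [lra|split; [lra|auto]]|]. field_simplify; try lra.
  replace (sqrt t ^ 3) with (t * sqrt t) by (rewrite <- Hss at 1; ring). field; lra. }
assert (D4 := is_derive_mult _ _ _ _ _ D3 D2 Rmult_comm).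
assert (D5 : is_derive eta t (plus (mult (- / (2 * t * sqrt t)) (eta (/ t)))
   (mult (/ sqrt t) (- (- (PI / 12) * hat E2s (/ t) * eta (/ t)) / t ^ 2)))).
{ apply is_derive_ext_loc with (2 := D4).
  apply near1_locally; [exact Ht|]; intros y Hy; symmetry; apply eta_inv; destruct Hy; lra. }
apply is_derive_unique in D1; apply is_derive_unique in D5; rewrite D1 in D5.
unfold plus, mult in D5; simpl in D5.
assert (Hinv : eta (/ t) = sqrt t * eta t).
{ rewrite (eta_inv t) by lra; field; lra. }
rewrite Hinv in D5.
assert (Hne : eta t <> 0).
{ rewrite eta_hat by lra; apply Rmult_integral_contrapositive; split.
  - apply Rgt_not_eq, exp_pos.
  - intros H0; assert (h := hat_phi_psi t H1); rewrite H0 in h; lra. }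
assert (D6 : - (PI / 12) * hat E2s t = - / (2 * t) + (PI / 12) * hat E2s (/ t) / t ^ 2).
{ apply (Rmult_eq_reg_r (eta t)); [|exact Hne]; rewrite D5; field; lra. }
replace (hat E2s (/ t)) with ((PI / 12 * hat E2s (/ t) / t ^ 2) * (12 * t ^ 2 / PI)) by (field; lra).
replace (PI / 12 * hat E2s (/ t) / t ^ 2) with (- (PI / 12) * hat E2s t + / (2 * t)) by lra.
field; lra.
Qed.

(* The relation obtained by differentiating [f (1/t) = g t]. *)
Lemma hat_inv_derive (f : nat -> R) (g : R -> R) (t l : R) : conv4 f -> near1 t ->
  (forall y, near1 y -> hat f (/ y) = g y) -> is_derive g t l ->
  hat (xD f) (/ t) = l * t ^ 2 / (2 * PI).
Proof.
intros Hf Ht Hg Hl; assert (Hi := near1_inv t Ht).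
assert (HPI := PI_RGT_0).
assert (Ht0 : t <> 0) by (destruct Ht; lra).
assert (D := is_derive_inv_comp (hat f) t _ Ht0 (is_derive_hat f (/ t) Hf (proj1 Hi))).
assert (D2 : is_derive g t (- (- (2 * PI) * hat (xD f) (/ t)) / t ^ 2)).
{ apply is_derive_ext_loc with (2 := D); apply near1_locally; auto. }
apply is_derive_unique in D2; apply is_derive_unique in Hl; rewrite Hl in D2; rewrite D2.
field; lra.
Qed.

(** Differentiating the law of E2 produces anomalous terms, which cancel in E2^2 - 12 q dE2/dq;
    [E6_inv] repeats the argument one step further. *)
Lemma E4_inv (t : R) : near1 t -> hat E4s (/ t) = t ^ 4 * hat E4s t.
Proof.
intros Ht; assert (Hi := near1_inv t Ht); assert (HPI := PI_RGT_0).
assert (Ht2 : / 2 < t) by apply Ht.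
rewrite !hat_E4 by (apply Ht || apply Hi).
rewrite (hat_inv_derive E2s (fun t => - t ^ 2 * hat E2s t + 6 * t / PI) t
  (- (2 * t) * hat E2s t - t ^ 2 * (- (2 * PI) * hat (xD E2s) t) + 6 / PI)).
- rewrite E2_inv by exact Ht; field; lra.
- apply conv4_E2.
- exact Ht.
- apply E2_inv.
- assert (D := is_derive_hat E2s t conv4_E2 (proj1 Ht)).
  auto_derive; [repeat split; eexists; exact D|].
  replace (Derive (fun x => hat E2s x) t) with (- (2 * PI) * hat (xD E2s) t)
    by (symmetry; apply is_derive_unique; exact D).
  simpl; field; lra.
Qed.

Lemma E6_inv (t : R) : near1 t -> hat E6s (/ t) = - t ^ 6 * hat E6s t.
Proof.
intros Ht; assert (Hi := near1_inv t Ht); assert (HPI := PI_RGT_0).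
assert (Ht2 : / 2 < t) by apply Ht.
rewrite !hat_E6 by (apply Ht || apply Hi).
rewrite (hat_inv_derive E4s (fun t => t ^ 4 * hat E4s t) t
  (4 * t ^ 3 * hat E4s t + t ^ 4 * (- (2 * PI) * hat (xD E4s) t))).
- rewrite E2_inv, E4_inv by exact Ht; field; lra.
- apply conv4_E4.
- exact Ht.
- apply E4_inv.
- assert (D := is_derive_hat E4s t conv4_E4 (proj1 Ht)).
  auto_derive; [repeat split; eexists; exact D|].
  replace (Derive (fun x => hat E4s x) t) with (- (2 * PI) * hat (xD E4s) t)
    by (symmetry; apply is_derive_unique; exact D).
  simpl; field; lra.
Qed.

(** * Power series under a Cayley transform *)

Lemma exp_series (x : R) : is_series (fun k => x ^ k / INR (fact k)) (exp x).
Proof.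
apply is_series_ext with (2 := is_exp_Reals x); intros k.
rewrite pow_n_pow; reflexivity.
Qed.

(* [geo k j] is the coefficient of [w^j] in [(w / (1 - w))^k]. *)
Fixpoint geo (k : nat) : nat -> R :=
  match k with
  | O => PS_one
  | S k => fix g (j : nat) : R := match j with O => 0 | S j => g j + geo k j end
  end.

Lemma geo_SS (k j : nat) : geo (S k) (S j) = geo (S k) j + geo k j.
Proof. reflexivity. Qed.

Lemma geo_nonneg (k j : nat) : 0 <= geo k j.
Proof.
revert j; induction k as [|k IH]; [intros [|j]; simpl; lra|].
induction j as [|j IHj]; [simpl; lra|]; rewrite geo_SS; specialize (IH j); lra.
Qed.

(** Partial sums are bounded first; then the recursion gives s = r (s + T), where T is the sum of
    index k, and this determines s. *)
Lemma geo_sum (k : nat) (r : R) : 0 <= r < 1 ->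
  is_series (fun j => geo k j * r ^ j) ((r / (1 - r)) ^ k).
Proof.
intros Hr; induction k as [|k IH].
- apply is_series_ext with (2 := is_series_single 0 1); intros [|j]; simpl; ring.
- assert (Hpos : forall i j, 0 <= geo i j * r ^ j).
  { intros i j; apply Rmult_le_pos; [apply geo_nonneg| apply pow_le; lra]. }
  assert (Hfin : forall N, sum_n (fun j => geo (S k) j * r ^ j) N * (1 - r) <= r * (r / (1 - r)) ^ k).
  { assert (Hrec : forall N, sum_n (fun j => geo (S k) j * r ^ j) (S N) =
       r * (sum_n (fun j => geo (S k) j * r ^ j) N + sum_n (fun j => geo k j * r ^ j) N) :> R).
    { intros N; rewrite sum_n_shift1, <- sum_n_add, <- sum_n_scal.
      replace (geo (S k) 0 * r ^ 0) with 0 by (simpl; ring); rewrite Rplus_0_l.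
      apply sum_n_eq; intros j _; rewrite geo_SS; simpl; ring. }
    intros N.
    assert (H1 := sum_n_incr (fun j => geo (S k) j * r ^ j) (Hpos (S k)) N).
    rewrite Hrec in H1.
    assert (H2 := sum_n_le_series _ _ (Hpos k) IH N).
    set (X := sum_n (fun j => geo (S k) j * r ^ j) N : R) in *.
    set (Z := sum_n (fun j => geo k j * r ^ j) N : R) in *.
    apply Rle_trans with (r * Z).
    - clear - H1; clearbody X Z; simpl in X, Z; lra.
    - apply Rmult_le_compat_l; [lra| exact H2]. }
  assert (Hex : exists s : R, is_series (fun j => geo (S k) j * r ^ j) s).
  { apply (ex_series_bounded (fun j => geo (S k) j * r ^ j) (r * (r / (1 - r)) ^ k / (1 - r)) (Hpos (S k))).
    intros N; specialize (Hfin N); apply Rmult_le_reg_r with (1 - r); [lra|].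
    apply Rle_trans with (1 := Hfin); right; field; lra. }
  destruct Hex as [s Hs].
  assert (Hs' : is_series (fun j => geo (S k) (S j) * r ^ (S j)) s).
  { apply is_series_ext with (fun j => geo (S k) (S j) * r ^ (S j)); [reflexivity|].
    apply (is_series_incr_1 (fun j => geo (S k) j * r ^ j)).
    change (is_series (fun j => geo (S k) j * r ^ j) (s + geo (S k) 0 * r ^ 0)).
    replace (s + geo (S k) 0 * r ^ 0) with s by (simpl; ring); exact Hs. }
  assert (Hs'' : is_series (fun j => geo (S k) (S j) * r ^ (S j)) (r * (s + (r / (1 - r)) ^ k))).
  { apply is_series_ext with (fun j => r * (geo (S k) j * r ^ j + geo k j * r ^ j)).
    - intros j; rewrite geo_SS; simpl; ring.
    - exact (is_series_scal_l r _ _ (is_series_plus _ _ _ _ Hs IH)). }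
  assert (E : s = r * (s + (r / (1 - r)) ^ k)).
  { rewrite <- (is_series_unique _ _ Hs') at 1; now apply is_series_unique. }
  replace ((r / (1 - r)) ^ S k) with s; [exact Hs|].
  apply (Rmult_eq_reg_r (1 - r)); [|lra].
  replace ((r / (1 - r)) ^ S k * (1 - r)) with (r * (r / (1 - r)) ^ k) by (simpl; field; lra).
  lra.
Qed.

(* [ell a j] is the coefficient of [w^j] in [exp (- a * (2 w / (1 - w)))]. *)
Definition ell (a : R) (j : nat) : R :=
  Series (fun k => (- (2 * a)) ^ k / INR (fact k) * geo k j).

(** Stated for every kap bounded by r^j, so that it covers both the powers of a real w and the
    imaginary parts of the powers of i rho. The absolute bound feeds the second interchange of sums,
    in [primitive_fubini]. *)
Lemma ell_sum (a r : R) (kap : nat -> R) : 0 <= r < 1 -> (forall j, Rabs (kap j) <= r ^ j) ->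
  ex_series (fun j => Rabs (ell a j * kap j)) /\
  Series (fun j => Rabs (ell a j * kap j)) <= exp (2 * Rabs a * (r / (1 - r))) /\
  Series (fun j => ell a j * kap j) =
    Series (fun k => (- (2 * a)) ^ k / INR (fact k) * Series (fun j => geo k j * kap j)).
Proof.
intros Hr Hk.
set (f := fun k j => (- (2 * a)) ^ k / INR (fact k) * (geo k j * kap j)).
assert (Hfa : forall k j, Rabs (f k j) <= (2 * Rabs a) ^ k / INR (fact k) * (geo k j * r ^ j)).
{ intros k j; unfold f, Rdiv; rewrite !Rabs_mult, <- RPow_abs, Rabs_Ropp, Rabs_mult, Rabs_inv.
  rewrite (Rabs_pos_eq 2), (Rabs_pos_eq (INR _)), (Rabs_pos_eq (geo k j)) by
    (try apply geo_nonneg; try apply pos_INR; lra).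
  assert (h := geo_nonneg k j).
  apply Rmult_le_compat_l.
  - apply Rmult_le_pos; [apply pow_le; assert (h' := Rabs_pos a); lra|].
    left; apply Rinv_0_lt_compat, INR_fact_lt_0.
  - apply Rmult_le_compat_l; [exact h| apply Hk]. }
assert (Hrow : forall k, is_series (fun j => (2 * Rabs a) ^ k / INR (fact k) * (geo k j * r ^ j))
   ((2 * Rabs a) ^ k / INR (fact k) * (r / (1 - r)) ^ k)).
{ intros k; exact (is_series_scal_l ((2 * Rabs a) ^ k / INR (fact k)) _ _ (geo_sum k r Hr)). }
assert (Hex1 : forall k, ex_series (fun j => Rabs (f k j))).
{ intros k; apply (@ex_series_le R_AbsRing R_CompleteNormedModule) with
    (fun j => (2 * Rabs a) ^ k / INR (fact k) * (geo k j * r ^ j)).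
  - intros j; change (Rabs (Rabs (f k j)) <= (2 * Rabs a) ^ k / INR (fact k) * (geo k j * r ^ j)).
    rewrite Rabs_Rabsolu; apply Hfa.
  - eexists; apply Hrow. }
assert (Hle : forall k, 0 <= Series (fun j => Rabs (f k j)) <= (2 * Rabs a * (r / (1 - r))) ^ k / INR (fact k)).
{ intros k; split.
  - apply Rle_trans with (sum_n (fun j => Rabs (f k j)) 0).
    + rewrite sum_n_0; apply Rabs_pos.
    + apply sum_n_le_series; [intros; apply Rabs_pos| now apply Series_correct].
  - apply Rle_trans with ((2 * Rabs a) ^ k / INR (fact k) * (r / (1 - r)) ^ k).
    + rewrite <- (is_series_unique _ _ (Hrow k)); apply Series_le.
      * intros j; split; [apply Rabs_pos| apply Hfa].
      * eexists; apply Hrow.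
    + right; rewrite (Rpow_mult_distr (2 * Rabs a) (r / (1 - r))).
      unfold Rdiv; ring. }
assert (Hex2 : ex_series (fun k => Series (fun j => Rabs (f k j)))).
{ apply (@ex_series_le R_AbsRing R_CompleteNormedModule) with
    (fun k => (2 * Rabs a * (r / (1 - r))) ^ k / INR (fact k)).
  - intros k; change (Rabs (Series (fun j => Rabs (f k j))) <= (2 * Rabs a * (r / (1 - r))) ^ k / INR (fact k)).
    rewrite Rabs_pos_eq; apply Hle.
  - eexists; apply exp_series. }
destruct (fubini f Hex1 Hex2) as [Hcol HF].
assert (Hell : forall j, Series (fun k => f k j) = ell a j * kap j).
{ intros j; unfold ell; rewrite <- Series_scal_r; apply Series_ext; intros k; unfold f; ring. }
assert (HFa := fubini_nonneg_eq (fun k j => Rabs (f k j)) _ _ (fun k j => Rabs_pos _)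
   (fun k => Series_correct _ (Hex1 k)) (Series_correct _ Hex2)).
assert (Hb : forall j, 0 <= Rabs (ell a j * kap j) <= Series (fun k => Rabs (f k j))).
{ intros j; split; [apply Rabs_pos|]; rewrite <- Hell; apply Series_Rabs, Hcol. }
assert (Hex3 : ex_series (fun j => Rabs (ell a j * kap j))).
{ apply (@ex_series_le R_AbsRing R_CompleteNormedModule) with (fun j => Series (fun k => Rabs (f k j))).
  - intros j; change (Rabs (Rabs (ell a j * kap j)) <= Series (fun k => Rabs (f k j))).
    rewrite Rabs_Rabsolu; apply Hb.
  - eexists; exact HFa. }
split; [exact Hex3|split].
- apply Rle_trans with (Series (fun j => Series (fun k => Rabs (f k j)))).
  + apply Series_le; [exact Hb| eexists; exact HFa].
  + rewrite (is_series_unique _ _ HFa).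
    rewrite <- (is_series_unique _ _ (exp_series _)).
    apply Series_le; [exact Hle| eexists; apply exp_series].
- rewrite (Series_ext _ (fun j => Series (fun k => f k j))) by (intros; symmetry; apply Hell).
  rewrite (is_series_unique _ _ HF); apply Series_ext; intros k.
  apply Series_scal_l.
Qed.

Lemma geo_ex (k : nat) (r : R) (kap : nat -> R) : 0 <= r < 1 -> (forall j, Rabs (kap j) <= r ^ j) ->
  ex_series (fun j => geo k j * kap j).
Proof.
intros Hr Hk.
apply (@ex_series_le R_AbsRing R_CompleteNormedModule) with (fun j => geo k j * r ^ j).
- intros j; change (Rabs (geo k j * kap j) <= geo k j * r ^ j).
  rewrite Rabs_mult, Rabs_pos_eq by apply geo_nonneg.
  apply Rmult_le_compat_l; [apply geo_nonneg| apply Hk].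
- eexists; now apply geo_sum.
Qed.

Lemma Series_geo_S (k : nat) (r : R) (kap : nat -> R) : 0 <= r < 1 ->
  (forall j, Rabs (kap j) <= r ^ j) -> (forall j, Rabs (kap (S j)) <= r ^ j) ->
  Series (fun j => geo (S k) j * kap j) =
  Series (fun j => geo (S k) j * kap (S j)) + Series (fun j => geo k j * kap (S j)).
Proof.
intros Hr H1 H2.
rewrite Series_incr_1 by (eapply geo_ex; eauto).
rewrite <- Series_plus by (eapply geo_ex; eauto).
replace (geo (S k) 0 * kap 0%nat) with 0 by (simpl; ring); rewrite Rplus_0_l.
apply Series_ext; intros j; rewrite geo_SS; ring.
Qed.

Lemma geo_real (k : nat) (w : R) : Rabs w < 1 ->
  Series (fun j => geo k j * w ^ j) = (w / (1 - w)) ^ k.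
Proof.
intros Hw.
assert (Hr : 0 <= Rabs w < 1) by (split; [apply Rabs_pos| exact Hw]).
assert (Hk : forall j, Rabs (w ^ j) <= Rabs w ^ j) by (intros j; rewrite RPow_abs; lra).
assert (Hw1 : w < 1) by (assert (h := Rle_abs w); lra).
induction k as [|k IH].
- apply is_series_unique; apply is_series_ext with (2 := is_series_single 0 1); intros [|j]; simpl; ring.
- assert (Hk2 : forall j, Rabs (w ^ S j) <= Rabs w ^ j).
  { intros j; rewrite <- RPow_abs; simpl; rewrite <- (Rmult_1_l (Rabs w ^ j)) at 2.
    apply Rmult_le_compat_r; [apply pow_le, Rabs_pos| lra]. }
  assert (E := Series_geo_S k (Rabs w) (fun j => w ^ j) Hr Hk Hk2); cbv beta in E.
  rewrite (Series_ext (fun j => geo (S k) j * w ^ S j) (fun j => w * (geo (S k) j * w ^ j))) in E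
    by (intros; simpl; ring).
  rewrite (Series_ext (fun j => geo k j * w ^ S j) (fun j => w * (geo k j * w ^ j))) in E
    by (intros; simpl; ring).
  rewrite !Series_scal_l, IH in E.
  apply (Rmult_eq_reg_r (1 - w)); [|lra].
  replace ((w / (1 - w)) ^ S k * (1 - w)) with (w * (w / (1 - w)) ^ k) by (simpl; field; lra).
  lra.
Qed.

Lemma ell_real (a w : R) : Rabs w < 1 ->
  Series (fun j => ell a j * w ^ j) = exp (- a * (2 * w / (1 - w))).
Proof.
intros Hw.
assert (Hr : 0 <= Rabs w < 1) by (split; [apply Rabs_pos| exact Hw]).
assert (Hk : forall j, Rabs (w ^ j) <= Rabs w ^ j) by (intros j; rewrite RPow_abs; lra).
destruct (ell_sum a (Rabs w) (fun j => w ^ j) Hr Hk) as [_ [_ ->]].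
assert (Hw1 : w < 1) by (assert (h := Rle_abs w); lra).
rewrite (Series_ext _ (fun k => (- a * (2 * w / (1 - w))) ^ k / INR (fact k))).
- apply is_series_unique, exp_series.
- intros k; rewrite geo_real by exact Hw.
  replace (- a * (2 * w / (1 - w))) with ((- (2 * a)) * (w / (1 - w))) by (field; lra).
  rewrite Rpow_mult_distr; unfold Rdiv; ring.
Qed.

(* Real and imaginary parts of the power series [sum (a + i b)^k x^k / k!]. *)
Lemma exp_complex (a b : R) (c s : nat -> R) (x : R) : c 0%nat = 1 -> s 0%nat = 0 ->
  (forall k, c (S k) = a * c k - b * s k) -> (forall k, s (S k) = b * c k + a * s k) ->
  Series (fun k => x ^ k / INR (fact k) * s k) = exp (a * x) * sin (b * x).
Proof.
intros Hc0 Hs0 Hc Hs.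
set (M := Rabs a + Rabs b).
assert (HM : 0 <= M) by (unfold M; assert (h1 := Rabs_pos a); assert (h2 := Rabs_pos b); lra).
assert (Hb : forall k, Rabs (c k) + Rabs (s k) <= M ^ k).
{ induction k as [|k IH].
  - rewrite Hc0, Hs0, Rabs_R1, Rabs_R0; simpl; lra.
  - rewrite Hc, Hs.
    apply Rle_trans with ((Rabs a * Rabs (c k) + Rabs b * Rabs (s k)) + (Rabs b * Rabs (c k) + Rabs a * Rabs (s k))).
    + apply Rplus_le_compat; [unfold Rminus|]; apply Rle_trans with (1 := Rabs_triang _ _);
        rewrite ?Rabs_Ropp, !Rabs_mult; lra.
    + replace ((Rabs a * Rabs (c k) + Rabs b * Rabs (s k)) + (Rabs b * Rabs (c k) + Rabs a * Rabs (s k)))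
        with (M * (Rabs (c k) + Rabs (s k))) by (unfold M; ring).
      simpl; now apply Rmult_le_compat_l. }
set (C := fun k => c k / INR (fact k)); set (S' := fun k => s k / INR (fact k)).
assert (Hrad : forall (u : nat -> R), (forall k, Rabs (u k) <= M ^ k) ->
   CV_radius (fun k => u k / INR (fact k)) = p_infty).
{ intros u Hu.
  destruct (CV_radius (fun k => u k / INR (fact k))) as [r| |] eqn:E; [|reflexivity|].
  2:{ assert (h := CV_radius_ge_0 (fun k => u k / INR (fact k))); rewrite E in h; contradiction. }
  exfalso; apply (CV_disk_outside (fun k => u k / INR (fact k)) (Rabs r + 1)).
  - rewrite E; simpl; rewrite Rabs_pos_eq; assert (h := Rle_abs r); assert (h' := Rabs_pos r); lra.
  - apply (ex_series_lim_0 (fun k => u k / INR (fact k) * (Rabs r + 1) ^ k)).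
    apply (@ex_series_le R_AbsRing R_CompleteNormedModule) with
      (fun k => (M * (Rabs r + 1)) ^ k / INR (fact k)); [|eexists; apply exp_series].
    intros k; change (Rabs (u k / INR (fact k) * (Rabs r + 1) ^ k) <= (M * (Rabs r + 1)) ^ k / INR (fact k)).
    assert (h := Rabs_pos r).
    unfold Rdiv; rewrite !Rabs_mult, Rabs_inv, (Rabs_pos_eq (INR _)), (Rabs_pos_eq (_ ^ k))
      by (try apply pos_INR; apply pow_le; lra).
    rewrite Rpow_mult_distr, Rmult_assoc, Rmult_assoc.
    rewrite (Rmult_comm (/ INR (fact k))).
    apply Rmult_le_compat_r; [|apply Hu].
    apply Rmult_le_pos; [apply pow_le; lra|]; left; apply Rinv_0_lt_compat, INR_fact_lt_0. }
assert (RC : forall x, Rbar_lt (Rabs x) (CV_radius C)).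
{ intros y; unfold C; rewrite Hrad; [exact I|]; intros k; assert (h := Hb k); assert (h' := Rabs_pos (s k)); lra. }
assert (RS : forall x, Rbar_lt (Rabs x) (CV_radius S')).
{ intros y; unfold S'; rewrite Hrad; [exact I|]; intros k; assert (h := Hb k); assert (h' := Rabs_pos (c k)); lra. }
assert (Hf : forall k, INR (S k) <> 0) by (intros k; apply not_0_INR; lia).
assert (DC : forall y, is_derive (PSeries C) y (a * PSeries C y - b * PSeries S' y)).
{ intros y; replace (a * PSeries C y - b * PSeries S' y) with (PSeries (PS_derive C) y).
  - apply is_derive_PSeries, RC.
  - rewrite <- !PSeries_scal, <- PSeries_minus.
    + apply PSeries_ext; intros k; unfold PS_derive, PS_minus, PS_plus, PS_opp, PS_scal, C, S'.
      change (INR (S k) * (c (S k) / INR (fact (S k))) = a * (c k / INR (fact k)) + - (b * (s k / INR (fact k)))).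
      rewrite Hc, fact_simpl, mult_INR; field; split; [apply INR_fact_neq_0| apply Hf].
    + apply (@ex_pseries_scal R_AbsRing R_NormedModule); [apply Rmult_comm| apply CV_radius_inside, RC].
    + apply (@ex_pseries_scal R_AbsRing R_NormedModule); [apply Rmult_comm| apply CV_radius_inside, RS]. }
assert (DS : forall y, is_derive (PSeries S') y (b * PSeries C y + a * PSeries S' y)).
{ intros y; replace (b * PSeries C y + a * PSeries S' y) with (PSeries (PS_derive S') y).
  - apply is_derive_PSeries, RS.
  - rewrite <- !PSeries_scal, <- PSeries_plus.
    + apply PSeries_ext; intros k; unfold PS_derive, PS_plus, PS_scal, C, S'.
      change (INR (S k) * (s (S k) / INR (fact (S k))) = b * (c k / INR (fact k)) + (a * (s k / INR (fact k)))).
      rewrite Hs, fact_simpl, mult_INR; field; split; [apply INR_fact_neq_0| apply Hf].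
    + apply (@ex_pseries_scal R_AbsRing R_NormedModule); [apply Rmult_comm| apply CV_radius_inside, RC].
    + apply (@ex_pseries_scal R_AbsRing R_NormedModule); [apply Rmult_comm| apply CV_radius_inside, RS]. }
(* e^(-ax) (F cos bx + G sin bx) and e^(-ax) (G cos bx - F sin bx) are constant *)
assert (Hconst : forall g : R -> R, (forall y, is_derive g y 0) -> g x = g 0).
{ intros g Hg; destruct (MVT_gen g 0 x (fun _ => 0)) as [z [_ Hz]].
  - intros; apply Hg.
  - intros y _; apply derivable_continuous_pt; exists 0; apply is_derive_Reals, Hg.
  - lra. }
assert (H0C : PSeries C 0 = 1) by (rewrite PSeries_0; unfold C; rewrite Hc0; simpl; field).
assert (H0S : PSeries S' 0 = 0) by (rewrite PSeries_0; unfold S'; rewrite Hs0; simpl; field).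
assert (E1 : exp (- (a * x)) * (PSeries C x * cos (b * x) + PSeries S' x * sin (b * x)) = 1).
{ transitivity (exp (- (a * 0)) * (PSeries C 0 * cos (b * 0) + PSeries S' 0 * sin (b * 0))).
  - apply (Hconst (fun x => exp (- (a * x)) * (PSeries C x * cos (b * x) + PSeries S' x * sin (b * x)))).
    intros y; assert (dc := DC y); assert (ds := DS y).
    auto_derive; [repeat split; eexists; eassumption|].
    replace (Derive (fun x => PSeries C x) y) with (a * PSeries C y - b * PSeries S' y)
      by (symmetry; apply is_derive_unique; exact dc).
    replace (Derive (fun x => PSeries S' x) y) with (b * PSeries C y + a * PSeries S' y)
      by (symmetry; apply is_derive_unique; exact ds).
    ring.
  - rewrite H0C, H0S, !Rmult_0_r, Ropp_0, exp_0, cos_0; ring. }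
assert (E2 : exp (- (a * x)) * (PSeries S' x * cos (b * x) - PSeries C x * sin (b * x)) = 0).
{ transitivity (exp (- (a * 0)) * (PSeries S' 0 * cos (b * 0) - PSeries C 0 * sin (b * 0))).
  - apply (Hconst (fun x => exp (- (a * x)) * (PSeries S' x * cos (b * x) - PSeries C x * sin (b * x)))).
    intros y; assert (dc := DC y); assert (ds := DS y).
    auto_derive; [repeat split; eexists; eassumption|].
    replace (Derive (fun x => PSeries C x) y) with (a * PSeries C y - b * PSeries S' y)
      by (symmetry; apply is_derive_unique; exact dc).
    replace (Derive (fun x => PSeries S' x) y) with (b * PSeries C y + a * PSeries S' y)
      by (symmetry; apply is_derive_unique; exact ds).
    ring.
  - rewrite H0C, H0S, !Rmult_0_r, Ropp_0, exp_0, sin_0; ring. }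
replace (Series (fun k => x ^ k / INR (fact k) * s k)) with (PSeries S' x).
2:{ apply Series_ext; intros k; unfold S', Rdiv; ring. }
assert (He : exp (a * x) * exp (- (a * x)) = 1).
{ rewrite <- exp_plus, Rplus_opp_r; apply exp_0. }
assert (Hsc := sin2_cos2 (b * x)); unfold Rsqr in Hsc.
set (F := PSeries C x) in *; set (G := PSeries S' x) in *.
set (co := cos (b * x)) in *; set (si := sin (b * x)) in *.
set (e := exp (a * x)) in *; set (e' := exp (- (a * x))) in *.
transitivity (e * (si * (e' * (F * co + G * si)) + co * (e' * (G * co - F * si)))).
- replace (e * (si * (e' * (F * co + G * si)) + co * (e' * (G * co - F * si))))
    with ((e * e') * (G * (si * si + co * co))) by ring.
  rewrite He, Hsc; ring.
- rewrite E1, E2; ring.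
Qed.

(** * Vanishing of the constant term *)

(* Real and imaginary parts of [i^j]. *)
Fixpoint ipow (j : nat) : R * R :=
  match j with O => (1, 0) | S j => (- snd (ipow j), fst (ipow j)) end.

Lemma ipow_bound (j : nat) : Rabs (fst (ipow j)) <= 1 /\ Rabs (snd (ipow j)) <= 1.
Proof.
induction j as [|j [H1 H2]]; simpl; [rewrite Rabs_R1, Rabs_R0; lra|].
now rewrite Rabs_Ropp.
Qed.

Lemma ipow_even (j : nat) : snd (ipow (2 * j)) = 0.
Proof.
induction j as [|j IH]; [reflexivity|].
replace (2 * S j)%nat with (S (S (2 * j))) by lia; simpl in *; rewrite IH; ring.
Qed.

(* The corner [exp(i PI/6)] of the fundamental domain, in the disc coordinate
   [w = (t - 1)/(t + 1)], is [i * rho]. *)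
Definition rho : R := 2 - sqrt 3.

Lemma sqrt3_bounds : 17 / 10 <= sqrt 3 <= 173333 / 100000.
Proof.
assert (h : sqrt 3 * sqrt 3 = 3) by (apply sqrt_sqrt; lra).
assert (h0 := sqrt_pos 3); split; nra.
Qed.

Lemma rho_bounds : / 4 < rho < / 3.
Proof. unfold rho; assert (h := sqrt3_bounds); lra. Qed.

Lemma rho_sqr : rho * rho = 4 * rho - 1.
Proof.
assert (h : sqrt 3 * sqrt 3 = 3) by (apply sqrt_sqrt; lra).
unfold rho; lra.
Qed.

Definition kc (j : nat) : R := fst (ipow j) * rho ^ j.
Definition ks (j : nat) : R := snd (ipow j) * rho ^ j.

Lemma kcs_bound (j : nat) :
  (Rabs (kc j) <= rho ^ j /\ Rabs (kc (S j)) <= rho ^ j) /\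
  (Rabs (ks j) <= rho ^ j /\ Rabs (ks (S j)) <= rho ^ j).
Proof.
assert (Hr := rho_bounds).
assert (Hp : forall k, 0 < rho ^ k) by (intros; apply pow_lt; lra).
assert (H1 : forall a k, Rabs a <= 1 -> Rabs (a * rho ^ k) <= rho ^ k).
{ intros a k Ha; rewrite Rabs_mult, (Rabs_pos_eq (rho ^ k)) by (left; apply Hp).
  rewrite <- (Rmult_1_l (rho ^ k)) at 2; apply Rmult_le_compat_r; [left; apply Hp| exact Ha]. }
assert (H2 : rho ^ S j <= rho ^ j) by (simpl; assert (h := Hp j); nra).
destruct (ipow_bound j) as [I1 I2]; destruct (ipow_bound (S j)) as [I3 I4].
unfold kc, ks; repeat split; try (apply H1; assumption);
  (eapply Rle_trans; [apply H1; assumption| exact H2]).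
Qed.

Definition geoc (k : nat) : R := Series (fun j => geo k j * kc j).
Definition geos (k : nat) : R := Series (fun j => geo k j * ks j).

Lemma geo_corner0 : geoc 0 = 1 /\ geos 0 = 0.
Proof.
split; apply is_series_unique.
- apply is_series_ext with (2 := is_series_single 0 1); intros [|j]; unfold kc; simpl; ring.
- apply is_series_ext with (2 := is_series_zero); intros [|j]; unfold ks; simpl; ring.
Qed.

(** At w = i rho one has w/(1-w) = (-rho + i)/4, because 1 + rho^2 = 4 rho; [geoc] and [geos] are
    the real and imaginary parts of its powers. *)
Lemma geo_cornerS (k : nat) :
  geoc (S k) = - rho / 4 * geoc k - / 4 * geos k /\
  geos (S k) = / 4 * geoc k + - rho / 4 * geos k.
Proof.
assert (Hr := rho_bounds); assert (Hr2 := rho_sqr).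
assert (Hr1 : 0 <= rho < 1) by lra.
assert (E1 := Series_geo_S k rho kc Hr1 (fun j => proj1 (proj1 (kcs_bound j)))
   (fun j => proj2 (proj1 (kcs_bound j)))).
assert (E2 := Series_geo_S k rho ks Hr1 (fun j => proj1 (proj2 (kcs_bound j)))
   (fun j => proj2 (proj2 (kcs_bound j)))).
assert (X1 : forall i, Series (fun j => geo i j * kc (S j)) = - rho * geos i).
{ intros i; unfold geos; rewrite <- Series_scal_l; apply Series_ext; intros j; unfold kc, ks; simpl; ring. }
assert (X2 : forall i, Series (fun j => geo i j * ks (S j)) = rho * geoc i).
{ intros i; unfold geoc; rewrite <- Series_scal_l; apply Series_ext; intros j; unfold kc, ks; simpl; ring. }
rewrite !X1 in E1; rewrite !X2 in E2.
fold (geoc (S k)) in E1; fold (geos (S k)) in E2.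
assert (H4 : 4 * rho <> 0) by lra.
split; apply (Rmult_eq_reg_l (4 * rho)); trivial.
- replace (4 * rho * geoc (S k)) with (geoc (S k) + rho * rho * geoc (S k)) by (rewrite Hr2; ring).
  replace (4 * rho * (- rho / 4 * geoc k - / 4 * geos k)) with (- (rho * rho) * geoc k - rho * geos k) by field.
  rewrite E1 at 1; rewrite E2; ring.
- replace (4 * rho * geos (S k)) with (geos (S k) + rho * rho * geos (S k)) by (rewrite Hr2; ring).
  replace (4 * rho * (/ 4 * geoc k + - rho / 4 * geos k)) with (rho * geoc k - (rho * rho) * geos k) by field.
  rewrite E2 at 1; rewrite E1; ring.
Qed.

(** At the corner 2w/(1-w) has imaginary part 1/2, so exp (-2 PI m * 2w/(1-w)) has argument -PI m
    and is real. *)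
Lemma ell_corner (m : Z) : Series (fun j => ell (2 * PI * IZR m) j * ks j) = 0.
Proof.
assert (Hr := rho_bounds).
destruct (ell_sum (2 * PI * IZR m) rho ks ltac:(lra) (fun j => proj1 (proj2 (kcs_bound j)))) as [_ [_ ->]].
change (Series (fun k => (- (2 * (2 * PI * IZR m))) ^ k / INR (fact k) * geos k) = 0).
destruct geo_corner0 as [C0 S0].
rewrite (exp_complex (- rho / 4) (/ 4) geoc geos (- (2 * (2 * PI * IZR m))) C0 S0
  (fun k => proj1 (geo_cornerS k)) (fun k => proj2 (geo_cornerS k))).
replace (/ 4 * - (2 * (2 * PI * IZR m))) with (IZR (- m) * PI) by (rewrite opp_IZR; field).
rewrite (sin_eq_0_1 (IZR (- m) * PI)) by (now exists (- m)%Z); ring.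
Qed.

Lemma CV_radius_pos (a : nat -> R) (x : R) : 0 < x -> ex_pseries a x -> Rbar_lt 0 (CV_radius a).
Proof.
intros Hx Ha.
destruct (Rbar_lt_dec 0 (CV_radius a)) as [H|H]; [exact H|exfalso].
apply Rbar_not_lt_le in H.
apply (CV_disk_outside a x).
- apply Rbar_le_lt_trans with (1 := H); simpl; rewrite Rabs_pos_eq; lra.
- apply ex_series_lim_0 in Ha; apply is_lim_seq_ext with (2 := Ha); intros n.
  rewrite pow_n_pow; apply Rmult_comm.
Qed.

(** q^(n-3) = exp (- fac n * t): the forms considered have a pole of order 3 in the nome. *)
Definition fac (n : nat) : R := 2 * PI * (INR n - 3).

(** By rho^2 = 4 rho - 1 one has 2 rho/(1-rho) = 1 - rho, so for n >= 3 the left side is exp (- fac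
    n * rho). The constant 12 PI absorbs the terms with n < 3. *)
Lemma fac_bound (n : nat) :
  exp (- fac n) * exp (2 * Rabs (fac n) * (rho / (1 - rho))) <=
  exp (12 * PI + 6 * PI * rho) * exp (- (2 * PI * rho)) ^ n.
Proof.
assert (HPI := PI_RGT_0); assert (Hr := rho_bounds); assert (Hr2 := rho_sqr).
assert (Hy : rho / (1 - rho) = (1 - rho) / 2).
{ apply (Rmult_eq_reg_r (1 - rho)); [|lra]; field_simplify; [lra|lra]. }
rewrite exp_pow, <- !exp_plus, Hy; apply exp_le; unfold fac.
assert (hn := pos_INR n).
rewrite Rabs_mult, (Rabs_pos_eq (2 * PI)) by lra.
destruct (Rle_dec 3 (INR n)) as [H|H].
- rewrite Rabs_pos_eq by lra; nra.
- rewrite Rabs_left by lra.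
  replace (- (2 * PI * (INR n - 3)) + 2 * (2 * PI * - (INR n - 3)) * ((1 - rho) / 2))
    with (PI * (2 * (3 - INR n) * (2 - rho))) by field.
  replace (12 * PI + 6 * PI * rho + INR n * - (2 * PI * rho))
    with (PI * (12 + 2 * rho * (3 - INR n))) by ring.
  apply Rmult_le_compat_l; [lra|]; nra.
Qed.

(** 2 PI rho >= 8/5 and exp (8/5) >= (6/5)^8 > 4; the upper bound 1.73333 for sqrt 3 is just sharp
    enough for the first inequality. *)
Lemma corner_nome : 0 < exp (- (2 * PI * rho)) < / 4.
Proof.
split; [apply exp_pos|].
assert (HPI : 3 < PI) by (assert (h := PI2_3_2); lra).
assert (Hs := sqrt3_bounds).
rewrite exp_Ropp; apply Rinv_lt_contravar.
- apply Rmult_lt_0_compat; [lra| apply exp_pos].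
- assert (H1 : 6 / 5 <= exp (/ 5)) by (assert (h := exp_ineq1_le (/ 5)); lra).
  assert (H2 : (6 / 5) ^ 8 <= exp (/ 5) ^ 8) by (apply pow_incr; lra).
  rewrite exp_pow in H2.
  assert (H3 : exp (INR 8 * / 5) <= exp (2 * PI * rho)).
  { apply exp_le; simpl; unfold rho; nra. }
  replace ((6 / 5) ^ 8) with (1679616 / 390625) in H2 by field; lra.
Qed.

Section ConstantTerm.
Variable c : nat -> R.
Hypothesis Hc : conv4 c.

(** Termwise integration divides q^(n-3) by 2 PI (3-n). The term n = 3 integrates to c 3 * t and is
    kept apart in H, where it is the only term that can fail to be real at the corner. *)
Let b (n : nat) : R := if Nat.eqb n 3 then 0 else c n / (2 * PI * (3 - INR n)).

Lemma conv4_primitive : conv4 b.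
Proof.
assert (HPI : 3 < PI) by (assert (h := PI2_3_2); lra).
apply conv4_ex; intros x Hx; apply ex_series_Rabs.
apply (@ex_series_le R_AbsRing R_CompleteNormedModule) with (fun n => Rabs (c n * x ^ n)).
- intros n; change (Rabs (Rabs (pow_n x n * b n)) <= Rabs (c n * x ^ n)).
  rewrite Rabs_Rabsolu, pow_n_pow, !Rabs_mult, Rmult_comm.
  apply Rmult_le_compat_r; [apply Rabs_pos|]; unfold b.
  destruct (Nat.eqb_spec n 3) as [->|Hn]; [rewrite Rabs_R0; apply Rabs_pos|].
  unfold Rdiv; rewrite Rabs_mult, Rabs_inv.
  assert (H1 : 1 <= Rabs (2 * PI * (3 - INR n))).
  { rewrite Rabs_mult, Rabs_pos_eq by lra.
    assert (1 <= Rabs (3 - INR n)); [|nra].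
    destruct (le_lt_dec n 3) as [H3|H3].
    - assert (h : INR (S n) <= INR 3) by (apply le_INR; lia).
      rewrite S_INR in h; simpl in h; rewrite Rabs_pos_eq; lra.
    - assert (h : INR 4 <= INR n) by (apply le_INR; lia).
      simpl in h; rewrite Rabs_left; lra. }
  rewrite <- (Rmult_1_r (Rabs (c n))) at 2.
  apply Rmult_le_compat_l; [apply Rabs_pos|].
  rewrite <- Rinv_1; apply Rinv_le_contravar; lra.
- apply CV_disk_inside, conv4_lt_pos; assumption.
Qed.

Let H (t : R) : R := c 3%nat * t + exp (6 * PI * t) * hat b t.
Let k (t : R) : R := exp (6 * PI * t) * hat c t.

Lemma is_derive_primitive (t : R) : / 2 < t -> is_derive H t (k t).
Proof.
intros Ht; assert (HPI := PI_RGT_0).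
assert (Db := is_derive_hat b t conv4_primitive Ht).
assert (Hb := conv4_primitive); assert (Hxb := conv4_xD _ Hb).
set (d3 := fun n => if Nat.eqb n 3 then 1 else 0).
assert (Hd3 : is_pseries d3 (qexp t) (qexp t ^ 3)).
{ apply is_series_ext with (2 := is_series_single 3 (qexp t ^ 3)); intros n.
  assert (Hn : (if Nat.eqb n 3 then qexp t ^ 3 else 0) = qexp t ^ n * d3 n).
  { unfold d3; destruct (Nat.eqb_spec n 3) as [->|_]; ring. }
  refine (eq_trans Hn _); rewrite <- (pow_n_pow (qexp t) n); reflexivity. }
assert (Hs1 := conv4_scal 3 _ Hb); assert (Hs2 := conv4_scal (-1) _ Hxb).
assert (Hs3 := conv4_plus _ _ Hs1 Hs2); assert (Hs4 := conv4_scal (2 * PI) _ Hs3).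
assert (E : hat c t = 2 * PI * (3 * hat b t - hat (xD b) t) + c 3%nat * qexp t ^ 3).
{ transitivity (PSeries (PS_plus (PS_scal (2 * PI) (PS_plus (PS_scal 3 b) (PS_scal (-1) (xD b)))) (PS_scal (c 3%nat) d3)) (qexp t)).
  - apply PSeries_ext; intros n; unfold PS_plus, PS_scal, xD, b, d3.
    change (c n = 2 * PI * (3 * (if Nat.eqb n 3 then 0 else c n / (2 * PI * (3 - INR n))) +
      (-1) * (INR n * (if Nat.eqb n 3 then 0 else c n / (2 * PI * (3 - INR n))))) +
      c 3%nat * (if Nat.eqb n 3 then 1 else 0)).
    destruct (Nat.eqb_spec n 3) as [->|Hn]; [ring|].
    assert (INR n <> 3).
    { intros h; apply Hn; apply INR_eq; rewrite h; simpl; ring. }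
    field; split; lra.
  - rewrite PSeries_plus.
    + fold (hat (PS_scal (2 * PI) (PS_plus (PS_scal 3 b) (PS_scal (-1) (xD b)))) t).
      rewrite hat_scal, hat_plus, !hat_scal by auto.
      rewrite PSeries_scal, (is_pseries_unique _ _ _ Hd3); ring.
    + apply CV_radius_inside, conv4_lt_pos; [exact Hs4| now apply qexp_small].
    + apply (@ex_pseries_scal R_AbsRing R_NormedModule); [apply Rmult_comm| eexists; exact Hd3]. }
unfold k; rewrite E, qexp_pow.
unfold H; auto_derive; [repeat split; eexists; exact Db|].
replace (Derive (fun x => hat b x) t) with (- (2 * PI) * hat (xD b) t)
  by (symmetry; apply is_derive_unique; exact Db).
assert (Ee : exp (6 * PI * t) * exp (- (2 * PI * t * INR 3)) = 1).
{ rewrite <- exp_plus, <- exp_0; f_equal; simpl; ring. }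
replace (exp (6 * PI * t) * (2 * PI * (3 * hat b t - hat (xD b) t) + c 3%nat * exp (- (2 * PI * t * INR 3))))
  with (exp (6 * PI * t) * (2 * PI * (3 * hat b t - hat (xD b) t)) +
    c 3%nat * (exp (6 * PI * t) * exp (- (2 * PI * t * INR 3)))) by ring.
rewrite Ee; ring.
Qed.

Hypothesis Hinv : forall t, near1 t -> k (/ t) = - t ^ 2 * k t.

(** H (1/t) - H t has derivative 0 by the weight 2 relation and vanishes at t = 1. *)
Lemma primitive_inv (t : R) : near1 t -> H (/ t) = H t.
Proof.
intros Ht.
assert (HD : forall y, near1 y -> is_derive (fun y => H (/ y) - H y) y 0).
{ intros y Hy; assert (Hi := near1_inv y Hy).
  assert (Hy0 : y <> 0) by (destruct Hy; lra).
  assert (D1 := is_derive_inv_comp H y _ Hy0 (is_derive_primitive (/ y) (proj1 Hi))).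
  assert (D2 := is_derive_primitive y (proj1 Hy)).
  assert (D3 := is_derive_minus _ _ _ _ _ D1 D2).
  replace 0 with (minus (- k (/ y) / y ^ 2) (k y)); [exact D3|].
  change (- k (/ y) / y ^ 2 - k y = 0).
  rewrite Hinv by exact Hy; field; exact Hy0. }
assert (Hbt : forall y, Rmin 1 t <= y <= Rmax 1 t -> near1 y).
{ intros y Hy; destruct Ht as [H1 H2]; unfold near1.
  destruct (Rle_dec 1 t) as [h|h].
  - rewrite Rmin_left, Rmax_right in Hy by lra; lra.
  - rewrite Rmin_right, Rmax_left in Hy by lra; lra. }
destruct (MVT_gen (fun y => H (/ y) - H y) 1 t (fun _ => 0)) as [z [_ Hz]].
- intros y Hy; apply HD, Hbt; lra.
- intros y Hy; apply derivable_continuous_pt; exists 0; apply is_derive_Reals, HD, Hbt, Hy.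
- rewrite Rinv_1 in Hz; lra.
Qed.

Let K (j : nat) : R := Series (fun n => b n * exp (- fac n) * ell (fac n) j).

(** Re-expands the series in q as a series in w, under no more than |kap j| <= rho^j. So real w near
    0 and the corner i rho, on the boundary of the disc, are treated by the same lemma. *)
Lemma primitive_fubini (kap : nat -> R) : (forall j, Rabs (kap j) <= rho ^ j) ->
  is_series (fun j => K j * kap j)
    (Series (fun n => b n * exp (- fac n) * Series (fun j => ell (fac n) j * kap j))).
Proof.
intros Hk; assert (Hr := rho_bounds).
assert (Hr1 : 0 <= rho < 1) by lra.
set (a := fun n j => b n * exp (- fac n) * (ell (fac n) j * kap j)).
assert (Ha1 : forall n, ex_series (fun j => Rabs (a n j))).
{ intros n; apply ex_series_ext with (fun j => Rabs (b n * exp (- fac n)) * Rabs (ell (fac n) j * kap j)).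
  - intros j; symmetry; apply Rabs_mult.
  - exact (ex_series_scal_l (Rabs (b n * exp (- fac n))) _ (proj1 (ell_sum (fac n) rho kap Hr1 Hk))). }
assert (Ha2 : ex_series (fun n => Series (fun j => Rabs (a n j)))).
{ assert (HC := CV_disk_inside b (exp (- (2 * PI * rho))) (conv4_lt_pos _ _ conv4_primitive corner_nome)).
  apply (@ex_series_le R_AbsRing R_CompleteNormedModule) with
    (fun n => exp (12 * PI + 6 * PI * rho) * Rabs (b n * exp (- (2 * PI * rho)) ^ n)).
  - intros n.
    change (Rabs (Series (fun j => Rabs (a n j))) <= exp (12 * PI + 6 * PI * rho) * Rabs (b n * exp (- (2 * PI * rho)) ^ n)).
    rewrite (Series_ext _ (fun j => Rabs (b n * exp (- fac n)) * Rabs (ell (fac n) j * kap j)))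
      by (intros; apply Rabs_mult).
    rewrite Series_scal_l.
    destruct (ell_sum (fac n) rho kap Hr1 Hk) as [E1 [E2 _]].
    assert (E0 : 0 <= Series (fun j => Rabs (ell (fac n) j * kap j))).
    { apply Rle_trans with (sum_n (fun j => Rabs (ell (fac n) j * kap j)) 0).
      - rewrite sum_n_0; apply Rabs_pos.
      - apply sum_n_le_series; [intros; apply Rabs_pos| now apply Series_correct]. }
    rewrite Rabs_mult, Rabs_Rabsolu, (Rabs_pos_eq (Series _)) by exact E0.
    rewrite !Rabs_mult, (Rabs_pos_eq (exp (- fac n))) by (left; apply exp_pos).
    rewrite (Rabs_pos_eq (exp _ ^ n)) by (apply pow_le; left; apply exp_pos).
    replace (exp (12 * PI + 6 * PI * rho) * (Rabs (b n) * exp (- (2 * PI * rho)) ^ n))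
      with (Rabs (b n) * (exp (12 * PI + 6 * PI * rho) * exp (- (2 * PI * rho)) ^ n)) by ring.
    rewrite (Rmult_assoc (Rabs (b n))).
    apply Rmult_le_compat_l; [apply Rabs_pos|].
    apply Rle_trans with (exp (- fac n) * exp (2 * Rabs (fac n) * (rho / (1 - rho)))).
    + apply Rmult_le_compat_l; [left; apply exp_pos| exact E2].
    + apply fac_bound.
  - exact (ex_series_scal_l (exp (12 * PI + 6 * PI * rho)) _ HC). }
destruct (fubini a Ha1 Ha2) as [_ HF].
replace (Series (fun n => b n * exp (- fac n) * Series (fun j => ell (fac n) j * kap j)))
  with (Series (fun n => Series (a n))).
2:{ apply Series_ext; intros n; apply Series_scal_l. }
apply is_series_ext with (2 := HF); intros j; unfold K, a.
rewrite <- Series_scal_r; apply Series_ext; intros n; ring.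
Qed.

(** The Taylor coefficients of H in w; the linear term is expanded by t = 1 + 2 w/(1-w). *)
Let E (j : nat) : R := c 3%nat * (geo 0 j + 2 * geo 1 j) + K j.

Lemma E_series (kap : nat -> R) : (forall j, Rabs (kap j) <= rho ^ j) ->
  is_series (fun j => E j * kap j)
    (c 3%nat * (Series (fun j => geo 0 j * kap j) + 2 * Series (fun j => geo 1 j * kap j)) +
     Series (fun n => b n * exp (- fac n) * Series (fun j => ell (fac n) j * kap j))).
Proof.
intros Hk; assert (Hr := rho_bounds).
assert (Hg : forall i, is_series (fun j => geo i j * kap j) (Series (fun j => geo i j * kap j))).
{ intros i; apply Series_correct, geo_ex with rho; auto; lra. }
assert (G1 := is_series_scal_l 2 _ _ (Hg 1%nat)).
assert (G2 := is_series_scal_l (c 3%nat) _ _ (is_series_plus _ _ _ _ (Hg 0%nat) G1)).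
assert (G3 := is_series_plus _ _ _ _ G2 (primitive_fubini kap Hk)).
apply is_series_ext with (2 := G3); intros j; unfold E.
change (c 3%nat * (geo 0 j * kap j + 2 * (geo 1 j * kap j)) + K j * kap j =
  (c 3%nat * (geo 0 j + 2 * geo 1 j) + K j) * kap j); ring.
Qed.

Lemma E_real (w : R) : Rabs w < / 4 -> is_pseries E w (H ((1 + w) / (1 - w))).
Proof.
intros Hw; assert (Hr := rho_bounds).
assert (Hk : forall j, Rabs (w ^ j) <= rho ^ j).
{ intros j; rewrite <- RPow_abs; apply pow_incr; split; [apply Rabs_pos| lra]. }
assert (Hs := E_series (fun j => w ^ j) Hk).
assert (Hw' : -/ 4 < w < / 4) by (apply Rabs_def2 in Hw; lra).
apply is_pseries_R.
replace (H ((1 + w) / (1 - w))) with (c 3%nat * (Series (fun j => geo 0 j * w ^ j) + 2 * Series (fun j => geo 1 j * w ^ j)) +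
     Series (fun n => b n * exp (- fac n) * Series (fun j => ell (fac n) j * w ^ j))); [exact Hs|].
rewrite !geo_real by lra.
unfold H; f_equal.
- simpl; field; lra.
- unfold hat, PSeries; rewrite <- Series_scal_l; apply Series_ext; intros n.
  rewrite ell_real by lra; rewrite qexp_pow.
  transitivity (b n * (exp (- fac n) * exp (- fac n * (2 * w / (1 - w))))); [ring|].
  transitivity (b n * (exp (6 * PI * ((1 + w) / (1 - w))) * exp (- (2 * PI * ((1 + w) / (1 - w)) * INR n)))); [|ring].
  f_equal; rewrite <- !exp_plus; f_equal; unfold fac; field; lra.
Qed.

(** Since t -> 1/t is w -> -w, [primitive_inv] makes H even in w on a real interval, and uniqueness
    of power series carries this over to the coefficients. *)
Lemma E_odd (j : nat) : E (S (2 * j)) = 0.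
Proof.
set (E' := fun j => (-1) ^ j * E j).
assert (HE' : forall w, Rabs w < / 4 -> is_pseries E' w (H ((1 + w) / (1 - w)))).
{ intros w Hw.
  assert (Hw' : -/ 4 < w < / 4) by (apply Rabs_def2 in Hw; lra).
  replace (H ((1 + w) / (1 - w))) with (H ((1 + - w) / (1 - - w))).
  - assert (HE := E_real (- w) ltac:(rewrite Rabs_Ropp; exact Hw)).
    apply is_pseries_R in HE; apply is_pseries_R.
    apply is_series_ext with (2 := HE); intros i; unfold E'.
    replace (- w) with (-1 * w) by ring; rewrite Rpow_mult_distr.
    change (E i * ((-1) ^ i * w ^ i) = (-1) ^ i * E i * w ^ i :> R); ring.
  - rewrite <- (primitive_inv ((1 + w) / (1 - w))).
    + f_equal; field; lra.
    + split.
      * apply Rmult_lt_reg_r with (1 - w); [lra|]; unfold Rdiv; rewrite Rmult_assoc, Rinv_l; lra.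
      * apply Rmult_lt_reg_r with (1 - w); [lra|]; unfold Rdiv; rewrite Rmult_assoc, Rinv_l; lra. }
assert (Hex : forall a, (forall w, Rabs w < / 4 -> is_pseries a w (H ((1 + w) / (1 - w)))) ->
   Rbar_lt 0 (CV_radius a)).
{ intros a Ha; apply CV_radius_pos with (/ 8); [lra|].
  eexists; apply Ha; rewrite Rabs_pos_eq; lra. }
assert (Heq : E (S (2 * j)) = E' (S (2 * j))).
{ apply PSeries_ext_recip; [now apply Hex, E_real| now apply Hex|].
  exists (mkposreal (/ 4) ltac:(lra)); intros w Hw.
  assert (Hw' : Rabs w < / 4).
  { change (Rabs (w - 0) < / 4) in Hw; now rewrite Rminus_0_r in Hw. }
  rewrite (is_pseries_unique _ _ _ (E_real w Hw')).
  now rewrite (is_pseries_unique _ _ _ (HE' w Hw')). }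
unfold E' in Heq; rewrite pow_1_odd in Heq; lra.
Qed.

(* Otherwise [H] would have the non-real value [c 3 * exp (i PI / 6) + ...] at
   the corner, where all the other terms of its expansion are real. *)
Lemma constant_term_zero : c 3%nat = 0.
Proof.
assert (Hs := E_series ks (fun j => proj1 (proj2 (kcs_bound j)))).
assert (H0 : is_series (fun j => E j * ks j) 0).
{ apply is_series_ext with (2 := is_series_zero); intros j.
  change (0 = E j * ks j :> R).
  destruct (Nat.Even_or_Odd j) as [[i ->]|[i ->]].
  - unfold ks; rewrite ipow_even; ring.
  - replace (2 * i + 1)%nat with (S (2 * i)) by lia; rewrite E_odd; ring. }
apply is_series_unique in Hs; apply is_series_unique in H0; rewrite Hs in H0.
change (c 3%nat * (geos 0 + 2 * geos 1) +
  Series (fun n => b n * exp (- fac n) * Series (fun j => ell (fac n) j * ks j)) = 0) in H0.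
rewrite (proj2 (geo_cornerS 0)), (proj1 geo_corner0), (proj2 geo_corner0) in H0.
rewrite (Series_ext _ (fun _ => 0)) in H0.
- rewrite (is_series_unique _ _ is_series_zero) in H0; lra.
- intros n; unfold fac.
  replace (INR n - 3) with (IZR (Z.of_nat n - 3)) by (rewrite minus_IZR, <- INR_IZR_INZ; reflexivity).
  rewrite ell_corner; ring.
Qed.

End ConstantTerm.

(** * Theta series with polynomial moments *)

Ltac R_eq := match goal with |- @eq _ ?a ?b => change (@eq R a b) end.

Lemma is_series_even (a : nat -> R) (l : R) : (forall j, a (S (2 * j)) = 0) ->
  is_series a l -> is_series (fun j => a (2 * j)%nat) l.
Proof.
intros H Ha.
change (is_lim_seq (sum_n (fun j => a (2 * j)%nat)) l).
apply is_lim_seq_ext with (fun N => sum_n a (2 * N)).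
- intros N; induction N as [|N IH]; [rewrite Nat.mul_0_r, !sum_n_0; reflexivity|].
  replace (2 * S N)%nat with (S (S (2 * N))) by lia.
  rewrite !(sum_n_S a), IH, (sum_n_S (fun j => a (2 * j)%nat)), H, Rplus_0_r.
  replace (2 * S N)%nat with (S (S (2 * N))) by lia; reflexivity.
- apply (is_lim_seq_sub (sum_n a) l (fun N => 2 * N)%nat); [intros; lia| exact Ha].
Qed.

Lemma cosh_series (x : R) : is_series (fun j => x ^ (2 * j) / INR (fact (2 * j))) ((exp x + exp (- x)) / 2).
Proof.
assert (H := is_series_scal_l (/ 2) _ _ (is_series_plus _ _ _ _ (exp_series x) (exp_series (- x)))).
assert (H' := is_series_even (fun k => / 2 * (x ^ k / INR (fact k) + (- x) ^ k / INR (fact k))) (/ 2 * (exp x + exp (- x)))).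
replace ((exp x + exp (- x)) / 2) with (/ 2 * (exp x + exp (- x))) by field.
apply is_series_ext with (2 := H' ltac:(intros j; replace (- x) with (-1 * x) by ring;
  rewrite Rpow_mult_distr, pow_1_odd; unfold Rdiv; R_eq; ring) H).
intros j; replace (- x) with (-1 * x) by ring; rewrite (Rpow_mult_distr (-1)), pow_1_even.
R_eq; field; apply INR_fact_neq_0.
Qed.

Lemma cos_series (x : R) : is_series (fun j => (-1) ^ j * (x ^ (2 * j) / INR (fact (2 * j)))) (cos x).
Proof.
unfold cos; destruct (exist_cos (Rsqr x)) as [c Hc].
apply is_series_Reals in Hc; apply is_series_ext with (2 := Hc); intros j.
unfold cos_n, Rsqr; rewrite pow_mult; replace (x ^ 2) with (x * x) by ring.
unfold Rdiv; R_eq; ring.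
Qed.

(** One-sided, because the relation between theta series is a relation in x = y^2 > 0. *)
Lemma PSeries_zero_right (d : nat -> R) (eps : R) : 0 < eps -> Rbar_lt 0 (CV_radius d) ->
  (forall x, 0 < x < eps -> PSeries d x = 0) -> forall n, d n = 0.
Proof.
intros He Hr H n; revert d Hr H; induction n as [|n IH]; intros d Hr H.
- destruct (Req_dec (d 0%nat) 0) as [H0|H0]; [exact H0|exfalso].
  assert (Hc : continuity_pt (PSeries d) 0) by (apply PSeries_continuity; rewrite Rabs_R0; exact Hr).
  apply continuity_pt_filterlim in Hc.
  assert (Ha : 0 < Rabs (d 0%nat)) by now apply Rabs_pos_lt.
  rewrite PSeries_0 in Hc.
  destruct (Hc (ball (d 0%nat) (mkposreal _ Ha)) (locally_ball _ _)) as [del Hdel].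
  set (x := Rmin (eps / 2) (del / 2)).
  assert (Hdp := cond_pos del).
  assert (Hx : 0 < x) by (unfold x; apply Rmin_case; lra).
  assert (h1 := Rmin_l (eps / 2) (del / 2)); assert (h2 := Rmin_r (eps / 2) (del / 2)); fold x in h1, h2.
  assert (Hb : ball 0 del x).
  { change (Rabs (x - 0) < del); rewrite Rminus_0_r, Rabs_pos_eq; lra. }
  specialize (Hdel x Hb); change (Rabs (PSeries d x - d 0%nat) < Rabs (d 0%nat)) in Hdel.
  rewrite H in Hdel by lra; rewrite Rabs_minus_sym, Rminus_0_r in Hdel; lra.
- assert (H0 : d 0%nat = 0).
  { clear IH; destruct (Req_dec (d 0%nat) 0) as [H0|H0]; [exact H0|exfalso].
    assert (Hc : continuity_pt (PSeries d) 0) by (apply PSeries_continuity; rewrite Rabs_R0; exact Hr).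
    apply continuity_pt_filterlim in Hc.
    assert (Ha : 0 < Rabs (d 0%nat)) by now apply Rabs_pos_lt.
    rewrite PSeries_0 in Hc.
    destruct (Hc (ball (d 0%nat) (mkposreal _ Ha)) (locally_ball _ _)) as [del Hdel].
    set (x := Rmin (eps / 2) (del / 2)).
    assert (Hdp := cond_pos del).
    assert (Hx : 0 < x) by (unfold x; apply Rmin_case; lra).
    assert (h1 := Rmin_l (eps / 2) (del / 2)); assert (h2 := Rmin_r (eps / 2) (del / 2)); fold x in h1, h2.
    assert (Hb : ball 0 del x).
    { change (Rabs (x - 0) < del); rewrite Rminus_0_r, Rabs_pos_eq; lra. }
    specialize (Hdel x Hb); change (Rabs (PSeries d x - d 0%nat) < Rabs (d 0%nat)) in Hdel.
    rewrite H in Hdel by lra; rewrite Rabs_minus_sym, Rminus_0_r in Hdel; lra. }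
  apply (IH (PS_decr_1 d)).
  + now rewrite CV_radius_decr_1.
  + intros x Hx.
    assert (E : PSeries d x = x * PSeries (PS_decr_1 d) x).
    { rewrite <- PSeries_incr_1; apply PSeries_ext; intros [|k]; [exact H0| reflexivity]. }
    rewrite H in E by exact Hx.
    symmetry in E; apply Rmult_integral in E; destruct E as [E|E]; [lra| exact E].
Qed.

Lemma CV_radius_infty (a : nat -> R) : (forall x, 0 < x -> ex_pseries a x) -> CV_radius a = p_infty.
Proof.
intros H; destruct (CV_radius a) as [r| |] eqn:E; [|reflexivity|].
- exfalso; apply (CV_disk_outside a (Rabs r + 1)).
  + rewrite E; simpl; rewrite Rabs_pos_eq; assert (h := Rle_abs r); assert (h' := Rabs_pos r); lra.
  + assert (Hx := H (Rabs r + 1) ltac:(assert (h' := Rabs_pos r); lra)).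
    destruct Hx as [s Hs]; apply is_pseries_R in Hs.
    apply (ex_series_lim_0 (fun n => a n * (Rabs r + 1) ^ n)); now exists s.
- assert (h := CV_radius_ge_0 a); rewrite E in h; contradiction.
Qed.

Section Theta.
Variables (l : nat -> list R) (N : R).

(** In the application [l n] lists the inner products of v with the lattice vectors of norm 2n, and
    N is the norm of v. Poisson summation over the lattice enters this section as the hypothesis
    [Hpoisson]. *)
Definition asum (n : nat) (F : R -> R) : R := fold_right (fun x acc => F x + acc) 0 (l n).

Lemma asum_ext (n : nat) (F G : R -> R) : (forall x, F x = G x) -> asum n F = asum n G.
Proof. intros H; unfold asum; induction (l n) as [|x s IH]; simpl; [reflexivity|]; now rewrite H, IH. Qed.

Lemma asum_plus (n : nat) (F G : R -> R) : asum n (fun x => F x + G x) = asum n F + asum n G.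
Proof. unfold asum; induction (l n) as [|x s IH]; simpl; [ring|]; rewrite IH; ring. Qed.

Lemma asum_scal (n : nat) (c : R) (F : R -> R) : asum n (fun x => c * F x) = c * asum n F.
Proof. unfold asum; induction (l n) as [|x s IH]; simpl; [ring|]; rewrite IH; ring. Qed.

Lemma asum_le (n : nat) (F G : R -> R) : (forall x, F x <= G x) -> asum n F <= asum n G.
Proof. intros H; unfold asum; induction (l n) as [|x s IH]; simpl; [lra|]; specialize (H x); lra. Qed.

Lemma asum_abs (n : nat) (F : R -> R) : Rabs (asum n F) <= asum n (fun x => Rabs (F x)).
Proof.
unfold asum; induction (l n) as [|x s IH]; simpl; [rewrite Rabs_R0; lra|].
apply Rle_trans with (1 := Rabs_triang _ _); lra.
Qed.

Lemma asum_series (n : nat) (g : nat -> R -> R) (G : R -> R) :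
  (forall x, is_series (fun j => g j x) (G x)) -> is_series (fun j => asum n (g j)) (asum n G).
Proof.
intros H; unfold asum; induction (l n) as [|x s IH]; simpl; [apply is_series_zero|].
exact (is_series_plus _ _ _ _ (H x) IH).
Qed.

Hypothesis Hsym : forall n F, asum n (fun x => F (- x)) = asum n F.

Hypothesis Hpoisson : forall t s, 0 < t -> exists u v,
  is_series (fun n => qexp t ^ n * asum n (fun x => exp (- (2 * PI * t * s * x)))) u /\
  is_series (fun n => qexp (/ t) ^ n * asum n (fun x => cos (2 * PI * s * x))) v /\
  exp (- (PI * t * s ^ 2 * N)) * u = / t ^ 24 * v.

Definition cosh_sum (t x : R) : R :=
  Series (fun n => qexp t ^ n * asum n (fun y => (exp (x * y) + exp (- (x * y))) / 2)).

Lemma cosh_sum_series (t s : R) : 0 < t -> forall u,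
  is_series (fun n => qexp t ^ n * asum n (fun x => exp (- (2 * PI * t * s * x)))) u ->
  is_series (fun n => qexp t ^ n * asum n (fun y => (exp (2 * PI * t * s * y) + exp (- (2 * PI * t * s * y))) / 2)) u.
Proof.
intros Ht u Hu; apply is_series_ext with (2 := Hu); intros n.
replace (asum n (fun y => (exp (2 * PI * t * s * y) + exp (- (2 * PI * t * s * y))) / 2))
  with (asum n (fun x => exp (- (2 * PI * t * s * x)))); [reflexivity|].
transitivity (/ 2 * (asum n (fun y => exp (2 * PI * t * s * y)) + asum n (fun y => exp (- (2 * PI * t * s * y))))).
- rewrite <- (Hsym n (fun y => exp (2 * PI * t * s * y))).
  rewrite (asum_ext n (fun x => exp (2 * PI * t * s * - x)) (fun x => exp (- (2 * PI * t * s * x)))).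
  + field.
  + intros x; f_equal; ring.
- rewrite <- asum_plus, <- asum_scal; apply asum_ext; intros x; field.
Qed.

Lemma cosh_sum_ex (t x : R) : 0 < t ->
  ex_series (fun n => qexp t ^ n * asum n (fun y => (exp (x * y) + exp (- (x * y))) / 2)).
Proof.
intros Ht; assert (HPI := PI_RGT_0).
destruct (Hpoisson t (x / (2 * PI * t)) Ht) as [u [_ [Hu _]]].
apply cosh_sum_series in Hu; [|exact Ht]; exists u.
replace (2 * PI * t * (x / (2 * PI * t))) with x in Hu by (field; lra); exact Hu.
Qed.

Definition mu (j n : nat) : R := asum n (fun x => x ^ (2 * j)).

(* Interchange of the sum over the lattice with the Taylor series in [x]. *)
Lemma theta_taylor (t x : R) (w : nat -> R) (G : R -> R) : 0 < t -> (forall j, Rabs (w j) <= 1) ->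
  (forall y, is_series (fun j => w j * ((x * y) ^ (2 * j) / INR (fact (2 * j)))) (G y)) ->
  (forall j, ex_series (fun n => Rabs (qexp t ^ n * (w j * (x ^ (2 * j) / INR (fact (2 * j)))) * mu j n))) /\
  is_series (fun j => w j * (x ^ (2 * j) / INR (fact (2 * j))) * hat (mu j) t)
    (Series (fun n => qexp t ^ n * asum n G)).
Proof.
intros Ht Hw HG.
set (a := fun n j => qexp t ^ n * (w j * (x ^ (2 * j) / INR (fact (2 * j)))) * mu j n).
assert (Hq : forall n, 0 <= qexp t ^ n) by (intros; apply pow_le; left; apply qexp_pos).
assert (Ea : forall n j, a n j = qexp t ^ n * asum n (fun y => w j * ((x * y) ^ (2 * j) / INR (fact (2 * j))))).
{ intros n j; unfold a, mu; rewrite (Rmult_assoc (qexp t ^ n)), <- asum_scal; f_equal.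
  apply asum_ext; intros y; rewrite Rpow_mult_distr; unfold Rdiv; ring. }
assert (Hrow : forall n, is_series (a n) (qexp t ^ n * asum n G)).
{ intros n; apply is_series_ext with (fun j => qexp t ^ n * asum n (fun y => w j * ((x * y) ^ (2 * j) / INR (fact (2 * j))))).
  - intros; symmetry; apply Ea.
  - exact (is_series_scal_l (qexp t ^ n) _ _ (asum_series n _ G HG)). }
assert (Hdom : forall n, is_series (fun j => qexp t ^ n * asum n (fun y => (x * y) ^ (2 * j) / INR (fact (2 * j))))
   (qexp t ^ n * asum n (fun y => (exp (x * y) + exp (- (x * y))) / 2))).
{ intros n; exact (is_series_scal_l (qexp t ^ n) _ _ (asum_series n _ _ (fun y => cosh_series (x * y)))). }
assert (Hev : forall y j, 0 <= (x * y) ^ (2 * j) / INR (fact (2 * j))).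
{ intros y j; apply Rdiv_le_0_compat; [rewrite pow_mult; apply pow_le, pow2_ge_0| apply INR_fact_lt_0]. }
assert (Hle : forall n j, 0 <= Rabs (a n j) <= qexp t ^ n * asum n (fun y => (x * y) ^ (2 * j) / INR (fact (2 * j)))).
{ intros n j; split; [apply Rabs_pos|]; rewrite Ea, Rabs_mult, (Rabs_pos_eq (qexp t ^ n)) by apply Hq.
  apply Rmult_le_compat_l; [apply Hq|]; apply Rle_trans with (1 := asum_abs _ _), asum_le; intros y.
  rewrite Rabs_mult, (Rabs_pos_eq (_ / _)) by apply Hev.
  rewrite <- (Rmult_1_l (_ / _)) at 2; apply Rmult_le_compat_r; [apply Hev| apply Hw]. }
assert (H1 : forall n, ex_series (fun j => Rabs (a n j))).
{ intros n; apply (@ex_series_le R_AbsRing R_CompleteNormedModule) with (2 := ex_intro _ _ (Hdom n)).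
  intros j; change (Rabs (Rabs (a n j)) <= qexp t ^ n * asum n (fun y => (x * y) ^ (2 * j) / INR (fact (2 * j)))).
  rewrite Rabs_Rabsolu; apply Hle. }
assert (H2 : ex_series (fun n => Series (fun j => Rabs (a n j)))).
{ apply (@ex_series_le R_AbsRing R_CompleteNormedModule) with (2 := cosh_sum_ex t x Ht).
  intros n; change (Rabs (Series (fun j => Rabs (a n j))) <= qexp t ^ n * asum n (fun y => (exp (x * y) + exp (- (x * y))) / 2)).
  rewrite Rabs_pos_eq.
  - rewrite <- (is_series_unique _ _ (Hdom n)); apply Series_le; [apply Hle| eexists; apply Hdom].
  - apply Rle_trans with (sum_n (fun j => Rabs (a n j)) 0).
    + rewrite sum_n_0; apply Rabs_pos.
    + apply sum_n_le_series; [intros; apply Rabs_pos| now apply Series_correct]. }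
destruct (fubini a H1 H2) as [Hcol HF]; split; [exact Hcol|].
replace (Series (fun n => qexp t ^ n * asum n G)) with (Series (fun n => Series (a n))).
2:{ apply Series_ext; intros n; apply is_series_unique, Hrow. }
apply is_series_ext with (2 := HF); intros j.
unfold hat, PSeries; rewrite <- Series_scal_l; apply Series_ext; intros n; unfold a; ring.
Qed.

(** Every x in (0, 1/4) is the nome of some t > 0, and the interchange at argument 1 includes
    absolute convergence of each moment series. *)
Lemma conv4_mu (j : nat) : conv4 (mu j).
Proof.
assert (HPI : 3 < PI) by (assert (h := PI2_3_2); lra).
apply conv4_ex; intros x Hx.
set (t := - ln x / (2 * PI)).
assert (Hln : ln x < 0) by (rewrite <- ln_1; apply ln_increasing; lra).
assert (Ht : 0 < t) by (unfold t; apply Rdiv_lt_0_compat; lra).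
assert (Hq : qexp t = x).
{ unfold qexp, t; replace (- (2 * PI * (- ln x / (2 * PI)))) with (ln x) by (field; lra).
  apply exp_ln; lra. }
destruct (theta_taylor t 1 (fun _ => 1) _ Ht ltac:(intros; cbv beta; rewrite Rabs_R1; lra)
  (fun y => is_series_ext _ _ _ (fun j => eq_sym (Rmult_1_l _)) (cosh_series (1 * y)))) as [H _].
specialize (H j); apply ex_series_Rabs in H.
assert (H' := ex_series_scal_l (INR (fact (2 * j))) _ H).
destruct H' as [s Hs]; exists s; apply is_pseries_R; apply is_series_ext with (2 := Hs); intros n.
rewrite Hq; change (INR (fact (2 * j)) * (x ^ n * (1 * (1 ^ (2 * j) / INR (fact (2 * j)))) * mu j n) = mu j n * x ^ n :> R).
rewrite pow1; field; apply INR_fact_neq_0.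
Qed.

Definition tcoef (t : R) (j : nat) : R := hat (mu j) t / INR (fact (2 * j)).

Lemma tcoef_pos (t x : R) : 0 < t -> is_pseries (tcoef t) (x ^ 2) (cosh_sum t x).
Proof.
intros Ht.
destruct (theta_taylor t x (fun _ => 1) _ Ht ltac:(intros; cbv beta; rewrite Rabs_R1; lra)
  (fun y => is_series_ext _ _ _ (fun j => eq_sym (Rmult_1_l _)) (cosh_series (x * y)))) as [_ H].
apply is_pseries_R; apply is_series_ext with (2 := H); intros j; unfold tcoef.
rewrite pow_mult; unfold Rdiv.
change (1 * ((x ^ 2) ^ j * / INR (fact (2 * j))) * hat (mu j) t =
  hat (mu j) t * / INR (fact (2 * j)) * (x ^ 2) ^ j :> R); ring.
Qed.

Lemma tcoef_neg (t x : R) : 0 < t ->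
  is_pseries (tcoef t) (- x ^ 2) (Series (fun n => qexp t ^ n * asum n (fun y => cos (x * y)))).
Proof.
intros Ht.
destruct (theta_taylor t x (fun j => (-1) ^ j) _ Ht
   ltac:(intros; cbv beta; rewrite pow_1_abs; lra) (fun y => cos_series (x * y))) as [_ H].
apply is_pseries_R; apply is_series_ext with (2 := H); intros j; unfold tcoef.
replace (- x ^ 2) with (-1 * x ^ 2) by ring; rewrite Rpow_mult_distr, <- (pow_mult x); unfold Rdiv.
change ((-1) ^ j * (x ^ (2 * j) * / INR (fact (2 * j))) * hat (mu j) t =
  hat (mu j) t * / INR (fact (2 * j)) * ((-1) ^ j * x ^ (2 * j)) :> R); ring.
Qed.

Lemma CV_radius_tcoef (t : R) : 0 < t -> CV_radius (tcoef t) = p_infty.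
Proof.
intros Ht; apply CV_radius_infty; intros x Hx.
assert (h := tcoef_pos t (sqrt x) Ht); rewrite pow2_sqrt in h by lra; eexists; exact h.
Qed.

(** Inversion turns the hyperbolic cosine in x.v into a cosine, hence the argument t^2 y^2 on one
    side and -y^2 on the other. *)
Lemma tcoef_relation (t y : R) : 0 < t ->
  exp (- (t * y ^ 2 * N / (4 * PI))) * PSeries (tcoef t) (t ^ 2 * y ^ 2) =
  / t ^ 24 * PSeries (tcoef (/ t)) (- y ^ 2).
Proof.
intros Ht; assert (HPI := PI_RGT_0).
destruct (Hpoisson t (y / (2 * PI)) Ht) as [u [v [Hu [Hv E]]]].
apply cosh_sum_series in Hu; [|exact Ht].
replace (PI * t * (y / (2 * PI)) ^ 2 * N) with (t * y ^ 2 * N / (4 * PI)) in E by (field; lra).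
replace (t ^ 2 * y ^ 2) with ((t * y) ^ 2) by ring.
rewrite (is_pseries_unique _ _ _ (tcoef_pos t (t * y) Ht)).
rewrite (is_pseries_unique _ _ _ (tcoef_neg (/ t) y (Rinv_0_lt_compat _ Ht))).
replace (cosh_sum t (t * y)) with u.
- rewrite E; f_equal; symmetry; apply is_series_unique.
  apply is_series_ext with (2 := Hv); intros n.
  replace (2 * PI * (y / (2 * PI))) with y by (field; lra); reflexivity.
- symmetry; apply is_series_unique; apply is_series_ext with (2 := Hu); intros n.
  replace (2 * PI * t * (y / (2 * PI))) with (t * y) by (field; lra); reflexivity.
Qed.

Definition ecoef (t : R) (i : nat) : R := (- (N * hat E2s t / 24)) ^ i / INR (fact i).

(** The factor exp (-N E2 x / 24) restores modularity: the anomalous term of E2 cancels the Gaussian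
    factor of [tcoef_relation]. It is the usual passage from the Taylor coefficients of a Jacobi
    form to modular forms. *)
Definition gcoef (t : R) : nat -> R := PS_mult (ecoef t) (tcoef t).

Lemma ecoef_series (t x : R) : is_pseries (ecoef t) x (exp (- (N * hat E2s t / 24) * x)).
Proof.
apply is_pseries_R; apply is_series_ext with (2 := exp_series _); intros i; unfold ecoef.
rewrite Rpow_mult_distr; unfold Rdiv.
generalize ((- (N * hat E2s t * / 24)) ^ i) (x ^ i) (/ INR (fact i)); intros p q r.
change (p * q * r = p * r * q :> R); ring.
Qed.

Lemma CV_radius_ecoef (t : R) : CV_radius (ecoef t) = p_infty.
Proof. apply CV_radius_infty; intros x _; eexists; apply ecoef_series. Qed.

Lemma PSeries_gcoef (t x : R) : 0 < t ->
  PSeries (gcoef t) x = exp (- (N * hat E2s t / 24) * x) * PSeries (tcoef t) x.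
Proof.
intros Ht; unfold gcoef; rewrite PSeries_mult.
- now rewrite (is_pseries_unique _ _ _ (ecoef_series t x)).
- now rewrite CV_radius_ecoef.
- now rewrite CV_radius_tcoef.
Qed.

Lemma CV_radius_gcoef (t : R) : 0 < t -> CV_radius (gcoef t) = p_infty.
Proof.
intros Ht; apply CV_radius_infty; intros x Hx; apply ex_pseries_mult.
- now rewrite CV_radius_ecoef.
- now rewrite CV_radius_tcoef.
Qed.

(** Weight 24 + 2j on the imaginary axis: the factor (i t)^(24+2j) has sign (-1)^j. *)
Lemma gcoef_inv (t : R) (j : nat) : near1 t ->
  gcoef (/ t) j = (-1) ^ j * t ^ (24 + 2 * j) * gcoef t j.
Proof.
intros Ht; assert (Hi := near1_inv t Ht); assert (HPI := PI_RGT_0).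
assert (Ht0 : 0 < t) by (destruct Ht; lra).
assert (Hi0 : 0 < / t) by now apply Rinv_0_lt_compat.
set (a := fun j => (-1) ^ j * gcoef (/ t) j).
set (b := fun j => t ^ 24 * ((t ^ 2) ^ j * gcoef t j)).
assert (Ha : forall x, PSeries a x = PSeries (gcoef (/ t)) (- x)).
{ intros x; unfold PSeries, a; apply Series_ext; intros i.
  replace (- x) with (-1 * x) by ring; rewrite (Rpow_mult_distr (-1) x); ring. }
assert (Hb : forall x, PSeries b x = t ^ 24 * PSeries (gcoef t) (t ^ 2 * x)).
{ intros x; unfold PSeries, b; rewrite <- Series_scal_l; apply Series_ext; intros i.
  rewrite (Rpow_mult_distr (t ^ 2) x); ring. }
assert (Hexa : forall x, ex_pseries a x).
{ intros x; assert (h : ex_pseries (gcoef (/ t)) (- x)).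
  { apply CV_radius_inside; now rewrite CV_radius_gcoef. }
  destruct h as [s Hs]; exists s; apply is_pseries_R; apply is_pseries_R in Hs.
  apply is_series_ext with (2 := Hs); intros i; unfold a.
  replace (- x) with (-1 * x) by ring; rewrite (Rpow_mult_distr (-1) x).
  change (gcoef (/ t) i * ((-1) ^ i * x ^ i) = (-1) ^ i * gcoef (/ t) i * x ^ i :> R); ring. }
assert (Hexb : forall x, ex_pseries b x).
{ intros x; assert (h : ex_pseries (gcoef t) (t ^ 2 * x)).
  { apply CV_radius_inside; now rewrite CV_radius_gcoef. }
  destruct h as [s Hs]; exists (t ^ 24 * s); apply is_pseries_R; apply is_pseries_R in Hs.
  apply is_series_ext with (2 := is_series_scal_l (t ^ 24) _ _ Hs); intros i; unfold b.
  rewrite (Rpow_mult_distr (t ^ 2) x).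
  change (t ^ 24 * (gcoef t i * ((t ^ 2) ^ i * x ^ i)) = t ^ 24 * ((t ^ 2) ^ i * gcoef t i) * x ^ i :> R); ring. }
assert (Hd : PS_minus a b j = 0).
{ apply PSeries_zero_right with 1; [lra| |].
  - rewrite CV_radius_infty; [exact I|]; intros x _.
    apply (@ex_pseries_minus R_AbsRing R_NormedModule); auto.
  - intros x Hx; rewrite PSeries_minus by auto; rewrite Ha, Hb, !PSeries_gcoef by assumption.
    assert (E := tcoef_relation t (sqrt x) Ht0); rewrite !pow2_sqrt in E by lra.
    assert (E' : PSeries (tcoef (/ t)) (- x) = t ^ 24 * (exp (- (t * x * N / (4 * PI))) * PSeries (tcoef t) (t ^ 2 * x))).
    { rewrite E; field; lra. }
    rewrite E', E2_inv by exact Ht.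
    set (T := PSeries (tcoef t) (t ^ 2 * x)).
    assert (Ee : exp (- (N * (- t ^ 2 * hat E2s t + 6 * t / PI) / 24) * - x) * exp (- (t * x * N / (4 * PI)))
      = exp (- (N * hat E2s t / 24) * (t ^ 2 * x))).
    { rewrite <- exp_plus; f_equal; field; lra. }
    rewrite <- Ee; ring. }
unfold PS_minus, PS_plus, PS_opp, a, b in Hd.
change ((-1) ^ j * gcoef (/ t) j + - (t ^ 24 * ((t ^ 2) ^ j * gcoef t j)) = 0) in Hd.
assert (Hs : (-1) ^ j * (-1) ^ j = 1).
{ rewrite <- Rpow_mult_distr; replace (-1 * -1) with 1 by ring; apply pow1. }
rewrite pow_add, pow_mult.
transitivity ((-1) ^ j * ((-1) ^ j * gcoef (/ t) j)); [rewrite <- Rmult_assoc, Hs; ring|].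
replace ((-1) ^ j * gcoef (/ t) j) with (t ^ 24 * ((t ^ 2) ^ j * gcoef t j)) by lra; ring.
Qed.

End Theta.

(** * The moments of the first shell *)

Fixpoint PS_pow (a : nat -> R) (n : nat) : nat -> R :=
  match n with O => PS_one | S n => PS_mult a (PS_pow a n) end.

Lemma conv4_pow (a : nat -> R) (n : nat) : conv4 a -> conv4 (PS_pow a n).
Proof.
intros Ha; induction n as [|n IH]; [apply conv4_one| now apply conv4_mult].
Qed.

Lemma hat_pow (a : nat -> R) (n : nat) (t : R) : conv4 a -> / 2 < t ->
  hat (PS_pow a n) t = hat a t ^ n.
Proof.
intros Ha Ht; induction n as [|n IH]; [apply hat_one|].
simpl; rewrite hat_mult, IH; auto; now apply conv4_pow.
Qed.

(** After division by q^3 the constant term involves the coefficients of index 0 to 3 only; index 3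
    is the shell of norm 6. *)
Definition coefs4 (a : nat -> R) (x0 x1 x2 x3 : R) : Prop :=
  a 0%nat = x0 /\ a 1%nat = x1 /\ a 2%nat = x2 /\ a 3%nat = x3.

Lemma coefs4_mult (a b : nat -> R) (x0 x1 x2 x3 y0 y1 y2 y3 : R) :
  coefs4 a x0 x1 x2 x3 -> coefs4 b y0 y1 y2 y3 ->
  coefs4 (PS_mult a b) (x0 * y0) (x0 * y1 + x1 * y0) (x0 * y2 + x1 * y1 + x2 * y0)
    (x0 * y3 + x1 * y2 + x2 * y1 + x3 * y0).
Proof.
intros [<- [<- [<- <-]]] [<- [<- [<- <-]]]; repeat split; reflexivity.
Qed.

Lemma coefs4_eq (a : nat -> R) (x0 x1 x2 x3 y0 y1 y2 y3 : R) :
  coefs4 a x0 x1 x2 x3 -> x0 = y0 -> x1 = y1 -> x2 = y2 -> x3 = y3 -> coefs4 a y0 y1 y2 y3.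
Proof. intros H <- <- <- <-; exact H. Qed.

Lemma coefs4_one : coefs4 PS_one 1 0 0 0.
Proof. repeat split. Qed.

Lemma coefs4_phi : coefs4 phi 1 (-1) (-1) 0.
Proof. repeat split; reflexivity. Qed.

Lemma coefs4_psi : coefs4 psi 1 1 2 3.
Proof.
destruct coefs4_phi as [P0 [P1 [P2 P3]]].
assert (H0 := PS_mult_phi_psi 0); assert (H1 := PS_mult_phi_psi 1);
  assert (H2 := PS_mult_phi_psi 2); assert (H3 := PS_mult_phi_psi 3).
unfold PS_mult in H0, H1, H2, H3; cbn [sum_f_R0 Nat.sub PS_one] in H0, H1, H2, H3.
rewrite P0, ?P1, ?P2, ?P3 in *.
repeat split; lra.
Qed.

(** Polynomial in n, so that the power 72 is reached by induction and not by 72 explicit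
    products. *)
Lemma coefs4_psi_pow (n : nat) : coefs4 (PS_pow psi n) 1 (INR n)
  (INR n * (INR n + 3) / 2) (INR n * (INR n + 1) * (INR n + 8) / 6).
Proof.
induction n as [|n IH].
- apply (coefs4_eq _ _ _ _ _ _ _ _ _ coefs4_one); simpl; field.
- apply (coefs4_eq _ _ _ _ _ _ _ _ _ (coefs4_mult _ _ _ _ _ _ _ _ _ _ coefs4_psi IH));
    rewrite ?S_INR; field.
Qed.

Lemma coefs4_E2 : coefs4 E2s 1 (-24) (-72) (-96).
Proof.
destruct coefs4_phi as [P0 [P1 [P2 P3]]]; destruct coefs4_psi as [Q0 [Q1 [Q2 Q3]]].
repeat split; unfold E2s, PS_plus, PS_scal, PS_mult, xD; cbn [sum_f_R0 Nat.sub PS_one];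
  rewrite ?P0, ?P1, ?P2, ?P3, ?Q0, ?Q1, ?Q2, ?Q3; unfold plus, scal; simpl; unfold mult; simpl; ring.
Qed.

Lemma coefs4_E4 : coefs4 E4s 1 240 2160 6720.
Proof.
destruct coefs4_E2 as [P0 [P1 [P2 P3]]].
repeat split; unfold E4s, PS_plus, PS_scal, PS_mult, xD; cbn [sum_f_R0 Nat.sub];
  rewrite ?P0, ?P1, ?P2, ?P3; unfold plus, scal; simpl; unfold mult; simpl; ring.
Qed.

Lemma coefs4_E6 : coefs4 E6s 1 (-504) (-16632) (-122976).
Proof.
destruct coefs4_E2 as [P0 [P1 [P2 P3]]]; destruct coefs4_E4 as [Q0 [Q1 [Q2 Q3]]].
repeat split; unfold E6s, PS_plus, PS_scal, PS_mult, xD; cbn [sum_f_R0 Nat.sub];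
  rewrite ?P0, ?P1, ?P2, ?P3, ?Q0, ?Q1, ?Q2, ?Q3; unfold plus, scal; simpl; unfold mult; simpl; ring.
Qed.

Lemma hat_pow_inv (a : nat -> R) (e : R) (k n : nat) (t : R) : conv4 a -> near1 t ->
  hat a (/ t) = e * t ^ k * hat a t ->
  hat (PS_pow a n) (/ t) = e ^ n * t ^ (k * n) * hat (PS_pow a n) t.
Proof.
intros Ha Ht H; assert (Hi := near1_inv t Ht).
rewrite !hat_pow by (auto; apply Ht || apply Hi).
rewrite H, !Rpow_mult_distr, pow_mult; ring.
Qed.

Lemma eta_pos (t : R) : / 2 < t -> eta t <> 0.
Proof.
intros Ht; rewrite eta_hat by lra; apply Rmult_integral_contrapositive; split.
- apply Rgt_not_eq, exp_pos.
- intros H0; assert (h := hat_phi_psi t Ht); rewrite H0 in h; lra.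
Qed.

(** [psi]^72 / q^3 is the inverse cube of the discriminant. *)
Lemma hat_psi72 (t : R) : / 2 < t ->
  exp (6 * PI * t) * hat (PS_pow psi 72) t = / eta t ^ 72.
Proof.
intros Ht; rewrite hat_pow by (auto; apply conv4_psi).
assert (H1 := hat_phi_psi t Ht).
assert (H2 : hat psi t = exp (- (PI * t / 12)) / eta t).
{ rewrite eta_hat by lra.
  assert (hat phi t <> 0) by (intros h; rewrite h in H1; lra).
  assert (he := exp_pos (- (PI * t / 12))).
  apply (Rmult_eq_reg_l (hat phi t)); [|assumption]; rewrite H1; field; lra. }
rewrite H2; unfold Rdiv at 1; rewrite Rpow_mult_distr, exp_pow, pow_inv, <- Rmult_assoc, <- exp_plus.
replace (6 * PI * t + INR 72 * - (PI * t / 12)) with 0; [rewrite exp_0; ring|].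
replace (INR 72) with 72 by (rewrite INR_IZR_INZ; reflexivity); field.
Qed.

Lemma eta72_inv (t : R) : near1 t -> eta (/ t) ^ 72 = t ^ 36 * eta t ^ 72.
Proof.
intros Ht; assert (Ht0 : 0 < t) by (destruct Ht; lra).
assert (Hs : 0 < sqrt t) by now apply sqrt_lt_R0.
assert (E : eta (/ t) = sqrt t * eta t) by (rewrite (eta_inv t) by exact Ht0; field; lra).
rewrite E, Rpow_mult_distr; f_equal.
replace 72%nat with (2 * 36)%nat by reflexivity; rewrite pow_mult, pow2_sqrt by lra; reflexivity.
Qed.

Lemma conv4_sum (a : nat -> nat -> R) (j : nat) : (forall i, conv4 (a i)) ->
  conv4 (fun n => sum_f_R0 (fun i => a i n) j).
Proof.
intros H; induction j as [|j IH]; simpl; [apply H|].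
exact (conv4_plus _ _ IH (H (S j))).
Qed.

Lemma hat_sum (a : nat -> nat -> R) (j : nat) (t : R) : (forall i, conv4 (a i)) -> / 2 < t ->
  hat (fun n => sum_f_R0 (fun i => a i n) j) t = sum_f_R0 (fun i => hat (a i) t) j.
Proof.
intros H Ht; induction j as [|j IH]; simpl; [reflexivity|].
rewrite <- IH; exact (hat_plus _ _ _ (conv4_sum a j H) (H (S j)) Ht).
Qed.

Lemma INR_fact_values : INR (fact 0) = 1 /\ INR (fact 2) = 2 /\ INR (fact 4) = 24 /\
  INR (fact 6) = 720 /\ INR (fact 8) = 40320 /\ INR (fact 10) = 3628800.
Proof.
assert (H : forall n, INR (fact (S n)) = (INR n + 1) * INR (fact n)).
{ intros n; rewrite fact_simpl, mult_INR, S_INR; reflexivity. }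
assert (H0 : INR (fact 0) = 1) by reflexivity.
repeat split; rewrite ?H, H0, ?S_INR; simpl INR; ring.
Qed.

Definition theta_inversion (l : nat -> list R) (N : R) : Prop :=
  forall t s, 0 < t -> exists u v : R,
  is_series (fun n => qexp t ^ n * asum l n (fun x => exp (- (2 * PI * t * s * x)))) u /\
  is_series (fun n => qexp (/ t) ^ n * asum l n (fun x => cos (2 * PI * s * x))) v /\
  exp (- (PI * t * s ^ 2 * N)) * u = / t ^ 24 * v.

Section Moments.
Variables (l : nat -> list R) (N : R).
Hypothesis Hsym : forall n F, asum l n (fun x => F (- x)) = asum l n F.
Hypothesis Hpoisson : theta_inversion l N.

Let M (j : nat) : nat -> R := mu l j.

Definition fcoef (j i : nat) : R := (- (N / 24)) ^ i / INR (fact i) / INR (fact (2 * (j - i))).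

Definition fseries (j : nat) : nat -> R :=
  fun n => sum_f_R0 (fun i => fcoef j i * PS_mult (PS_pow E2s i) (M (j - i)) n) j.

Lemma conv4_M (j : nat) : conv4 (M j).
Proof. exact (conv4_mu l N Hsym Hpoisson j). Qed.

Lemma conv4_fterm (j i : nat) : conv4 (PS_scal (fcoef j i) (PS_mult (PS_pow E2s i) (M (j - i)))).
Proof. apply conv4_scal, conv4_mult; [apply conv4_pow, conv4_E2| apply conv4_M]. Qed.

Lemma conv4_fseries (j : nat) : conv4 (fseries j).
Proof. exact (conv4_sum (fun i => PS_scal (fcoef j i) (PS_mult (PS_pow E2s i) (M (j - i)))) j (conv4_fterm j)). Qed.

Lemma hat_fseries (j : nat) (t : R) : / 2 < t -> hat (fseries j) t = gcoef l N t j.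
Proof.
intros Ht.
transitivity (sum_f_R0 (fun i => hat (PS_scal (fcoef j i) (PS_mult (PS_pow E2s i) (M (j - i)))) t) j).
- exact (hat_sum _ j t (conv4_fterm j) Ht).
- change (gcoef l N t j) with (sum_f_R0 (fun i => ecoef N t i * tcoef l t (j - i)) j).
  apply sum_eq; intros i Hi.
  rewrite hat_scal, hat_mult, hat_pow by
    (auto; try apply conv4_pow; try apply conv4_E2; try apply conv4_M).
  unfold fcoef, ecoef, tcoef.
  replace (- (N * hat E2s t / 24)) with (- (N / 24) * hat E2s t) by field.
  rewrite Rpow_mult_distr; fold (M (j - i)); field; split; apply INR_fact_neq_0.
Qed.

(** The weights 24 + 2j of the theta part, 4a + 6b of the Eisenstein part and -36 of the inverse
    cube of the discriminant add up to 2. The signs agree since j + 2a + 3b = 7 makes j + b odd. *)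
Lemma moment_equation (j a b : nat) : (4 * a + 6 * b + 2 * j = 14)%nat ->
  PS_mult (PS_mult (fseries j) (PS_mult (PS_pow E4s a) (PS_pow E6s b))) (PS_pow psi 72) 3 = 0.
Proof.
intros Hab.
assert (HW : conv4 (PS_mult (PS_pow E4s a) (PS_pow E6s b))).
{ apply conv4_mult; apply conv4_pow; [apply conv4_E4| apply conv4_E6]. }
assert (HF := conv4_fseries j).
assert (H72 : conv4 (PS_pow psi 72)) by apply conv4_pow, conv4_psi.
apply constant_term_zero; [now apply conv4_mult; [apply conv4_mult|]|].
intros t Ht; assert (Hi := near1_inv t Ht).
assert (Ht1 := proj1 Ht); assert (Hi1 := proj1 Hi).
assert (HFW := conv4_mult _ _ HF HW).
assert (H4 := conv4_pow _ a conv4_E4); assert (H6 := conv4_pow _ b conv4_E6).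
assert (Hk : forall s, / 2 < s -> exp (6 * PI * s) *
   hat (PS_mult (PS_mult (fseries j) (PS_mult (PS_pow E4s a) (PS_pow E6s b))) (PS_pow psi 72)) s =
   gcoef l N s j * (hat (PS_pow E4s a) s * hat (PS_pow E6s b) s) * / eta s ^ 72).
{ intros s Hs; rewrite hat_mult, hat_mult, hat_mult, hat_fseries by auto.
  rewrite <- hat_psi72 by exact Hs; ring. }
rewrite !Hk by assumption.
rewrite (gcoef_inv l N Hsym Hpoisson t j Ht).
rewrite (hat_pow_inv E4s 1 4 a t conv4_E4 Ht) by (rewrite E4_inv by exact Ht; ring).
rewrite (hat_pow_inv E6s (-1) 6 b t conv4_E6 Ht) by (rewrite E6_inv by exact Ht; ring).
rewrite eta72_inv by exact Ht.
assert (He := eta_pos t Ht1).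
assert (Ht0 : t <> 0) by lra.
assert (Hw : t ^ (24 + 2 * j) * (t ^ (4 * a) * t ^ (6 * b)) = t ^ 2 * t ^ 36).
{ rewrite <- !pow_add; f_equal; lia. }
assert (Hsg : (-1) ^ j * (-1) ^ b = -1).
{ rewrite <- pow_add; replace (j + b)%nat with (S (2 * (3 - a - b))) by lia; apply pow_1_odd. }
rewrite pow1.
transitivity (((-1) ^ j * (-1) ^ b) * (t ^ (24 + 2 * j) * (t ^ (4 * a) * t ^ (6 * b))) *
  gcoef l N t j * (hat (PS_pow E4s a) t * hat (PS_pow E6s b) t) / (t ^ 36 * eta t ^ 72)).
- unfold Rdiv; ring.
- rewrite Hw, Hsg; field; repeat split; first [assumption|apply pow_nonzero; assumption].
Qed.

Hypothesis Hl0 : l 0%nat = 0 :: nil.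
Hypothesis Hl1 : l 1%nat = nil.
Hypothesis Hl2 : l 2%nat = nil.

Lemma coefs4_M0 : coefs4 (M 0) 1 0 0 (M 0 3).
Proof. repeat split; unfold M, mu, asum; rewrite ?Hl0, ?Hl1, ?Hl2; simpl; ring. Qed.

Lemma coefs4_MS (j : nat) : coefs4 (M (S j)) 0 0 0 (M (S j) 3).
Proof.
repeat split; unfold M, mu, asum; rewrite ?Hl0, ?Hl1, ?Hl2; simpl fold_right; ring.
Qed.

Lemma E2_pow_0 (i : nat) : PS_pow E2s i 0 = 1.
Proof.
induction i as [|i IH]; [reflexivity|].
simpl; unfold PS_mult; simpl; rewrite IH, (proj1 coefs4_E2); ring.
Qed.

Definition moment_sum (j : nat) : R := sum_f_R0 (fun i => fcoef j i * M (j - i) 3) j.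

(** Below q^3 only the zero vector is present, and it contributes only to the moment of order 0,
    that is to the term i = j. The shell of norm 6 enters at q^3, through [moment_sum]. *)
Lemma fseries_coefs (j : nat) : let p := PS_pow E2s j in
  coefs4 (fseries j) (fcoef j j * p 0%nat) (fcoef j j * p 1%nat) (fcoef j j * p 2%nat)
    (fcoef j j * p 3%nat + moment_sum j).
Proof.
intros p.
set (q := fun i => PS_mult (PS_pow E2s i) (M (j - i))).
assert (Hlt : forall i, (i < j)%nat -> coefs4 (q i) 0 0 0 (M (j - i) 3)).
{ intros i Hi; unfold q; replace (j - i)%nat with (S (j - i - 1)) by lia.
  assert (HP : coefs4 (PS_pow E2s i) 1 (PS_pow E2s i 1) (PS_pow E2s i 2) (PS_pow E2s i 3)).
  { repeat split; apply E2_pow_0. }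
  apply (coefs4_eq _ _ _ _ _ _ _ _ _ (coefs4_mult _ _ _ _ _ _ _ _ _ _ HP (coefs4_MS _))); ring. }
assert (Heq : coefs4 (q j) (p 0%nat) (p 1%nat) (p 2%nat) (p 3%nat + M 0 3)).
{ unfold q; rewrite Nat.sub_diag.
  assert (HP : coefs4 p 1 (p 1%nat) (p 2%nat) (p 3%nat)) by (repeat split; apply E2_pow_0).
  apply (coefs4_eq _ _ _ _ _ _ _ _ _ (coefs4_mult _ _ _ _ _ _ _ _ _ _ HP coefs4_M0));
    first [ring | change (p 0%nat) with (PS_pow E2s j 0); rewrite E2_pow_0; ring]. }
assert (Hs : forall n x, (forall i, (i < j)%nat -> q i n = x i) ->
   fseries j n = fcoef j j * q j n + (sum_f_R0 (fun i => fcoef j i * (if Nat.ltb i j then x i else 0)) j)).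
{ intros n x Hx; unfold fseries; fold (q j).
  change (fun i => fcoef j i * PS_mult (PS_pow E2s i) (M (j - i)) n) with (fun i => fcoef j i * q i n).
  destruct j as [|k]; [simpl; ring|].
  rewrite !tech5.
  replace (Nat.ltb (S k) (S k)) with false by (symmetry; apply Nat.ltb_irrefl).
  rewrite (sum_eq (fun i => fcoef (S k) i * (if Nat.ltb i (S k) then x i else 0)) (fun i => fcoef (S k) i * q i n)).
  - ring.
  - intros i Hi; destruct (Nat.ltb_spec i (S k)); [|lia]; rewrite Hx by lia; reflexivity. }
assert (Hz : sum_f_R0 (fun i => fcoef j i * (if Nat.ltb i j then 0 else 0)) j = 0).
{ rewrite (sum_eq _ (fun _ => 0)); [apply sum_eq_R0; reflexivity|].
  intros i _; destruct (Nat.ltb i j); ring. }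
destruct Heq as [E0 [E1 [E2 E3]]].
repeat split.
- rewrite (Hs 0%nat (fun _ => 0)), Hz, E0 by (intros i Hi; apply (Hlt i Hi)); ring.
- rewrite (Hs 1%nat (fun _ => 0)), Hz, E1 by (intros i Hi; apply (Hlt i Hi)); ring.
- rewrite (Hs 2%nat (fun _ => 0)), Hz, E2 by (intros i Hi; apply (Hlt i Hi)); ring.
- rewrite (Hs 3%nat (fun i => M (j - i) 3)), E3 by (intros i Hi; apply (Hlt i Hi)).
  unfold moment_sum.
  destruct j as [|k]; [simpl; ring|].
  rewrite !tech5, Nat.ltb_irrefl, Nat.sub_diag.
  rewrite (sum_eq (fun i => fcoef (S k) i * (if Nat.ltb i (S k) then M (S k - i) 3 else 0)) (fun i => fcoef (S k) i * M (S k - i) 3)).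
  + ring.
  + intros i Hi; destruct (Nat.ltb_spec i (S k)); [reflexivity|lia].
Qed.

(** 72, 2700 and 70080 are the coefficients of q, q^2 and q^3 in [psi]^72. *)
Lemma moment_sum_eq (j a b : nat) (w0 w1 w2 w3 e0 e1 e2 e3 : R) :
  (4 * a + 6 * b + 2 * j = 14)%nat -> coefs4 (PS_pow E2s j) e0 e1 e2 e3 ->
  coefs4 (PS_mult (PS_pow E4s a) (PS_pow E6s b)) w0 w1 w2 w3 -> w0 = 1 ->
  moment_sum j = - fcoef j j *
    (e0 * (w0 * 70080 + w1 * 2700 + w2 * 72 + w3) + e1 * (w0 * 2700 + w1 * 72 + w2) +
     e2 * (w0 * 72 + w1) + e3 * w0).
Proof.
intros Hab [<- [<- [<- <-]]] HW Hw0.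
assert (HK : coefs4 (PS_pow psi 72) 1 72 2700 70080).
{ apply (coefs4_eq _ _ _ _ _ _ _ _ _ (coefs4_psi_pow 72));
    replace (INR 72) with 72 by (rewrite INR_IZR_INZ; reflexivity); field. }
assert (E := moment_equation j a b Hab).
destruct (coefs4_mult _ _ _ _ _ _ _ _ _ _ (coefs4_mult _ _ _ _ _ _ _ _ _ _ (fseries_coefs j) HW) HK)
  as [_ [_ [_ E3]]].
rewrite E3, Hw0 in E; rewrite Hw0; lra.
Qed.

(** The equation for j involves only moments of index at most j, so the six are solved one after the
    other, each with its own monomial in E4 and E6. *)
Lemma moment_values :
  M 0 3 = 52416000 /\ M 1 3 = 6552000 * N /\ M 2 3 = 2358720 * N ^ 2 /\
  M 3 3 = 1360800 * N ^ 3 /\ M 4 3 = 1058400 * N ^ 4 /\ M 5 3 = 1020600 * N ^ 5.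
Proof.
destruct INR_fact_values as [F0 [F2 [F4 [F6 [F8 F10]]]]].
assert (F1 : INR (fact 1) = 1) by reflexivity.
assert (F3 : INR (fact 3) = 6) by (simpl; ring).
assert (F5 : INR (fact 5) = 120) by (rewrite INR_IZR_INZ; reflexivity).
assert (P0 : coefs4 (PS_pow E2s 0) 1 0 0 0) by exact coefs4_one.
assert (PS : forall i x0 x1 x2 x3, coefs4 (PS_pow E2s i) x0 x1 x2 x3 -> coefs4 (PS_pow E2s (S i)) _ _ _ _)
  by (intros; apply (coefs4_mult _ _ _ _ _ _ _ _ _ _ coefs4_E2 H)).
assert (P1 := PS _ _ _ _ _ P0); assert (P2 := PS _ _ _ _ _ P1); assert (P3 := PS _ _ _ _ _ P2);
  assert (P4 := PS _ _ _ _ _ P3); assert (P5 := PS _ _ _ _ _ P4).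
assert (Q0 : coefs4 (PS_pow E4s 0) 1 0 0 0) by exact coefs4_one.
assert (QS : forall i x0 x1 x2 x3, coefs4 (PS_pow E4s i) x0 x1 x2 x3 -> coefs4 (PS_pow E4s (S i)) _ _ _ _)
  by (intros; apply (coefs4_mult _ _ _ _ _ _ _ _ _ _ coefs4_E4 H)).
assert (Q1 := QS _ _ _ _ _ Q0); assert (Q2 := QS _ _ _ _ _ Q1); assert (Q3 := QS _ _ _ _ _ Q2).
assert (S0 : coefs4 (PS_pow E6s 0) 1 0 0 0) by exact coefs4_one.
assert (S1 : coefs4 (PS_pow E6s 1) _ _ _ _) by exact (coefs4_mult _ _ _ _ _ _ _ _ _ _ coefs4_E6 S0).
assert (W0 := moment_sum_eq 0 2 1 _ _ _ _ _ _ _ _ eq_refl P0 (coefs4_mult _ _ _ _ _ _ _ _ _ _ Q2 S1) ltac:(ring)).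
assert (W1 := moment_sum_eq 1 3 0 _ _ _ _ _ _ _ _ eq_refl P1 (coefs4_mult _ _ _ _ _ _ _ _ _ _ Q3 S0) ltac:(ring)).
assert (W2 := moment_sum_eq 2 1 1 _ _ _ _ _ _ _ _ eq_refl P2 (coefs4_mult _ _ _ _ _ _ _ _ _ _ Q1 S1) ltac:(ring)).
assert (W3 := moment_sum_eq 3 2 0 _ _ _ _ _ _ _ _ eq_refl P3 (coefs4_mult _ _ _ _ _ _ _ _ _ _ Q2 S0) ltac:(ring)).
assert (W4 := moment_sum_eq 4 0 1 _ _ _ _ _ _ _ _ eq_refl P4 (coefs4_mult _ _ _ _ _ _ _ _ _ _ Q0 S1) ltac:(ring)).
assert (W5 := moment_sum_eq 5 1 0 _ _ _ _ _ _ _ _ eq_refl P5 (coefs4_mult _ _ _ _ _ _ _ _ _ _ Q1 S0) ltac:(ring)).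
clear PS QS P0 P1 P2 P3 P4 P5 Q0 Q1 Q2 Q3 S0 S1.
unfold moment_sum, fcoef in *.
cbn [sum_f_R0 Nat.sub Nat.mul Nat.add] in *.
rewrite ?F0, ?F1, ?F2, ?F3, ?F4, ?F5, ?F6, ?F8, ?F10 in *.
assert (V0 : M 0 3 = 52416000) by lra.
rewrite V0 in *.
assert (V1 : M 1 3 = 6552000 * N) by lra.
rewrite V1 in *.
assert (V2 : M 2 3 = 2358720 * N ^ 2) by (simpl pow in *; lra).
rewrite V2 in *.
assert (V3 : M 3 3 = 1360800 * N ^ 3) by (simpl pow in *; lra).
rewrite V3 in *.
assert (V4 : M 4 3 = 1058400 * N ^ 4) by (simpl pow in *; lra).
rewrite V4 in *.
assert (V5 : M 5 3 = 1020600 * N ^ 5) by (simpl pow in *; lra).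
repeat split; assumption.
Qed.

End Moments.

End Analysis.

(** * Multiplicities of the projected shell over the vectors of E8, by exact integer computation *)

Module E8Shell.
Import ZArith List Lia Bool Permutation Sorted.
Import ListNotations.
Local Open Scope Z_scope.

(** * Integer sums *)

Definition zsum {A : Type} (F : A -> Z) (l : list A) : Z := fold_right (fun x acc => F x + acc) 0 l.

Lemma zsum_cons {A} (F : A -> Z) x l : zsum F (x :: l) = F x + zsum F l.
Proof. reflexivity. Qed.

Lemma zsum_ext {A} (F G : A -> Z) l : (forall x, In x l -> F x = G x) -> zsum F l = zsum G l.
Proof.
induction l as [|x l IH]; intros H; [reflexivity|].
rewrite !zsum_cons, H, IH; [reflexivity| |now left]; intros; apply H; now right.
Qed.

Lemma zsum_add {A} (F G : A -> Z) l : zsum (fun x => F x + G x) l = zsum F l + zsum G l.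
Proof. induction l as [|x l IH]; [reflexivity|]; rewrite !zsum_cons, IH; lia. Qed.

Lemma zsum_scal {A} c (F : A -> Z) l : zsum (fun x => c * F x) l = c * zsum F l.
Proof. induction l as [|x l IH]; [cbn; lia|]; rewrite !zsum_cons, IH; lia. Qed.

Lemma zsum_zero {A} (l : list A) : zsum (fun _ => 0) l = 0.
Proof. induction l as [|x l IH]; [reflexivity|]; rewrite zsum_cons, IH; reflexivity. Qed.

Lemma zsum_swap {A B} (F : A -> B -> Z) l l' :
  zsum (fun x => zsum (F x) l') l = zsum (fun y => zsum (fun x => F x y) l) l'.
Proof.
induction l as [|x l IH]; [symmetry; exact (zsum_zero l')|].
rewrite zsum_cons, IH, <- zsum_add; reflexivity.
Qed.

Lemma zsum_map {A B} (f : A -> B) (F : B -> Z) l : zsum F (map f l) = zsum (fun x => F (f x)) l.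
Proof. induction l as [|x l IH]; [reflexivity|]; cbn [map]; now rewrite !zsum_cons, IH. Qed.

Definition shell_moment (j : nat) : Z := nth j [52416000; 6552000; 2358720; 1360800; 1058400; 1020600] 0.

(** * Candidate vectors and isolating polynomials *)

Fixpoint dotp (c u : list Z) : Z :=
  match c, u with x :: c', y :: u' => x * y + dotp c' u' | _, _ => 0 end.

Definition lsum (u : list Z) : Z := fold_right Z.add 0 u.

Definition even_sum4 (u : list Z) : bool := Z.land (lsum u) 3 =? 0.

(* Vectors of E8 are scaled by 2 to have integer coordinates, so a vector of squared norm [n] has [dotp u u = 4 n]. *)
Definition e8 (u : list Z) : bool :=
  forallb (fun x => eqb (Z.odd x) (Z.odd (hd 0 u))) u && even_sum4 u.

(* For a vector of [2 E8] of norm 32: twice a root. *)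
Definition dbl (u : list Z) : bool := forallb Z.even u && e8 (map Z.div2 u).

(* The integers congruent to [r] mod 3, of parity [par] and with square at most 32. *)
Definition vals (par : bool) (r : Z) : list Z :=
  match par, r with
  | false, 0 => [0] | false, 1 => [4; -2] | false, _ => [2; -4]
  | true, 0 => [3; -3] | true, 1 => [1; -5] | true, _ => [-1; 5]
  end.

(* Common parity of the entries, remaining norm, and the last entries of a vector. *)
Definition state : Type := bool * Z * list Z.

(** Vectors grow from the last entry to the first, with one prescribed residue modulo 3 per step;
    eight residues single out a class of E8 modulo 3 E8, which may contain vectors of both
    parities. *)
Definition extend (r : Z) (s : state) : list state :=
  let '(par, b, p) := s in
  flat_map (fun v => if v * v <=? b then [(par, b - v * v, v :: p)] else []) (vals par r).

(** b = 0 means norm 32, where twice a root must be discarded: it lies outside the scaled Voronoi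
    cell. *)
Definition okpt (s : state) : bool :=
  let '(par, b, p) := s in
  even_sum4 p && (negb (b =? 0) || negb (dbl p)).

(* Exponents and coefficient of a term [q s^b d^(2a)]. *)
Definition term : Type := nat * nat * Z.

Definition small (q : list term) (i j : Z) : Z :=
  zsum (fun '(a, b, q) => q * (i ^ Z.of_nat b * j ^ Z.of_nat (2 * a))) q.

Record target := Target {
  fams : list (list term * list (list Z)); unit_ : Z; mult : Z; tgt : list Z -> bool }.

(** [None] marks an inner product that [r] does not divide, and a look-up beyond the 42 entries
    gives [None] as well; so a table that is too small makes a check fail instead of returning a
    wrong value. *)
Definition row (r : Z) (q : list term) (i : Z) : list (option Z) :=
  map (fun n => let d := Z.of_nat n in
       if d mod r =? 0 then Some (small q i (d / r)) else None) (seq 0 42).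

(** s = 0, ..., 4 are the valid norms and s = 9 is the norm of three times a root; [rowof] recovers
    s from b = 32 - 8 s. *)
Definition rows (r : Z) (q : list term) : list (list (option Z)) :=
  map (row r q) [0; 1; 2; 3; 4; 9].

Definition rowof (t : list (list (option Z))) (b : Z) : list (option Z) :=
  match b with
  | 32 => nth 0 t [] | 24 => nth 1 t [] | 16 => nth 2 t [] | 8 => nth 3 t [] | 0 => nth 4 t []
  | -40 => nth 5 t [] | _ => [] end.

Definition oadd (x y : option Z) : option Z :=
  match x, y with Some a, Some b => Some (a + b) | _, _ => None end.

Definition osum {A} (F : A -> option Z) (l : list A) : option Z :=
  fold_right (fun x acc => oadd (F x) acc) (Some 0) l.

Definition table (t : target) : list (list (list (option Z)) * list (list Z)) :=
  map (fun '(q, V) => (rows (unit_ t) q, V)) (fams t).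

Definition qval (tb : list (list (list (option Z)) * list (list Z))) (b : Z) (p : list Z) : option Z :=
  osum (fun '(t, V) => let rw := rowof t b in
    osum (fun c => nth (Z.to_nat (Z.abs (dotp c p))) rw None) V) tb.

Definition tcheck (P : list state) (tb : target * list (list (list (option Z)) * list (list Z))) : bool :=
  let '(t, tb) := tb in
  match osum (fun '(_, b, p) => oadd (qval tb b p) (Some (if tgt t p then - mult t else 0))) P with
  | Some z => z =? 0 | None => false end.

(** Also verifies that all remaining vectors of the class have the same norm. They then share one
    multiplicity, which factors out of the sum tested by [tcheck]. *)
Definition leaf tbs (P : list state) : bool :=
  match filter okpt P with
  | [] => true
  | (par, b, p) :: P' => forallb (fun '(_, b', _) => b' =? b) P' &&
      forallb (tcheck ((par, b, p) :: P')) tbs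
  end.

Fixpoint chk tbs (n : nat) (P : list state) : bool :=
  match n with
  | O => leaf tbs P
  | S n => chk tbs n (flat_map (extend 0) P) && chk tbs n (flat_map (extend 1) P)
      && chk tbs n (flat_map (extend 2) P)
  end.

Definition init : list state := [(false, 32, []); (true, 32, [])].

Fixpoint leqb (u v : list Z) : bool :=
  match u, v with [], [] => true | x :: u', y :: v' => (x =? y) && leqb u' v' | _, _ => false end.

Definition plusminus (v u : list Z) : bool := leqb u v || leqb u (map Z.opp v).

Definition zeros : list Z := [0; 0; 0; 0; 0; 0; 0; 0].

(** The radial part is attached to the zero vector, where d = 0. For a vector of norm 6 the list V
    holds, up to a common factor, its three congruent minimal vectors, so that the polynomial
    depends symmetrically on the class. *)
Definition isolate (rad q : list term) (r m : Z) (V : list (list Z)) (v : list Z) : target :=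
  Target [(rad, [zeros]); (q, V)] r m (plusminus v).

(* The coefficients solve the linear system which says that, for every class of E8 modulo 3 E8, the sum over its
minimal vectors of the polynomial is [mult] times the number of those satisfying [tgt]. Here
[s = dotp u u / 8] and [d = dotp c u / unit_]. *)
Definition rad2 : list term := [(0%nat, 1%nat, -6); (0%nat, 2%nat, 11); (0%nat, 3%nat, -6); (0%nat, 4%nat, 1)].
Definition pol2 : list term := [(1%nat, 0%nat, -36); (1%nat, 1%nat, 30); (1%nat, 2%nat, -6); (2%nat, 0%nat, 48); (2%nat, 1%nat, -52); (2%nat, 2%nat, 18); (2%nat, 3%nat, -2)].
Definition rad4 : list term := [(0%nat, 1%nat, -7980); (0%nat, 2%nat, 14630); (0%nat, 3%nat, -7980); (0%nat, 4%nat, 1330)].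
Definition pol4 : list term := [(1%nat, 0%nat, -108); (1%nat, 1%nat, 672); (1%nat, 2%nat, -336); (2%nat, 0%nat, 637); (2%nat, 1%nat, -1995); (2%nat, 2%nat, 1295); (2%nat, 3%nat, -210); (3%nat, 0%nat, 168); (3%nat, 1%nat, -147); (3%nat, 2%nat, 21); (4%nat, 0%nat, 3)].
Definition rad6 : list term := [(0%nat, 1%nat, 612360); (0%nat, 2%nat, -1122660); (0%nat, 3%nat, 612360); (0%nat, 4%nat, -102060)].
Definition pol6 : list term := [(1%nat, 0%nat, -27036); (1%nat, 1%nat, 11340); (1%nat, 2%nat, 252); (2%nat, 0%nat, 3031); (2%nat, 1%nat, 15120); (2%nat, 2%nat, -12880); (2%nat, 3%nat, 2520); (3%nat, 0%nat, -1764); (3%nat, 1%nat, 1260); (3%nat, 2%nat, -252); (4%nat, 0%nat, 9)].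
Definition rad8 : list term := [(0%nat, 1%nat, -17280); (0%nat, 2%nat, 31680); (0%nat, 3%nat, -17280); (0%nat, 4%nat, 2880)].
Definition pol8 : list term := [(1%nat, 0%nat, 13824); (1%nat, 1%nat, -11520); (1%nat, 2%nat, 2304); (2%nat, 0%nat, -8160); (2%nat, 1%nat, 19280); (2%nat, 2%nat, -11760); (2%nat, 3%nat, 2080); (3%nat, 0%nat, -1080); (3%nat, 1%nat, 900); (3%nat, 2%nat, -180)].
Definition pol8' : list term := [(2%nat, 0%nat, 120); (2%nat, 1%nat, -1300); (2%nat, 2%nat, 1020); (2%nat, 3%nat, -200); (3%nat, 0%nat, 54); (3%nat, 1%nat, -45); (3%nat, 2%nat, 9)].

Definition support (u : list Z) : list Z := map (fun x => if x =? 0 then 0 else 1) u.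

(** Norm 32 with five nonzero even entries forces one entry 4 and four entries 2 up to sign. The
    multiplicities of these vectors enter only through their sum over one support. *)
Definition five (z u : list Z) : bool :=
  (dotp u u =? 32) && forallb Z.even u && leqb (support u) z.

Definition ei (i : nat) : list Z := map (fun j => if Nat.eqb i j then 1 else 0) (seq 0 8).

Definition targets : list target :=
  [isolate rad2 pol2 2 144 [[1; 1; 0; 0; 0; 0; 0; 0]] [2; 2; 0; 0; 0; 0; 0; 0];
   isolate rad4 pol4 1 60480 [ei 0] [4; 0; 0; 0; 0; 0; 0; 0];
   isolate rad4 pol4 2 60480 [[1; 1; 1; 1; 0; 0; 0; 0]] [2; 2; 2; 2; 0; 0; 0; 0];
   isolate rad6 pol6 2 13063680
     [[2; 1; 1; 0; 0; 0; 0; 0]; [-1; -2; 1; 0; 0; 0; 0; 0]; [-1; 1; -2; 0; 0; 0; 0; 0]] [4; 2; 2; 0; 0; 0; 0; 0];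
   isolate rad6 pol6 4 13063680
     [[2; 2; 2; 2; 2; 2; 0; 0]; [-1; -1; -1; -1; -1; -1; -3; -3]; [-1; -1; -1; -1; -1; -1; 3; 3]]
     [2; 2; 2; 2; 2; 2; 0; 0];
   Target [(rad8, [zeros]); (pol8, [ei 0; ei 1; ei 2]);
     (pol8', [[1; 1; 1; 0; 0; 0; 0; 0]; [1; 1; -1; 0; 0; 0; 0; 0]; [1; -1; 1; 0; 0; 0; 0; 0]; [1; -1; -1; 0; 0; 0; 0; 0]])]
     1 1492992 (five [0; 0; 0; 1; 1; 1; 1; 1]);
   Target [([(0%nat, 0%nat, 24); (0%nat, 1%nat, -50); (0%nat, 2%nat, 35); (0%nat, 3%nat, -10); (0%nat, 4%nat, 1)], [zeros])]
     1 24 (plusminus zeros)].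

(** Evaluated once, so that the run over the 3^8 classes looks values up instead of computing
    powers. *)
Definition tables := Eval vm_compute in map table targets.

Lemma chk_targets : chk (combine targets tables) 8 init = true.
Proof. vm_compute; reflexivity. Qed.

Lemma tables_eq : tables = map table targets.
Proof. vm_compute; reflexivity. Qed.

(** * Multiplicity functions *)

Lemma leqb_eq u v : leqb u v = true <-> u = v.
Proof.
revert v; induction u as [|x u IH]; intros [|y v]; cbn; try easy.
rewrite andb_true_iff, Z.eqb_eq, IH; split; [intros [-> ->]; reflexivity|intros E; now injection E].
Qed.

Lemma leqb_refl u : leqb u u = true.
Proof. now apply leqb_eq. Qed.

Definition inb (u : list Z) (l : list (list Z)) : bool := existsb (leqb u) l.

Lemma inb_In u l : inb u l = true <-> In u l.
Proof.
unfold inb; rewrite existsb_exists; split.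
- intros [v [H E]]; apply leqb_eq in E; now subst.
- intros H; exists u; split; [exact H|apply leqb_refl].
Qed.

Lemma even_sum4_mod u : even_sum4 u = true <-> lsum u mod 4 = 0.
Proof. unfold even_sum4; rewrite Z.eqb_eq; change 3 with (Z.ones 2); rewrite Z.land_ones by lia; reflexivity. Qed.

Definition congr3 : list Z -> list Z -> Prop := Forall2 (fun x y => (x - y) mod 3 = 0).

Definition valid (p : list Z) : Prop :=
  length p = 8%nat /\ e8 p = true /\ dotp p p <= 32 /\ (dotp p p = 32 -> dbl p = false).

Definition validb (p : list Z) : bool :=
  Nat.eqb (length p) 8 && e8 p && (dotp p p <=? 32) && (negb (dotp p p =? 32) || negb (dbl p)).

Lemma validb_valid p : validb p = true <-> valid p.
Proof.
unfold validb, valid; rewrite !andb_true_iff, Nat.eqb_eq, Z.leb_le, orb_true_iff, !negb_true_iff, Z.eqb_neq.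
split; [intros [[[? ?] ?] [?|?]]|intros [? [? [? H]]]]; intuition.
destruct (Z.eq_dec (dotp p p) 32) as [E|E]; auto.
Qed.

Definition e8_root (r : list Z) : Prop := length r = 8%nat /\ e8 r = true /\ dotp r r = 8.

Definition triple : list Z -> list Z := map (Z.mul 3).

Definition cnt {A} (X : list A) (u : A -> list Z) (p : list Z) : Z :=
  zsum (fun x => if leqb (u x) p then 1 else 0) X.

(** All that the finite part knows of the lattice. X is the shell and u x is 2p when x projects to p
    / sqrt 3; accordingly 12 [dotp c c] is the norm of the lattice vector whose inner product with x
    is [dotp c (u x)]. *)
Record good {A} (X : list A) (u : A -> list Z) : Prop := Good {
  good_moment : forall c j, length c = 8%nat -> (j <= 5)%nat ->
    zsum (fun x => dotp c (u x) ^ Z.of_nat (2 * j)) X = shell_moment j * (12 * dotp c c) ^ Z.of_nat j;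
  good_values : forall x, In x X -> valid (u x) \/ exists r, e8_root r /\ u x = triple r;
  good_root : forall r, e8_root r -> cnt X u (triple r) = 1;
  good_opp : forall p, length p = 8%nat -> cnt X u (map Z.opp p) = cnt X u p;
  good_congr : forall p q, length p = 8%nat -> length q = 8%nat -> e8 p = true -> e8 q = true ->
    dotp p p = dotp q q -> congr3 p q -> cnt X u p = cnt X u q }.

Lemma cnt_sum {A} (X : list A) u (F : list Z -> Z) l : NoDup l ->
  zsum (fun x => if inb (u x) l then F (u x) else 0) X = zsum (fun p => F p * cnt X u p) l.
Proof.
intros Hl; unfold cnt.
transitivity (zsum (fun x => zsum (fun p => F p * (if leqb (u x) p then 1 else 0)) l) X).
- apply zsum_ext; intros x _; induction Hl as [|p l Hp Hl IH]; [reflexivity|].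
  cbn [inb existsb]; rewrite zsum_cons, <- IH; fold (inb (u x) l).
  destruct (leqb (u x) p) eqn:E; cbn [orb]; [|lia].
  apply leqb_eq in E; subst p.
  destruct (inb (u x) l) eqn:E2; [apply inb_In in E2; tauto|lia].
- rewrite zsum_swap; apply zsum_ext; intros p _; now rewrite zsum_scal.
Qed.

Lemma dotp_app c d p q : length c = length p -> dotp (c ++ d) (p ++ q) = dotp c p + dotp d q.
Proof.
revert p; induction c as [|x c IH]; intros [|y p] H; cbn in *; try easy.
rewrite IH by lia; ring.
Qed.

Lemma dotp_sq_nonneg p : 0 <= dotp p p.
Proof. induction p as [|x p IH]; cbn; nia. Qed.

Lemma NoDup_flat_map {A B} (f : A -> list B) (g : B -> A) l :
  (forall x y, In x l -> In y (f x) -> g y = x) -> (forall x, In x l -> NoDup (f x)) ->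
  NoDup l -> NoDup (flat_map f l).
Proof.
intros Hg Hf Hl; induction Hl as [|x l Hx Hl IH]; cbn; [constructor|].
apply NoDup_app.
- apply Hf; now left.
- apply IH; intros; [apply Hg; [now right|assumption]|apply Hf; now right].
- intros y Hy H; apply in_flat_map in H as [x' [Hx' Hy']].
  assert (g y = x) by (apply Hg; [now left|assumption]).
  assert (g y = x') by (apply Hg; [now right|assumption]).
  congruence.
Qed.

Definition shrink (s : state) : state :=
  let '(par, b, p) := s in match p with [] => s | v :: p => (par, b + v * v, p) end.

Lemma in_extend r s s' : In s' (extend r s) <->
  let '(par, b, p) := s in exists v, In v (vals par r) /\ v * v <= b /\ s' = (par, b - v * v, v :: p).
Proof.
destruct s as [[par b] p]; unfold extend; rewrite in_flat_map; split.
- intros [v [Hv H]]; exists v; destruct (Z.leb_spec (v * v) b); cbn in H; [|easy].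
  destruct H as [<-|[]]; auto.
- intros [v [Hv [Hb ->]]]; exists v; split; [exact Hv|].
  apply Z.leb_le in Hb; rewrite Hb; now left.
Qed.

Lemma shrink_extend r s s' : In s' (extend r s) -> shrink s' = s.
Proof.
rewrite in_extend; destruct s as [[par b] p]; intros [v [_ [_ ->]]]; cbn.
f_equal; f_equal; ring.
Qed.

Lemma NoDup_vals par r : NoDup (vals par r).
Proof. destruct par, r as [|[]|]; repeat constructor; cbn; lia. Qed.

Lemma NoDup_extend r s : NoDup (extend r s).
Proof.
destruct s as [[par b] p]; unfold extend.
apply (NoDup_flat_map _ (fun s => hd 0 (snd s))); [|intros v _|apply NoDup_vals].
- intros v y _ H; destruct (v * v <=? b); cbn in H; [|easy]; now destruct H as [<-|[]].
- destruct (v * v <=? b); repeat constructor; auto.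
Qed.

Lemma NoDup_extend_all r P : NoDup P -> NoDup (flat_map (extend r) P).
Proof.
apply NoDup_flat_map with (g := shrink); [intros s s' _; apply shrink_extend|intros s _; apply NoDup_extend].
Qed.

Lemma in_vals par r v : 0 <= r < 3 -> v * v <= 32 -> Z.odd v = par -> (In v (vals par r) <-> v mod 3 = r).
Proof.
intros Hr Hv Hp.
assert (H : v = -5 \/ v = -4 \/ v = -3 \/ v = -2 \/ v = -1 \/ v = 0 \/ v = 1 \/ v = 2 \/ v = 3 \/ v = 4 \/ v = 5) by nia.
assert (H' : r = 0 \/ r = 1 \/ r = 2) by lia.
repeat destruct H as [H|H]; subst v; cbn in Hp; subst par;
  repeat destruct H' as [H'|H']; subst r; cbn; lia.
Qed.

Lemma vals_spec par r v : 0 <= r < 3 -> In v (vals par r) -> Z.odd v = par /\ (v - r) mod 3 = 0.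
Proof.
intros Hr H; assert (H' : r = 0 \/ r = 1 \/ r = 2) by lia.
repeat destruct H' as [H'|H']; subst r; destruct par; cbn in H; intuition; subst; reflexivity.
Qed.

(** * Soundness of the enumeration *)

Definition parity (u : list Z) : bool := Z.odd (hd 0 u).

Lemma e8_parity u : e8 u = true -> Forall (fun v => Z.odd v = parity u) u.
Proof.
unfold e8; rewrite andb_true_iff, forallb_forall; intros [H _].
apply Forall_forall; intros v Hv; now apply eqb_prop, H.
Qed.

Lemma skipn_nth n u : (n < length u)%nat -> skipn n u = nth n u 0 :: skipn (S n) u.
Proof.
revert u; induction n as [|n IH]; intros [|x u] H; cbn in H; try lia; [reflexivity|].
cbn [skipn nth]; rewrite IH by lia; reflexivity.
Qed.

Lemma dotp_skipn n u : dotp (skipn n u) (skipn n u) <= dotp u u.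
Proof.
rewrite <- (firstn_skipn n u) at 3 4; rewrite dotp_app by reflexivity.
pose proof (dotp_sq_nonneg (firstn n u)); lia.
Qed.

Definition inv (n : nat) (res : list Z) (s : state) : Prop :=
  let '(par, b, p) := s in
  (n + length p = 8)%nat /\ b = 32 - dotp p p /\ 0 <= b /\
  Forall (fun v => Z.odd v = par) p /\ congr3 p res.

Lemma inv_extend n res r s s' : 0 <= r < 3 -> inv (S n) res s -> In s' (extend r s) -> inv n (r :: res) s'.
Proof.
intros Hr H1 H2; apply in_extend in H2; destruct s as [[par b] p].
destruct H2 as [v [Hv [Hb ->]]]; destruct H1 as [H1 [H3 [H4 [H5 H6]]]].
apply vals_spec in Hv; [|assumption].
destruct Hv; unfold inv; cbn [length dotp].
repeat split; try lia; constructor; assumption.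
Qed.

Definition sel (n : nat) (P : list state) (u : list Z) : bool :=
  existsb (fun '(par, b, p) => eqb par (parity u) && leqb (skipn n u) p) P.

Lemma sel_spec n P u : sel n P u = true <-> exists b, In (parity u, b, skipn n u) P.
Proof.
unfold sel; rewrite existsb_exists; split.
- intros [[[par b] p] [H E]]; apply andb_true_iff in E as [E1 E2].
  apply eqb_prop in E1; apply leqb_eq in E2; subst; now exists b.
- intros [b H]; eexists; split; [exact H|]; cbn; now rewrite eqb_reflx, leqb_refl.
Qed.

Lemma sel_extend n res P u r : valid u -> (n < 8)%nat -> 0 <= r < 3 ->
  (forall s, In s P -> inv (S n) res s) ->
  sel n (flat_map (extend r) P) u = sel (S n) P u && (nth n u 0 mod 3 =? r).
Proof.
intros [Hl [He [Hn _]]] Hn8 Hr HP; apply eq_true_iff_eq.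
rewrite andb_true_iff, Z.eqb_eq, !sel_spec.
assert (Hs : skipn n u = nth n u 0 :: skipn (S n) u) by (apply skipn_nth; lia).
pose proof (dotp_skipn n u) as Hd; rewrite Hs in Hd; cbn [dotp] in Hd.
pose proof (dotp_sq_nonneg (skipn (S n) u)) as Hd0.
assert (Hpar : Z.odd (nth n u 0) = parity u).
{ pose proof (e8_parity u He) as H; rewrite Forall_forall in H; apply H, nth_In; lia. }
assert (Hv := in_vals (parity u) r (nth n u 0) Hr ltac:(lia) Hpar).
split.
- intros [b H]; apply in_flat_map in H as [[[par b0] p] [H1 H2]].
  apply in_extend in H2 as [v [H3 [H4 H5]]]; rewrite Hs in H5; injection H5 as E1 E2 E3 E4; subst.
  split; [now exists b0|now apply Hv].
- intros [[b H] H']; exists (b - nth n u 0 * nth n u 0).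
  apply in_flat_map; exists (parity u, b, skipn (S n) u); split; [exact H|].
  apply in_extend; exists (nth n u 0); apply HP in H as [_ [Hb _]]; rewrite Hs.
  repeat split; [now apply Hv|lia].
Qed.

Definition VS {A} (X : list A) (u : A -> list Z) (F : list Z -> Z) : Z :=
  zsum (fun x => if validb (u x) then F (u x) else 0) X.

Lemma VS_ext {A} (X : list A) u F G : (forall p, valid p -> F p = G p) -> VS X u F = VS X u G.
Proof.
intros H; apply zsum_ext; intros x _; destruct (validb (u x)) eqn:E; [|reflexivity].
now apply H, validb_valid.
Qed.

Lemma VS_add {A} (X : list A) u F G : VS X u (fun p => F p + G p) = VS X u F + VS X u G.
Proof. unfold VS; rewrite <- zsum_add; apply zsum_ext; intros x _; now destruct (validb (u x)). Qed.

Lemma VS_scal {A} (X : list A) u c F : VS X u (fun p => c * F p) = c * VS X u F.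
Proof. unfold VS; rewrite <- zsum_scal; apply zsum_ext; intros x _; destruct (validb (u x)); lia. Qed.

Section Soundness.
Context {A : Type} (X : list A) (u : A -> list Z).
Hypothesis HX : good X u.
Variables (tbs : list (target * list (list (list (option Z)) * list (list Z)))).
Variable (G : list Z -> Z).
Hypothesis HG : forall P, forallb (tcheck P) tbs = true ->
  (forall par b p, In (par, b, p) P -> b = 32 - dotp p p) -> zsum (fun '(_, _, p) => G p) P = 0.

Lemma leaf_valid res par b p : inv 0 res (par, b, p) -> okpt (par, b, p) = true -> valid p.
Proof.
intros [H1 [H2 [H3 [H4 H5]]]]; cbn [okpt]; rewrite andb_true_iff, orb_true_iff, !negb_true_iff, Z.eqb_neq.
intros [Hs Hd]; repeat split; [exact H1| |lia|].
- unfold e8; rewrite Hs, andb_true_r; apply forallb_forall; intros v Hv.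
  rewrite Forall_forall in H4; rewrite (H4 v Hv).
  destruct p as [|w p]; [easy|]; cbn; rewrite (H4 w); [apply eqb_reflx|now left].
- intros E; destruct Hd as [Hd|Hd]; [lia|exact Hd].
Qed.

Lemma congr3_common p q res : congr3 p res -> congr3 q res -> congr3 p q.
Proof.
intros H; revert q; induction H as [|x r p res Hx H IH]; intros [|y q] Hq; inversion Hq as [|y' r' q' res' Hy Hq']; subst; constructor.
- replace (x - y) with ((x - r) - (y - r)) by ring; rewrite Zminus_mod, Hx, Hy; reflexivity.
- now apply IH.
Qed.

Lemma leaf_sound res P : leaf tbs P = true -> NoDup P -> (forall s, In s P -> inv 0 res s) ->
  VS X u (fun p => if sel 0 P p then G p else 0) = 0.
Proof.
unfold leaf; intros H HP Hinv; set (P' := filter okpt P) in *.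
assert (HP' : forall s, In s P' -> In s P /\ okpt s = true) by (intros s; apply filter_In).
set (pts := map (fun '(_, _, p) => p) P').
assert (Hpts : forall p, In p pts -> exists par b, In (par, b, p) P').
{ intros p Hp; apply in_map_iff in Hp as [[[par b] p'] [E Hp]]; subst p'; eauto. }
assert (Hval : forall p, In p pts -> valid p).
{ intros p Hp; apply Hpts in Hp as [par [b Hp]]; apply HP' in Hp as [H1 H2].
  exact (leaf_valid res par b p (Hinv _ H1) H2). }
assert (Hnd : NoDup pts).
{ unfold pts; apply NoDup_map_NoDup_ForallPairs; [|now apply NoDup_filter].
  intros [[par b] p] [[par' b'] p'] H1 H2 E; subst p'.
  apply HP' in H1 as [H1 _]; apply HP' in H2 as [H2 _].
  apply Hinv in H1 as [L1 [-> [_ [F1 _]]]]; apply Hinv in H2 as [_ [-> [_ [F2 _]]]].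
  destruct p as [|v p]; [easy|]; inversion F1; inversion F2; congruence. }
transitivity (zsum (fun x => if inb (u x) pts then G (u x) else 0) X).
{ apply zsum_ext; intros x Hx.
  assert (E : (validb (u x) && sel 0 P (u x)) = inb (u x) pts).
  { apply eq_true_iff_eq; rewrite andb_true_iff, validb_valid, sel_spec, inb_In; cbn [skipn]; split.
    - intros [Hv [b Hb]]; apply in_map_iff; exists (parity (u x), b, u x); split; [reflexivity|].
      apply filter_In; split; [exact Hb|]; cbn [okpt].
      destruct Hv as [_ [He [Hn Hd]]]; apply Hinv in Hb as [_ [-> _]].
      unfold e8 in He; apply andb_true_iff in He as [_ ->].
      destruct (Z.eqb_spec (32 - dotp (u x) (u x)) 0); cbn [negb andb orb]; [|reflexivity].
      rewrite Hd by lia; reflexivity.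
    - intros Hp; split; [now apply Hval|]; apply Hpts in Hp as [par [b Hp]]; exists b.
      apply HP' in Hp as [Hp _]; assert (E : par = parity (u x)); [|now rewrite <- E].
      apply Hinv in Hp as [L1 [_ [_ [F1 _]]]]; destruct (u x); [easy|]; inversion F1; subst; reflexivity. }
  rewrite <- E; destruct (validb (u x)); reflexivity. }
rewrite cnt_sum by assumption.
destruct P' as [|[[par b] p0] P''] eqn:EP; [reflexivity|].
apply andb_true_iff in H as [H1 H2].
assert (Hb : forall p, In p pts -> dotp p p = dotp p0 p0).
{ intros p Hp; apply Hpts in Hp as [par' [b' Hp]].
  assert (b' = b).
  { destruct Hp as [Hp|Hp]; [congruence|]; rewrite forallb_forall in H1; apply Z.eqb_eq; exact (H1 _ Hp). }
  apply HP' in Hp as [Hp _]; apply Hinv in Hp as [_ [Hp _]].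
  assert (H0 : In (par, b, p0) P) by (apply HP'; now left).
  apply Hinv in H0 as [_ [H0 _]]; lia. }
assert (H0 : In p0 pts) by (unfold pts; now left).
transitivity (zsum (fun p => cnt X u p0 * G p) pts).
{ apply zsum_ext; intros p Hp; rewrite Z.mul_comm; f_equal.
  destruct (Hval p Hp) as [L1 [E1 _]], (Hval p0 H0) as [L2 [E2 _]].
  apply (good_congr _ _ HX); auto.
  apply Hpts in Hp as [par1 [b1 Hp]]; apply Hpts in H0 as [par2 [b2 H0]].
  apply HP' in Hp as [Hp _]; apply HP' in H0 as [H0 _].
  apply (congr3_common _ _ res); [apply Hinv in Hp; apply Hp|apply Hinv in H0; apply H0]. }
rewrite zsum_scal.
unfold pts; rewrite zsum_map, (zsum_ext _ (fun '(_, _, p) => G p)) by now intros [[? ?] ?].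
rewrite HG; [lia|exact H2|].
intros par' b' p Hp; apply HP' in Hp as [Hp _]; now apply Hinv in Hp as [_ [Hp _]].
Qed.

(** The extensions by the residues 0, 1 and 2 partition the selected vectors, so the sum for P is
    the sum over the three branches. *)
Lemma chk_sound n res P : (n <= 8)%nat -> chk tbs n P = true -> NoDup P ->
  (forall s, In s P -> inv n res s) -> VS X u (fun p => if sel n P p then G p else 0) = 0.
Proof.
revert res P; induction n as [|n IH]; intros res P Hn H HP Hinv; [now apply (leaf_sound res)|].
cbn [chk] in H; rewrite !andb_true_iff in H; destruct H as [[C0 C1] C2].
assert (Hr : forall r, 0 <= r < 3 -> forall s, In s (flat_map (extend r) P) -> inv n (r :: res) s).
{ intros r Hr s Hs; apply in_flat_map in Hs as [s0 [H1 H2]]; exact (inv_extend n res r s0 s Hr (Hinv _ H1) H2). }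
assert (I0 := IH (0 :: res) _ ltac:(lia) C0 (NoDup_extend_all 0 P HP) (Hr 0 ltac:(lia))).
assert (I1 := IH (1 :: res) _ ltac:(lia) C1 (NoDup_extend_all 1 P HP) (Hr 1 ltac:(lia))).
assert (I2 := IH (2 :: res) _ ltac:(lia) C2 (NoDup_extend_all 2 P HP) (Hr 2 ltac:(lia))).
match type of I0 with ?a0 = _ => match type of I1 with ?a1 = _ => match type of I2 with ?a2 = _ =>
  transitivity (a0 + a1 + a2); [|lia] end end end.
rewrite <- !VS_add; apply VS_ext; intros p Hp.
rewrite !(sel_extend n res P p) by (assumption || lia).
destruct (sel (S n) P p); cbn [andb]; [|reflexivity].
pose proof (Z.mod_pos_bound (nth n p 0) 3 ltac:(lia)).
destruct (Z.eqb_spec (nth n p 0 mod 3) 0), (Z.eqb_spec (nth n p 0 mod 3) 1), (Z.eqb_spec (nth n p 0 mod 3) 2); lia.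
Qed.

Lemma chk_init : chk tbs 8 init = true -> VS X u G = 0.
Proof.
intros H; rewrite <- (chk_sound 8 [] init (le_n 8) H).
- apply VS_ext; intros p [Hl _].
  enough (E : sel 8 init p = true) by now rewrite E.
  apply sel_spec; exists 32; rewrite skipn_all2 by lia; destruct (parity p); cbn; auto.
- repeat constructor; cbn; intuition congruence.
- intros s [<-|[<-|[]]]; unfold inv; cbn [length dotp]; repeat split; try lia; constructor.
Qed.

End Soundness.

(** * Values of the isolating sums *)

Definition extall (s : state) : list state := flat_map (fun r => extend r s) [0; 1; 2].

Fixpoint gen (n : nat) (P : list state) : list state :=
  match n with O => P | S n => gen n (flat_map extall P) end.

Lemma in_extall par b p v : v * v <= b -> b <= 32 -> Z.odd v = par -> In (par, b - v * v, v :: p) (extall (par, b, p)).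
Proof.
intros Hv Hb Hp; unfold extall; apply in_flat_map; exists (v mod 3).
pose proof (Z.mod_pos_bound v 3 ltac:(lia)).
split; [cbn; lia|]; apply in_extend; exists v; repeat split; [|assumption].
apply in_vals; auto; lia.
Qed.

Lemma gen_complete n v par b p P : length v = n -> Forall (fun x => Z.odd x = par) v -> dotp v v <= b -> b <= 32 ->
  In (par, b, p) P -> In (par, b - dotp v v, v ++ p) (gen n P).
Proof.
revert v b p P; induction n as [|n IH]; intros v b p P Hl Hv Hd Hb HP.
- destruct v; [|easy]; cbn [dotp app gen]; rewrite Z.sub_0_r; exact HP.
- destruct (@exists_last _ v) as [v' [w ->]]; [now destruct v|].
  rewrite length_app in Hl; cbn [length] in Hl.
  apply Forall_app in Hv as [Hv Hw]; inversion Hw; subst.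
  rewrite dotp_app in * by reflexivity; cbn [dotp] in *.
  pose proof (dotp_sq_nonneg v'); pose proof (Z.square_nonneg w).
  rewrite <- app_assoc; cbn [app gen].
  replace (b - (dotp v' v' + (w * w + 0))) with ((b - w * w) - dotp v' v') by ring.
  apply IH; try lia; auto.
  apply in_flat_map; eexists; split; [exact HP|]; apply in_extall; auto; lia.
Qed.

Lemma NoDup_extall s : NoDup (extall s).
Proof.
unfold extall; apply (NoDup_flat_map _ (fun s => hd 0 (snd s) mod 3)).
- intros r y Hr Hy; apply in_extend in Hy; destruct s as [[par b] p]; destruct Hy as [v [Hv [_ ->]]]; cbn [snd hd].
  assert (0 <= r < 3) by (cbn in Hr; lia).
  apply vals_spec in Hv as [_ Hv]; [|lia]; rewrite <- (Z.mod_small r 3) by lia.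
  apply Z.mod_divide in Hv as [k Hk]; [|lia]; replace v with (r + k * 3) by lia; apply Z_mod_plus_full.
- intros r _; apply NoDup_extend.
- repeat constructor; cbn; lia.
Qed.

Lemma NoDup_gen n P : NoDup P -> NoDup (gen n P).
Proof.
revert P; induction n as [|n IH]; intros P HP; [exact HP|]; cbn; apply IH.
apply NoDup_flat_map with (g := shrink); [|intros s _; apply NoDup_extall|exact HP].
intros s y _ Hy; unfold extall in Hy; apply in_flat_map in Hy as [r [_ Hy]]; exact (shrink_extend r s y Hy).
Qed.

Definition rootlist : list (list Z) :=
  Eval vm_compute in map snd (filter (fun '(_, b, p) => (b =? 0) && even_sum4 p) (gen 8 [(false, 8, []); (true, 8, [])])).

Lemma rootlist_eq :
  rootlist = map snd (filter (fun '(_, b, p) => (b =? 0) && even_sum4 p) (gen 8 [(false, 8, []); (true, 8, [])])).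
Proof. vm_compute; reflexivity. Qed.

Lemma in_rootlist r : e8_root r -> In r rootlist.
Proof.
intros [Hl [He Hn]]; rewrite rootlist_eq.
apply in_map_iff; exists (parity r, 8 - dotp r r, r); split; [reflexivity|].
apply filter_In; split.
- pose proof (gen_complete 8 r (parity r) 8 [] [(false, 8, []); (true, 8, [])] Hl (e8_parity r He)) as H.
  rewrite app_nil_r in H; apply H; try lia; destruct (parity r); cbn; auto.
- unfold e8 in He; apply andb_true_iff in He as [_ ->]; rewrite Hn; reflexivity.
Qed.

Lemma rootlist_root r : In r rootlist -> e8_root r.
Proof.
assert (H : forallb (fun r => Nat.eqb (length r) 8 && e8 r && (dotp r r =? 8)) rootlist = true) by (vm_compute; reflexivity).
rewrite forallb_forall in H; intros Hr; specialize (H r Hr).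
rewrite !andb_true_iff, Nat.eqb_eq, Z.eqb_eq in H; unfold e8_root; tauto.
Qed.

Fixpoint nodupb (l : list (list Z)) : bool :=
  match l with [] => true | x :: l => negb (inb x l) && nodupb l end.

Lemma nodupb_NoDup l : nodupb l = true -> NoDup l.
Proof.
induction l as [|x l IH]; intros H; constructor; cbn in H; apply andb_true_iff in H as [H1 H2].
- intros Hx; apply inb_In in Hx; rewrite Hx in H1; discriminate.
- now apply IH.
Qed.

Lemma NoDup_rootlist : NoDup rootlist.
Proof. apply nodupb_NoDup; vm_compute; reflexivity. Qed.

Lemma dotp_triple p : dotp (triple p) (triple p) = 9 * dotp p p.
Proof. unfold triple; induction p as [|x p IH]; cbn [map dotp]; [reflexivity|]; rewrite IH; ring. Qed.

Lemma triple_inj p q : triple p = triple q -> p = q.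
Proof.
unfold triple; revert q; induction p as [|x p IH]; intros [|y q] E; cbn [map] in E; try easy.
assert (E1 := f_equal (hd 0) E); assert (E2 := f_equal (@tl Z) E); cbn [hd tl] in E1, E2.
f_equal; [lia|now apply IH].
Qed.

(** Points over valid vectors and points over three times a root are disjoint, their norms being at
    most 32 and exactly 72. Each root is hit once, so the second kind contributes an explicit
    constant. *)
Lemma split_sum {A} (X : list A) u (F : list Z -> Z) : good X u ->
  zsum (fun x => F (u x)) X = VS X u F + zsum (fun r => F (triple r)) rootlist.
Proof.
intros HX.
assert (E : zsum (fun r => F (triple r)) rootlist =
  zsum (fun x => if inb (u x) (map triple rootlist) then F (u x) else 0) X).
{ rewrite cnt_sum, zsum_map.
  - apply zsum_ext; intros r Hr; rewrite (good_root _ _ HX) by now apply rootlist_root.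
    ring.
  - apply NoDup_map_NoDup_ForallPairs; [intros p q _ _; apply triple_inj|exact NoDup_rootlist]. }
rewrite E; unfold VS; rewrite <- zsum_add; apply zsum_ext; intros x Hx.
destruct (validb (u x)) eqn:V.
- destruct (inb (u x) (map triple rootlist)) eqn:I; [|lia].
  apply inb_In, in_map_iff in I as [r [Er Hr]]; apply rootlist_root in Hr as [_ [_ Hr]].
  apply validb_valid in V as [_ [_ [V _]]]; rewrite <- Er, dotp_triple, Hr in V; lia.
- destruct (good_values _ _ HX x Hx) as [V'|[r [Hr Er]]]; [apply validb_valid in V'; congruence|].
  assert (I : inb (u x) (map triple rootlist) = true); [|now rewrite I].
  apply inb_In; rewrite Er; now apply in_map, in_rootlist.
Qed.

(** The isolating polynomials in the fractions [dotp p p] / 8 and [dotp c p] / r, multiplied by 8^5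
    r^10: integral for every p, whether or not the divisions are exact. *)
Definition termval (r : Z) (c p : list Z) (tm : term) : Z :=
  let '(a, b, q) := tm in
  q * (8 ^ Z.of_nat (5 - b) * r ^ Z.of_nat (10 - 2 * a)) * (dotp p p ^ Z.of_nat b * dotp c p ^ Z.of_nat (2 * a)).

Definition Qbig (t : target) (p : list Z) : Z :=
  zsum (fun '(q, V) => zsum (fun c => zsum (termval (unit_ t) c p) q) V) (fams t).

Definition scale (t : target) : Z := 8 ^ 5 * unit_ t ^ 10.

Definition wf (t : target) : bool :=
  (0 <? unit_ t) && forallb (fun '(q, V) => forallb (fun '(a, b, _) => Nat.leb (a + b) 5) q
    && forallb (fun c => Nat.eqb (length c) 8) V) (fams t).

Lemma osum_link {A} (F : A -> option Z) (G : A -> Z) k l z :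
  (forall x y, In x l -> F x = Some y -> G x = k * y) -> osum F l = Some z -> zsum G l = k * z.
Proof.
revert z; induction l as [|x l IH]; intros z H E; cbn in E.
- injection E as <-; cbn; ring.
- fold (osum F l) in E; destruct (F x) eqn:Fx; [|easy]; destruct (osum F l) eqn:Fl; [|easy].
  injection E as <-; rewrite zsum_cons, (H x z0) by (auto; now left).
  rewrite (IH z1); [ring| |reflexivity]; intros; apply H; [now right|assumption].
Qed.

Lemma nth_row r q i n y : nth n (row r q i) None = Some y ->
  Z.of_nat n mod r = 0 /\ y = small q i (Z.of_nat n / r).
Proof.
unfold row; set (f := fun n => _); intros H.
destruct (Nat.lt_ge_cases n 42) as [Hn|Hn].
- rewrite (nth_indep _ _ (f 0%nat)), map_nth, seq_nth in H by (rewrite ?length_map, ?length_seq; assumption).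
  cbn [plus] in H; unfold f in H; destruct (Z.eqb_spec (Z.of_nat n mod r) 0); [|easy].
  split; [assumption|congruence].
- rewrite nth_overflow in H by (rewrite length_map, length_seq; assumption); easy.
Qed.

Lemma nth_rowof r q b n y : nth n (rowof (rows r q) b) None = Some y ->
  exists i, b = 32 - 8 * i /\ nth n (row r q i) None = Some y.
Proof.
assert (E : nth n [] (None : option Z) = None) by now destruct n.
unfold rowof, rows; intros H.
destruct (Z.eq_dec b 32) as [->|N1]; [now exists 0|].
destruct (Z.eq_dec b 24) as [->|N2]; [now exists 1|].
destruct (Z.eq_dec b 16) as [->|N3]; [now exists 2|].
destruct (Z.eq_dec b 8) as [->|N4]; [now exists 3|].
destruct (Z.eq_dec b 0) as [->|N5]; [now exists 4|].
destruct (Z.eq_dec b (-40)) as [->|N6]; [now exists 9|].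
exfalso; destruct b as [|p|p]; [easy| |];
  do 6 (destruct p as [p|p|]; try congruence).
Qed.

Lemma term_scale r c p q i j : 0 < r ->
  dotp p p = 8 * i -> Z.abs (dotp c p) = r * j -> forallb (fun '(a, b, _) => Nat.leb (a + b) 5) q = true ->
  zsum (termval r c p) q = 8 ^ 5 * r ^ 10 * small q i j.
Proof.
intros Hr Hs Hd Hq; unfold small; rewrite <- zsum_scal; apply zsum_ext; intros [[a b] k] Hk.
rewrite forallb_forall in Hq; specialize (Hq _ Hk); cbn beta iota in Hq; apply Nat.leb_le in Hq.
unfold termval; rewrite Hs.
assert (Ed : dotp c p ^ Z.of_nat (2 * a) = (r * j) ^ Z.of_nat (2 * a)).
{ rewrite <- Hd, Nat2Z.inj_mul, !Z.pow_mul_r by lia; f_equal.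
  change (Z.of_nat 2) with 2; rewrite !Z.pow_2_r; nia. }
rewrite Ed, !Z.pow_mul_l.
replace (8 ^ 5) with (8 ^ Z.of_nat (5 - b) * 8 ^ Z.of_nat b)
  by (rewrite <- Z.pow_add_r by lia; f_equal; lia).
replace (r ^ 10) with (r ^ Z.of_nat (10 - 2 * a) * r ^ Z.of_nat (2 * a))
  by (rewrite <- Z.pow_add_r by lia; f_equal; lia).
ring.
Qed.

Lemma qval_big t b p z : wf t = true -> b = 32 - dotp p p -> qval (table t) b p = Some z -> Qbig t p = scale t * z.
Proof.
unfold wf; rewrite andb_true_iff, Z.ltb_lt, forallb_forall; intros [Hr Hw] Hb H.
unfold qval, table in H.
assert (H' : osum (fun '(q, V) => osum (fun c => nth (Z.to_nat (Z.abs (dotp c p))) (rowof (rows (unit_ t) q) b) None) V) (fams t) = Some z).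
{ rewrite <- H; clear H Hw; induction (fams t) as [|[q V] l IH]; [reflexivity|]; cbn; f_equal; exact IH. }
revert H'; apply osum_link; intros [q V] y Hq; apply osum_link; intros c y' Hc E.
apply nth_rowof in E as [i [Hi E]]; apply nth_row in E as [E1 ->].
rewrite Z2Nat.id in * by lia.
apply term_scale; [assumption|lia| |].
- apply Z.div_exact; lia.
- specialize (Hw _ Hq); cbn beta iota in Hw; apply andb_true_iff in Hw; tauto.
Qed.

Definition ind (b : bool) : Z := if b then 1 else 0.

Definition Gval (t : target) (p : list Z) : Z := Qbig t p + - (scale t * mult t) * ind (tgt t p).

Lemma tcheck_sound t P : wf t = true -> tcheck P (t, table t) = true ->
  (forall par b p, In (par, b, p) P -> b = 32 - dotp p p) -> zsum (fun '(_, _, p) => Gval t p) P = 0.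
Proof.
intros Hw H HP; unfold tcheck in H.
match type of H with match ?o with _ => _ end = _ => destruct o as [z|] eqn:E; [|easy] end.
apply Z.eqb_eq in H; subst z.
rewrite <- (Z.mul_0_r (scale t)); revert E; apply osum_link.
intros [[par b] p] y Hp E; destruct (qval (table t) b p) as [z|] eqn:Q; [|easy].
cbn in E; injection E as <-; unfold Gval; rewrite (qval_big t b p z Hw (HP _ _ _ Hp) Q).
unfold ind; destruct (tgt t p); ring.
Qed.

Lemma combine_map {A B} (f : A -> B) l x : In x l -> In (x, f x) (combine l (map f l)).
Proof. induction l as [|y l IH]; cbn; [easy|]; intros [->|H]; auto. Qed.

Lemma targets_wf : forallb wf targets = true.
Proof. reflexivity. Qed.

Lemma target_sum {A} (X : list A) u t : good X u -> In t targets ->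
  VS X u (Qbig t) = scale t * mult t * VS X u (fun p => ind (tgt t p)).
Proof.
intros HX Ht.
assert (H : VS X u (Gval t) = 0).
{ apply (chk_init X u HX (combine targets tables)); [|exact chk_targets].
  intros P HP; apply tcheck_sound.
  - pose proof targets_wf as W; rewrite forallb_forall in W; now apply W.
  - rewrite forallb_forall in HP; apply HP; rewrite tables_eq; now apply combine_map. }
unfold Gval in H; rewrite VS_add, (VS_scal X u _ (fun p => ind (tgt t p))) in H; lia.
Qed.

Definition root_part tb : option Z := osum (fun r => qval tb (-40) (triple r)) rootlist.

Lemma root_part_sum t z : wf t = true -> root_part (table t) = Some z -> zsum (fun r => Qbig t (triple r)) rootlist = scale t * z.
Proof.
intros Hw; apply osum_link; intros r y Hr; apply qval_big; [exact Hw|].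
apply rootlist_root in Hr as [_ [_ Hr]]; rewrite dotp_triple, Hr; reflexivity.
Qed.

(** For each target, the contribution of three times the roots to the total of the polynomial, with
    the factor [scale] removed. *)
Definition root_values : list Z :=
  [-4445280; -1229437440; -1229437440; 74208234240; 74208234240; 4598415360; 403200].

Lemma root_parts : map root_part tables = map Some root_values.
Proof. vm_compute; reflexivity. Qed.

Fixpoint addat (i : nat) (t : Z) (c : list Z) : list Z :=
  match c, i with [], _ => [] | x :: c, O => (x + t) :: c | x :: c, S i => x :: addat i t c end.

Lemma length_addat i t c : length (addat i t c) = length c.
Proof. revert i; induction c as [|x c IH]; intros [|i]; cbn; auto. Qed.

Lemma dotp_addat i t c u : length c = length u -> (i < length c)%nat ->
  dotp (addat i t c) u = dotp c u + t * nth i u 0.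
Proof.
revert i u; induction c as [|x c IH]; intros [|i] [|y u] Hl Hi; cbn [length] in *; try lia; cbn [addat dotp nth].
- ring.
- rewrite IH by lia; ring.
Qed.

Lemma norm_addat i t c : (i < length c)%nat ->
  dotp (addat i t c) (addat i t c) = dotp c c + 2 * t * nth i c 0 + t ^ 2.
Proof.
revert i; induction c as [|x c IH]; intros [|i] Hi; cbn [length] in *; try lia; cbn [addat dotp nth].
- ring.
- rewrite IH by lia; ring.
Qed.

Lemma sum_nth_sq u : zsum (fun i => nth i u 0 ^ 2) (seq 0 (length u)) = dotp u u.
Proof.
induction u as [|x u IH]; [reflexivity|].
cbn [length seq]; rewrite zsum_cons, <- seq_shift, zsum_map; cbn [nth dotp]; rewrite IH; ring.
Qed.

(* [sum_j w_j f j / 50400] is the coefficient of [t^2] in [f t], for every polynomial [f] of degree at most 11. *)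
Definition stencil : list (Z * Z) :=
  [(-5, 8); (-4, -125); (-3, 1000); (-2, -6000); (-1, 42000); (0, -73766);
   (1, 42000); (2, -6000); (3, 1000); (4, -125); (5, 8)].

Lemma stencil_power A B a : (a <= 4)%nat ->
  zsum (fun '(t, w) => w * (A + t * B) ^ Z.of_nat (2 * S a)) stencil =
  50400 * ((Z.of_nat a + 1) * (2 * Z.of_nat a + 1)) * (A ^ Z.of_nat (2 * a) * B ^ 2).
Proof.
intros Ha; unfold stencil, zsum; cbn [fold_right].
do 5 (destruct a as [|a]; [cbn [Nat.mul Nat.add]; simpl Z.of_nat; ring|]); lia.
Qed.

Lemma stencil_norm N c a : (a <= 4)%nat ->
  zsum (fun '(t, w) => w * (N + 2 * t * c + t ^ 2) ^ Z.of_nat (S a)) stencil =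
  50400 * (Z.of_nat a + 1) * (N ^ Z.of_nat a + 2 * Z.of_nat a * N ^ Z.of_nat (a - 1) * c ^ 2).
Proof.
intros Ha; unfold stencil, zsum; cbn [fold_right].
do 5 (destruct a as [|a]; [cbn [Nat.sub]; simpl Z.of_nat; ring|]); lia.
Qed.

Section Laplace.
Context {A : Type} (X : list A) (u : A -> list Z).
Hypothesis Hu : forall x, In x X -> length (u x) = 8%nat.

Definition mixed (b a : nat) (c : list Z) : Z :=
  zsum (fun x => dotp (u x) (u x) ^ Z.of_nat b * dotp c (u x) ^ Z.of_nat (2 * a)) X.

(* The Laplacian in [c] of [(c.u)^(2a+2)] is [(2a+2)(2a+1) s (c.u)^(2a)]. *)
Lemma laplace b a K K' : (a <= 4)%nat -> (2 * Z.of_nat a + 1) * K' = (2 * Z.of_nat a + 8) * K ->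
  (forall c, length c = 8%nat -> mixed b (S a) c = K * dotp c c ^ Z.of_nat (S a)) ->
  forall c, length c = 8%nat -> mixed (S b) a c = K' * dotp c c ^ Z.of_nat a.
Proof.
intros Ha HK H c Hc.
set (n := (Z.of_nat a + 1)); set (m := (2 * Z.of_nat a + 1)).
assert (Hi : forall i, (i < 8)%nat ->
  zsum (fun x => 50400 * (n * m) * (dotp (u x) (u x) ^ Z.of_nat b * (dotp c (u x) ^ Z.of_nat (2 * a) * nth i (u x) 0 ^ 2))) X =
  50400 * n * K * (dotp c c ^ Z.of_nat a + 2 * Z.of_nat a * dotp c c ^ Z.of_nat (a - 1) * nth i c 0 ^ 2)).
{ intros i Hi.
  transitivity (zsum (fun '(t, w) => w * mixed b (S a) (addat i t c)) stencil).
  - transitivity (zsum (fun x => zsum (fun '(t, w) =>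
      w * (dotp (u x) (u x) ^ Z.of_nat b * dotp (addat i t c) (u x) ^ Z.of_nat (2 * S a))) stencil) X).
    + apply zsum_ext; intros x Hx.
      transitivity (dotp (u x) (u x) ^ Z.of_nat b *
        zsum (fun '(t, w) => w * (dotp c (u x) + t * nth i (u x) 0) ^ Z.of_nat (2 * S a)) stencil).
      * rewrite stencil_power by assumption; unfold n, m; ring.
      * rewrite <- zsum_scal; apply zsum_ext; intros [t w] _.
        rewrite dotp_addat by (rewrite ?Hu; lia || assumption); ring.
    + rewrite zsum_swap; apply zsum_ext; intros [t w] _; unfold mixed; now rewrite zsum_scal.
  - transitivity (K * zsum (fun '(t, w) => w * (dotp c c + 2 * t * nth i c 0 + t ^ 2) ^ Z.of_nat (S a)) stencil).
    + rewrite <- zsum_scal; apply zsum_ext; intros [t w] _.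
      rewrite H by (now rewrite length_addat); rewrite norm_addat by lia; ring.
    + rewrite stencil_norm by assumption; unfold n; ring. }
assert (S1 : zsum (fun i => zsum (fun x => 50400 * (n * m) * (dotp (u x) (u x) ^ Z.of_nat b *
    (dotp c (u x) ^ Z.of_nat (2 * a) * nth i (u x) 0 ^ 2))) X) (seq 0 8) = 50400 * (n * m) * mixed (S b) a c).
{ rewrite zsum_swap; unfold mixed; rewrite <- zsum_scal; apply zsum_ext; intros x Hx.
  transitivity (50400 * (n * m) * (dotp (u x) (u x) ^ Z.of_nat b * dotp c (u x) ^ Z.of_nat (2 * a)) *
    zsum (fun i => nth i (u x) 0 ^ 2) (seq 0 8)).
  - rewrite <- zsum_scal; apply zsum_ext; intros i _; ring.
  - rewrite <- (Hu x Hx) at 1; rewrite sum_nth_sq, Nat2Z.inj_succ, Z.pow_succ_r by lia; ring. }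
assert (S2 : zsum (fun i => 50400 * n * K * (dotp c c ^ Z.of_nat a +
    2 * Z.of_nat a * dotp c c ^ Z.of_nat (a - 1) * nth i c 0 ^ 2)) (seq 0 8) =
  50400 * n * K * (8 * dotp c c ^ Z.of_nat a + 2 * Z.of_nat a * dotp c c ^ Z.of_nat a)).
{ rewrite zsum_scal, zsum_add, (zsum_scal _ (fun i => nth i c 0 ^ 2)).
  rewrite <- Hc at 2; rewrite sum_nth_sq.
  replace (zsum (fun _ => dotp c c ^ Z.of_nat a) (seq 0 8)) with (8 * dotp c c ^ Z.of_nat a)
    by (unfold zsum; cbn [seq fold_right]; ring).
  destruct a as [|a]; [simpl Z.of_nat; ring|].
  replace (S a - 1)%nat with a by lia; rewrite (Nat2Z.inj_succ a), Z.pow_succ_r by lia; ring. }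
rewrite (zsum_ext _ _ _ (fun i Hi' => Hi i (proj2 (proj1 (in_seq 8 0 i) Hi')))), S2 in S1.
assert (0 < n * m) by (unfold n, m; nia).
apply (Z.mul_reg_l _ _ (50400 * (n * m))); [lia|].
rewrite <- S1; unfold m.
transitivity (50400 * n * ((2 * Z.of_nat a + 8) * K) * dotp c c ^ Z.of_nat a); [ring|].
rewrite <- HK; ring.
Qed.

End Laplace.

(** In dimension 8 each Laplacian multiplies the constant by (2a+8)/(2a+1); exactness of the
    division in the range a + b <= 5 is checked by computation in [mixed_moment]. *)
Fixpoint Kc (b a : nat) : Z :=
  match b with
  | O => shell_moment a * 12 ^ Z.of_nat a
  | S b => Kc b (S a) * (2 * Z.of_nat a + 8) / (2 * Z.of_nat a + 1)
  end.

Lemma good_length {A} (X : list A) u x : good X u -> In x X -> length (u x) = 8%nat.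
Proof.
intros HX Hx; destruct (good_values _ _ HX x Hx) as [[H _]|[r [[H _] ->]]]; [exact H|].
unfold triple; now rewrite length_map.
Qed.

Lemma mixed_moment {A} (X : list A) u b a c : good X u -> (a + b <= 5)%nat -> length c = 8%nat ->
  mixed X u b a c = Kc b a * dotp c c ^ Z.of_nat a.
Proof.
intros HX; revert a c; induction b as [|b IH]; intros a c Hab Hc.
- unfold mixed; rewrite (zsum_ext _ (fun x => dotp c (u x) ^ Z.of_nat (2 * a))) by (intros; rewrite Z.mul_1_l; reflexivity).
  rewrite (good_moment _ _ HX) by (assumption || lia); rewrite Z.pow_mul_l; cbn [Kc]; ring.
- apply (laplace X u (fun x Hx => good_length X u x HX Hx) b a (Kc b (S a))); try lia; try assumption.
  + clear - Hab; revert Hab.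
    do 5 (destruct a as [|a]; [do 5 (destruct b as [|b]; [intros; vm_compute; reflexivity|]); lia|]); lia.
  + intros c' Hc'; apply IH; [lia|exact Hc'].
Qed.

Definition Ktot (t : target) : Z :=
  zsum (fun '(q, V) => zsum (fun c => zsum (fun '(a, b, k) =>
    k * (8 ^ Z.of_nat (5 - b) * unit_ t ^ Z.of_nat (10 - 2 * a)) * (Kc b a * dotp c c ^ Z.of_nat a)) q) V) (fams t).

Lemma Qbig_total {A} (X : list A) u t : good X u -> wf t = true -> zsum (fun x => Qbig t (u x)) X = Ktot t.
Proof.
intros HX Hw; unfold wf in Hw; apply andb_true_iff in Hw as [_ Hw]; rewrite forallb_forall in Hw.
unfold Qbig, Ktot; rewrite zsum_swap; apply zsum_ext; intros [q V] Hq.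
specialize (Hw _ Hq); cbn beta iota in Hw; apply andb_true_iff in Hw as [Hq' HV]; rewrite forallb_forall in Hq', HV.
rewrite zsum_swap; apply zsum_ext; intros c Hc; specialize (HV c Hc); apply Nat.eqb_eq in HV.
rewrite zsum_swap; apply zsum_ext; intros [[a b] k] Hk; specialize (Hq' _ Hk); cbn beta iota in Hq'; apply Nat.leb_le in Hq'.
unfold termval; rewrite zsum_scal; f_equal; exact (mixed_moment X u b a c HX Hq' HV).
Qed.

Lemma target_value {A} (X : list A) u t z v : good X u -> In t targets -> root_part (table t) = Some z ->
  Ktot t = scale t * (z + mult t * v) -> 0 < scale t * mult t ->
  VS X u (fun p => ind (tgt t p)) = v.
Proof.
intros HX Ht Hz Hv Hs.
assert (Hw : wf t = true) by (pose proof targets_wf as W; rewrite forallb_forall in W; now apply W).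
pose proof (Qbig_total X u t HX Hw) as H.
rewrite (split_sum X u (Qbig t) HX), (target_sum X u t HX Ht), (root_part_sum t z Hw Hz), Hv in H.
apply (Z.mul_reg_l _ _ (scale t * mult t)); lia.
Qed.

(** Keeps the property of X abstract while the arithmetic for all targets is left to a single
    boolean goal. *)
Lemma values_forall2 (ts : list target) (zs vs : list Z) (P : target -> Z -> Prop) :
  (forall t z v, In t ts -> root_part (table t) = Some z ->
    Ktot t = scale t * (z + mult t * v) -> 0 < scale t * mult t -> P t v) ->
  map root_part (map table ts) = map Some zs -> length vs = length ts ->
  forallb (fun '(t, (z, v)) => (Ktot t =? scale t * (z + mult t * v)) && (0 <? scale t * mult t))
    (combine ts (combine zs vs)) = true -> Forall2 P ts vs.
Proof.
revert zs vs; induction ts as [|t ts IH]; intros [|z zs] [|v vs] H R L C; try easy; constructor.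
- cbn [combine forallb] in C; rewrite !andb_true_iff, Z.eqb_eq, Z.ltb_lt in C.
  apply (H t z v); [now left| |tauto|tauto].
  exact (f_equal (hd None) R).
- apply (IH zs); [intros; apply (H t0 z0 v0); auto; now right|exact (f_equal (@tl _) R)|now injection L|].
  cbn [combine forallb] in C; now apply andb_true_iff in C.
Qed.

Lemma target_values {A} (X : list A) u : good X u ->
  Forall2 (fun t v => VS X u (fun p => ind (tgt t p)) = v) targets
    [232470; 18360; 18360; 990; 990; 2520; 1092000].
Proof.
intros HX; apply (values_forall2 targets root_values).
- intros t z v Ht; now apply target_value.
- rewrite <- root_parts, tables_eq; reflexivity.
- reflexivity.
- vm_compute; reflexivity.
Qed.

(** * Symmetries *)

(** Restricted to involutions, so that f p = q and p = f q are equivalent. Adjacent transpositions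
    and changes of two signs, which generate the symmetries in use, are of this kind. *)
Record isosym (f : list Z -> list Z) : Prop := Isosym {
  iso_length : forall p, length (f p) = length p;
  iso_inv : forall p, length p = 8%nat -> f (f p) = p;
  iso_dot : forall c p, length c = 8%nat -> length p = 8%nat -> dotp (f c) (f p) = dotp c p;
  iso_e8 : forall p, length p = 8%nat -> e8 p = true -> e8 (f p) = true;
  iso_scal : forall k p, f (map (Z.mul k) p) = map (Z.mul k) (f p);
  iso_congr : forall p q, congr3 p q -> congr3 (f p) (f q) }.

Lemma dbl_spec p : dbl p = true <-> exists r, p = map (Z.mul 2) r /\ e8 r = true.
Proof.
unfold dbl; rewrite andb_true_iff, forallb_forall; split.
- intros [H1 H2]; exists (map Z.div2 p); split; [|exact H2].
  rewrite map_map; transitivity (map (fun x => x) p); [symmetry; apply map_id|].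
  apply map_ext_in; intros x Hx; specialize (H1 x Hx).
  rewrite (Z.div2_odd x) at 1; rewrite <- Z.negb_even, H1; cbn [negb Z.b2z]; ring.
- intros [r [-> Hr]]; split.
  + intros x Hx; apply in_map_iff in Hx as [y [<- _]]; now rewrite Z.even_mul.
  + rewrite map_map, (map_ext _ (fun x => x)), map_id; [exact Hr|].
    intros x; rewrite Z.div2_div, Z.mul_comm, Z.div_mul; lia.
Qed.

Lemma opp_scal p : map Z.opp p = map (Z.mul (-1)) p.
Proof. apply map_ext; intros; lia. Qed.

Section Transport.
Context {A : Type} (X : list A) (u : A -> list Z) (f : list Z -> list Z).
Hypothesis (HX : good X u) (Hf : isosym f).

Lemma iso_dbl p : length p = 8%nat -> dbl (f p) = dbl p.
Proof.
intros Hl; apply eq_true_iff_eq; rewrite !dbl_spec; split; intros [r [E Hr]]; exists (f r).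
- assert (length r = 8%nat) by (apply (f_equal (@length Z)) in E; rewrite length_map, (iso_length f Hf) in E; lia).
  split; [|now apply (iso_e8 f Hf)].
  now rewrite <- (iso_scal f Hf), <- E, (iso_inv f Hf).
- assert (length r = 8%nat) by (apply (f_equal (@length Z)) in E; rewrite length_map in E; lia).
  split; [|now apply (iso_e8 f Hf)]; now rewrite E, (iso_scal f Hf).
Qed.

Lemma iso_valid p : valid p -> valid (f p).
Proof.
intros [H1 [H2 [H3 H4]]]; repeat split.
- now rewrite (iso_length f Hf).
- now apply (iso_e8 f Hf).
- now rewrite (iso_dot f Hf).
- now rewrite (iso_dot f Hf), iso_dbl.
Qed.

Lemma iso_leqb p q : length p = 8%nat -> length q = 8%nat -> leqb (f p) q = leqb p (f q).
Proof.
intros Hp Hq; apply eq_true_iff_eq; rewrite !leqb_eq; split; [intros <-|intros ->]; now rewrite (iso_inv f Hf).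
Qed.

Lemma iso_cnt p : length p = 8%nat -> cnt X (fun x => f (u x)) p = cnt X u (f p).
Proof.
intros Hp; apply zsum_ext; intros x Hx; rewrite iso_leqb; auto; exact (good_length X u x HX Hx).
Qed.

Lemma iso_good : good X (fun x => f (u x)).
Proof.
constructor.
- intros c j Hc Hj; rewrite (zsum_ext _ (fun x => dotp (f c) (u x) ^ Z.of_nat (2 * j))).
  + rewrite (good_moment _ _ HX) by (now rewrite ?(iso_length f Hf)); now rewrite (iso_dot f Hf).
  + intros x Hx; f_equal; rewrite <- (iso_inv f Hf c Hc) at 1; apply (iso_dot f Hf).
    * now rewrite (iso_length f Hf).
    * exact (good_length X u x HX Hx).
- intros x Hx; destruct (good_values _ _ HX x Hx) as [V|[r [[R1 [R2 R3]] Er]]]; [left; now apply iso_valid|].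
  right; exists (f r); split; [|rewrite Er; apply (iso_scal f Hf)].
  repeat split; [now rewrite (iso_length f Hf)|now apply (iso_e8 f Hf)|now rewrite (iso_dot f Hf)].
- intros r [R1 [R2 R3]]; rewrite iso_cnt by (unfold triple; now rewrite length_map).
  unfold triple; rewrite (iso_scal f Hf); apply (good_root _ _ HX).
  repeat split; [now rewrite (iso_length f Hf)|now apply (iso_e8 f Hf)|now rewrite (iso_dot f Hf)].
- intros p Hp; rewrite !iso_cnt by (now rewrite ?length_map).
  rewrite opp_scal, (iso_scal f Hf), <- opp_scal; apply (good_opp _ _ HX); now rewrite (iso_length f Hf).
- intros p q Hp Hq Ep Eq Hn Hc; rewrite !iso_cnt by assumption; apply (good_congr _ _ HX).
  + now rewrite (iso_length f Hf).
  + now rewrite (iso_length f Hf).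
  + now apply (iso_e8 f Hf).
  + now apply (iso_e8 f Hf).
  + now rewrite !(iso_dot f Hf).
  + now apply (iso_congr f Hf).
Qed.

End Transport.

(** Quantified over all good families: composing u with a symmetry gives another good family, so a
    count established for v moves along its orbit. *)
Definition all_cnt (v : list Z) (N : Z) : Prop :=
  length v = 8%nat /\ forall A (X : list A) u, good X u -> cnt X u v = N.

Lemma all_cnt_iso f v N : isosym f -> all_cnt v N -> all_cnt (f v) N.
Proof.
intros Hf [Hl Hv]; split; [now rewrite (iso_length f Hf)|]; intros A X u HX.
rewrite <- (iso_cnt X u f HX Hf v Hl); apply Hv; now apply iso_good.
Qed.

Fixpoint swp (i : nat) (p : list Z) : list Z :=
  match i, p with
  | O, x :: y :: p => y :: x :: p
  | S i, x :: p => x :: swp i p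
  | _, p => p
  end.

Lemma swp_map i (g : Z -> Z) p : swp i (map g p) = map g (swp i p).
Proof. revert p; induction i as [|i IH]; intros [|x p]; try reflexivity; [destruct p; reflexivity|cbn; f_equal; apply IH]. Qed.

Lemma swp_length i p : length (swp i p) = length p.
Proof. revert p; induction i as [|i IH]; intros [|x p]; try reflexivity; [destruct p; reflexivity|cbn; f_equal; apply IH]. Qed.

Lemma swp_inv i p : swp i (swp i p) = p.
Proof. revert p; induction i as [|i IH]; intros [|x p]; try reflexivity; [destruct p; reflexivity|cbn; f_equal; apply IH]. Qed.

Lemma swp_dot i c p : length c = length p -> dotp (swp i c) (swp i p) = dotp c p.
Proof.
revert c p; induction i as [|i IH]; intros [|x c] [|y p] H; cbn in H; try easy.
- destruct c, p; cbn in H; try easy; cbn [swp dotp]; ring.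
- cbn [swp dotp]; rewrite IH by lia; reflexivity.
Qed.

Lemma swp_perm i p : Permutation (swp i p) p.
Proof.
revert p; induction i as [|i IH]; intros [|x p]; try reflexivity; cbn.
- destruct p; [reflexivity|apply perm_swap].
- now apply perm_skip.
Qed.

Lemma lsum_perm p q : Permutation p q -> lsum p = lsum q.
Proof. unfold lsum; induction 1; cbn [fold_right]; lia. Qed.

Lemma e8_spec p : e8 p = true <-> (forall x y, In x p -> In y p -> Z.odd x = Z.odd y) /\ lsum p mod 4 = 0.
Proof.
unfold e8; rewrite andb_true_iff, even_sum4_mod, forallb_forall.
split; intros [H H4]; split; auto; [intros x y Hx Hy|intros x Hx].
- rewrite (eqb_prop _ _ (H x Hx)), (eqb_prop _ _ (H y Hy)); reflexivity.
- apply eqb_true_iff, H; [exact Hx|]; destruct p; [easy|now left].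
Qed.

Lemma isosym_swp i : isosym (swp i).
Proof.
constructor.
- apply swp_length.
- intros p _; apply swp_inv.
- intros c p Hc Hp; apply swp_dot; congruence.
- intros p _; rewrite !e8_spec, (lsum_perm _ _ (swp_perm i p)); intros [H H4]; split; [|exact H4].
  intros x y Hx Hy; apply H; eapply Permutation_in; eauto using swp_perm.
- intros k p; apply swp_map.
- intros p q H; revert i; induction H as [|x y p q Hxy H IH]; intros [|i]; cbn; try constructor.
  + inversion H; subst; repeat constructor; auto.
  + assumption.
  + apply IH.
Qed.

Fixpoint negat (j : nat) (p : list Z) : list Z :=
  match j, p with _, [] => [] | O, x :: p => - x :: p | S j, x :: p => x :: negat j p end.

Definition neg0 (j : nat) (p : list Z) : list Z :=
  match p with [] => [] | x :: p => - x :: negat j p end.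

Lemma negat_length j p : length (negat j p) = length p.
Proof. revert p; induction j as [|j IH]; intros [|x p]; cbn; auto. Qed.

Lemma negat_inv j p : negat j (negat j p) = p.
Proof. revert p; induction j as [|j IH]; intros [|x p]; cbn [negat]; f_equal; auto; lia. Qed.

Lemma negat_dot j c p : length c = length p -> dotp (negat j c) (negat j p) = dotp c p.
Proof.
revert c p; induction j as [|j IH]; intros [|x c] [|y p] H; cbn in H; try easy; cbn [negat dotp]; [ring|].
rewrite IH by lia; reflexivity.
Qed.

Lemma negat_lsum j p : (j < length p)%nat -> lsum (negat j p) = lsum p - 2 * nth j p 0.
Proof.
unfold lsum; revert p; induction j as [|j IH]; intros [|x p] H; cbn [length] in H; try lia; cbn [negat fold_right nth]; [lia|].
rewrite IH by lia; lia.
Qed.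

Lemma negat_in j p x : In x (negat j p) -> exists y, In y p /\ Z.odd x = Z.odd y.
Proof.
revert p; induction j as [|j IH]; intros [|y p] H; cbn in H; try easy; destruct H as [H|H].
- exists y; split; [now left|]; subst x; apply Z.odd_opp.
- exists x; split; [now right|reflexivity].
- exists y; split; [now left|now subst].
- apply IH in H as [z [Hz E]]; exists z; split; [now right|exact E].
Qed.

Lemma isosym_neg0 j : (j < 7)%nat -> isosym (neg0 j).
Proof.
intros Hj; constructor.
- intros [|x p]; cbn [neg0 length]; [reflexivity|]; now rewrite negat_length.
- intros [|x p] _; cbn [neg0]; [reflexivity|]; now rewrite negat_inv, Z.opp_involutive.
- intros [|x c] [|y p] Hc Hp; cbn [length] in *; try easy; cbn [neg0 dotp].
  rewrite negat_dot by lia; ring.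
- intros [|x p] Hl; cbn [length] in Hl; [easy|]; rewrite !e8_spec; intros [H H4]; split.
  + assert (K : forall z, In z (neg0 j (x :: p)) -> Z.odd z = Z.odd x).
    { intros z [<-|Hz]; [apply Z.odd_opp|].
      apply negat_in in Hz as [y [Hy ->]]; apply H; [now right|now left]. }
    intros y z Hy Hz; now rewrite (K y Hy), (K z Hz).
  + assert (E : lsum (neg0 j (x :: p)) = lsum (x :: p) - 2 * (x + nth j p 0)).
    { cbn [neg0]; unfold lsum at 1 2; cbn [fold_right]; fold (lsum (negat j p)) (lsum p).
      rewrite negat_lsum by lia; ring. }
    rewrite E.
    assert (P : Z.even (x + nth j p 0) = true).
    { rewrite <- Z.negb_odd, Z.odd_add, (H (nth j p 0) x); [now rewrite xorb_nilpotent| |now left].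
      right; apply nth_In; lia. }
    apply Z.even_spec in P as [k Hk]; rewrite Hk.
    replace (lsum (x :: p) - 2 * (2 * k)) with (lsum (x :: p) + (- k) * 4) by ring.
    now rewrite Z_mod_plus_full.
- intros k [|x p]; cbn [neg0 map]; [reflexivity|]; f_equal; [ring|].
  clear; revert p; induction j as [|j IH]; intros [|y p]; cbn [negat map]; try reflexivity; f_equal; [ring|apply IH].
- intros p q H; destruct H as [|x y p q Hxy H]; [constructor|]; cbn [neg0].
  assert (K : forall x y, (x - y) mod 3 = 0 -> (- x - - y) mod 3 = 0).
  { intros a b Hab; apply Z.mod_divide in Hab as [k Hk]; [|lia].
    replace (- a - - b) with (- k * 3) by lia; apply Z_mod_mult. }
  constructor; [now apply K|]; clear Hj Hxy x y; revert j.
  induction H as [|x y p q Hxy H IH]; intros [|j]; cbn [negat]; constructor; auto.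
Qed.

Lemma all_cnt_perm p q N : Permutation p q -> all_cnt p N -> all_cnt q N.
Proof.
intros H; change p with ([] ++ p); change q with ([] ++ q); generalize (@nil Z).
induction H as [|x p q H IH|x y p|p q r H1 IH1 H2 IH2]; intros pre Hp; auto.
- change (x :: q) with ([x] ++ q); rewrite app_assoc; apply IH; now rewrite <- app_assoc.
- replace (pre ++ x :: y :: p) with (swp (length pre) (pre ++ y :: x :: p)).
  + now apply all_cnt_iso; [apply isosym_swp|].
  + clear; induction pre as [|z pre IH]; cbn; [reflexivity|now f_equal].
Qed.

(** Only changes of two signs preserve E8; as the first entry is 0, pairing it with another entry
    changes that entry alone. *)
Lemma all_cnt_abs b a N : all_cnt (0 :: a ++ map Z.abs b) N -> all_cnt (0 :: a ++ b) N.
Proof.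
revert a; induction b as [|x b IH]; intros a H; [exact H|].
change (x :: b) with ([x] ++ b); rewrite app_assoc; apply IH; rewrite <- app_assoc; cbn [app map] in *.
destruct (Z.abs_eq_or_opp x) as [E|E]; rewrite E in H; [exact H|].
replace (0 :: a ++ x :: map Z.abs b) with (neg0 (length a) (0 :: a ++ - x :: map Z.abs b)).
- apply all_cnt_iso; [|exact H]; apply isosym_neg0.
  destruct H as [H _]; cbn [length] in H; rewrite length_app in H; cbn [length] in H; lia.
- cbn [neg0]; f_equal; clear; induction a as [|y a IH]; cbn [length app negat]; f_equal; [lia|exact IH].
Qed.

Fixpoint insert (x : Z) (l : list Z) : list Z :=
  match l with [] => [x] | y :: l => if y <=? x then x :: y :: l else y :: insert x l end.

Definition isort (l : list Z) : list Z := fold_right insert [] l.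

Lemma isort_perm l : Permutation (isort l) l.
Proof.
induction l as [|x l IH]; [reflexivity|]; cbn [isort fold_right]; fold (isort l).
transitivity (x :: isort l); [|now apply perm_skip].
generalize (isort l); clear; induction l as [|y l IH]; [reflexivity|]; cbn.
destruct (y <=? x); [reflexivity|]; rewrite IH; apply perm_swap.
Qed.

Lemma all_cnt_sort p N : hd 1 p = 0 -> all_cnt (isort (map Z.abs p)) N -> all_cnt p N.
Proof.
destruct p as [|x p]; cbn [hd]; [easy|]; intros ->.
intros H; apply (all_cnt_abs p []); apply (all_cnt_perm _ _ N (isort_perm (map Z.abs (0 :: p))) H).
Qed.

Lemma forallb_perm {A} (g : A -> bool) p q : Permutation p q -> forallb g p = forallb g q.
Proof.
induction 1 as [|x p q H IH|x y p|p q r H1 IH1 H2 IH2]; cbn; try congruence.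
now rewrite !andb_assoc, (andb_comm (g x)).
Qed.

Definition all_five (z : list Z) : Prop :=
  forall A (X : list A) u, good X u -> VS X u (fun p => ind (five z p)) = 2520.

Lemma all_five_swp i z : all_five z -> all_five (swp i z).
Proof.
intros H A X u HX.
rewrite <- (H A X (fun x => swp i (u x)) (iso_good X u _ HX (isosym_swp i))).
apply zsum_ext; intros x Hx.
assert (Hl := good_length X u x HX Hx).
replace (validb (swp i (u x))) with (validb (u x)).
- destruct (validb (u x)); [|reflexivity]; f_equal; unfold five.
  rewrite swp_dot by reflexivity; f_equal; [f_equal|].
  + apply forallb_perm, Permutation_sym, swp_perm.
  + unfold support; rewrite <- swp_map; apply eq_true_iff_eq; rewrite !leqb_eq.
    split; [intros ->|intros <-]; now rewrite swp_inv.
- apply eq_true_iff_eq; rewrite !validb_valid; split; intros V.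
  + now apply (iso_valid _ (isosym_swp i)).
  + rewrite <- (swp_inv i (u x)); now apply (iso_valid _ (isosym_swp i)).
Qed.

Lemma all_five_perm z z' : Permutation z z' -> all_five z -> all_five z'.
Proof.
intros H; change z with ([] ++ z); change z' with ([] ++ z'); generalize (@nil Z).
induction H as [|x p q H IH|x y p|p q r H1 IH1 H2 IH2]; intros pre Hp; auto.
- change (x :: q) with ([x] ++ q); rewrite app_assoc; apply IH; now rewrite <- app_assoc.
- replace (pre ++ x :: y :: p) with (swp (length pre) (pre ++ y :: x :: p)); [now apply all_five_swp|].
  clear; induction pre as [|z pre IH]; cbn; [reflexivity|now f_equal].
Qed.

(** * Counting perpendicular vectors *)

Lemma Forall2_combine_in {A B} (P : A -> B -> Prop) l l' x y : Forall2 P l l' -> In (x, y) (combine l l') -> P x y.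
Proof. induction 1 as [|a b l l' H _ IH]; cbn; [easy|]; intros [E|E]; [now injection E as <- <-|auto]. Qed.

Lemma plusminus_cnt {A} (X : list A) u v : good X u -> valid v -> v <> map Z.opp v ->
  VS X u (fun p => ind (plusminus v p)) = 2 * cnt X u v.
Proof.
intros HX Hv Hne; assert (Hl : length v = 8%nat) by apply Hv.
assert (Hv' : valid (map Z.opp v)).
{ destruct Hv as [H1 [H2 [H3 H4]]].
  assert (D : dotp (map Z.opp v) (map Z.opp v) = dotp v v).
  { clear; induction v as [|x v IH]; cbn [map dotp]; [reflexivity|]; rewrite IH; ring. }
  assert (E : forall w, e8 w = true -> e8 (map Z.opp w) = true).
  { clear; intros w; rewrite !e8_spec; intros [H H4]; split.
    - intros x y Hx Hy; apply in_map_iff in Hx as [x' [<- Hx]]; apply in_map_iff in Hy as [y' [<- Hy]].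
      rewrite !Z.odd_opp; now apply H.
    - replace (lsum (map Z.opp w)) with (- lsum w).
      + apply Z.mod_divide in H4 as [k Hk]; [|lia]; rewrite Hk, <- Z.mul_opp_l; apply Z_mod_mult.
      + clear; unfold lsum; induction w as [|x w IH]; cbn [map fold_right]; lia. }
  repeat split; [now rewrite length_map|now apply E|lia|].
  intros H; rewrite D in H; specialize (H4 H); apply not_true_iff_false; intros Hd.
  apply not_true_iff_false in H4; apply H4, dbl_spec; apply dbl_spec in Hd as [r [Er Hr]].
  exists (map Z.opp r); split; [|now apply E].
  rewrite map_map, (map_ext _ (fun x => Z.opp (Z.mul 2 x))) by (intros; ring).
  rewrite <- map_map, <- Er, map_map, (map_ext _ (fun x => x)), map_id; [reflexivity|]; intros; ring. }
transitivity (zsum (fun x => if inb (u x) [v; map Z.opp v] then 1 else 0) X).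
- apply zsum_ext; intros x _; unfold plusminus, inb; cbn [existsb]; rewrite orb_false_r.
  apply validb_valid in Hv, Hv'.
  destruct (leqb (u x) v) eqn:E1; [apply leqb_eq in E1; now rewrite E1, Hv|].
  destruct (leqb (u x) (map Z.opp v)) eqn:E2; [apply leqb_eq in E2; now rewrite E2, Hv'|].
  now destruct (validb (u x)).
- rewrite (cnt_sum X u (fun _ => 1)).
  + rewrite !zsum_cons; cbn [zsum fold_right]; rewrite (good_opp _ _ HX v Hl); ring.
  + repeat constructor; cbn; intuition congruence.
Qed.

(** One vector from each orbit of permutations and sign changes on the vectors of E8 with first
    entry 0 and norm at most 6; in each of the norms 4 and 6 there are two orbits. *)
Definition reps : list (list Z * Z) :=
  [(zeros, 1092000); ([2; 2; 0; 0; 0; 0; 0; 0], 116235); ([4; 0; 0; 0; 0; 0; 0; 0], 9180);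
   ([2; 2; 2; 2; 0; 0; 0; 0], 9180); ([4; 2; 2; 0; 0; 0; 0; 0], 495); ([2; 2; 2; 2; 2; 2; 0; 0], 495)].

Ltac solve_valid := apply validb_valid; vm_compute; reflexivity.

Lemma all_cnt_rep v N : In (v, N) reps -> all_cnt v N.
Proof.
intros H; split; [repeat destruct H as [H|H]; try (injection H as <- <-; reflexivity); easy|].
intros A X u HX.
pose proof (fun t n => Forall2_combine_in _ _ _ t n (target_values X u HX)) as T.
assert (E : forall w n, In (plusminus w, n) (combine (map tgt targets) [232470; 18360; 18360; 990; 990; 2520; 1092000]) ->
  VS X u (fun p => ind (plusminus w p)) = n).
{ intros w n Hw; rewrite <- (map_id [232470; 18360; 18360; 990; 990; 2520; 1092000]) in Hw.
  assert (C : forall l l', combine (map tgt l) (map (fun x => x) l') = map (fun '(t, n) => (tgt t, n : Z)) (combine l l')).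
  { clear; induction l as [|t l IH]; intros [|n l']; cbn; try reflexivity; now rewrite IH. }
  unfold id in Hw; rewrite C in Hw; apply in_map_iff in Hw as [[t n'] [Et Ht]].
  injection Et as Et <-; rewrite <- Et; now apply T. }
destruct H as [H|H].
{ injection H as <- <-.
  rewrite <- (E zeros 1092000 ltac:(cbn; tauto)).
  apply zsum_ext; intros x _; unfold plusminus; change (map Z.opp zeros) with zeros.
  destruct (leqb (u x) zeros) eqn:E1.
  - apply leqb_eq in E1; rewrite E1; reflexivity.
  - now destruct (validb (u x)). }
assert (P : forall w n, valid w -> w <> map Z.opp w ->
  In (plusminus w, n) (combine (map tgt targets) [232470; 18360; 18360; 990; 990; 2520; 1092000]) -> 2 * cnt X u w = n).
{ intros w n Hw Hne Hin; rewrite <- (plusminus_cnt X u w HX Hw Hne); now apply E. }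
repeat destruct H as [H|H]; try (injection H as <- <-); try easy.
- specialize (P [2; 2; 0; 0; 0; 0; 0; 0] 232470 ltac:(solve_valid) ltac:(discriminate) ltac:(cbn; tauto)); lia.
- specialize (P [4; 0; 0; 0; 0; 0; 0; 0] 18360 ltac:(solve_valid) ltac:(discriminate) ltac:(cbn; tauto)); lia.
- specialize (P [2; 2; 2; 2; 0; 0; 0; 0] 18360 ltac:(solve_valid) ltac:(discriminate) ltac:(cbn; tauto)); lia.
- specialize (P [4; 2; 2; 0; 0; 0; 0; 0] 990 ltac:(solve_valid) ltac:(discriminate) ltac:(cbn; tauto)); lia.
- specialize (P [2; 2; 2; 2; 2; 2; 0; 0] 990 ltac:(solve_valid) ltac:(discriminate) ltac:(cbn; tauto)); lia.
Qed.

Lemma all_five_base : all_five [0; 0; 0; 1; 1; 1; 1; 1].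
Proof.
intros A X u HX.
pose proof (fun t n => Forall2_combine_in _ _ _ t n (target_values X u HX)) as T.
apply (T (nth 5 targets (Target [] 0 0 (fun _ => true))) 2520).
do 5 right; left; reflexivity.
Qed.

Fixpoint masks (m n : nat) : list (list Z) :=
  match m, n with
  | O, O => [[]]
  | O, S _ => []
  | S m, O => map (cons 0) (masks m O)
  | S m, S n' => map (cons 1) (masks m n') ++ map (cons 0) (masks m n)
  end.

Definition perp_masks (k : nat) : list (list Z) := map (app (repeat 0 k)) (masks (8 - k) 5).

Definition perp_points (k : nat) : list (list Z) :=
  filter validb (map (fun s => repeat 0 k ++ snd s) (gen (8 - k) [(false, 32, [])])).

Definition rep_count (p : list Z) : Z :=
  match find (fun '(r, _) => leqb r (isort (map Z.abs p))) reps with Some (_, N) => N | None => -1 end.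

Definition small_norm (p : list Z) : bool := dotp p p <=? 24.

Definition perp_vec (k : nat) (p : list Z) : bool := forallb (fun v => v =? 0) (firstn k p).

Definition perp_check (k : nat) : bool :=
  forallb (fun p => if small_norm p then (hd 1 p =? 0) && (0 <=? rep_count p)
    else (dotp p p =? 32) && forallb Z.even p && inb (support p) (perp_masks k)) (perp_points k) &&
  nodupb (perp_masks k) &&
  forallb (fun z => leqb (isort z) [1; 1; 1; 1; 1; 0; 0; 0] && perp_vec k z) (perp_masks k).

Definition perp_total (k : nat) : Z :=
  zsum rep_count (filter small_norm (perp_points k)) + 2520 * Z.of_nat (length (perp_masks k))
  + zsum (fun r => ind (perp_vec k (triple r))) rootlist.

Lemma gen_inv (I : state -> Prop) n P : (forall s, In s P -> I s) ->
  (forall r s s', I s -> In s' (extend r s) -> I s') -> forall s, In s (gen n P) -> I s.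
Proof.
intros HP Hs; revert P HP; induction n as [|n IH]; intros P HP; [exact HP|].
apply IH; intros s' H; apply in_flat_map in H as [s [H1 H2]].
unfold extall in H2; apply in_flat_map in H2 as [r [_ H2]]; exact (Hs r s s' (HP s H1) H2).
Qed.

Lemma NoDup_perp_points k : NoDup (perp_points k).
Proof.
apply NoDup_filter, NoDup_map_NoDup_ForallPairs; [|apply NoDup_gen; repeat constructor; auto].
assert (K : forall s, In s (gen (8 - k) [(false, 32, [])]) ->
  let '(par, b, p) := s in par = false /\ b = 32 - dotp p p).
{ apply gen_inv.
  - intros s [<-|[]]; split; reflexivity.
  - intros r [[par b] p] s' [-> ->] H; apply in_extend in H as [v [_ [_ ->]]]; split; [reflexivity|].
    cbn [dotp]; ring. }
intros [[par b] p] [[par' b'] p'] H1 H2 E; apply K in H1, H2; destruct H1 as [-> ->], H2 as [-> ->].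
cbn [snd] in E; apply app_inv_head in E; now subst.
Qed.

Lemma perp_vec_spec k p : perp_vec k p = true <-> firstn k p = repeat 0 (length (firstn k p)).
Proof.
unfold perp_vec; induction (firstn k p) as [|x q IH]; cbn; [tauto|].
rewrite andb_true_iff, Z.eqb_eq, IH; split; [intros [-> <-]; reflexivity|intros E; now injection E].
Qed.

Lemma perp_points_vec k p : In p (perp_points k) -> valid p /\ perp_vec k p = true.
Proof.
intros H; apply filter_In in H as [H V]; split; [now apply validb_valid|].
apply in_map_iff in H as [s [<- _]]; apply perp_vec_spec.
rewrite firstn_app, repeat_length, Nat.sub_diag, app_nil_r, firstn_all2 by (now rewrite repeat_length).
now rewrite repeat_length.
Qed.

Lemma perp_points_complete k p : (1 <= k <= 8)%nat -> valid p -> perp_vec k p = true -> In p (perp_points k).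
Proof.
intros Hk V H; apply filter_In; split; [|now apply validb_valid].
destruct V as [Hl [He [Hn _]]]; apply perp_vec_spec in H; rewrite length_firstn, Hl, Nat.min_l in H by lia.
assert (Ep : p = repeat 0 k ++ skipn k p) by (rewrite <- H; symmetry; apply firstn_skipn).
assert (par : parity p = false).
{ rewrite Ep; destruct k; [lia|reflexivity]. }
apply in_map_iff; exists (false, 32 - dotp (skipn k p) (skipn k p), skipn k p ++ []).
cbn [snd]; rewrite app_nil_r; split; [now symmetry|].
rewrite <- (app_nil_r (skipn k p)) at 3; apply gen_complete.
- rewrite length_skipn; lia.
- apply Forall_forall; intros x Hx; rewrite <- par.
  pose proof (e8_parity p He) as F; rewrite Forall_forall in F; apply F.
  rewrite Ep; apply in_or_app; now right.
- pose proof (dotp_skipn k p); lia.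
- lia.
- now left.
Qed.

Lemma zsum_ind_notin {B} (g : B -> bool) l : (forall z, In z l -> g z = false) -> zsum (fun z => ind (g z)) l = 0.
Proof. intros H; rewrite (zsum_ext _ (fun _ => 0)); [apply zsum_zero|]; intros z Hz; now rewrite H. Qed.

Lemma zsum_ind_one v l : NoDup l -> In v l -> zsum (fun z => ind (leqb v z)) l = 1.
Proof.
induction 1 as [|x l Hx Hl IH]; intros H; [easy|]; rewrite zsum_cons; destruct H as [->|H].
- rewrite leqb_refl, zsum_ind_notin; [reflexivity|]; intros z Hz.
  apply not_true_iff_false; intros E; apply leqb_eq in E; now subst.
- rewrite IH by assumption; enough (E : leqb v x = false) by (now rewrite E).
  apply not_true_iff_false; intros E; apply leqb_eq in E; now subst.
Qed.

Lemma perp_checks : forallb perp_check (seq 1 8) = true.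
Proof. vm_compute; reflexivity. Qed.

Lemma VS_zsum {A B} (X : list A) u (F : B -> list Z -> Z) l :
  VS X u (fun p => zsum (fun z => F z p) l) = zsum (fun z => VS X u (F z)) l.
Proof.
induction l as [|z l IH].
- unfold VS; cbn [zsum fold_right]; rewrite (zsum_ext _ (fun _ => 0)); [apply zsum_zero|].
  intros x _; now destruct (validb (u x)).
- rewrite zsum_cons, <- IH, <- VS_add; reflexivity.
Qed.

(** A perpendicular valid vector either has [dotp p p] at most 24 and is counted through its
    representative, or it has one of the supports in [perp_masks] and is counted through [five];
    [perp_checks] verifies that there is no third case. *)
Lemma perp_sum {A} (X : list A) u k : good X u -> (1 <= k <= 8)%nat ->
  zsum (fun x => ind (perp_vec k (u x))) X = perp_total k.
Proof.
intros HX Hk; pose proof perp_checks as C; rewrite forallb_forall in C.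
specialize (C k ltac:(apply in_seq; lia)); unfold perp_check in C; rewrite !andb_true_iff, !forallb_forall in C.
destruct C as [[C1 C2] C3]; apply nodupb_NoDup in C2.
rewrite (split_sum X u (fun p => ind (perp_vec k p)) HX); unfold perp_total; f_equal.
set (lst := filter small_norm (perp_points k)).
assert (Hlst : forall p, In p lst -> In p (perp_points k) /\ small_norm p = true) by (intros p; apply filter_In).
transitivity (VS X u (fun p => ind (inb p lst) + zsum (fun z => ind (five z p)) (perp_masks k))).
- apply VS_ext; intros p Vp; destruct (perp_vec k p) eqn:E.
  + assert (Hp := perp_points_complete k p Hk Vp E); specialize (C1 p Hp).
    destruct (small_norm p) eqn:S.
    * rewrite (zsum_ind_notin (fun z => five z p)).
      -- enough (I : inb p lst = true) by (now rewrite I).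
         apply inb_In, filter_In; auto.
      -- intros z _; unfold five; unfold small_norm in S; apply Z.leb_le in S.
         destruct (Z.eqb_spec (dotp p p) 32); [lia|reflexivity].
    * replace (inb p lst) with false.
      -- apply andb_true_iff in C1 as [C1 C4]; apply inb_In in C4.
         cbn [ind Z.add]; rewrite <- (zsum_ind_one _ _ C2 C4) at 1.
         apply zsum_ext; intros z _; unfold five; now rewrite C1.
      -- symmetry; apply not_true_iff_false; intros I; apply inb_In, Hlst in I as [_ I]; congruence.
  + rewrite (zsum_ind_notin (fun z => five z p)).
    * replace (inb p lst) with false; [reflexivity|].
      symmetry; apply not_true_iff_false; intros I; apply inb_In, Hlst in I as [I _].
      apply perp_points_vec in I as [_ I]; congruence.
    * intros z Hz; apply not_true_iff_false; intros F; unfold five in F; apply andb_true_iff in F as [_ F].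
      apply leqb_eq in F; specialize (C3 z Hz); apply andb_true_iff in C3 as [_ C3].
      rewrite <- F in C3; unfold perp_vec, support in C3; rewrite firstn_map, forallb_forall in C3.
      unfold perp_vec in E; apply not_true_iff_false in E; apply E, forallb_forall; intros v Hv.
      specialize (C3 _ (in_map _ _ _ Hv)); cbv beta in C3; destruct (v =? 0); [reflexivity|exact C3].
- rewrite VS_add, VS_zsum; f_equal.
  + transitivity (zsum (fun x => if inb (u x) lst then 1 else 0) X).
    * apply zsum_ext; intros x _; destruct (inb (u x) lst) eqn:I; [|now destruct (validb (u x))].
      apply inb_In, Hlst in I as [I _]; apply perp_points_vec in I as [I _]; apply validb_valid in I; now rewrite I.
    * rewrite (cnt_sum X u (fun _ => 1)) by apply NoDup_filter, NoDup_perp_points.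
      apply zsum_ext; intros p Hp; rewrite Z.mul_1_l; apply Hlst in Hp as [Hp Sp].
      specialize (C1 p Hp); rewrite Sp in C1; apply andb_true_iff in C1 as [C1 C4].
      apply Z.eqb_eq in C1; apply Z.leb_le in C4; unfold rep_count in *.
      destruct (find _ reps) as [[r N]|] eqn:F; [|lia]; apply find_some in F as [F1 F2]; apply leqb_eq in F2.
      apply (all_cnt_sort p N C1); [|exact HX]; rewrite <- F2; now apply all_cnt_rep.
  + rewrite (zsum_ext _ (fun _ => 2520 * 1)).
    * rewrite zsum_scal; f_equal; clear; induction (perp_masks k) as [|z l IH]; [reflexivity|].
      cbn [length]; rewrite zsum_cons, IH; lia.
    * intros z Hz; specialize (C3 z Hz); apply andb_true_iff in C3 as [C3 _]; apply leqb_eq in C3.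
      apply (all_five_perm [0; 0; 0; 1; 1; 1; 1; 1] z); [|exact all_five_base|exact HX].
      rewrite <- (isort_perm z), C3; symmetry; exact (isort_perm [0; 0; 0; 1; 1; 1; 1; 1]).
Qed.

Definition perp_values : list Z := [1092000; 1110360; 1593664; 2553792; 4149504; 6688960; 10663920; 16815624].

Lemma perp_totals : map perp_total (seq 1 8) = rev perp_values.
Proof. vm_compute; reflexivity. Qed.

Lemma perp_total_value k : (1 <= k <= 8)%nat -> perp_total k = nth (8 - k) perp_values 0.
Proof.
intros Hk; pose proof (f_equal (fun l => nth (k - 1) l 0) perp_totals) as H; cbv beta in H.
rewrite rev_nth in H by (change (length perp_values) with 8%nat; lia).
rewrite (nth_indep _ _ (perp_total 0)), map_nth, seq_nth in H by (rewrite ?length_map, ?length_seq; lia).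
change (length perp_values) with 8%nat in H.
replace (1 + (k - 1))%nat with k in H by lia; rewrite H; f_equal; lia.
Qed.

Fixpoint decimal_value (d : Decimal.uint) (acc : Z) : Z :=
  match d with
  | Decimal.Nil => acc
  | Decimal.D0 d => decimal_value d (10 * acc) | Decimal.D1 d => decimal_value d (10 * acc + 1)
  | Decimal.D2 d => decimal_value d (10 * acc + 2) | Decimal.D3 d => decimal_value d (10 * acc + 3)
  | Decimal.D4 d => decimal_value d (10 * acc + 4) | Decimal.D5 d => decimal_value d (10 * acc + 5)
  | Decimal.D6 d => decimal_value d (10 * acc + 6) | Decimal.D7 d => decimal_value d (10 * acc + 7)
  | Decimal.D8 d => decimal_value d (10 * acc + 8) | Decimal.D9 d => decimal_value d (10 * acc + 9)
  end.

(* Large numerals of type [nat] are applications of [Nat.of_num_uint], which must not be unfolded. *)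
Lemma numeral_value d : Z.of_nat (Nat.of_num_uint (Number.UIntDecimal d)) = decimal_value d 0.
Proof.
change (Z.of_nat (Nat.of_uint_acc d 0) = decimal_value d (Z.of_nat 0)); generalize 0%nat.
induction d; intros acc; [reflexivity|..];
  cbn [Nat.of_uint_acc decimal_value]; rewrite IHd; f_equal;
  rewrite Nat.tail_mul_spec; lia.
Qed.

(** * The Voronoi cell of E8 *)

(** Three times the Voronoi cell of E8: the inner product of the root r/2 with p/2 is at most 3, so
    p/2 is on the near side of the bisector of 0 and three times that root. *)
Definition short (p : list Z) : Prop := forall r, e8_root r -> dotp r p <= 12.

Lemma short_swp i p : length p = 8%nat -> short p -> short (swp i p).
Proof.
intros Hl H r [R1 [R2 R3]]; rewrite <- (swp_inv i r), swp_dot by (rewrite swp_length; congruence).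
apply H; repeat split; [now rewrite swp_length|now apply (iso_e8 _ (isosym_swp i))|now rewrite swp_dot].
Qed.

Lemma short_perm p q : Permutation p q -> length p = 8%nat -> short p -> short q.
Proof.
intros H; change p with ([] ++ p); change q with ([] ++ q); generalize (@nil Z).
induction H as [|x p q H IH|x y p|p q r H1 IH1 H2 IH2]; intros pre Hl Hp; auto.
- change (x :: q) with ([x] ++ q); rewrite app_assoc; apply IH; rewrite <- app_assoc; assumption.
- replace (pre ++ x :: y :: p) with (swp (length pre) (pre ++ y :: x :: p)); [now apply short_swp|].
  clear; induction pre as [|z pre IH]; cbn; [reflexivity|now f_equal].
- apply IH2; [|now apply IH1]; rewrite <- Hl, !length_app; f_equal; symmetry; now apply Permutation_length.
Qed.

Fixpoint insert_abs (x : Z) (l : list Z) : list Z :=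
  match l with [] => [x] | y :: l => if Z.abs y <=? Z.abs x then x :: y :: l else y :: insert_abs x l end.

Definition sort_abs (l : list Z) : list Z := fold_right insert_abs [] l.

Lemma insert_abs_perm x l : Permutation (insert_abs x l) (x :: l).
Proof.
induction l as [|y l IH]; [reflexivity|]; cbn [insert_abs].
destruct (Z.abs y <=? Z.abs x); [reflexivity|]; rewrite IH; apply perm_swap.
Qed.

Lemma sort_abs_perm l : Permutation (sort_abs l) l.
Proof.
induction l as [|x l IH]; [reflexivity|]; cbn [sort_abs fold_right]; fold (sort_abs l).
rewrite insert_abs_perm; now apply perm_skip.
Qed.

Lemma sort_abs_sorted l : StronglySorted (fun x y => Z.abs y <= Z.abs x) (sort_abs l).
Proof.
induction l as [|x l IH]; [constructor|]; cbn [sort_abs fold_right]; fold (sort_abs l).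
revert IH; generalize (sort_abs l); clear; induction 1 as [|y l Hl IH Hy]; cbn [insert_abs]; [repeat constructor|].
destruct (Z.leb_spec (Z.abs y) (Z.abs x)).
- constructor; [now constructor|]; constructor; [assumption|].
  revert Hy; apply Forall_impl; intros; lia.
- constructor; [exact IH|]; apply Forall_forall; intros z Hz.
  apply (Permutation_in _ (insert_abs_perm x l)) in Hz; destruct Hz as [<-|Hz]; [lia|].
  rewrite Forall_forall in Hy; now apply Hy.
Qed.

Lemma norm_perm p q : Permutation p q -> dotp p p = dotp q q.
Proof. induction 1; cbn [dotp]; lia. Qed.

Definition sg (x : Z) : Z := if x <? 0 then -1 else 1.

Lemma sg_spec x : (sg x = 1 \/ sg x = -1) /\ sg x * x = Z.abs x.
Proof. unfold sg; destruct (Z.ltb_spec x 0); lia. Qed.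

(** The covering radius of E8 is 1, so the norm is at most 9, that is 36 in doubled coordinates.
    With absolute values a1 >= ... >= a8, roots of the two shapes give a1 + a2 <= 6 and a1 + ... +
    a7 - a8 <= 12; the last sign of a half-integral root is forced by the others, so the smallest
    entry may count negatively. *)
Lemma short_norm p : length p = 8%nat -> short p -> dotp p p <= 36.
Proof.
intros Hl H; rewrite <- (norm_perm _ _ (sort_abs_perm p)).
assert (S := sort_abs_sorted p); assert (P := Permutation_sym (sort_abs_perm p)).
assert (Hq : length (sort_abs p) = 8%nat) by (rewrite <- Hl; symmetry; now apply Permutation_length).
apply (short_perm _ _ P Hl) in H; revert Hq S H; generalize (sort_abs p); clear.
intros q Hq S H.
destruct q as [|x1 [|x2 [|x3 [|x4 [|x5 [|x6 [|x7 [|x8 [|? ?]]]]]]]]]; try discriminate; clear Hq.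
assert (B12 : Z.abs x1 + Z.abs x2 <= 6).
{ destruct (sg_spec x1) as [E1 A1], (sg_spec x2) as [E2 A2].
  assert (K : e8_root [2 * sg x1; 2 * sg x2; 0; 0; 0; 0; 0; 0])
    by (destruct E1 as [-> | ->], E2 as [-> | ->]; repeat split).
  apply H in K; cbn [dotp] in K; rewrite <- A1, <- A2; clear - K; lia. }
assert (B8 : Z.abs x1 + Z.abs x2 + Z.abs x3 + Z.abs x4 + Z.abs x5 + Z.abs x6 + Z.abs x7 - Z.abs x8 <= 12).
{ destruct (sg_spec x1) as [E1 A1], (sg_spec x2) as [E2 A2], (sg_spec x3) as [E3 A3], (sg_spec x4) as [E4 A4],
    (sg_spec x5) as [E5 A5], (sg_spec x6) as [E6 A6], (sg_spec x7) as [E7 A7].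
  set (s8 := sg x1 * sg x2 * sg x3 * sg x4 * sg x5 * sg x6 * sg x7).
  assert (R : e8_root [sg x1; sg x2; sg x3; sg x4; sg x5; sg x6; sg x7; s8] /\ (s8 = 1 \/ s8 = -1)).
  { unfold s8; destruct E1 as [-> | ->], E2 as [-> | ->], E3 as [-> | ->], E4 as [-> | ->], E5 as [-> | ->],
      E6 as [-> | ->], E7 as [-> | ->]; (split; [repeat split|cbn; auto]). }
  clearbody s8; destruct R as [R E8]; specialize (H _ R); cbn [dotp] in H.
  assert (N8 : s8 * x8 >= - Z.abs x8) by (clear - E8; destruct E8 as [-> | ->]; lia).
  rewrite <- A1, <- A2, <- A3, <- A4, <- A5, <- A6, <- A7; clear - H N8; lia. }
clear H.
repeat match goal with
  | K : StronglySorted _ (_ :: _) |- _ => apply StronglySorted_inv in K as [? ?]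
  | K : Forall _ (_ :: _) |- _ => inversion K; clear K; subst
  | K : Forall _ [] |- _ => clear K
  | K : StronglySorted _ [] |- _ => clear K end.
cbn [dotp].
rewrite <- (Z.abs_square x1), <- (Z.abs_square x2), <- (Z.abs_square x3), <- (Z.abs_square x4),
  <- (Z.abs_square x5), <- (Z.abs_square x6), <- (Z.abs_square x7), <- (Z.abs_square x8).
pose proof (Z.abs_nonneg x8) as N8.
revert B12 B8 N8; repeat match goal with K : Z.abs _ <= Z.abs _ |- _ => revert K end.
generalize (Z.abs x1) (Z.abs x2) (Z.abs x3) (Z.abs x4) (Z.abs x5) (Z.abs x6) (Z.abs x7) (Z.abs x8).
clear; intros a1 a2 a3 a4 a5 a6 a7 t; intros.
destruct (Z.le_gt_cases a1 2) as [S|S]; [nia|].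
(* Now a1 >= 3, so m <= 3; by a1 + a2 <= 6 all the other entries lie between t and m. *)
set (m := 6 - a1).
(* Convexity: on [t, m] the square lies below its chord. With the bound T on the linear part, the
   total is at most 36 - 2 (m-t)(3-(m-t)), and U shows that the subtracted term is nonnegative. *)
assert (Q : forall a, t <= a -> a <= m -> a * a <= (m + t) * a - m * t) by (intros; nia).
assert (Q2 := Q a2 ltac:(lia) ltac:(unfold m; lia)); assert (Q3 := Q a3 ltac:(lia) ltac:(unfold m; lia)).
assert (Q4 := Q a4 ltac:(lia) ltac:(unfold m; lia)); assert (Q5 := Q a5 ltac:(lia) ltac:(unfold m; lia)).
assert (Q6 := Q a6 ltac:(lia) ltac:(unfold m; lia)); assert (Q7 := Q a7 ltac:(lia) ltac:(unfold m; lia)).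
assert (T : (m + t) * (a2 + a3 + a4 + a5 + a6 + a7) <= (m + t) * (6 + m + t)) by (apply Z.mul_le_mono_nonneg_l; unfold m; lia).
assert (U : 0 <= (m - t) * (3 - (m - t))) by (apply Z.mul_nonneg_nonneg; unfold m; lia).
assert (Ea : a1 = 6 - m) by (unfold m; lia); clearbody m; subst a1.
clear - Q2 Q3 Q4 Q5 Q6 Q7 T U; ring_simplify in T; ring_simplify in U; lia.
Qed.

Lemma e8_norm8 p : e8 p = true -> length p = 8%nat -> exists k, dotp p p = 8 * k.
Proof.
intros He Hl; apply e8_spec in He as [Hp H4].
destruct p as [|x1 [|x2 [|x3 [|x4 [|x5 [|x6 [|x7 [|x8 [|? ?]]]]]]]]]; try discriminate; clear Hl.
assert (D : forall y, In y [x2; x3; x4; x5; x6; x7; x8] -> exists k, y = x1 + 2 * k).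
{ intros y Hy; assert (E : Z.odd (y - x1) = false).
  { rewrite Z.odd_sub, (Hp y x1); [apply xorb_nilpotent|now right|now left]. }
  rewrite <- Z.negb_even in E; apply negb_false_iff, Z.even_spec in E as [k Hk]; exists k; lia. }
destruct (D x2) as [k2 ->]; [cbn; tauto|]; destruct (D x3) as [k3 ->]; [cbn; tauto|].
destruct (D x4) as [k4 ->]; [cbn; tauto|]; destruct (D x5) as [k5 ->]; [cbn; tauto|].
destruct (D x6) as [k6 ->]; [cbn; tauto|]; destruct (D x7) as [k7 ->]; [cbn; tauto|].
destruct (D x8) as [k8 ->]; [cbn; tauto|]; clear D Hp.
apply Z.mod_divide in H4 as [s Hs]; [|lia]; unfold lsum in Hs; cbn [fold_right] in Hs; cbn [dotp].
assert (Hk : k2 + k3 + k4 + k5 + k6 + k7 + k8 = 2 * s - 4 * x1) by lia.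
assert (Hsq : forall k, exists h, k * k = k + 2 * h).
{ intros k; destruct (Z.Even_or_Odd k) as [[h ->]|[h ->]]; [exists (2 * h * h - h)|exists (2 * h * h + h)]; ring. }
destruct (Hsq k2) as [h2 E2], (Hsq k3) as [h3 E3], (Hsq k4) as [h4 E4], (Hsq k5) as [h5 E5],
  (Hsq k6) as [h6 E6], (Hsq k7) as [h7 E7], (Hsq k8) as [h8 E8].
exists (x1 * x1 + x1 * (s - 2 * x1) + (s - 2 * x1) + h2 + h3 + h4 + h5 + h6 + h7 + h8).
assert (k8 = 2 * s - 4 * x1 - (k2 + k3 + k4 + k5 + k6 + k7)) by lia.
transitivity (8 * (x1 * x1) + 4 * x1 * (k2 + k3 + k4 + k5 + k6 + k7 + k8) +
  4 * (k2 * k2 + k3 * k3 + k4 * k4 + k5 * k5 + k6 * k6 + k7 * k7 + k8 * k8)); [ring|].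
rewrite E2, E3, E4, E5, E6, E7, E8, Hk; subst k8; ring.
Qed.

(** Norms in E8 are multiples of 8 in these coordinates, so 36 drops to 32; twice a root r is
    excluded by its inner product 16 > 12 with r. *)
Lemma short_valid p : e8 p = true -> length p = 8%nat -> short p -> valid p.
Proof.
intros He Hl H; destruct (e8_norm8 p He Hl) as [k Hk]; pose proof (short_norm p Hl H) as Hn.
repeat split; [exact Hl|exact He|lia|].
intros E; apply not_true_iff_false; intros Hd; apply dbl_spec in Hd as [r [-> Hr]].
rewrite length_map in Hl.
assert (D : forall q, dotp q (map (Z.mul 2) q) = 2 * dotp q q /\ dotp (map (Z.mul 2) q) (map (Z.mul 2) q) = 4 * dotp q q).
{ clear; induction q as [|x q [IH1 IH2]]; cbn [map dotp]; [split; reflexivity|]; rewrite IH1, IH2; split; ring. }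
destruct (D r) as [D1 D2]; rewrite D2 in E.
specialize (H r ltac:(repeat split; [exact Hl|exact Hr|lia])); lia.
Qed.

(** Pairing with 2 (e_1 + e_i) forces equal parities, and pairing with the all-one vector forces the
    sum to be divisible by 4. *)
Lemma e8_self_dual l : length l = 8%nat ->
  (forall c, length c = 8%nat -> e8 c = true -> exists k, dotp c l = 4 * k) -> e8 l = true.
Proof.
intros Hl H; destruct l as [|x1 [|x2 [|x3 [|x4 [|x5 [|x6 [|x7 [|x8 [|? ?]]]]]]]]]; try discriminate; clear Hl.
assert (P : forall y k, 2 * x1 + 2 * y = 4 * k -> Z.odd y = Z.odd x1).
{ intros y k E; replace y with (2 * k - x1) by lia; rewrite Z.odd_sub, Z.odd_mul; now destruct (Z.odd x1). }
assert (K : forall y, In y [x1; x2; x3; x4; x5; x6; x7; x8] -> Z.odd y = Z.odd x1).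
{ intros y Hy; repeat destruct Hy as [<-|Hy]; try easy;
    [destruct (H [2; 2; 0; 0; 0; 0; 0; 0]) as [k Hk] | destruct (H [2; 0; 2; 0; 0; 0; 0; 0]) as [k Hk]
    | destruct (H [2; 0; 0; 2; 0; 0; 0; 0]) as [k Hk] | destruct (H [2; 0; 0; 0; 2; 0; 0; 0]) as [k Hk]
    | destruct (H [2; 0; 0; 0; 0; 2; 0; 0]) as [k Hk] | destruct (H [2; 0; 0; 0; 0; 0; 2; 0]) as [k Hk]
    | destruct (H [2; 0; 0; 0; 0; 0; 0; 2]) as [k Hk] ]; try reflexivity;
    apply (P _ k); cbn [dotp] in Hk; lia. }
apply e8_spec; split.
- intros x y Hx Hy; now rewrite (K x Hx), (K y Hy).
- destruct (H [1; 1; 1; 1; 1; 1; 1; 1] eq_refl eq_refl) as [k Hk].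
  apply Z.mod_divide; [lia|]; exists k; unfold lsum; cbn [dotp fold_right] in *; lia.
Qed.

(** Since 3 is invertible modulo 2 and modulo 4, the quotient by 3 of a difference of E8 vectors
    inherits the parity and sum conditions. *)
Lemma congr3_quot p q : length p = 8%nat -> e8 p = true -> e8 q = true -> congr3 p q ->
  exists d, length d = 8%nat /\ e8 d = true /\ (forall i, nth i q 0 = nth i p 0 - 3 * nth i d 0) /\
    dotp q q = dotp p p - 6 * dotp d p + 9 * dotp d d.
Proof.
intros Hl Hp Hq H.
assert (E : exists d, length d = length p /\ (forall i, nth i q 0 = nth i p 0 - 3 * nth i d 0) /\
    dotp q q = dotp p p - 6 * dotp d p + 9 * dotp d d /\ lsum q = lsum p - 3 * lsum d /\
    (forall y, In y d -> exists x z, In x p /\ In z q /\ z = x - 3 * y)).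
{ clear Hl Hp Hq; induction H as [|x z p q Hx H IH].
  - exists []; repeat split; [intros [|i]; reflexivity|easy].
  - destruct IH as [d [D1 [D2 [D3 [D4 D5]]]]]; apply Z.mod_divide in Hx as [k Hk]; [|lia].
    exists (k :: d); repeat split.
    + cbn [length]; now rewrite D1.
    + intros [|i]; cbn [nth]; [lia|apply D2].
    + cbn [dotp]; rewrite D3; replace z with (x - 3 * k) by lia; ring.
    + unfold lsum in *; cbn [fold_right]; lia.
    + intros y [<-|Hy]; [exists x, z; repeat split; [now left|now left|lia]|].
      destruct (D5 y Hy) as [x' [z' [A [B C]]]]; exists x', z'; repeat split; auto; now right. }
destruct E as [d [D1 [D2 [D3 [D4 D5]]]]]; exists d; repeat split; auto; [congruence|].
apply e8_spec in Hp as [Pp Sp]; apply e8_spec in Hq as [Pq Sq]; apply e8_spec; split.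
- intros y y' Hy Hy'; destruct (D5 y Hy) as [x [z [A [B C]]]]; destruct (D5 y' Hy') as [x' [z' [A' [B' C']]]].
  specialize (Pp x x' A A'); specialize (Pq z z' B B'); subst z z'.
  rewrite !Z.odd_sub, !Z.odd_mul in Pq; rewrite Pp in Pq; cbn in Pq.
  now destruct (Z.odd x'), (Z.odd y), (Z.odd y').
- apply Z.mod_divide in Sp as [s Hs]; [|lia]; apply Z.mod_divide in Sq as [t Ht]; [|lia].
  apply Z.mod_divide; [lia|]; exists (lsum d - s + t); lia.
Qed.

Lemma dotp_triple_r r : dotp r (triple r) = 3 * dotp r r.
Proof. unfold triple; induction r as [|x r IH]; cbn [map dotp]; [reflexivity|]; rewrite IH; ring. Qed.

Lemma congr3_sym p q : congr3 p q -> congr3 q p.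
Proof.
induction 1 as [|x y p q H _ IH]; constructor; [|exact IH].
apply Z.mod_divide in H as [k Hk]; [|lia]; apply Z.mod_divide; [lia|]; exists (- k); lia.
Qed.

End E8Shell.

Require Import Defs.
From mathcomp Require Import all_boot all_order all_algebra.
From mathcomp Require Import boolp classical_sets functions cardinality reals.
From mathcomp Require complex Rstruct.
From mathcomp Require Import ssrZ zify ring lra.
Set Implicit Arguments.
Unset Strict Implicit.
Unset Printing Implicit Defensive.
Import Order.TTheory GRing.Theory Num.Theory.

(** * Self-dual lattices in the coordinates of an orthogonal family *)

Module SelfDual.
Local Open Scope ring_scope.

Fixpoint izs (N : nat) : seq int :=
  if N is N'.+1 then [:: N%:Z, - N%:Z & izs N'] else [:: 0].

Lemma izsS N : izs N.+1 = [:: N.+1%:Z, - N.+1%:Z & izs N].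
Proof. by []. Qed.

Lemma mem_izs N (m : int) : (m \in izs N) = (`|m| <= N%:Z).
Proof.
elim: N => [|N IH]; rewrite /= ?inE; first by rewrite normr_le0.
rewrite IH; lia.
Qed.

Lemma uniq_izs N : uniq (izs N).
Proof.
elim: N => [//|N IH] /=; rewrite IH !inE !mem_izs; lia.
Qed.

Section Boxes.
Variable n : nat.
Implicit Types (k c : {ffun 'I_n -> int}) (N : nat).

Definition box N : seq {ffun 'I_n -> int} :=
  [seq [ffun i => (izs N)`_(f i)] | f : {ffun 'I_n -> 'I_(size (izs N))}].

Lemma mem_box N k : (k \in box N) = [forall i, `|k i| <= N%:Z].
Proof.
apply/mapP/forallP => [[f _ ->] i|H]; first by rewrite ffunE -mem_izs mem_nth.
have H' i : (index (k i) (izs N) < size (izs N))%N by rewrite index_mem mem_izs.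
exists [ffun i => Ordinal (H' i)]; first by rewrite mem_enum.
by apply/ffunP => i; rewrite !ffunE /= nth_index // mem_izs.
Qed.

Lemma uniq_box N : uniq (box N).
Proof.
rewrite map_inj_uniq ?enum_uniq // => f g /ffunP H.
apply/ffunP => i; have := H i; rewrite !ffunE => /eqP.
by rewrite nth_uniq ?uniq_izs // => /eqP /val_inj.
Qed.

Lemma prod_sum_box (R : comPzRingType) N (F : 'I_n -> int -> R) :
  \prod_i \sum_(m <- izs N) F i m = \sum_(k <- box N) \prod_i F i (k i).
Proof.
rewrite big_map big_enum /=.
transitivity (\prod_(i < n) \sum_(j < size (izs N)) F i (izs N)`_j).
  by apply: eq_bigr => i _; rewrite (big_nth 0) big_mkord.
rewrite bigA_distr_bigA; apply: eq_bigr => f _.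
by apply: eq_bigr => i _; rewrite ffunE.
Qed.

Lemma box_ex k : exists N, k \in box N.
Proof.
exists (\sum_i `|k i|)%N; rewrite mem_box; apply/forallP => i.
by rewrite (bigD1 i) //=; lia.
Qed.

Lemma box_mono N M k : (N <= M)%N -> k \in box N -> k \in box M.
Proof.
rewrite !mem_box => NM /forallP H; apply/forallP => i.
have := H i; lia.
Qed.

Lemma box_all (s : seq {ffun 'I_n -> int}) : exists N, forall k, k \in s -> k \in box N.
Proof.
elim: s => [|k s [N HN]]; first by exists 0.
have [M HM] := box_ex k; exists (maxn N M) => k'; rewrite inE => /predU1P[->|/HN].
  by apply: box_mono HM; rewrite leq_maxr.
by apply: box_mono; rewrite leq_maxl.
Qed.

Variable a : 'I_n -> nat.
Hypothesis a_gt0 : forall i, (0 < a i)%N.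

(** k lists the inner products of a vector with orthogonal w_i of norms a_i, and this is the inner
    product in such coordinates. Rational values make one statement usable both over the real field
    of the theorem and over the reals of the analysis. *)
Definition pair (k l : {ffun 'I_n -> int}) : rat := \sum_i (k i * l i)%:~R / (a i)%:R.

Definition neg k : {ffun 'I_n -> int} := [ffun i => - k i].

Lemma pair_sym k l : pair k l = pair l k.
Proof. by apply: eq_bigr => i _; rewrite [k i * _]mulrC. Qed.

Lemma pairNl k l : pair (neg k) l = - pair k l.
Proof.
rewrite -sumrN; apply: eq_bigr => i _; rewrite ffunE mulNr rmorphN /= mulNr //.
Qed.

Lemma negK : involutive neg.
Proof. by move=> k; apply/ffunP => i; rewrite !ffunE opprK. Qed.

Lemma pair_ge0 k : 0 <= pair k k.
Proof.
by apply: sumr_ge0 => i _; rewrite mulr_ge0 ?invr_ge0 ?ler0n // ler0z -expr2 sqr_ge0.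
Qed.

Lemma sqr_le_pair k i : ((k i) ^+ 2)%:~R <= (a i)%:R * pair k k.
Proof.
have ai : (0 : rat) < (a i)%:R by rewrite ltr0n.
rewrite -ler_pdivrMl // /pair (bigD1 i) //= -[leLHS]addr0; apply: lerD; first by rewrite mulrC expr2.
apply: sumr_ge0 => j _; rewrite mulr_ge0 ?invr_ge0 ?ler0n // ler0z -expr2 sqr_ge0 //.
Qed.

Lemma pair_eq0 k : pair k k = 0 -> k = [ffun=> 0].
Proof.
move=> H; apply/ffunP => i; rewrite ffunE.
have := sqr_le_pair k i; rewrite H mulr0 lerz0 => h; apply/eqP.
by rewrite -sqrf_eq0 eq_le h sqr_ge0.
Qed.

Definition integral (x : rat) : Prop := exists z : int, x = z%:~R.

Variable Lam : pred {ffun 'I_n -> int}.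
Hypothesis self_dual : forall k, Lam k <-> (forall l, Lam l -> integral (pair k l)).

Lemma integralD x y : integral x -> integral y -> integral (x + y).
Proof. by move=> [z ->] [w ->]; exists (z + w); rewrite rmorphD. Qed.

Lemma integralN x : integral x -> integral (- x).
Proof. by move=> [z ->]; exists (- z); rewrite rmorphN. Qed.

Definition addf k c : {ffun 'I_n -> int} := [ffun i => k i + c i].
(** The coordinates of the combination of the w_i with integer coefficients m_i. *)
Definition scalf (m : {ffun 'I_n -> int}) : {ffun 'I_n -> int} := [ffun i => (a i)%:Z * m i].

Lemma pair_addl k c l : pair (addf k c) l = pair k l + pair c l.
Proof.
rewrite -big_split; apply: eq_bigr => i _; rewrite ffunE mulrDl rmorphD /= mulrDl //.
Qed.

Lemma pair_scalf (m : {ffun 'I_n -> int}) l : pair (scalf m) l = (\sum_i m i * l i)%:~R.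
Proof.
rewrite rmorph_sum /=; apply: eq_bigr => i _; rewrite ffunE -mulrA rmorphM /=.
by rewrite mulrAC divff ?mul1r // pnatr_eq0 -lt0n.
Qed.

Lemma Lam_add k c : Lam k -> Lam c -> Lam (addf k c).
Proof.
move=> /self_dual Hk /self_dual Hc; apply/self_dual => l Hl.
by rewrite pair_addl; apply: integralD; [apply: Hk|apply: Hc].
Qed.

Lemma Lam_neg k : Lam k -> Lam (neg k).
Proof.
move=> /self_dual Hk; apply/self_dual => l Hl.
by rewrite pairNl; apply: integralN; apply: Hk.
Qed.

Lemma Lam_scalf m : Lam (scalf m).
Proof. by apply/self_dual => l Hl; rewrite pair_scalf; exists (\sum_i m i * l i). Qed.

Definition reduced c : bool := [forall i, 0 <= c i < (a i)%:Z].

Definition amax : nat := \max_i a i.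

(* The code [Lam / (sum_i a_i Z)], by its reduced representatives. *)
Definition code : seq {ffun 'I_n -> int} := [seq c <- box amax | Lam c && reduced c].

Lemma mem_code c : (c \in code) = Lam c && reduced c.
Proof.
rewrite mem_filter; case: (Lam c) => //=; case: (boolP (reduced c)) => //= /forallP H.
rewrite mem_box; apply/forallP => i.
have := H i; have : (a i <= amax)%N := leq_bigmax i; lia.
Qed.

Lemma uniq_code : uniq code.
Proof. by rewrite filter_uniq // uniq_box. Qed.

Definition red k : {ffun 'I_n -> int} := [ffun i => (k i %% (a i)%:Z)%Z].
Definition quo k : {ffun 'I_n -> int} := [ffun i => (k i %/ (a i)%:Z)%Z].

Lemma red_quo k : k = addf (scalf (quo k)) (red k).
Proof. by apply/ffunP => i; rewrite !ffunE mulrC -divz_eq. Qed.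

Lemma reduced_red k : reduced (red k).
Proof.
apply/forallP => i; rewrite ffunE modz_ge0 ?ltz_mod //; have := a_gt0 i; lia.
Qed.

Lemma Lam_red k : Lam k -> Lam (red k).
Proof.
move=> Hk; have -> : red k = addf k (neg (scalf (quo k))).
  by apply/ffunP => i; rewrite {2}(red_quo k) !ffunE addrC addKr.
by apply: Lam_add => //; apply/Lam_neg/Lam_scalf.
Qed.

Lemma red_code k : Lam k -> red k \in code.
Proof. by move=> Hk; rewrite mem_code Lam_red //= reduced_red. Qed.

Lemma red_uniq m c : reduced c -> red (addf (scalf m) c) = c.
Proof.
move=> /forallP H; apply/ffunP => i; rewrite !ffunE.
by rewrite mulrC modzMDl modz_small //; have := H i; lia.
Qed.

Lemma quo_uniq m c : reduced c -> quo (addf (scalf m) c) = m.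
Proof.
move=> /forallP H; apply/ffunP => i; rewrite !ffunE mulrC divzMDl; last by have := a_gt0 i; lia.
by rewrite divz_small ?addr0 //; have := H i; lia.
Qed.

Lemma code_shift d : d \in code -> perm_eq [seq red (addf c d) | c <- code] code.
Proof.
move=> Hd; have /andP[Ld _] : Lam d && reduced d by rewrite -mem_code.
apply: uniq_perm; rewrite ?uniq_code //.
  rewrite map_inj_in_uniq ?uniq_code // => c c' Hc Hc' /ffunP E.
  move: Hc Hc'; rewrite !mem_code => /andP[_ /forallP Rc] /andP[_ /forallP Rc'].
  apply/ffunP => i; have := E i; rewrite !ffunE => /eqP.
  rewrite eqz_modDr !modz_small => [/eqP //||]; [have := Rc' i|have := Rc i]; lia.
move=> c; apply/mapP/idP => [[c' Hc' ->]|Hc].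
  by apply/red_code/Lam_add => //; move: Hc'; rewrite mem_code => /andP[].
exists (red (addf c (neg d))).
  apply/red_code/Lam_add; last exact: Lam_neg.
  by move: Hc; rewrite mem_code => /andP[].
move: Hc; rewrite mem_code => /andP[_ /forallP Rc].
apply/ffunP => i; rewrite !ffunE modzDml addrNK modz_small //; have := Rc i; lia.
Qed.

(* The elements of [Lam] whose reduction has quotients in the box. *)
Definition cbox N : seq {ffun 'I_n -> int} := [seq addf (scalf m) c | c <- code, m <- box N].

Lemma mem_cbox N k : (k \in cbox N) = Lam k && (quo k \in box N).
Proof.
apply/allpairsP/andP => [[[c m] /= [Hc Hm ->]]|[Hk Hq]].
  move: Hc; rewrite mem_code => /andP[Lc Rc]; rewrite quo_uniq //; split=> //.
  by apply: Lam_add => //; apply: Lam_scalf.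
by exists (red k, quo k); rewrite red_code //= -red_quo.
Qed.

Lemma uniq_cbox N : uniq (cbox N).
Proof.
apply: allpairs_uniq; rewrite ?uniq_code ?uniq_box // => -[c m] [c' m'] /=.
case/allpairsP => [[x y]] /= [Hx _ [-> ->]] {c m}.
case/allpairsP => [[c m]] /= [Hc _ [-> ->]] {c' m'} E.
move: Hx Hc; rewrite !mem_code => /andP[_ Rx] /andP[_ Rc].
have Ex : x = c by rewrite -(red_uniq y Rx) E red_uniq.
by rewrite Ex; congr (_, _); rewrite -(quo_uniq y Rx) E quo_uniq.
Qed.

Hypothesis even_lam : forall k, Lam k -> exists c : nat, pair k k = (2 * c)%:R.

(** By k_i^2 <= a_i * norm the vectors of norm at most 2m lie in one box, so every shell is a finite
    list. *)
Definition lbox m : seq {ffun 'I_n -> int} := [seq k <- box ((2 * m) * amax) | Lam k].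
Definition level m := [seq k <- lbox m | pair k k == (2 * m)%:R].
Definition upto m := [seq k <- lbox m | pair k k <= (2 * m)%:R].

Lemma pair_box k m : pair k k <= (2 * m)%:R -> k \in box ((2 * m) * amax).
Proof.
move=> H; rewrite mem_box; apply/forallP => i.
have h := sqr_le_pair k i.
have am : (a i <= amax)%N := leq_bigmax i.
have h2 : (k i) ^+ 2 <= (a i * (2 * m))%N%:Z.
  rewrite -(ler_int rat) (le_trans h) // -pmulrn natrM ler_wpM2l ?ler0n //.
have E : `|k i| ^+ 2 = (k i) ^+ 2 by rewrite real_normK ?num_real.
rewrite -E in h2; set x := `|k i| in h2 *.
have x0 : 0 <= x := normr_ge0 _.
have ai := a_gt0 i.
rewrite leNgt; apply/negP => lt.
have : x ^+ 2 > (a i * (2 * m))%N%:Z by nia.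
by rewrite ltNge h2.
Qed.

Lemma mem_level k m : (k \in level m) = Lam k && (pair k k == (2 * m)%:R).
Proof.
rewrite !mem_filter andbC; case: (Lam k) => //=.
by case: eqP => [H|]; rewrite ?andbF // andbT pair_box // H.
Qed.

Lemma mem_upto k m : (k \in upto m) = Lam k && (pair k k <= (2 * m)%:R).
Proof.
rewrite !mem_filter andbC; case: (Lam k) => //=.
by case: (boolP (pair k k <= _)) => [H|]; rewrite ?andbF // andbT pair_box.
Qed.

Lemma uniq_level m : uniq (level m).
Proof. by rewrite !filter_uniq // uniq_box. Qed.

Lemma uniq_upto m : uniq (upto m).
Proof. by rewrite !filter_uniq // uniq_box. Qed.

Lemma upto0 : perm_eq (upto 0) (level 0).
Proof.
apply: uniq_perm; rewrite ?uniq_upto ?uniq_level // => k.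
by rewrite mem_level mem_upto muln0 eq_le pair_ge0 andbT.
Qed.

Lemma uptoS m : perm_eq (upto m.+1) (upto m ++ level m.+1).
Proof.
apply: uniq_perm; first exact: uniq_upto.
  rewrite cat_uniq uniq_upto uniq_level andbT; apply/hasPn => k.
  rewrite mem_level mem_upto => /andP[-> /eqP -> /=].
  by rewrite ler_nat; lia.
move=> k; rewrite mem_cat !mem_upto mem_level.
case: (boolP (Lam k)) => //= /even_lam[c ->].
by rewrite !ler_nat eqr_nat; lia.
Qed.

Lemma sum_level (R : zmodType) (F : {ffun 'I_n -> int} -> R) m :
  \sum_(0 <= j < m.+1) \sum_(k <- level j) F k = \sum_(k <- upto m) F k.
Proof.
elim: m => [|m IH]; first by rewrite big_nat1 (perm_big _ upto0).
by rewrite big_nat_recr //= IH (perm_big _ (uptoS m)) big_cat.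
Qed.

Lemma level_neg m : perm_eq [seq neg k | k <- level m] (level m).
Proof.
apply: uniq_perm; rewrite ?uniq_level //.
  by rewrite map_inj_uniq ?uniq_level //; apply: can_inj negK.
move=> k; apply/mapP/idP => [[k' Hk ->]|Hk].
  move: Hk; rewrite !mem_level => /andP[/Lam_neg -> /=].
  by rewrite pairNl pair_sym pairNl opprK.
exists (neg k); rewrite ?negK //; move: Hk; rewrite !mem_level => /andP[/Lam_neg -> /=].
by rewrite pairNl pair_sym pairNl opprK.
Qed.

End Boxes.

End SelfDual.

(** * Poisson summation over a self-dual lattice, from dimension one *)

Module Poisson.
Import ZArith Reals Coquelicot.
Import Analysis E8Shell.
Import all_boot all_order all_algebra.
Import complex Rstruct ssrZ zify ring lra.
Import SelfDual.
Import Order.TTheory GRing.Theory Num.Theory.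
Local Open Scope ring_scope.

Local Notation R := Rdefinitions.R.
Local Notation C := (complex R).

Lemma sum_izs (f : R -> R) N : \sum_(m <- izs N) f m%:~R = sum_n (sym f) N.
Proof.
elim: N => [|N IH]; first by rewrite big_seq1 sum_n_0.
rewrite sum_n_S -IH izsS !big_cons addrA addrC; congr (_ + _).
by rewrite -[sym f N.+1]/(f (INR N.+1) + f (Ropp (INR N.+1))) INRE rmorphN.
Qed.

Lemma lim_gauss (t u : R) : 0 < t ->
  is_lim_seq (fun N => \sum_(m <- izs N) gauss t u m%:~R) (/ sqrt t * dual_sum t u)%R.
Proof.
move=> /RltP Ht.
apply: (is_lim_seq_ext (sum_n (sym (gauss t u)))) => [N|]; first by rewrite sum_izs.
exact: (poisson t u Ht).
Qed.

Lemma cosN (x : R) : cos (- x) = cos x.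
Proof. exact: cos_neg. Qed.

Definition dual_gauss (t : R) (x : R) : R := exp (- (PI * x ^+ 2 / t)).

Lemma lim_dual (t x : R) : 0 < t ->
  is_lim_seq (fun N => \sum_(m <- izs N) dual_gauss t m%:~R * cos (2 * PI * m%:~R * x)) (dual_sum t x).
Proof.
move=> /RltP Ht.
apply: (is_lim_seq_ext (sum_n (dual_term t x))) => [N|]; last first.
  exact: (Series_correct _ (dual_sum_ex t x Ht)).
rewrite (sum_izs (fun y => dual_gauss t y * cos (2 * PI * y * x))).
apply: sum_n_eq => -[|k] _; rewrite /sym /dual_term /dual_gauss /ew.
  by rewrite !RealsE mul1r.
rewrite !RealsE sqrrN !(mulrN, mulNr) cosN -mulr2n -[RHS]mulr_natl mulrA //.
Qed.

Lemma lim_sum_seq (I : Type) (s : seq I) (F : I -> nat -> R) (L : I -> R) :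
  (forall i, is_lim_seq (F i) (L i)) ->
  is_lim_seq (fun N => \sum_(i <- s) F i N) (\sum_(i <- s) L i).
Proof.
move=> H; elim: s => [|i s IH].
  rewrite big_nil; apply: (is_lim_seq_ext (fun=> 0)) => [N|]; first by rewrite big_nil.
  exact: is_lim_seq_const.
rewrite big_cons; apply: (is_lim_seq_ext (fun N => Rplus (F i N) (\sum_(i <- s) F i N))) => [N|].
  by rewrite big_cons.
exact: is_lim_seq_plus'.
Qed.

Lemma lim_prod_seq (I : Type) (s : seq I) (F : I -> nat -> R) (L : I -> R) :
  (forall i, is_lim_seq (F i) (L i)) ->
  is_lim_seq (fun N => \prod_(i <- s) F i N) (\prod_(i <- s) L i).
Proof.
move=> H; elim: s => [|i s IH].
  rewrite big_nil; apply: (is_lim_seq_ext (fun=> 1)) => [N|]; first by rewrite big_nil.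
  exact: is_lim_seq_const.
rewrite big_cons; apply: (is_lim_seq_ext (fun N => Rmult (F i N) (\prod_(i <- s) F i N))) => [N|].
  by rewrite big_cons.
exact: is_lim_seq_mult'.
Qed.

Definition ce (x : R) : C := Complex (cos (2 * PI * x)) (sin (2 * PI * x)).

Arguments ce x%_ring_scope.
Lemma ceD x y : ce (x + y) = ce x * ce y.
Proof.
rewrite /ce !RealsE mulrDr cosD sinD; simpc.
by congr Complex; rewrite addrC.
Qed.

Lemma ce0 : ce 0 = 1.
Proof. by rewrite /ce !RealsE mulr0 cos_0 sin_0. Qed.

Lemma ce_sum (I : Type) (s : seq I) (F : I -> R) :
  ce (\sum_(i <- s) F i) = \prod_(i <- s) ce (F i).
Proof. exact: (big_morph ce ceD ce0). Qed.

Lemma ce_nat n : ce n%:R = 1.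
Proof.
have E : Rmult (Rmult 2 PI) n%:R = Rplus 0 (Rmult (Rmult 2 (INR n)) PI).
  by rewrite INRE; Lra.lra.
by rewrite /ce !E cos_period sin_period cos_0 sin_0.
Qed.

Lemma ceN_nat n : ce (- n%:R) = 1.
Proof.
have := ceD (- n%:R) n%:R.
by rewrite addNr ce0 ce_nat mulr1 => ->.
Qed.

Lemma ce_int (z : int) : ce z%:~R = 1.
Proof. by case: (ssrint.intP z) => [|k|k]; rewrite ?ce0 // ?rmorphN /= ?ceN_nat ?ce_nat. Qed.

Lemma Re_sum (I : Type) (s : seq I) (F : I -> C) :
  complex.Re (\sum_(i <- s) F i) = \sum_(i <- s) complex.Re (F i).
Proof. by elim: s => [|i s IH]; rewrite ?big_nil // !big_cons -IH; case: (F i) (bigop _ _ _) => ? ? []. Qed.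

Lemma Im_sum (I : Type) (s : seq I) (F : I -> C) :
  complex.Im (\sum_(i <- s) F i) = \sum_(i <- s) complex.Im (F i).
Proof. by elim: s => [|i s IH]; rewrite ?big_nil // !big_cons -IH; case: (F i) (bigop _ _ _) => ? ? []. Qed.

Lemma sin_sum_even (g : R -> R) x N : (forall y, g (- y) = g y) ->
  \sum_(m <- izs N) g m%:~R * sin (2 * PI * (m%:~R * x)) = 0.
Proof.
move=> Hg; elim: N => [|N IH]; first by rewrite big_seq1 !RealsE mul0r mulr0 sin_0 mulr0.
rewrite izsS !big_cons IH addr0 rmorphN /= Hg !RealsE mulNr mulrN.
by rewrite -RoppE sin_neg RoppE mulrN subrr.
Qed.

Lemma sum_ce_even (g : R -> R) x N : (forall y, g (- y) = g y) ->
  \sum_(m <- izs N) Complex (g m%:~R) 0 * ce (m%:~R * x) =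
  Complex (\sum_(m <- izs N) g m%:~R * cos (2 * PI * m%:~R * x)) 0.
Proof.
move=> Hg; apply/eqP; rewrite eq_complex Re_sum Im_sum /=.
apply/andP; split; apply/eqP.
  by apply: eq_bigr => m _; rewrite mul0r subr0 !RealsE mulrA.
rewrite -[RHS](sin_sum_even x N Hg); apply: eq_bigr => m _; by rewrite mul0r addr0.
Qed.

Lemma is_lim_seq_scalr (f : nat -> R) (l c : R) :
  is_lim_seq f l -> is_lim_seq (fun N => c * f N) (c * l).
Proof. by move=> H; apply: is_lim_seq_mult' H; apply: is_lim_seq_const. Qed.

Arguments is_lim_seq_scalr [f l] c _.

Section Exhaustion.
Variables (T : eqType) (P : pred T).

(** The one-dimensional formulas yield limits along boxes of quotients on one side and boxes of
    coordinates on the other, whereas the theta series is graded by the norm. Limits of absolutely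
    convergent sums do not depend on the exhaustion. *)
Definition exhausts (s : nat -> seq T) : Prop :=
  [/\ forall N, uniq (s N), forall N k, k \in s N -> P k
    & forall S : seq T, all P S -> exists N0, forall N, (N0 <= N)%coq_nat -> {subset S <= s N}].

Lemma sum_subset (F : T -> R) (s s' : seq T) : (forall k, 0 <= F k) -> uniq s -> uniq s' ->
  {subset s <= s'} -> \sum_(k <- s) F k <= \sum_(k <- s') F k.
Proof.
move=> F0 us us' sub; rewrite (bigID (mem s) xpredT F (r := s')) /= -[leLHS]addr0.
apply: lerD; last by apply: sumr_ge0.
have E : perm_eq s [seq k <- s' | mem s k].
  apply: uniq_perm => //; first exact: filter_uniq.
  by move=> k; rewrite mem_filter /=; case: (boolP (k \in s)) => //= /sub ->.
by rewrite (perm_big _ E) big_filter.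
Qed.

Lemma exhausts_lim_ge0 (s s' : nat -> seq T) (F : T -> R) (l : R) :
  exhausts s -> exhausts s' -> (forall k, 0 <= F k) ->
  is_lim_seq (fun N => \sum_(k <- s N) F k) l ->
  is_lim_seq (fun N => \sum_(k <- s' N) F k) l.
Proof.
move=> [us Ps es] [us' Ps' es'] F0 H.
have upper M : \sum_(k <- s' M) F k <= l.
  have [|N0 HN0] := es (s' M); first by apply/allP => k /Ps'.
  apply/RleP.
  apply: (is_lim_seq_le_loc (fun=> \sum_(k <- s' M) F k) _ _ _ _ (is_lim_seq_const _) H).
  exists N0 => N /HN0 sub; apply/RleP; exact: sum_subset.
apply/is_lim_seq_spec => eps.
have /is_lim_seq_spec /(_ eps) [N HN] := H.
have [|M0 HM0] := es' (s N); first by apply/allP => k /Ps.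
exists M0 => M /HM0 sub.
have /RleP h1 := upper M.
have /RleP h2 := sum_subset F0 (us N) (us' M) sub.
have := HN N (le_n N).
move=> /Rabs_def2 [h3 h4]; apply: Rabs_def1; Lra.lra.
Qed.

(** F = (F + G) - G with both parts nonnegative. *)
Lemma exhausts_lim (s s' : nat -> seq T) (F G : T -> R) (l l' : R) :
  exhausts s -> exhausts s' -> (forall k, `|F k| <= G k) ->
  is_lim_seq (fun N => \sum_(k <- s N) F k) l ->
  is_lim_seq (fun N => \sum_(k <- s N) G k) l' ->
  is_lim_seq (fun N => \sum_(k <- s' N) F k) l.
Proof.
move=> es es' FG HF HG.
have G0 k : 0 <= G k by apply: le_trans (FG k).
have FG0 k : 0 <= F k + G k by have := FG k; rewrite ler_norml => /andP[]; rewrite -subr_ge0 opprK addrC.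
have H1 := exhausts_lim_ge0 es es' G0 HG.
have : is_lim_seq (fun N => \sum_(k <- s N) (F k + G k)) (l + l').
  apply: is_lim_seq_ext (is_lim_seq_plus' _ _ _ _ HF HG) => N.
  by rewrite big_split.
move=> /(exhausts_lim_ge0 es es' FG0) H2.
have := is_lim_seq_minus' _ _ _ _ H2 H1.
rewrite RminusE addrK; apply: is_lim_seq_ext => N.
by rewrite big_split RminusE addrK.
Qed.

End Exhaustion.

Lemma exp_sum (I : Type) (s : seq I) (F : I -> R) :
  exp (\sum_(i <- s) F i) = \prod_(i <- s) exp (F i).
Proof. exact: (big_morph exp exp_plus exp_0). Qed.

Lemma IZR_int (z : Z) : exists m : int, IZR z = m%:~R.
Proof.
case: z => [|p|p]; first by exists 0.
  by exists (nat_of_pos p)%:Z; rewrite !RealsE.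
by exists (- (nat_of_pos p)%:Z); rewrite -Pos2Z.opp_pos opp_IZR !RealsE rmorphN.
Qed.

Lemma ce_eq1 (q : rat) : ce (ratr q) = 1 -> integral q.
Proof.
case=> E _.
have E2 : cos (Rmult 2 (Rmult PI (ratr q))) = 1 by rewrite -E; congr cos; Lra.lra.
rewrite cos_2a_sin in E2.
have S0 : sin (Rmult PI (ratr q)) = 0.
  by apply: Rsqr_0_uniq; rewrite /Rsqr -[RHS]/(IZR 0); move: E2; rewrite -[RHS]/(IZR 1) => E2; Lra.lra.
have [z Hz] := sin_eq_0_0 _ S0.
have [m Hm] := IZR_int z.
have Hq : ratr q = IZR z.
  apply: (Rmult_eq_reg_l PI); last exact: PI_neq0.
  by rewrite Hz Rmult_comm.
exists m; apply: (fmorph_inj (ratr : {rmorphism rat -> R})).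
by rewrite /= Hq Hm rmorph_int.
Qed.

Section Poisson.
Variables (n : nat) (a : 'I_n -> nat) (Lam : pred {ffun 'I_n -> int}).
Hypothesis a_gt0 : forall i, (0 < a i)%N.
Hypothesis self_dual :
  forall k, Lam k <-> (forall l, Lam l -> integral (pair a k l)).
Implicit Types k c : {ffun 'I_n -> int}.

Definition pairR (u v : 'I_n -> R) : R := \sum_i u i * v i / (a i)%:R.
Definition emb k : 'I_n -> R := fun i => (k i)%:~R.

Lemma pairR_emb k l : pairR (emb k) (emb l) = ratr (pair a k l).
Proof.
rewrite /pair rmorph_sum; apply: eq_bigr => i _ /=.
by rewrite rmorphM fmorphV /= rmorph_nat rmorph_int rmorphM.
Qed.

Lemma aR_gt0 i : 0 < (a i)%:R :> R.
Proof. by rewrite ltr0n. Qed.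

(** Orthogonality of characters. A shift by d permutes the code, so S is multiplied by the value of
    the character at d without changing. If S is nonzero all these values are 1, and self-duality
    puts k in the lattice. *)
Lemma code_sum k :
  \sum_(c <- code a Lam) ce (pairR (emb k) (emb c)) =
  if Lam k then (size (code a Lam))%:R else 0.
Proof.
case: ifPn => [Lk|nLk].
  rewrite (eq_big_seq (fun=> 1)) => [|c].
    by rewrite big_const_seq count_predT iter_addr_0.
  rewrite mem_code => /andP[Lc _].
  have [z Hz] := (self_dual k).1 Lk c Lc.
  by rewrite pairR_emb Hz ratr_int ce_int.
set S := \sum_(c <- _) _.
have pair_red l : ce (pairR (emb k) (emb (red a l))) = ce (pairR (emb k) (emb l)).
  rewrite !pairR_emb {2}(red_quo a l) pair_sym [in RHS]pair_sym pair_addl (pair_scalf a_gt0).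
  by rewrite rmorphD ceD rmorph_int ce_int mul1r.
have shift d : d \in code a Lam -> S * ce (pairR (emb k) (emb d)) = S.
  move=> Hd; rewrite {2}/S -(perm_big _ (code_shift a_gt0 self_dual Hd)) big_map mulr_suml.
  apply: eq_bigr => c _; rewrite pair_red !pairR_emb -ceD -rmorphD.
  by rewrite /= ![pair a k _]pair_sym pair_addl.
have [//|S0] := eqVneq S 0.
case/negP: nLk; apply/self_dual => l Hl; apply: ce_eq1.
rewrite -pairR_emb -pair_red; apply: (mulfI S0).
by rewrite mulr1 shift // (red_code a_gt0 self_dual).
Qed.

Definition expm (x : R) : R := exp (- x).
Arguments expm x%_ring_scope.

Definition cosp (x : R) : R := complex.Re (ce x).
Arguments cosp x%_ring_scope.

Definition gaussL (t : R) (u : 'I_n -> R) k : R :=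
  expm (PI * t * pairR (fun i => (k i)%:~R + u i) (fun i => (k i)%:~R + u i)).

Definition dualL (t : R) (u : 'I_n -> R) k : R :=
  (expm (PI / t * ratr (pair a k k)) * cosp (pairR (emb k) u))%R.

Lemma expmN_sum (I : Type) (s : seq I) (F : I -> R) :
  expm (\sum_(i <- s) F i) = \prod_(i <- s) expm (F i).
Proof. by rewrite /expm -exp_sum; congr exp; rewrite RoppE sumrN. Qed.

Lemma gaussL_prod t u c m :
  gaussL t u (addf (scalf a m) c) =
  \prod_i gauss (t * (a i)%:R) (((c i)%:~R + u i) / (a i)%:R) (m i)%:~R.
Proof.
rewrite /gaussL /pairR mulr_sumr expmN_sum; apply: eq_bigr => i _.
rewrite /gauss /expm; congr exp; rewrite !RealsE !ffunE.
congr (- _); have := aR_gt0 i => /lt0r_neq0 ai.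
by rewrite rmorphD rmorphM /= -pmulrn; field.
Qed.

Lemma dual_prod t k : \prod_i dual_gauss (t * (a i)%:R) (k i)%:~R = expm (PI / t * ratr (pair a k k)).
Proof.
rewrite -pairR_emb mulr_sumr expmN_sum; apply: eq_bigr => i _.
rewrite /dual_gauss /expm /emb; congr exp; rewrite !RealsE; congr (- _).
by rewrite expr2 invfM; move: PI t^-1 (_%:R^-1) => p y z; ring.
Qed.

Lemma prod_real (I : Type) (s : seq I) (F : I -> R) :
  \prod_(i <- s) Complex (F i) 0 = Complex (\prod_(i <- s) F i) 0 :> C.
Proof.
symmetry; apply: (big_morph (fun x : R => Complex x 0 : C)) => // x y.
by simpc; rewrite ?(mul0r, mulr0, addr0, subr0).
Qed.

Lemma sum_real (I : Type) (s : seq I) (F : I -> R) :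
  \sum_(i <- s) Complex (F i) 0 = Complex (\sum_(i <- s) F i) 0 :> C.
Proof.
symmetry; apply: (big_morph (fun x : R => Complex x 0 : C)) => // x y.
by simpc; rewrite ?(mul0r, mulr0, addr0, subr0).
Qed.

Definition coset_sum t (u : 'I_n -> R) N c : R :=
  \prod_i \sum_(m <- izs N) dual_gauss (t * (a i)%:R) m%:~R *
     cos (2 * PI * m%:~R * (((c i)%:~R + u i) / (a i)%:R)).

Lemma coset_sumE t u N c :
  Complex (coset_sum t u N c) 0 =
  \sum_(k <- box n N) Complex (expm (PI / t * ratr (pair a k k))) 0 *
      (ce (pairR (emb k) u) * ce (pairR (emb k) (emb c))).
Proof.
rewrite /coset_sum -prod_real.
under eq_bigr => i _.
  rewrite -sum_ce_even => [|y]; last by rewrite /dual_gauss !RealsE sqrrN.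
  over.
rewrite prod_sum_box; apply: eq_bigr => k _.
rewrite big_split /= prod_real dual_prod -ceD; congr (_ * _).
rewrite -ce_sum -big_split; congr ce; apply: eq_bigr => i _ /=.
by rewrite /emb !RealsE mulrA mulrDr mulrDl addrC.
Qed.

(** Each coset of the span has a dual sum over all integral k; adding these up over the code keeps
    only the k in [Lam]. *)
Lemma sum_coset_sum t u N :
  \sum_(c <- code a Lam) coset_sum t u N c =
  (size (code a Lam))%:R * \sum_(k <- [seq k <- box n N | Lam k]) dualL t u k.
Proof.
suff H : Complex (\sum_(c <- code a Lam) coset_sum t u N c) 0 =
  (size (code a Lam))%:R * \sum_(k <- [seq k <- box n N | Lam k])
    Complex (expm (PI / t * ratr (pair a k k))) 0 * ce (pairR (emb k) u).
  have := congr1 (@complex.Re _) H; rewrite /= => ->.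
  have Re_nat (m : nat) (z : C) : complex.Re (m%:R * z) = m%:R * complex.Re z.
    rewrite !mulr_natl; elim: m => [|m IH]; first by rewrite !mulr0n.
    by rewrite !mulrS -IH; case: z (z *+ m) {IH} => ? ? [].
  rewrite Re_nat Re_sum; congr (_ * _); apply: eq_bigr => k _.
  by rewrite /dualL /cosp; case: (ce _) => x y; simpc.
rewrite -sum_real; under eq_bigr => c _ do rewrite coset_sumE.
rewrite exchange_big /= big_filter mulr_sumr [RHS]big_mkcond; apply: eq_bigr => k _.
rewrite -mulr_sumr -mulr_sumr code_sum.
by case: (Lam k); rewrite ?mulr0 // mulrA mulrC.
Qed.

Lemma lim_coset t u : 0 < t ->
  is_lim_seq (fun N => \sum_(c <- code a Lam) coset_sum t u N c)
   (\sum_(c <- code a Lam) \prod_i dual_sum (t * (a i)%:R) (((c i)%:~R + u i) / (a i)%:R)).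
Proof.
move=> t0; apply: lim_sum_seq => c; apply: lim_prod_seq => i.
by apply: lim_dual; rewrite mulr_gt0 // aR_gt0.
Qed.

Lemma lim_cbox t u : 0 < t ->
  is_lim_seq (fun N => \sum_(k <- cbox a Lam N) gaussL t u k)
   (\sum_(c <- code a Lam) \prod_i
      ((sqrt (t * (a i)%:R)%R)^-1 * dual_sum (t * (a i)%:R) (((c i)%:~R + u i) / (a i)%:R))).
Proof.
move=> t0.
apply: (is_lim_seq_ext (fun N => \sum_(c <- code a Lam)
   \prod_i \sum_(m <- izs N) gauss (t * (a i)%:R) (((c i)%:~R + u i) / (a i)%:R) m%:~R)) => [N|].
  rewrite /cbox big_allpairs_dep; apply: eq_bigr => c _.
  by rewrite prod_sum_box; apply: eq_bigr => m _; rewrite gaussL_prod.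
apply: lim_sum_seq => c; apply: lim_prod_seq => i.
by apply: lim_gauss; rewrite mulr_gt0 // aR_gt0.
Qed.

Lemma sqrtM_prod t : 0 < t ->
  \prod_i (sqrt (t * (a i)%:R)%R)^-1 = ((sqrt t)^-1) ^+ n * \prod_i (sqrt (a i)%:R)^-1.
Proof.
move=> /RltP t0.
transitivity (\prod_(i < n) ((sqrt t)^-1 * (sqrt (a i)%:R)^-1)); last first.
  by rewrite big_split /= prodr_const card_ord.
apply: eq_bigr => i _; rewrite -invfM; congr (_ ^-1).
have /RltP ai := aR_gt0 i.
by rewrite -RmultE sqrt_mult //; apply: Rlt_le.
Qed.

Lemma code_gt0 : (0 < size (code a Lam))%N.
Proof.
have H : Lam [ffun=> 0].
  apply/self_dual => l _; exists 0; rewrite /pair big1 // => i _.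
  by rewrite ffunE mul0r mul0r.
have := red_code a_gt0 self_dual H.
by case: (code a Lam).
Qed.

(** The index of the span of the w_i divided by its covolume: the inverse covolume of the
    lattice. *)
Definition kappa : R := ((size (code a Lam))%:R * \prod_i (sqrt (a i)%:R)^-1)%R.

Lemma poisson_boxes t u : 0 < t ->
  exists2 S : R, is_lim_seq (fun N => \sum_(k <- [seq k <- box n N | Lam k]) dualL t u k) S
    & is_lim_seq (fun N => \sum_(k <- cbox a Lam N) gaussL t u k) (kappa * (sqrt t)^-1 ^+ n * S).
Proof.
move=> t0; set c : R := (size (code a Lam))%:R.
have c0 : c != 0 by rewrite pnatr_eq0 -lt0n code_gt0.
set D := \sum_(c <- code a Lam) \prod_i dual_sum (t * (a i)%:R) (((c i)%:~R + u i) / (a i)%:R).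
exists (c^-1 * D).
  apply: is_lim_seq_ext (is_lim_seq_scalr c^-1 (lim_coset t0)) => N.
  by rewrite sum_coset_sum mulrA mulVf // mul1r.
have -> : kappa * (sqrt t)^-1 ^+ n * (c^-1 * D) =
  \sum_(c <- code a Lam) \prod_i
      ((sqrt (t * (a i)%:R)%R)^-1 * dual_sum (t * (a i)%:R) (((c i)%:~R + u i) / (a i)%:R)).
  under eq_bigr => d _ do rewrite big_split sqrtM_prod //=.
  rewrite -mulr_sumr -/D /kappa -/c; set p := \prod_i _; set q := _ ^+ n.
  by field.
exact: lim_cbox.
Qed.

Lemma exhausts_cbox : exhausts Lam (cbox a Lam).
Proof.
split=> [N|N k|S /allP HS]; first exact: uniq_cbox.
  by rewrite (mem_cbox a_gt0 self_dual) => /andP[].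
have [N0 HN0] := box_all [seq quo a k | k <- S].
exists N0 => N /ssrnat.leP le k kS; rewrite (mem_cbox a_gt0 self_dual) HS //=.
by apply: box_mono le _; apply/HN0/map_f.
Qed.

Lemma exhausts_box : exhausts Lam (fun N => [seq k <- box n N | Lam k]).
Proof.
split=> [N|N k|S /allP HS]; first by rewrite filter_uniq // uniq_box.
  by rewrite mem_filter => /andP[].
have [N0 HN0] := box_all S.
exists N0 => N /ssrnat.leP le k kS; rewrite mem_filter HS //=.
by apply: box_mono le _; apply/HN0.
Qed.

Hypothesis even_lam : forall k, Lam k -> exists c : nat, pair a k k = (2 * c)%:R.

Lemma exhausts_upto : exhausts Lam (upto a Lam).
Proof.
split=> [N|N k|S /allP HS]; first exact: uniq_upto.
  by rewrite (mem_upto a_gt0) => /andP[].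
have [N0 HN0] : exists N0, forall k, k \in S -> pair a k k <= (2 * N0)%:R.
  elim: S HS => [|k S IH] HS; first by exists 0.
  have [|N1 H1] := IH; first by move=> x xS; apply: HS; rewrite inE xS orbT.
  have [|c Hc] := even_lam (k := k); first by apply: HS; rewrite inE eqxx.
  exists (maxn N1 c) => x; rewrite inE => /predU1P[->|/H1 H]; first by rewrite Hc ler_nat; lia.
  by apply: le_trans H _; rewrite ler_nat; lia.
exists N0 => N /ssrnat.leP le k kS; rewrite (mem_upto a_gt0) HS //=.
apply: le_trans (HN0 k kS) _; rewrite ler_nat; lia.
Qed.

Lemma abs_cosp x : `|cosp x| <= 1.
Proof.
rewrite /cosp /ce /=; have [/RleP h1 /RleP h2] := COS_bound (2 * PI * x).
by rewrite ler_norml h2 andbT; move: h1; rewrite (opp_IZR 1).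
Qed.

Lemma expm_ge0 x : 0 <= expm x.
Proof. by apply/ltW/RltP; exact: exp_pos. Qed.

Lemma cosp0 : cosp 0 = 1.
Proof. by rewrite /cosp ce0. Qed.

Arguments poisson_boxes [t] u _.

Lemma poisson_upto t u : 0 < t ->
  exists2 S : R, is_lim_seq (fun N => \sum_(k <- upto a Lam N) dualL t u k) S
    & is_lim_seq (fun N => \sum_(k <- upto a Lam N) gaussL t u k) (kappa * (sqrt t)^-1 ^+ n * S).
Proof.
move=> t0; have [S HS HG] := poisson_boxes u t0.
have [S0 HS0 _] := poisson_boxes (fun=> 0) t0.
exists S; last first.
  by apply: exhausts_lim_ge0 HG => [| |k]; [exact: exhausts_cbox|exact: exhausts_upto|exact: expm_ge0].
apply: exhausts_lim HS HS0 => [| |k]; [exact: exhausts_box|exact: exhausts_upto|].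
rewrite /dualL normrM [`|expm _|]ger0_norm ?expm_ge0 // ler_wpM2l ?expm_ge0 //.
rewrite {2}/pairR big1 => [|i _]; last by rewrite mulr0 mul0r.
by rewrite cosp0 abs_cosp.
Qed.

Arguments poisson_upto [t] u _.

(** That a self-dual lattice has covolume 1 is read off from Poisson summation itself: for t = 1 and
    u = 0 both sides are the same sum, which is at least 1. *)
Lemma kappa1 : kappa = 1.
Proof.
have [S HS HG] := poisson_upto (fun=> 0) ltr01.
have E k : dualL 1 (fun=> 0) k = gaussL 1 (fun=> 0) k.
  rewrite /dualL /gaussL {1}/pairR big1 => [|i _]; last by rewrite mulr0 mul0r.
  rewrite cosp0 -pairR_emb divr1 !mulr1; congr (expm (_ * _)).
  by apply: eq_bigr => i _; rewrite addr0.
have HG' : is_lim_seq (fun N => \sum_(k <- upto a Lam N) dualL 1 (fun=> 0) k) (kappa * S).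
  rewrite sqrt_1 invr1 expr1n mulr1 in HG; apply: is_lim_seq_ext HG => N.
  by apply: eq_bigr => k _; rewrite E.
have [ES] : Rbar.Finite S = Rbar.Finite (kappa * S).
  by rewrite -(is_lim_seq_unique _ _ HS) -(is_lim_seq_unique _ _ HG').
have S1 : 1 <= S.
  apply/RleP; apply: (is_lim_seq_le (fun=> 1) _ _ _ _ (is_lim_seq_const _) HS) => N.
  apply/RleP; have Z : [ffun=> 0] \in upto a Lam N.
    rewrite (mem_upto a_gt0); apply/andP; split.
      apply/self_dual => l _; exists 0; rewrite /pair big1 // => i _.
      by rewrite ffunE mul0r mul0r.
    by rewrite /pair big1 => [|i _]; rewrite ?ler0n // ffunE !mul0r.
  rewrite (perm_big _ (perm_to_rem Z)) big_cons E /= -[leLHS]addr0; apply: lerD.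
    rewrite /gaussL /pairR big1 => [|i _]; last by rewrite ffunE addr0 !mul0r.
    by rewrite mulr0 /expm RoppE oppr0 exp_0.
  by apply: sumr_ge0 => k _; rewrite E expm_ge0.
have S0 : S != 0 by apply: lt0r_neq0; apply: lt_le_trans S1; exact: ltr01.
by apply: (mulIf S0); rewrite mul1r [RHS]ES.
Qed.

End Poisson.

Lemma asumE (l : nat -> seq R) n F : asum l n F = \sum_(x <- l n) F x.
Proof. by rewrite /asum; elim: (l n) => [|x s IH]; rewrite ?big_nil //= big_cons IH. Qed.

Section Shell.
Variables (a : 'I_48 -> nat) (Lam : pred {ffun 'I_48 -> int}).
Hypothesis a_gt0 : forall i, (0 < a i)%N.
Hypothesis self_dual :
  forall k, Lam k <-> (forall l, Lam l -> integral (pair a k l)).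
Hypothesis even_lam : forall k, Lam k -> exists c : nat, pair a k k = (2 * c)%:R.
Hypothesis min6 : forall k, Lam k -> k != [ffun=> 0] -> 6 <= pair a k k.
Variable v : {ffun 'I_48 -> int}.

Let l m : seq R := [seq ratr (pair a k v) | k <- level a Lam m].
Let NN : R := ratr (pair a v v).

Lemma levels_sym n (F : R -> R) : asum l n (fun x => F (Ropp x)) = asum l n F.
Proof.
rewrite !asumE !big_map -[RHS](perm_big _ (level_neg a_gt0 self_dual n)) big_map.
by apply: eq_bigr => k _; rewrite pairNl rmorphN.
Qed.

Lemma sum_n_big (F : nat -> R) N : sum_n F N = \sum_(0 <= j < N.+1) F j.
Proof.
elim: N => [|N IH]; first by rewrite big_nat1 sum_n_0.
by rewrite sum_n_S IH [RHS]big_nat_recr.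
Qed.

Lemma series_levels (F : {ffun 'I_48 -> int} -> R) (S : R) :
  is_lim_seq (fun N => \sum_(k <- upto a Lam N) F k) S ->
  is_series (fun m => \sum_(k <- level a Lam m) F k) S.
Proof.
move=> H; apply: is_lim_seq_ext H => N.
by rewrite sum_n_big (sum_level a_gt0 even_lam).
Qed.

(** The square |k + x v|^2 is expanded; on a shell the first term is constant and becomes the power
    of the nome. *)
Lemma qexp_level (t x : R) m k : k \in level a Lam m ->
  gaussL a t (fun i => x * (v i)%:~R) k =
  exp (- (PI * t * x ^+ 2 * NN)) * (qexp t ^+ m * exp (- (2 * PI * t * x * ratr (pair a k v)))).
Proof.
rewrite (mem_level a_gt0) => /andP[_ /eqP Hk].
have -> : qexp t ^+ m = exp (- (2 * PI * t * m%:R)).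
  rewrite /qexp -RpowE exp_pow; congr exp; rewrite !RealsE; ring.
have EM x1 y1 : exp x1 * exp y1 = exp (x1 + y1) by rewrite exp_plus.
rewrite !EM /gaussL /expm; congr exp.
have -> : pairR a (fun i => (k i)%:~R + x * (v i)%:~R) (fun i => (k i)%:~R + x * (v i)%:~R)
  = ratr (pair a k k) + 2 * x * ratr (pair a k v) + x ^+ 2 * ratr (pair a v v).
  rewrite -!pairR_emb /pairR !mulr_sumr -!big_split /=; apply: eq_bigr => i _.
  by rewrite /emb; ring.
rewrite Hk ratr_nat -/NN !RealsE natrM -[nat_of_pos 2]/2%N; ring.
Qed.

Lemma levels_poisson : theta_inversion l NN.
Proof.
move=> t s Ht; have t0 : 0 < t by apply/RltP.
have tn0 := lt0r_neq0 t0.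
have [S HS HG] := poisson_upto a_gt0 self_dual even_lam (fun i => s * (v i)%:~R) t0.
rewrite (kappa1 a_gt0 self_dual even_lam) mul1r in HG.
set e := exp (- (PI * t * s ^+ 2 * NN))%R.
have e0 : e != 0 by apply/lt0r_neq0/RltP; exact: exp_pos.
exists (e^-1 * ((sqrt t)^-1 ^+ 48 * S)), S; split; [|split].
- apply: is_series_ext (is_series_scal_l e^-1 _ _ (series_levels HG)) => m.
  rewrite asumE big_map RpowE; rewrite RmultE -[LHS]/(Rmult e^-1 _) RmultE !mulr_sumr.
  apply: eq_big_seq => k Hk; rewrite (qexp_level _ _ Hk) !RealsE.
  by rewrite -/e mulKf.
- apply: is_series_ext (series_levels HS) => m.
  rewrite asumE big_map RpowE RmultE mulr_sumr.
  apply: eq_big_seq => k; rewrite (mem_level a_gt0) => /andP[_ /eqP Hk].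
  rewrite /dualL Hk ratr_nat; congr (_ * _).
    rewrite /qexp /expm -RpowE exp_pow; congr exp; rewrite !RealsE natrM -[nat_of_pos 2]/2%N; field; exact: tn0.
  rewrite /cosp /ce /=; congr cos; rewrite !RealsE -[RHS]mulrA; congr (_ * _).
  rewrite -pairR_emb /pairR mulr_sumr; apply: eq_bigr => i _; rewrite /emb; ring.
rewrite !RealsE -/e (mulVKf e0); congr (_ * _).
by rewrite exprVn (exprM _ 2 24) sqr_sqrtr // ltW.
Qed.

Lemma level0 : level a Lam 0 = [:: [ffun=> 0]].
Proof.
apply/perm_small_eq => //; apply: uniq_perm; rewrite ?uniq_level // => k.
rewrite (mem_level a_gt0) inE; apply/andP/eqP => [[_ /eqP]|->].
  exact: (pair_eq0 a_gt0).
split; last by apply/eqP; rewrite /pair big1 // => i _; rewrite ffunE !mul0r.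
apply/self_dual => k' _; exists 0; rewrite /pair big1 // => i _.
by rewrite ffunE !mul0r.
Qed.

Lemma level_small m : (0 < m < 3)%N -> level a Lam m = [::].
Proof.
move=> Hm; apply/eqP; rewrite -size_eq0 -leqn0 leqNgt; apply/negP.
rewrite -has_predT => /hasP[k]; rewrite (mem_level a_gt0) => /andP[Lk /eqP E] _.
have [k0|/(min6 Lk)] := eqVneq k [ffun=> 0].
  have : pair a k k = 0 by rewrite /pair big1 // => i _; rewrite k0 ffunE !mul0r.
  by move/eqP; rewrite E pnatr_eq0; case: m Hm {E}.
by rewrite E ler_nat; move: Hm; case: m {E} => [|[|[|]]].
Qed.

(** Here the real moment identities become identities between integers, in which form they no longer
    refer to a model of the reals. *)
Lemma shell_moments (z : {ffun 'I_48 -> int} -> Z) (N : Z) (j : nat) :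
  (forall k, k \in level a Lam 3 -> ratr (pair a k v) = IZR (z k)) -> NN = IZR N -> (j <= 5)%N ->
  zsum (fun k => Z.pow (z k) (Z.of_nat (2 * j))) (level a Lam 3) =
    Z.mul (shell_moment j) (Z.pow N (Z.of_nat j)).
Proof.
move=> Hz HN Hj.
have l0 : l 0 = [:: 0].
  by rewrite /l level0 /= /pair big1 ?rmorph0 // => i _; rewrite ffunE !mul0r.
have l1 : l 1 = [::] by rewrite /l level_small.
have l2 : l 2 = [::] by rewrite /l level_small.
have [H0 [H1 [H2 [H3 [H4 H5]]]]] := moment_values l NN levels_sym levels_poisson l0 l1 l2.
have muE i : mu l i 3 = IZR (zsum (fun k => Z.pow (z k) (Z.of_nat (2 * i))) (level a Lam 3)).
  rewrite /mu /asum /l /=; elim: (level a Lam 3) Hz => [//|k s IH] Hz /=.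
  rewrite IH => [|x xs]; last by apply: Hz; rewrite inE xs orbT.
  by rewrite plus_IZR Hz ?inE ?eqxx // pow_IZR.
apply: eq_IZR; rewrite -muE mult_IZR -pow_IZR -HN.
case: j Hj => [|[|[|[|[|[|]]]]]] // _.
- by rewrite pow_O Rmult_1_r.
- by rewrite pow_1.
Qed.

Lemma IZR_int_of_Z (z : Z) : IZR z = (int_of_Z z)%:~R.
Proof.
rewrite -{1}(int_of_ZK z); case: (int_of_Z z) => m /=; first by rewrite -INR_IZR_INZ INRE.
by rewrite opp_IZR -INR_IZR_INZ INRE NegzE rmorphN /= addn1.
Qed.

Lemma shell_moments_int (z : {ffun 'I_48 -> int} -> Z) (N : Z) (j : nat) :
  (forall k, k \in level a Lam 3 -> pair a k v = (int_of_Z (z k))%:~R) ->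
  pair a v v = (int_of_Z N)%:~R -> (j <= 5)%N ->
  zsum (fun k => Z.pow (z k) (Z.of_nat (2 * j))) (level a Lam 3) =
    Z.mul (shell_moment j) (Z.pow N (Z.of_nat j)).
Proof.
move=> Hz HN; apply: shell_moments => [k /Hz ->|]; first by rewrite ratr_int IZR_int_of_Z.
by rewrite /NN HN ratr_int IZR_int_of_Z.
Qed.

End Shell.

End Poisson.

(** * Orthogonal families of full rank in a unimodular lattice *)

Module LatticeBasis.
Local Open Scope ring_scope.
Local Open Scope classical_set_scope.

Section Dot.
Variables (R : realType) (n : nat).
Implicit Types (x y z : 'rV[R]_n).

Lemma dotE x y : dot x y = \sum_i x 0 i * y 0 i.
Proof. by rewrite /dot mxE; apply: eq_bigr => i _; rewrite !mxE. Qed.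

Lemma dotC x y : dot x y = dot y x.
Proof. by rewrite !dotE; apply: eq_bigr => i _; rewrite mulrC. Qed.

Lemma dotDl x y z : dot (x + y) z = dot x z + dot y z.
Proof. by rewrite /dot mulmxDl mxE. Qed.

Lemma dotZl a x z : dot (a *: x) z = a * dot x z.
Proof. by rewrite /dot -scalemxAl mxE. Qed.

Lemma dotNl x z : dot (- x) z = - dot x z.
Proof. by rewrite -scaleN1r dotZl mulN1r. Qed.

Lemma dotBl x y z : dot (x - y) z = dot x z - dot y z.
Proof. by rewrite dotDl dotNl. Qed.

Lemma dot0l z : dot 0 z = 0.
Proof. by rewrite /dot mul0mx mxE. Qed.

Lemma dotDr x y z : dot z (x + y) = dot z x + dot z y.
Proof. by rewrite ![dot z _]dotC dotDl. Qed.

Lemma dotZr a x z : dot z (a *: x) = a * dot z x.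
Proof. by rewrite ![dot z _]dotC dotZl. Qed.

Lemma dotNr x z : dot z (- x) = - dot z x.
Proof. by rewrite ![dot z _]dotC dotNl. Qed.

Lemma dotBr x y z : dot z (x - y) = dot z x - dot z y.
Proof. by rewrite dotDr dotNr. Qed.

Lemma dot_suml (I : Type) (s : seq I) (F : I -> 'rV[R]_n) z :
  dot (\sum_(i <- s) F i) z = \sum_(i <- s) dot (F i) z.
Proof. by elim: s => [|i s IH]; rewrite ?big_nil ?dot0l // !big_cons dotDl IH. Qed.

Lemma dot_ge0 x : 0 <= dot x x.
Proof. by rewrite dotE sumr_ge0 // => i _; rewrite -expr2 sqr_ge0. Qed.

Lemma dot_eq0 x : dot x x = 0 -> x = 0.
Proof.
rewrite dotE => /eqP; rewrite psumr_eq0 => [/allP H|i _]; last by rewrite -expr2 sqr_ge0.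
apply/rowP => i; have := H i (mem_index_enum i).
by rewrite mulf_eq0 orbb mxE => /eqP.
Qed.

Lemma dot_neq0 x : x != 0 -> dot x x != 0.
Proof. by apply: contra => /eqP /dot_eq0 ->. Qed.

End Dot.

Section Unimodular.
Variables (R : realType) (n : nat) (L : set 'rV[R]_n).
Hypothesis uni : unimodular L.

Lemma lattice_dot x y : L x -> L y -> exists c : int, dot x y = c%:~R.
Proof. by move=> + Ly; rewrite {1}uni.2 => /(_ y Ly). Qed.

Lemma dual_mem x : (forall y, L y -> exists c : int, dot x y = c%:~R) -> L x.
Proof. by move=> H; rewrite uni.2. Qed.

Lemma lattice_add x y : L x -> L y -> L (x + y).
Proof.
move=> Lx Ly; apply: dual_mem => z Lz.
have [c Hc] := lattice_dot Lx Lz; have [d Hd] := lattice_dot Ly Lz.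
by exists (c + d); rewrite dotDl Hc Hd rmorphD.
Qed.

Lemma lattice_scale (m : int) x : L x -> L (m%:~R *: x).
Proof.
move=> Lx; apply: dual_mem => z Lz; have [c Hc] := lattice_dot Lx Lz.
by exists (m * c); rewrite dotZl Hc rmorphM.
Qed.

Lemma lattice_opp x : L x -> L (- x).
Proof. by move=> Lx; rewrite -scaleN1r -(rmorphN1 (intmul 1)); apply: lattice_scale. Qed.

Lemma lattice_sub x y : L x -> L y -> L (x - y).
Proof. by move=> Lx Ly; apply: lattice_add => //; apply: lattice_opp. Qed.

Lemma lattice0 : L 0.
Proof. by apply: dual_mem => z _; exists 0; rewrite dot0l. Qed.

Lemma lattice_sum (I : Type) (s : seq I) (F : I -> 'rV[R]_n) :
  (forall i, L (F i)) -> L (\sum_(i <- s) F i).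
Proof. by move=> H; elim: s => [|i s IH]; rewrite ?big_nil ?big_cons; [apply: lattice0|apply: lattice_add]. Qed.

Lemma lattice_norm x : L x -> exists a : nat, dot x x = a%:R.
Proof.
move=> Lx; have [c Hc] := lattice_dot Lx Lx; exists `|c|%N.
by have := dot_ge0 x; rewrite Hc ler0z => c0; rewrite pmulrn gez0_abs.
Qed.

Lemma basis_rows : exists2 B : 'M[R]_n, B \in unitmx & forall i, L (row i B).
Proof.
have [[B Bu EL] _] := uni; exists B => // i; rewrite EL.
exists (delta_mx 0 i) => //; rewrite rowE; congr (_ *m _).
by apply/matrixP => j k; rewrite !mxE; case: (_ && _).
Qed.

(** Gram-Schmidt inside the lattice: projecting a basis row away from the family introduces the
    denominators a_j, and multiplication by their product D leads back into L. *)
Lemma orthogonal_family k : (k <= n)%N -> exists w : 'I_k -> 'rV[R]_n,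
  [/\ forall i, L (w i), forall i, w i != 0 & forall i j, i != j -> dot (w i) (w j) = 0].
Proof.
elim: k => [_|k IH kn]; first by exists (fun=> 0); split=> -[].
have [w [Lw nzw ow]] := IH (ltnW kn).
have [B Bu LB] := basis_rows.
pose W : 'M[R]_(k, n) := \matrix_i w i.
(* Fewer than n vectors cannot span all rows of an invertible matrix. *)
have [i Hi] : exists i, ~~ (row i B <= W)%MS.
  apply/existsP; rewrite -negb_forall; apply/negP => /forallP H.
  have BW : (B <= W)%MS by apply/row_subP.
  have := mxrankS BW; rewrite mxrank_unit // leqNgt.
  by rewrite (leq_ltn_trans (rank_leq_row W)).
have Ha j : {a : nat | dot (w j) (w j) = a%:R} by apply: cid; apply: lattice_norm.
pose a j := projT1 (Ha j).
have aE j : dot (w j) (w j) = (a j)%:R by rewrite /a; case: (Ha j).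
have Hc j : {c : int | dot (row i B) (w j) = c%:~R} by apply: cid; apply: lattice_dot.
pose c j := projT1 (Hc j).
have cE j : dot (row i B) (w j) = (c j)%:~R by rewrite /c; case: (Hc j).
have anz j : (a j)%:R != 0 :> R by rewrite -aE dot_neq0.
pose D := (\prod_j a j)%N.
pose v := row i B - \sum_j ((c j)%:~R / (a j)%:R) *: w j.
have Dnz : D%:R != 0 :> R by rewrite natr_prod; apply/prodf_neq0 => j _.
have vnz : v != 0.
  apply: contraNneq Hi => /eqP; rewrite subr_eq0 => /eqP ->.
  apply: summx_sub => j _; apply: scalemx_sub; rewrite -[w j](rowK w j) row_sub //.
have vw j : dot v (w j) = 0.
  rewrite dotBl dot_suml (bigD1 j) //= big1 => [|j' jj']; last by rewrite dotZl ow ?mulr0.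
  by rewrite dotZl aE cE addr0 divfK // subrr.
have Lv : L (D%:R *: v).
  rewrite scalerBr; apply: lattice_sub; first by rewrite pmulrn; apply: lattice_scale.
  rewrite scaler_sumr; apply: lattice_sum => j.
  have -> : D%:R *: ((c j)%:~R / (a j)%:R *: w j) = ((\prod_(j' | j' != j) a j')%N%:Z * c j)%:~R *: w j.
    rewrite scalerA; congr (_ *: _); rewrite /D (bigD1 j) //= natrM rmorphM /= -pmulrn.
    by field; exact: anz.
  exact: lattice_scale.
exists (fun j => if unlift ord0 j is Some j' then w j' else D%:R *: v); split=> [j|j|j j'].
- by case: unliftP.
- by case: unliftP => // _; rewrite scaler_eq0 negb_or Dnz vnz.
- case: unliftP => [j1 ->|->]; case: unliftP => [j2 ->|->] ne.
  + by apply: ow; apply: contraNneq ne => ->.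
  + by rewrite dotC dotZl vw mulr0.
  + by rewrite dotZl vw mulr0.
  + by rewrite eqxx in ne.
Qed.

Lemma orthogonal_basis : exists w : 'I_n -> 'rV[R]_n, exists a : 'I_n -> nat,
  [/\ forall i, L (w i), forall i, (0 < a i)%N
    & forall i j, dot (w i) (w j) = if i == j then (a i)%:R else 0].
Proof.
have [w [Lw nzw ow]] := orthogonal_family (leqnn n).
have Ha j : {a : nat | dot (w j) (w j) = a%:R} by apply: cid; apply: lattice_norm.
exists w, (fun j => projT1 (Ha j)); split=> // [i|i j].
  by case: (Ha i) => a /= Ea; rewrite -(ltr_nat R) -Ea lt_def dot_neq0 ?dot_ge0.
case: eqP => [->|/eqP /ow //]; by case: (Ha j).
Qed.

End Unimodular.

End LatticeBasis.

(** * Integer coordinates for the lattice of the theorem *)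

Module Coordinates.
Import ZArith List E8Shell.
Import all_boot all_order all_algebra boolp classical_sets functions cardinality reals Defs.
Import ssrZ zify ring lra.
Import SelfDual Poisson LatticeBasis.
Import Order.TTheory GRing.Theory Num.Theory.
Local Open Scope ring_scope.
Local Open Scope classical_set_scope.

Section Integers.
Variable R : realType.

Definition zc (z : Z) : R := (int_of_Z z)%:~R.

Lemma zcD x y : zc (Z.add x y) = zc x + zc y.
Proof. by rewrite /zc -rmorphD; congr (_%:~R); exact: (rmorphD int_of_Z). Qed.

Lemma zcM x y : zc (Z.mul x y) = zc x * zc y.
Proof. by rewrite /zc -rmorphM; congr (_%:~R); exact: (rmorphM int_of_Z). Qed.

Lemma zcN x : zc (Z.opp x) = - zc x.
Proof. by rewrite /zc -rmorphN; congr (_%:~R); exact: (rmorphN int_of_Z). Qed.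

Lemma zcB x y : zc (Z.sub x y) = zc x - zc y.
Proof. by rewrite -zcN -zcD. Qed.

Lemma zc_inj : injective zc.
Proof. by move=> x y /intr_inj /(can_inj int_of_ZK). Qed.

Lemma zc_le x y : zc x <= zc y -> Z.le x y.
Proof. rewrite /zc ler_int; lia. Qed.

Definition vecZ (l : seq Z) : 'rV[R]_8 := \row_(i < 8) zc (nth Z0 l i).

Lemma List_nth (l : seq Z) i : List.nth i l Z0 = nth Z0 l i.
Proof. by elim: l i => [|x l IH] [|i] //=. Qed.

Lemma dotp_sum (c u : seq Z) : size c = 8%N -> size u = 8%N ->
  zc (dotp c u) = \sum_(i < 8) zc (nth Z0 c i) * zc (nth Z0 u i).
Proof.
have H : forall n (c u : seq Z), size c = n -> size u = n ->
  zc (dotp c u) = \sum_(i < n) zc (nth Z0 c i) * zc (nth Z0 u i).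
  elim=> [|n IH] [|x c'] [|y u'] //=; first by rewrite big_ord0.
  by move=> [Hc] [Hu]; rewrite zcD zcM big_ord_recl /= (IH c' u').
exact: H.
Qed.

Lemma dot_vecZ c u : size c = 8%N -> size u = 8%N -> dot (vecZ c) (vecZ u) = zc (dotp c u).
Proof. by move=> Hc Hu; rewrite dotp_sum // dotE; apply: eq_bigr => i _; rewrite !mxE. Qed.

Lemma E8_vecZ r : size r = 8%N -> e8 r = true -> E8 (2^-1 *: vecZ r).
Proof.
move=> Hr /e8_spec [Hodd Hsum]; exists (\row_(i < 8) int_of_Z (nth Z0 r i)); split.
- by congr (_ *: _); apply/rowP => i; rewrite !mxE.
- move=> i j; rewrite !mxE.
  have In_nth (k : 'I_8) : List.In (nth Z0 r k) r.
    by rewrite -List_nth; apply: List.nth_In; apply/ssrnat.ltP; rewrite -[Datatypes.length r]/(size r) Hr.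
  have := Hodd _ _ (In_nth i) (In_nth j).
  move: (nth Z0 r i) (nth Z0 r j) => x y E.
  have [k Hk] : exists k, x = Z.add y (Z.mul 2 k).
    have E2 : Z.odd (Z.sub x y) = false by rewrite Z.odd_sub E; case: (Z.odd y).
    move: E2; rewrite -Z.negb_even => /negbFE /Z.even_spec [k Hk]; exists k; lia.
  by rewrite Hk; lia.
have Hs : forall s : seq Z, \sum_(i < size s) int_of_Z (nth Z0 s i) = int_of_Z (lsum s).
  elim=> [|x s IH]; first by rewrite big_ord0.
  rewrite big_ord_recl /= IH; symmetry; exact: (rmorphD int_of_Z).
have -> : \sum_i (\row_(i0 < 8) int_of_Z (nth Z0 r i0)) 0 i = int_of_Z (lsum r).
  by rewrite -Hs Hr; apply: eq_bigr => i _; rewrite mxE.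
have [k Hk] : Z.divide 4 (lsum r) by apply/Z.mod_divide.
by rewrite Hk; lia.
Qed.

End Integers.

Section Coordinates.
Variables (R : realType) (L : set 'rV[R]_48).
Hypothesis ext : extremal48 L.
Variables (w : 'I_48 -> 'rV[R]_48) (a : 'I_48 -> nat).
Hypotheses (Lw : forall i, L (w i)) (a_gt0 : forall i, (0 < a i)%N).
Hypothesis ww : forall i j, dot (w i) (w j) = if i == j then (a i)%:R else 0.

Let uni : unimodular L := let: And3 u _ _ := ext in u.

Lemma aRnz i : (a i)%:R != 0 :> R.
Proof. by rewrite pnatr_eq0 -lt0n. Qed.

Definition vec (k : {ffun 'I_48 -> int}) : 'rV[R]_48 := \sum_i ((k i)%:~R / (a i)%:R) *: w i.
(** [Num.floor] converts the inner product, which is an integer when x is in L, to type [int]. *)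
Definition co (x : 'rV[R]_48) : {ffun 'I_48 -> int} := [ffun i => Num.floor (dot x (w i))].

Lemma vec_dotw k i : dot (vec k) (w i) = (k i)%:~R.
Proof.
rewrite dot_suml (bigD1 i) //= big1 => [|j /negPf ji]; last by rewrite dotZl ww ji mulr0.
by rewrite dotZl ww eqxx addr0 divfK // aRnz.
Qed.

(** The Gram matrix of the 48 vectors w_i is diagonal with nonzero entries, so they form a basis. *)
Lemma dot_w_eq0 x : (forall i, dot x (w i) = 0) -> x = 0.
Proof.
move=> H; pose W : 'M[R]_48 := \matrix_i w i.
have Wdot i j : (W *m W^T) i j = dot (w i) (w j).
  by rewrite dotE mxE; apply: eq_bigr => k _; rewrite !mxE.
have Wu : W \in unitmx.
  pose D := \matrix_(i, j) (if i == j then ((a i)%:R)^-1 else 0 : R).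
  have : W *m (W^T *m D) = 1%:M.
    rewrite mulmxA; apply/matrixP => i j; rewrite mxE (bigD1 j) //= big1 => [|k /negPf kj].
      rewrite Wdot ww !mxE eqxx addr0; case: eqP => [->|_]; rewrite ?mul0r ?divff ?aRnz //.
    by rewrite [D k j]mxE kj mulr0.
  by case/mulmx1_unit.
have xW : x *m W^T = 0.
  apply/rowP => i; rewrite [RHS]mxE -(H i) dotE mxE; apply: eq_bigr => k _; by rewrite !mxE.
by rewrite -[x](mulmxK (_ : W^T \in unitmx)) ?unitmx_tr // xW mul0mx.
Qed.

Lemma vec_co x : L x -> vec (co x) = x.
Proof.
move=> Lx; apply/eqP; rewrite -subr_eq0; apply/eqP/dot_w_eq0 => i.
rewrite dotBl vec_dotw ffunE; have [c ->] := lattice_dot uni Lx (Lw i).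
by rewrite intrKfloor subrr.
Qed.

Lemma co_vec k : co (vec k) = k.
Proof. by apply/ffunP => i; rewrite ffunE vec_dotw intrKfloor. Qed.

Lemma vec_dot k l : dot (vec k) (vec l) = ratr (pair a k l).
Proof.
rewrite dotC /vec dot_suml /pair rmorph_sum; apply: eq_bigr => i _ /=.
rewrite dotZl dotC vec_dotw rmorphM fmorphV /= rmorph_nat rmorph_int rmorphM /=.
by rewrite mulrC mulrA.
Qed.

Definition Lam : pred {ffun 'I_48 -> int} := fun k => `[< L (vec k) >].

Lemma LamP k : Lam k <-> L (vec k).
Proof. by split=> /asboolP. Qed.

Lemma ratr_integral (q : rat) (c : int) : ratr q = c%:~R :> R -> q = c%:~R.
Proof. by rewrite -(ratr_int R) => /fmorph_inj. Qed.

Lemma Lam_self_dual k : Lam k <-> (forall l, Lam l -> integral (pair a k l)).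
Proof.
split=> [/LamP Lk l /LamP Ll|H].
  have [c Hc] := lattice_dot uni Lk Ll; exists c; apply: ratr_integral.
  by rewrite -vec_dot.
apply/LamP/(dual_mem uni) => y Ly; rewrite -(vec_co Ly).
have [|c Hc] := H (co y); first by apply/LamP; rewrite vec_co.
by exists c; rewrite vec_dot Hc ratr_int.
Qed.

Lemma Lam_even k : Lam k -> exists c : nat, pair a k k = (2 * c)%:R.
Proof.
move=> /LamP Lk; have [_ ev _] := ext; have [c Hc] := ev _ Lk.
exists `|c|%N; apply: (fmorph_inj (ratr : {rmorphism rat -> R})).
rewrite /= -vec_dot Hc ratr_nat; have := dot_ge0 (vec k).
rewrite Hc ler0z pmulr_rge0 // => c0.
by rewrite -{1}(gez0_abs c0) -PoszM -pmulrn.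
Qed.

Lemma vec_eq0 k : vec k = 0 -> k = [ffun=> 0].
Proof. by move=> H; rewrite -(co_vec k) H; apply/ffunP => i; rewrite !ffunE dot0l floor0. Qed.

Lemma Lam_min k : Lam k -> k != [ffun=> 0] -> 6 <= pair a k k.
Proof.
move=> /LamP Lk nk; have [_ _ [_ mn]] := ext.
have nz : vec k != 0 by apply: contra nk => /eqP /vec_eq0 ->.
by have := mn _ Lk nz; rewrite vec_dot -(ratr_nat R) ler_rat.
Qed.

Lemma mem_shell k : (k \in level a Lam 3) <-> shell L 6 (vec k).
Proof.
rewrite (mem_level a_gt0) /shell /= vec_dot; split=> [/andP[/LamP Lk /eqP ->]|[Lk Hk]].
  by split=> //; rewrite ratr_nat.
apply/andP; split; first exact/LamP.
apply/eqP; apply: (fmorph_inj (ratr : {rmorphism rat -> R})); by rewrite /= Hk ratr_nat.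
Qed.

End Coordinates.

End Coordinates.

(** * The shell of L as a good family over E8 *)

Module Embedding.
Import ZArith List E8Shell.
Import all_boot all_order all_algebra boolp classical_sets functions cardinality reals Defs.
Import ssrZ zify ring lra.
Import SelfDual Poisson LatticeBasis Coordinates.
Import Order.TTheory GRing.Theory Num.Theory.
Local Open Scope ring_scope.
Local Open Scope classical_set_scope.

Lemma InP (T : eqType) (x : T) (s : seq T) : List.In x s <-> x \in s.
Proof.
elim: s => [//|y s IH] /=; rewrite inE; split=> [[->|/IH ->]|/orP[/eqP ->|/IH H]].
- by rewrite eqxx.
- by rewrite orbT.
- by left.
- by right.
Qed.

Lemma zsum_count (T : Type) (P : pred T) (s : seq T) :
  zsum (fun k => if P k then Zpos xH else Z0) s = Z.of_nat (count P s).
Proof.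
elim: s => [//|x s IH]; rewrite zsum_cons IH /=; case: (P x); lia.
Qed.

Section Embedding.
Variables (R : realType) (L : set 'rV[R]_48).
Hypothesis ext : extremal48 L.
Variables (w : 'I_48 -> 'rV[R]_48) (a : 'I_48 -> nat).
Hypotheses (Lw : forall i, L (w i)) (a_gt0 : forall i, (0 < a i)%N).
Hypothesis ww : forall i j, dot (w i) (w j) = if i == j then (a i)%:R else 0.
Variable F : 'rV[R]_8 -> 'rV[R]_48.
Hypotheses (FD : forall x y, F (x + y) = F x + F y) (FZ : forall c x, F (c *: x) = c *: F x).
Hypotheses (FL : forall v, E8 v -> L (F v)) (Fdot : forall x y, dot (F x) (F y) = 3 * dot x y).

Let uni : unimodular L := let: And3 u _ _ := ext in u.
Notation vec := (vec w a).
Notation co := (co w).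
Notation Lam := (Lam L w a).
Notation zc := (zc R).
Notation vecZ := (vecZ R).
Notation e_ := (e_ R).

Lemma F_sum (I : Type) (s : seq I) (G : I -> 'rV[R]_8) : F (\sum_(i <- s) G i) = \sum_(i <- s) F (G i).
Proof. by apply: (big_morph F FD); rewrite -(scale0r 0) FZ scale0r. Qed.

Lemma E8_2e (i : nat) : E8 (2 *: e_ i).
Proof.
exists (\row_(j < 8) (4 * (j.+1 == i)%:Z)); split.
- apply/rowP => j; rewrite !mxE rmorphM /=; case: (_ == _); rewrite ?mulr0 //= !mulr1; lra.
- by move=> j k; rewrite !mxE; case: (_ == _); case: (_ == _).
- by apply/rpred_sum => j _; rewrite mxE; case: (_ == _).
Qed.

Lemma LF_2e i : L (F (2 *: e_ i)).
Proof. exact/FL/E8_2e. Qed.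

(** Twice the vector p for which x projects to p / sqrt 3. The vectors 2 e_i are used because they
    belong to E8, unlike the e_i, so the inner products are integers. *)
Definition uu (x : 'rV[R]_48) : seq Z :=
  [seq Z_of_int (Num.floor (dot x (F (2 *: e_ i.+1)))) | i <- iota 0 8].

Lemma nth_uu x (i : 'I_8) : L x -> zc (nth Z0 (uu x) i) = dot x (F (2 *: e_ i.+1)).
Proof.
move=> Lx; rewrite (nth_map 0%N) ?size_iota // nth_iota // add0n.
have [c ->] := lattice_dot uni Lx (LF_2e i.+1).
by rewrite intrKfloor /zc Z_of_intK.
Qed.

Lemma vecZ_sum c : vecZ c = \sum_(i < 8) zc (nth Z0 c i) *: e_ i.+1.
Proof.
apply/rowP => j; rewrite summxE (bigD1 j) //= big1 => [|i ij]; last first.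
  by rewrite !mxE eqSS eq_sym (inj_eq val_inj) (negPf ij) mulr0.
by rewrite !mxE eqxx mulr1 addr0.
Qed.

Lemma uu_dot x c : L x -> size c = 8%N -> zc (dotp c (uu x)) = 2 * dot x (F (vecZ c)).
Proof.
move=> Lx Hc; rewrite dotp_sum // vecZ_sum F_sum dotC dot_suml mulr_sumr.
apply: eq_bigr => i _; rewrite (nth_uu _ Lx) !FZ dotZl dotZr [dot x _]dotC; ring.
Qed.

Lemma uu_half x c : L x -> size c = 8%N -> dot x (F (2^-1 *: vecZ c)) = zc (dotp c (uu x)) / 4.
Proof. by move=> Lx Hc; rewrite (uu_dot Lx Hc) FZ dotZr; field. Qed.

Lemma uu_e8 x : L x -> e8 (uu x) = true.
Proof.
move=> Lx; apply: e8_self_dual => // c Hc ec.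
have [k Hk] := lattice_dot uni Lx (FL (E8_vecZ R Hc ec)).
exists (Z_of_int k); apply: (@zc_inj R); rewrite zcM.
have := uu_half Lx Hc; rewrite Hk => H.
have -> : zc 4 = 4 by [].
by rewrite /zc Z_of_intK H /zc; field.
Qed.

Lemma F_norm r : size r = 8%N ->
  dot (F (2^-1 *: vecZ r)) (F (2^-1 *: vecZ r)) = 3 / 4 * zc (dotp r r).
Proof. by move=> Hr; rewrite Fdot dotZl dotZr dot_vecZ //; field. Qed.

Lemma uu_F r : e8_root r -> uu (F (2^-1 *: vecZ r)) = triple r.
Proof.
move=> [Hr [er _]]; have Ly := FL (E8_vecZ R Hr er).
have Hr' : size r = 8%N by [].
have tE : triple r = [seq Z.mul 3 x | x <- r] by [].
rewrite tE; apply: (@eq_from_nth _ Z0); first by rewrite size_map Hr'.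
move=> i Hi; have {}Hi : (i < 8)%N by [].
apply: (@zc_inj R); rewrite (nth_uu (Ordinal Hi) Ly) (nth_map Z0) ?Hr' // zcM Fdot.
rewrite dotZl dotZr dotE (bigD1 (Ordinal Hi)) //= big1 => [|j ij].
  by rewrite !mxE eqxx mulr1 addr0 -[zc 3]/(3%:R); field.
by rewrite !mxE eqSS -[i]/(val (Ordinal Hi)) (inj_eq val_inj) (negPf ij) mulr0.
Qed.

Notation X := (level a Lam 3).
Notation u := (fun k => uu (vec k)).

Lemma X_shell k : k \in X -> L (vec k) /\ dot (vec k) (vec k) = 6.
Proof. by move/(mem_shell L a_gt0 ww). Qed.

Lemma shell_X x : L x -> dot x x = 6 -> co x \in X.
Proof. by move=> Lx Hx; apply/(mem_shell L a_gt0 ww); rewrite (vec_co ext Lw a_gt0 ww). Qed.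

(** This is where the minimum 6 enters: if y is the image of a root and x differs from y, then |x -
    y|^2 >= 6 gives x.y <= 3, that is [dotp] at most 12. So x lies over the scaled Voronoi cell
    unless it equals such a y. *)
Lemma short_or_root x : L x -> dot x x = 6 ->
  valid (uu x) \/ exists r, e8_root r /\ uu x = triple r.
Proof.
move=> Lx Hx; have [?|H] := pselect (exists r, e8_root r /\ uu x = triple r); [by right|left].
apply: short_valid; [exact: uu_e8|by []|] => r Hr.
have [Hs [er nr]] := Hr; have Hs' : size r = 8%N by [].
set y := F (2^-1 *: vecZ r); have Ly : L y := FL (E8_vecZ R Hs er).
have Hy : dot y y = 6 by rewrite F_norm // nr -[zc 8]/(8%:R); field.
have [xy|xy] := eqVneq x y; first by case: H; exists r; split=> //; rewrite xy uu_F.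
have [_ _ [_ mn]] := ext.
have := mn (x - y) (lattice_sub uni Lx Ly); rewrite subr_eq0 xy => /(_ isT).
rewrite dotBl !dotBr Hx Hy [dot y x]dotC (uu_half Lx Hs') => h.
apply: (@zc_le R); rewrite -[zc 12]/(12%:R); lra.
Qed.

Lemma cnt_count p : cnt X u p = Z.of_nat (count (fun k => leqb (u k) p) X).
Proof. exact: zsum_count. Qed.

(** If x lies over three times a root with image y, then x.y = 6 is the product of the lengths, so x
    = y. *)
Lemma cnt_root r : e8_root r -> cnt X u (triple r) = Zpos xH.
Proof.
move=> Hr; have [Hs [er nr]] := Hr; have Hs' : size r = 8%N by [].
set y := F (2^-1 *: vecZ r); have Ly : L y := FL (E8_vecZ R Hs er).
have Hy : dot y y = 6 by rewrite F_norm // nr -[zc 8]/(8%:R); field.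
rewrite cnt_count; have -> : count (fun k => leqb (u k) (triple r)) X = count (pred1 (co y)) X.
  apply: eq_in_count => k Hk; have [Lk nk] := X_shell Hk.
  apply/idP/eqP => [/leqb_eq E|->]; last by rewrite (vec_co ext Lw a_gt0 ww) // uu_F // leqb_refl.
  suff -> : y = vec k by rewrite (co_vec a_gt0 ww).
  apply/eqP; rewrite -subr_eq0; apply/eqP/dot_eq0.
  have E2 : dotp r (triple r) = Z.mul 3 8.
    by rewrite dotp_triple_r nr.
  rewrite dotBl !dotBr Hy nk [dot y _]dotC (uu_half Lk Hs') E E2 -[zc (Z.mul 3 8)]/(24%:R); lra.
by rewrite count_uniq_mem ?uniq_level // shell_X.
Qed.

Lemma vec_neg k : vec (neg k) = - vec k.
Proof. by rewrite /Coordinates.vec -sumrN; apply: eq_bigr => i _; rewrite ffunE rmorphN /= mulNr scaleNr. Qed.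

Lemma uu_opp x : L x -> uu (- x) = map Z.opp (uu x).
Proof.
move=> Lx; apply: (@eq_from_nth _ Z0) => // i Hi; have {}Hi : (i < 8)%N by [].
apply: (@zc_inj R); rewrite (nth_map Z0) // zcN.
rewrite (nth_uu (Ordinal Hi) (lattice_opp uni Lx)) (nth_uu (Ordinal Hi) Lx) dotNl //.
Qed.

Lemma cnt_opp p : cnt X u (map Z.opp p) = cnt X u p.
Proof.
rewrite !cnt_count; congr Z.of_nat.
rewrite -(permP (level_neg a_gt0 (Lam_self_dual ext Lw a_gt0 ww) 3)) count_map.
apply: eq_in_count => k /X_shell [Lk _].
rewrite -[LHS]/(leqb (uu (vec (neg k))) (map Z.opp p)) vec_neg (uu_opp Lk).
apply/idP/idP => /leqb_eq E; apply/leqb_eq; last by rewrite E.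
have opK : forall l : seq Z, map Z.opp (map Z.opp l) = l.
  by elim=> [//|x l IH] /=; rewrite IH Z.opp_involutive.
by rewrite -(opK (uu _)) E opK.
Qed.

(** When p - q = 3d, subtracting the image of d maps the vectors over p injectively to vectors over
    q, and equality of the norms of p and q is what preserves the norm 6. Exchanging p and q gives
    equality. *)
Lemma cnt_congr_le p q : size p = 8%N -> e8 p = true -> e8 q = true -> size q = 8%N ->
  dotp p p = dotp q q -> congr3 p q ->
  (count (fun k => leqb (u k) p) X <= count (fun k => leqb (u k) q) X)%N.
Proof.
move=> Hp ep eq_ Hq Epq Cpq; have [d [Hd [ed [dE dN]]]] := congr3_quot _ _ Hp ep eq_ Cpq.
have Hd' : size d = 8%N by [].
set y := F (2^-1 *: vecZ d); have Ly : L y := FL (E8_vecZ R Hd ed).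
pose g k := co (vec k - y).
have vg k : L (vec k) -> vec (g k) = vec k - y.
  by move=> Lk; rewrite (vec_co ext Lw a_gt0 ww) //; apply: (lattice_sub uni).
rewrite -!size_filter -(size_map g); apply: uniq_leq_size.
  rewrite map_inj_in_uniq => [|k l]; first by apply: filter_uniq; exact: uniq_level.
  rewrite mem_filter => /andP[_ /X_shell [Lk _]]; rewrite mem_filter => /andP[_ /X_shell [Ll _]] E.
  have : vec k - y = vec l - y by rewrite -!vg ?E.
  by move/addIr => E2; rewrite -(co_vec a_gt0 ww k) E2 (co_vec a_gt0 ww).
move=> _ /mapP[k + ->]; rewrite mem_filter => /andP[/leqb_eq uk Xk].
have [Lk nk] := X_shell Xk; have Lxy := lattice_sub uni Lk Ly.
rewrite mem_filter; apply/andP; split; last first.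
  apply: shell_X => //.
  rewrite dotBl !dotBr nk [dot y _]dotC (uu_half Lk Hd') uk F_norm //.
  have dd : Z.mul 2 (dotp d p) = Z.mul 3 (dotp d d) by lia.
  have := congr1 zc dd; rewrite !zcM -[zc 2]/(2%:R) -[zc 3]/(3%:R) => h; lra.
apply/leqb_eq; rewrite vg //; apply: (@eq_from_nth _ Z0); first by rewrite Hq.
move=> i Hi; have {}Hi : (i < 8)%N by [].
apply: (@zc_inj R); rewrite (nth_uu (Ordinal Hi) Lxy) dotBl -(nth_uu (Ordinal Hi) Lk) uk.
have := dE i; rewrite !List_nth => ->; rewrite zcB zcM; congr (_ - _).
rewrite Fdot dotZl dotZr dotE (bigD1 (Ordinal Hi)) //= big1 => [|j ij].
  by rewrite !mxE eqxx mulr1 addr0 -[zc 3]/(3%:R); field.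
by rewrite !mxE eqSS -[i]/(val (Ordinal Hi)) (inj_eq val_inj) (negPf ij) mulr0.
Qed.

Lemma good_shell : good X u.
Proof.
constructor.
- move=> c j Hc /ssrnat.leP Hj; have Hc' : size c = 8%N by [].
  set y := F (2 *: vecZ c).
  have Ly : L y.
    rewrite /y FZ vecZ_sum F_sum scaler_sumr; apply: (lattice_sum uni) => i.
    by rewrite FZ scalerA mulrC -scalerA -FZ; apply: (lattice_scale uni); apply: LF_2e.
  apply: (shell_moments_int a_gt0 (Lam_self_dual ext Lw a_gt0 ww) (Lam_even ext a_gt0 ww)
    (Lam_min ext a_gt0 ww) (v := co y)) => // [k /X_shell [Lk _]|].
    apply: (@ratr_integral R); rewrite -(vec_dot a_gt0 ww) (vec_co ext Lw a_gt0 ww) //.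
    by rewrite -/(zc _) (uu_dot Lk Hc') /y FZ dotZr.
  apply: (@ratr_integral R); rewrite -(vec_dot a_gt0 ww) (vec_co ext Lw a_gt0 ww) //.
  rewrite -/(zc _) zcM -dot_vecZ // /y Fdot dotZl dotZr -[zc 12]/(12%:R); ring.
- by move=> k /InP /X_shell [Lk nk]; apply: short_or_root.
- exact: cnt_root.
- by move=> p _; apply: cnt_opp.
- move=> p q Hp Hq ep eq_ Epq Cpq; rewrite !cnt_count; congr Z.of_nat; apply/eqP.
  rewrite eqn_leq !cnt_congr_le //; exact: congr3_sym.
Qed.

End Embedding.

End Embedding.

(** * Perpendicular vectors in the shell: from lists to cardinalities *)

Module Counting.
Import ZArith List E8Shell.
Import all_boot all_order all_algebra boolp classical_sets functions cardinality reals Defs.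
Import ssrZ zify ring lra.
Import SelfDual Poisson LatticeBasis Coordinates Embedding.
Import Order.TTheory GRing.Theory Num.Theory.
Delimit Scope Z_scope with coqZ.
Local Open Scope ring_scope.
Local Open Scope classical_set_scope.

(** The large numerals are generalised to variables of known value in [Z], since as unary naturals
    they must never be evaluated. *)
Lemma perp_count_bin m c2 c3 c4 c5 c6 : 'C(m, 2) = c2 -> 'C(m, 3) = c3 -> 'C(m, 4) = c4 ->
  'C(m, 5) = c5 -> 'C(m, 6) = c6 -> Z.of_nat (perp_count m) =
  (1092000 + 18360 * Z.of_nat m + 464944 * Z.of_nat c2 + 11880 * Z.of_nat c3 + 146880 * Z.of_nat c4
   + 2520 * Z.of_nat c5 + 31680 * Z.of_nat c6)%coqZ.
Proof.
unfold perp_count; intros H2 H3 H4 H5 H6.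
rewrite H2 H3 H4 H5 H6; clear H2 H3 H4 H5 H6.
repeat match goal with |- context [Nat.of_num_uint (Number.UIntDecimal ?d)] =>
  let H := fresh in let n := fresh in
  pose proof (numeral_value d) as H; revert H; generalize (Nat.of_num_uint (Number.UIntDecimal d)); intros n H;
  cbn [decimal_value] in H end.
lia.
Qed.

Lemma perp_count_value m : (m <= 7)%N -> Z.of_nat (perp_count m) = List.nth m perp_values Z0.
Proof.
move=> Hm; have H : (m = 0 \/ m = 1 \/ m = 2 \/ m = 3 \/ m = 4 \/ m = 5 \/ m = 6 \/ m = 7)%N by lia.
clear Hm; repeat (destruct H as [->|H]); [..|rewrite {}H].
- by rewrite (@perp_count_bin 0 0 0 0 0 0 erefl erefl erefl erefl erefl).
- by rewrite (@perp_count_bin 1 0 0 0 0 0 erefl erefl erefl erefl erefl).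
- by rewrite (@perp_count_bin 2 1 0 0 0 0 erefl erefl erefl erefl erefl).
- by rewrite (@perp_count_bin 3 3 1 0 0 0 erefl erefl erefl erefl erefl).
- by rewrite (@perp_count_bin 4 6 4 1 0 0 erefl erefl erefl erefl erefl).
- by rewrite (@perp_count_bin 5 10 10 5 1 0 erefl erefl erefl erefl erefl).
- by rewrite (@perp_count_bin 6 15 20 15 6 1 erefl erefl erefl erefl erefl).
- by rewrite (@perp_count_bin 7 21 35 35 21 7 erefl erefl erefl erefl erefl).
Qed.

Lemma perp_count_total k : (1 <= k <= 8)%N -> perp_total k = Z.of_nat (perp_count (8 - k)).
Proof.
move=> /andP[/ssrnat.leP k1 /ssrnat.leP k8].
by rewrite perp_count_value ?perp_total_value //; lia.
Qed.

Lemma perp_vec_nth k l : size l = 8%N -> (k <= 8)%N ->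
  (perp_vec k l = true) <-> (forall i, (i < k)%N -> nth Z0 l i = Z0).
Proof.
rewrite /perp_vec => <-; elim: l k => [|x l IH] [|k] //= Hk; split=> //.
  move=> /Bool.andb_true_iff [/Z.eqb_eq -> /(IH _ Hk) H] [|i] //= Hi; exact: H.
move=> H; apply/Bool.andb_true_iff; split; first by apply/Z.eqb_eq; apply: (H 0%N).
by apply/(IH _ Hk) => i Hi; apply: (H i.+1).
Qed.

Lemma card_seq_image (T U : eqType) (s : seq T) (g : T -> U) : uniq s -> injective g ->
  ([set g x | x in [set` s]] #= `I_(size s))%card.
Proof.
case: s => [|x0 s'] us ig; first by rewrite (_ : [set g x | x in _] = set0) ?II0 // -subset0 => y [].
set s := x0 :: s' in us *.
have -> : [set g x | x in [set` s]] = [set g (nth x0 s i) | i in `I_(size s)].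
  apply/seteqP; split=> [_ [x /= xs <-]|_ [i /= Hi <-]]; last by exists (nth x0 s i) => //=; apply: mem_nth.
  exists (index x s); first by rewrite /mkset index_mem.
  by congr g; apply: nth_index.
apply: inj_card_eq => i j; rewrite !inE /= => Hi Hj /ig /eqP.
by rewrite nth_uniq // => /eqP.
Qed.

Section Cardinality.
Variables (R : realType) (L : set 'rV[R]_48).
Hypothesis ext : extremal48 L.
Variable F : 'rV[R]_8 -> 'rV[R]_48.
Hypotheses (FD : forall x y, F (x + y) = F x + F y) (FZ : forall c x, F (c *: x) = c *: F x).
Hypotheses (FL : forall v, E8 v -> L (F v)) (Fdot : forall x y, dot (F x) (F y) = 3 * dot x y).

Lemma perp_card k : (1 <= k <= 8)%N ->
  (shell L 6 `&` [set x | forall i, (1 <= i <= k)%N -> dot x (F (e_ R i)) = 0%R]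
    #= `I_(perp_count (8 - k)%N))%card.
Proof.
move=> Hk; move: (perp_count _) (perp_count_total Hk) => N HN; have [uni _ _] := ext.
have [w [a [Lw a_gt0 ww]]] := orthogonal_basis uni.
pose X := level a (Lam L w a) 3; pose u k := uu F (vec w a k).
have G : good X u := good_shell ext Lw a_gt0 ww FD FZ FL Fdot.
have [k1 k8] := andP Hk.
have := perp_sum X u k G (conj (ssrnat.leP k1) (ssrnat.leP k8)).
rewrite HN [LHS]zsum_count => /Nat2Z.inj cX.
pose S := [seq l <- X | perp_vec k (u l)].
have -> : shell L 6 `&` [set x | forall i, (1 <= i <= k)%N -> dot x (F (e_ R i)) = 0%R] =
  [set vec w a l | l in [set` S]].
  have Hperp x : L x -> perp_vec k (uu F x) = true <->
      forall i, (1 <= i <= k)%N -> dot x (F (e_ R i)) = 0%R.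
    move=> Lx; rewrite perp_vec_nth //; split=> H i Hi.
      case: i Hi => // i /andP[_ Hi]; have i8 : (i < 8)%N by apply: leq_trans Hi k8.
      have := nth_uu ext FL (Ordinal i8) Lx; rewrite [nth _ _ _](H i Hi) FZ dotZr /= => E.
      by apply: (@mulfI _ (2 : R)); rewrite ?pnatr_eq0 // mulr0 -E.
    have i8 : (i < 8)%N by apply: leq_trans Hi k8.
    apply: (@zc_inj R); rewrite (nth_uu ext FL (Ordinal i8) Lx) FZ dotZr /= H ?mulr0 //.
  apply/seteqP; split=> [x [[Lx nx] Px]|_ [l + <-]].
    exists (co w x); last exact: (vec_co ext Lw a_gt0 ww).
    rewrite /= mem_filter (shell_X ext Lw a_gt0 ww Lx nx) andbT /u (vec_co ext Lw a_gt0 ww Lx).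
    exact/Hperp.
  rewrite /= mem_filter => /andP[Pl Xl]; have [Ll nl] := X_shell a_gt0 ww Xl.
  by split=> //; apply/Hperp.
rewrite -cX -size_filter; apply: card_seq_image; first by rewrite filter_uniq // uniq_level.
exact: can_inj (co_vec a_gt0 ww).
Qed.

End Cardinality.

(** * Weyl group elements as linear isometries preserving E8 *)

Section Weyl.
Variable R : realType.
Implicit Types (x y v a : 'rV[R]_8).
Notation E8 := (@E8 R).

Lemma E8_add x y : E8 x -> E8 y -> E8 (x + y).
Proof.
move=> [u [-> Hu Su]] [v [-> Hv Sv]]; exists (u + v); split.
- by rewrite -scalerDr; congr (_ *: _); apply/rowP => i; rewrite !mxE rmorphD.
- by move=> i j; rewrite !mxE -modzDm (Hu i j) (Hv i j) modzDm.
- by under eq_bigr do rewrite mxE; rewrite big_split; apply: rpredD.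
Qed.

Lemma E8_scale (m : int) x : E8 x -> E8 (m%:~R *: x).
Proof.
move=> [u [-> Hu Su]]; exists (m *: u); split.
- by rewrite scalerA mulrC -scalerA; congr (_ *: _); apply/rowP => i; rewrite !mxE rmorphM.
- by move=> i j; rewrite !mxE -modzMmr (Hu i j) modzMmr.
- by under eq_bigr do rewrite mxE; rewrite -mulr_sumr dvdz_mull.
Qed.

Lemma E8_norm x : E8 x -> exists k : int, dot x x = (2 * k)%:~R.
Proof.
move=> [u [-> Hu Su]].
pose l : seq Z := [seq Z_of_int (u 0 (inord i)) | i <- iota 0 8].
have sl : size l = 8%N by [].
have nl (i : 'I_8) : nth Z0 l i = Z_of_int (u 0 i).
  by rewrite (nth_map 0%N) ?size_iota // nth_iota // add0n inord_val.
have lE : map_mx intr u = vecZ R l by apply/rowP => i; rewrite !mxE nl /zc Z_of_intK.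
have el : e8 l = true.
  apply/e8_spec; split.
    have Hl z : List.In z l -> exists i, z = Z_of_int (u 0 i).
      by move=> /InP /(nthP Z0) [i Hi <-]; exists (Ordinal Hi); rewrite -nl.
    move=> z z' /Hl [i ->] /Hl [j ->].
    have [k Hk] : exists k : int, u 0 i = u 0 j + 2 * k.
      exists ((u 0%R i %/ 2)%Z - (u 0%R j %/ 2)%Z).
      rewrite {1}(divz_eq (u 0 i) 2) {1}(divz_eq (u 0 j) 2) (Hu i j); ring.
    rewrite Hk; have -> : Z_of_int (u 0 j + 2 * k) = Z.add (Z_of_int (u 0 j)) (Z.mul 2 (Z_of_int k)) by lia.
    by rewrite Z.odd_add Z.odd_mul; case: (Z.odd _).
  have E : lsum l = Z_of_int (\sum_i u 0 i).
    have H : forall s : seq Z, lsum s = \sum_(z <- s) z by elim=> [|z s IH]; rewrite ?big_nil // big_cons -IH.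
    rewrite H /l big_map -[iota 0 8]/(index_iota 0 8) big_mkord rmorph_sum.
    by apply: eq_bigr => i _; rewrite inord_val.
  rewrite E; have [k ->] : exists k : int, \sum_i u 0 i = 4 * k.
    by move: Su => /dvdzP[k ->]; exists k; rewrite mulrC.
  have -> : Z_of_int (4 * k) = Z.mul (Z_of_int k) 4 by lia.
  exact: Z_mod_mult.
have [k Hk] := e8_norm8 _ el sl.
exists (int_of_Z k).
rewrite lE dotZl dotZr dot_vecZ // Hk zcM rmorphM /= -/(zc R k) -[zc R 8]/(8%:R).
by field.
Qed.

(** Polarisation of the even norm. *)
Lemma E8_dot x y : E8 x -> E8 y -> exists k : int, dot x y = k%:~R.
Proof.
move=> Ex Ey; have [k Hk] := E8_norm Ex; have [l Hl] := E8_norm Ey; have [m Hm] := E8_norm (E8_add Ex Ey).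
exists (m - k - l); apply: (@mulfI _ (2 : R)); first by rewrite pnatr_eq0.
move: Hm; rewrite dotDl !dotDr Hk Hl [dot y x]dotC => Hm.
rewrite !rmorphB /= ; move: Hm; rewrite !rmorphM /= => Hm; lra.
Qed.

Lemma reflectionE a v : E8_root a -> reflection a v = v - dot v a *: a.
Proof. by move=> [_ Ha]; rewrite /reflection Ha mulrAC divff ?mul1r // pnatr_eq0. Qed.

Definition isometry8 (w : 'rV[R]_8 -> 'rV[R]_8) : Prop :=
  [/\ forall x y, w (x + y) = w x + w y, forall c x, w (c *: x) = c *: w x,
      forall x y, dot (w x) (w y) = dot x y & forall x, E8 x -> E8 (w x)].

Lemma weyl_isometry w : weyl_E8 w -> isometry8 w.
Proof.
elim=> [|a w' Ha _ [wD wZ wdot wE]]; first by split.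
have [Ea na] := Ha; split=> [x y|c x|x y|x Ex]; rewrite /comp ?reflectionE //.
- by rewrite wD dotDl scalerDl opprD addrACA.
- by rewrite wZ dotZl scalerBr scalerA.
- rewrite dotBl !dotBr !(dotZl, dotZr) na wdot [dot a _]dotC; ring.
- have [k ->] := E8_dot (wE _ Ex) Ea; rewrite -scaleNr -rmorphN.
  by apply: E8_add; [apply: wE|apply: E8_scale].
Qed.

End Weyl.

(** * The nested spaces and their Weyl conjugates *)

Section Spaces.
Variables (R : realType) (L : set 'rV[R]_48) (f : {linear 'rV[R]_8 -> 'rV[R]_48}).
Hypothesis femb : isometric_embedding f L.
Variable w : 'rV[R]_8 -> 'rV[R]_8.
Hypothesis wiso : isometry8 w.

(** The Weyl element is absorbed into the embedding, so the count for the standard coordinate flag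
    applies to every conjugate. *)
Let F v := f (Num.sqrt 3 *: w v).

Lemma F_add x y : F (x + y) = F x + F y.
Proof. by case: wiso => wD _ _ _; rewrite /F wD scalerDr linearD. Qed.

Lemma F_scale c x : F (c *: x) = c *: F x.
Proof. by case: wiso => _ wZ _ _; rewrite /F wZ scalerA mulrC -scalerA linearZ. Qed.

Lemma F_lattice v : E8 v -> L (F v).
Proof. by case: wiso => _ _ _ wE /wE Ev; apply: femb.1; exists (w v). Qed.

Lemma sqrt3_dot x y : E8 x -> E8 y -> dot (F x) (F y) = 3 * dot x y.
Proof.
case: wiso => _ _ wdot wE Ex Ey; rewrite /F femb.2; [|by exists (w x); [apply: wE|]|by exists (w y); [apply: wE|]].
by rewrite dotZl dotZr wdot mulrA -expr2 sqr_sqrtr.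
Qed.

(** Isometry is given on the lattice only; the vectors 2 e_i lie in E8, and bilinearity extends the
    relation to the whole space. *)
Lemma F_dot x y : dot (F x) (F y) = 3 * dot x y.
Proof.
have dec (v : 'rV[R]_8) : v = \sum_(i < 8) v 0 i *: e_ R i.+1.
  apply/rowP => j; rewrite summxE (bigD1 j) //= big1 => [|i ij]; last first.
    by rewrite !mxE eqSS eq_sym (inj_eq val_inj) (negPf ij) mulr0.
  by rewrite !mxE eqxx mulr1 addr0.
have F0 : F 0 = 0 by rewrite -(scale0r 0) F_scale scale0r.
have Fs (G : 'I_8 -> 'rV[R]_8) : F (\sum_i G i) = \sum_i F (G i) by apply: (big_morph F F_add F0).
rewrite (dec x) (dec y) !Fs !dot_suml mulr_sumr; apply: eq_bigr => i _.
rewrite ![dot _ (\sum_j _)]dotC !dot_suml mulr_sumr; apply: eq_bigr => j _.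
rewrite !F_scale !dotZl !dotZr.
have := sqrt3_dot (E8_2e R j.+1) (E8_2e R i.+1); rewrite !F_scale !dotZl !dotZr => H.
have -> : dot (F (e_ R j.+1)) (F (e_ R i.+1)) = 3 * dot (e_ R j.+1) (e_ R i.+1) by lra.
ring.
Qed.

Lemma perp_Uspace k : perp (Uspace f w k) =
  [set x | forall i, (1 <= i <= k)%N -> dot x (F (e_ R i)) = 0].
Proof.
apply/seteqP; split=> x /= H.
  move=> i Hi; apply: H; exists (w (e_ R i)) => //=.
  by apply: memv_span; apply: map_f; rewrite mem_iota add1n.
move=> _ [v /= Hv <-].
rewrite (coord_span (X := in_tuple _) Hv) scaler_sumr linear_sum /= dotC dot_suml big1 // => i _.
have Hi : (i < k)%N by have := ltn_ord i; rewrite [X in (_ < X)%N]size_map size_iota.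
rewrite scalerA mulrC -scalerA linearZ dotZl dotC.
rewrite (nth_map 0%N) ?size_iota // nth_iota // -/(F _) H ?mulr0 //.
Qed.

Lemma Uspace_card k : extremal48 L -> (1 <= k <= 8)%N ->
  (shell L 6 `&` perp (Uspace f w k) #= `I_(perp_count (8 - k)%N))%card.
Proof.
by move=> ext Hk; rewrite perp_Uspace; exact: (perp_card ext F_add F_scale F_lattice F_dot Hk).
Qed.

End Spaces.

(** * The conjugate whose rank-five member is spanned by D5 *)

Section D5.
Variables (R : realType).
Notation e_ := (e_ R).

(** beta1 and beta2 are the sum and the difference of the orthogonal unit vectors [half4'] and
    [half4]. The product of their reflections is -1 on the plane of these two vectors and the
    identity on its complement, hence also the product of the reflections in [half4] and [half4'],
    which are not roots. *)
Definition beta1 : 'rV[R]_8 := 2^-1 *: (e_ 1 + e_ 2 + e_ 3 + e_ 4 + e_ 5 - e_ 6 - e_ 7 + e_ 8).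
Definition beta2 : 'rV[R]_8 := 2^-1 *: (- e_ 1 - e_ 2 - e_ 3 - e_ 4 + e_ 5 - e_ 6 - e_ 7 + e_ 8).

Lemma beta_root (b : 'rV[R]_8) (s : 'rV[int]_8) : b = 2^-1 *: map_mx intr s ->
  (forall i, (s 0%R i == 1) || (s 0%R i == -1)) -> (4 %| \sum_i s 0%R i)%Z -> E8_root b.
Proof.
move=> -> Hs Ss; split.
  exists s; split=> // i j.
  by case/orP: (Hs i) => /eqP ->; case/orP: (Hs j) => /eqP ->.
rewrite dotZl dotZr dotE (eq_bigr (fun=> 1)) => [|i _]; last first.
  by rewrite mxE; case/orP: (Hs i) => /eqP ->; rewrite /= ?mulrNN mulr1.
by rewrite sumr_const card_ord; field.
Qed.

Lemma beta1_root : E8_root beta1.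
Proof.
apply: (@beta_root _ (\row_(j < 8) if (j == 5 :> nat) || (j == 6 :> nat) then -1 else 1)).
- congr (_ *: _); apply/rowP; case=> [[|[|[|[|[|[|[|[|//]]]]]]]] Hj]; rewrite !mxE /=; ring.
- by move=> i; rewrite mxE; case: ifP.
- by rewrite !big_ord_recl big_ord0 !mxE.
Qed.

Lemma beta2_root : E8_root beta2.
Proof.
apply: (@beta_root _ (\row_(j < 8) if (j == 4 :> nat) || (j == 7 :> nat) then 1 else -1)).
- congr (_ *: _); apply/rowP; case=> [[|[|[|[|[|[|[|[|//]]]]]]]] Hj]; rewrite !mxE /=; ring.
- by move=> i; rewrite mxE; case: ifP.
- by rewrite !big_ord_recl big_ord0 !mxE.
Qed.

Definition w5 := reflection beta1 \o (reflection beta2 \o id).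

Lemma w5_weyl : weyl_E8 w5.
Proof. by apply: weyl_reflection beta1_root _; apply: weyl_reflection beta2_root _; apply: weyl_id. Qed.

Definition half4 : 'rV[R]_8 := 2^-1 *: (e_ 1 + e_ 2 + e_ 3 + e_ 4).
Definition half4' : 'rV[R]_8 := 2^-1 *: (e_ 5 - e_ 6 - e_ 7 + e_ 8).

Lemma w5E v : w5 v = v - (2 * dot v half4) *: half4 - (2 * dot v half4') *: half4'.
Proof.
rewrite /w5 /comp (reflectionE _ beta1_root) (reflectionE _ beta2_root).
have -> : beta1 = half4' + half4 by rewrite /half4 /half4' /beta1; apply/rowP => j; rewrite !mxE; ring.
have -> : beta2 = half4' - half4 by rewrite /half4 /half4' /beta2; apply/rowP => j; rewrite !mxE; ring.
have o : dot half4 half4' = 0 by rewrite dotE !big_ord_recl big_ord0 !mxE /=; ring.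
have n1 : dot half4 half4 = 1 by rewrite dotE !big_ord_recl big_ord0 !mxE /=; field.
have n2 : dot half4' half4' = 1 by rewrite dotE !big_ord_recl big_ord0 !mxE /=; field.
move: half4 half4' o n1 n2 => h h' o n1 n2.
rewrite !(dotBl, dotDl, dotNl, dotZl, dotBr, dotDr) [dot h' h]dotC o n1 n2.
by apply/rowP => j; rewrite !mxE; ring.
Qed.

Lemma w5_e (i : nat) : (1 <= i <= 4)%N -> w5 (e_ i) = e_ i - half4.
Proof.
move=> Hi; have h1 : dot (e_ i) half4 = 2^-1.
  by case: i Hi => [|[|[|[|[|]]]]] // _; rewrite dotE !big_ord_recl big_ord0 !mxE /=; ring.
have h2 : dot (e_ i) half4' = 0.
  by case: i Hi {h1} => [|[|[|[|[|]]]]] // _; rewrite dotE !big_ord_recl big_ord0 !mxE /=; ring.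
by rewrite w5E h1 h2 mulr0 scale0r subr0 divff ?pnatr_eq0 // scale1r.
Qed.

Lemma w5_e5 : w5 (e_ 5) = e_ 5 - half4'.
Proof.
have h1 : dot (e_ 5) half4 = 0 by rewrite dotE !big_ord_recl big_ord0 !mxE /=; ring.
have h2 : dot (e_ 5) half4' = 2^-1 by rewrite dotE !big_ord_recl big_ord0 !mxE /=; ring.
by rewrite w5E h1 h2 mulr0 scale0r subr0 divff ?pnatr_eq0 // scale1r.
Qed.

(** [w5] is chosen so that in the frame W i = w5 (e_ i) the five simple roots take the standard
    shape of D5: four differences of frame vectors and one element -W 3 - W 4. *)
Lemma span_D5 : (<<[seq w5 (e_ i) | i <- iota 1 5]>> = <<[seq alpha R i | i <- iota 1 5]>>)%VS.
Proof.
pose W i := w5 (e_ i).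
have A1 : alpha R 1 = W 1%N - W 5%N.
  by rewrite /W w5_e // w5_e5 /half4 /half4' /alpha; apply/rowP => j; rewrite !mxE; field.
have A2 : alpha R 2 = - W 3%N - W 4%N.
  by rewrite /W !w5_e // /half4 /alpha; apply/rowP => j; rewrite !mxE; field.
have A3 : alpha R 3 = W 2%N - W 1%N.
  by rewrite /W !w5_e // /half4 /alpha; apply/rowP => j; rewrite !mxE; ring.
have A4 : alpha R 4 = W 3%N - W 2%N.
  by rewrite /W !w5_e // /half4 /alpha; apply/rowP => j; rewrite !mxE; ring.
have A5 : alpha R 5 = W 4%N - W 3%N.
  by rewrite /W !w5_e // /half4 /alpha; apply/rowP => j; rewrite !mxE; ring.
apply/eqP; rewrite eqEsubv; apply/andP; split; apply/span_subvP => v /mapP[i Hi ->].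
  set U := (<<_>>)%VS.
  have AU j : j \in iota 1 5 -> alpha R j \in U by move=> Hj; apply/memv_span/map_f.
  have W4 : W 4%N \in U.
    (* The two nodes 2 and 5 at the fork supply -W 3 - W 4 and W 4 - W 3, hence twice W 4; the other
       frame vectors follow along the differences. *)
    have -> : W 4%N = 2^-1 *: (alpha R 5 - alpha R 2).
      by rewrite A5 A2; move: (W 4%N) (W 3%N) => x y; apply/rowP => j; rewrite !mxE; field.
    by rewrite memvZ // memvB // AU.
  have E3 : W 3%N = W 4%N - alpha R 5 by rewrite A5 subKr.
  have W3 : W 3%N \in U by rewrite E3 memvB ?AU.
  have E2 : W 2%N = W 3%N - alpha R 4 by rewrite A4 subKr.
  have W2 : W 2%N \in U by rewrite E2 memvB ?AU.
  have E1 : W 1%N = W 2%N - alpha R 3 by rewrite A3 subKr.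
  have W1 : W 1%N \in U by rewrite E1 memvB ?AU.
  have E5 : W 5%N = W 1%N - alpha R 1 by rewrite A1 subKr.
  have W5 : W 5%N \in U by rewrite E5 memvB ?AU.
  move: Hi; rewrite !inE => /or4P[/eqP ->|/eqP ->|/eqP ->|/orP[/eqP ->|/eqP ->]];
    [exact: W1|exact: W2|exact: W3|exact: W4|exact: W5].
set U := (<<_>>)%VS.
have WU j : j \in iota 1 5 -> W j \in U by move=> Hj; apply/memv_span; apply: (map_f (fun i => w5 (e_ i))).
move: Hi; rewrite !inE => /or4P[/eqP ->|/eqP ->|/eqP ->|/orP[/eqP ->|/eqP ->]].
- by rewrite A1 memvB ?WU.
- by rewrite A2 memvB ?memvN ?WU.
- by rewrite A3 memvB ?WU.
- by rewrite A4 memvB ?WU.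
- by rewrite A5 memvB ?WU.
Qed.

Lemma Uspace_D5 (f : {linear 'rV[R]_8 -> 'rV[R]_48}) : Uspace f w5 5 = D5_space f.
Proof.
pose g := linfun (f \o ( *:%R (Num.sqrt 3))).
have gE v : g v = f (Num.sqrt 3 *: v) by rewrite lfunE.
have -> : D5_space f = [set` (g @: <<[seq alpha R i | i <- iota 1 5]>>)%VS].
  have E : [seq f (Num.sqrt 3 *: alpha R i) | i <- iota 1 5] = [seq g x | x <- [seq alpha R i | i <- iota 1 5]].
    by rewrite -map_comp; apply: eq_map => i; rewrite /comp gE.
  by rewrite limg_span -E.
rewrite /Uspace span_D5; apply/seteqP; split=> [_ [v /= Hv <-]|x /= /memv_imgP[v Hv ->]].
  by rewrite -gE memv_img.
by exists v; rewrite //= gE.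
Qed.

End D5.

End Counting.

Local Open Scope ring_scope.
Local Open Scope classical_set_scope.

Theorem theorem9p4 (R : realType) (L : set 'rV[R]_48)
    (f : {linear 'rV[R]_8 -> 'rV[R]_48}) :
  extremal48 L -> isometric_embedding f L ->
  [/\ forall k : nat, (1 <= k <= 8)%N ->
        (shell L 6 `&` perp (Uspace f id k) #= `I_(perp_count (8 - k)%N))%card,
      forall w : 'rV[R]_8 -> 'rV[R]_8, weyl_E8 w ->
        forall k : nat, (1 <= k <= 8)%N ->
          (shell L 6 `&` perp (Uspace f w k) #= `I_(perp_count (8 - k)%N))%card
    & exists2 w : 'rV[R]_8 -> 'rV[R]_8, weyl_E8 w
        & Uspace f w 5 = D5_space f].
Proof.
move=> ext emb.
have H w : weyl_E8 w -> forall k : nat, (1 <= k <= 8)%N ->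
    (shell L 6 `&` perp (Uspace f w k) #= `I_(perp_count (8 - k)%N))%card.
  by move=> /Counting.weyl_isometry iso k Hk; apply: Counting.Uspace_card.
split=> [|//|]; first exact: H (weyl_id R).
by exists (@Counting.w5 R); [exact: Counting.w5_weyl|exact: Counting.Uspace_D5].
Qed.
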